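(* Let $n\ge1$, $A_{-1}\in\mathbb{R}^{n\times n}$, $b\in\mathbb{R}^{n\times 1}$ (one-dimensional control, $r=1$), and let $A_2,A_3$ be $n\times n$ matrix functions on $[-1,0]$ with entries in $L_2([-1,0],\mathbb{C})$. Consider the system $$\dot z(t)=A_{-1}\dot z(t-1)+\int_{-1}^0A_2(\theta)\dot z(t+\theta)\,d\theta+\int_{-1}^0A_3(\theta)z(t+\theta)\,d\theta+b\,u(t),\quad u(t)\in\mathbb{C},$$ with operator model $\dot x=\mathcal Ax+\mathcal Bu$ on $M_2$ as in the context. Let $\Delta_{\mathcal A}(\lambda)=\lambda I-\lambda e^{-\lambda}A_{-1}-\lambda\int_{-1}^0e^{\lambda s}A_2(s)\,ds-\int_{-1}^0e^{\lambda s}A_3(s)\,ds$. Assume (i) $\operatorname{rank}(\Delta_{\mathcal A}(\lambda)\ \ b)=n$ for all $\lambda\in\mathbb{C}$, and (ii) $\operatorname{rank}(b\ \ A_{-1}b\ \cdots\ A_{-1}^{n-1}b)=n$. Then: (1) the system is exactly controllable at every time $T>n$, i.e. $\mathcal R_T=\mathcal D(\mathcal A)$ for all $T>n$; (2) the system is not exactly controllable at any time $T\le n$, i.e. $\mathcal R_T\neq\mathcal D(\mathcal A)$ for all $T\le n$.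
   Context: The state space is $M_2=\mathbb{C}^n\times L_2(-1,0;\mathbb{C}^n)$. The operator $\mathcal A$ is defined by $\mathcal A(y,z(\cdot))=\big(Lz,\ \tfrac{d}{d\theta}z\big)$, where $Lz=\int_{-1}^0A_2(\theta)z'(\theta)\,d\theta+\int_{-1}^0A_3(\theta)z(\theta)\,d\theta$, on the domain $\mathcal D(\mathcal A)=\{(y,z(\cdot))\in M_2: z\in H^1(-1,0;\mathbb{C}^n),\ y=z(0)-A_{-1}z(-1)\}$; $\mathcal A$ generates a $C_0$-semigroup $e^{\mathcal At}$ on $M_2$. The control operator is $\mathcal Bu=(bu,0)$ for $u\in\mathbb{C}$. The reachability set from $0$ at time $T$ is $\mathcal R_T=\{\int_0^Te^{\mathcal At}\mathcal Bu(t)\,dt: u\in L_2(0,T;\mathbb{C})\}$. *)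

(* Defs.v *)
(* mathcomp-analysis (Lebesgue integration on R : realType)
   + mathcomp-real-closed complex numbers R[i]. *)
From mathcomp Require Import all_boot all_algebra.
From mathcomp Require Import all_classical all_reals all_analysis.
From mathcomp Require Import complex.
Import GRing.Theory Num.Theory.

Set Implicit Arguments.
Unset Strict Implicit.
Unset Printing Implicit Defensive.

Local Open Scope ring_scope.
Local Open Scope classical_set_scope.
Local Open Scope complex_scope.

Section Defs.
Context (R : realType).
Local Notation C := R[i].
Local Notation mu := (@lebesgue_measure R).

(* the delay interval [-1,0] *)
Definition Iint : set R := `[(-1)%R, 0%R].

(* Lebesgue integral of a complex-valued function (real and imaginary parts) *)
Definition cint (D : set R) (f : R -> C) : C :=
  (Rintegral mu D (fun t => complex.Re (f t))) +i* (Rintegral mu D (fun t => complex.Im (f t))).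

Definition cabs2 (c : C) : R := complex.Re c ^+ 2 + complex.Im c ^+ 2.

(* f belongs to L_2(D; C) *)
Definition cL2 (D : set R) (f : R -> C) : Prop :=
  [/\ measurable_fun D (fun t => complex.Re (f t)),
      measurable_fun D (fun t => complex.Im (f t)) &
      mu.-integrable D (fun t => (cabs2 (f t))%:E)].

Definition vL2 n (D : set R) (f : R -> 'cV[C]_n) : Prop :=
  forall i, cL2 D (fun t => f t i 0).
Definition mL2 n (D : set R) (F : R -> 'M[C]_n) : Prop :=
  forall i j, cL2 D (fun t => F t i j).
Definition vint n (D : set R) (f : R -> 'cV[C]_n) : 'cV[C]_n :=
  \col_i cint D (fun t => f t i 0).
Definition mint n (D : set R) (F : R -> 'M[C]_n) : 'M[C]_n :=
  \matrix_(i, j) cint D (fun t => F t i j).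

Definition toCmx m n (M : 'M[R]_(m, n)) : 'M[C]_(m, n) :=
  map_mx (fun r => r%:C) M.

(* complex exponential *)
Definition cexp (z : C) : C :=
  (expR (complex.Re z) * cos (complex.Im z)) +i* (expR (complex.Re z) * sin (complex.Im z)).

(* ---- the state space M_2 = C^n x L_2(-1,0;C^n), via representatives ---- *)
Definition M2 n := ('cV[C]_n * (R -> 'cV[C]_n))%type.
Definition inM2 n (x : M2 n) : Prop := vL2 Iint x.2.
(* equality in M_2: equal first components, second components equal a.e. *)
Definition eqM2 n (x w : M2 n) : Prop :=
  x.1 = w.1 /\ {ae mu, forall t, Iint t -> x.2 t = w.2 t}.
Definition addM2 n (x w : M2 n) : M2 n := (x.1 + w.1, fun t => x.2 t + w.2 t).
Definition scaleM2 n (a : C) (x : M2 n) : M2 n := (a *: x.1, fun t => a *: x.2 t).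
Definition subM2 n (x w : M2 n) : M2 n := addM2 x (scaleM2 (-1) w).
(* inner product <x, w> of M_2 *)
Definition ipM2 n (x w : M2 n) : C :=
  \sum_i x.1 i 0 * (w.1 i 0)^* +
  cint Iint (fun t => \sum_i x.2 t i 0 * (w.2 t i 0)^*).
(* squared norm of M_2 *)
Definition nrm2M2 n (x : M2 n) : R :=
  \sum_i cabs2 (x.1 i 0) + Rintegral mu Iint (fun t => \sum_i cabs2 (x.2 t i 0)).

(* z in H^1(-1,0;C^n): z agrees a.e. on [-1,0] with an absolutely continuous
   zt whose derivative is zd in L_2, i.e. zt(t) = zt(-1) + int_{-1}^t zd *)
Definition H1rep n (z zt zd : R -> 'cV[C]_n) : Prop :=
  [/\ vL2 Iint zd,
      (forall t, Iint t -> zt t = zt (-1) + vint `[(-1)%R, t] zd) &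
      {ae mu, forall t, Iint t -> z t = zt t}].

(* L z = int A2 z' + int A3 z *)
Definition Lop n (A2 A3 : R -> 'M[C]_n) (zt zd : R -> 'cV[C]_n) : 'cV[C]_n :=
  vint Iint (fun t => A2 t *m zd t) + vint Iint (fun t => A3 t *m zt t).

(* graph of the operator A: x in D(A) and A x = v (in M_2) *)
Definition Arel n (Am1 : 'M[R]_n) (A2 A3 : R -> 'M[C]_n) (x v : M2 n) : Prop :=
  exists zt zd, [/\ H1rep x.2 zt zd,
                    x.1 = zt 0 - toCmx Am1 *m zt (-1) &
                    eqM2 v (Lop A2 A3 zt zd, zd)].

(* the domain D(A) *)
Definition inDA n (Am1 : 'M[R]_n) (A2 A3 : R -> 'M[C]_n) (x : M2 n) : Prop :=
  inM2 x /\ exists v, Arel Am1 A2 A3 x v.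

(* S is (a representative-level version of) the C_0-semigroup e^{At}
   generated by the operator with graph Ar *)
Definition C0_semigroup_generated_by n (S : R -> M2 n -> M2 n)
    (Ar : M2 n -> M2 n -> Prop) : Prop :=
  (forall t x, 0 <= t -> inM2 x -> inM2 (S t x)) /\
  (forall t x w, 0 <= t -> inM2 x -> inM2 w -> eqM2 x w -> eqM2 (S t x) (S t w)) /\
  (forall t a x w, 0 <= t -> inM2 x -> inM2 w ->
     eqM2 (S t (addM2 (scaleM2 a x) w)) (addM2 (scaleM2 a (S t x)) (S t w))) /\
  (forall t, 0 <= t -> exists M : R, forall x, inM2 x -> nrm2M2 (S t x) <= M * nrm2M2 x) /\
  (forall x, inM2 x -> eqM2 (S 0 x) x) /\
  (forall t s x, 0 <= t -> 0 <= s -> inM2 x -> eqM2 (S (t + s) x) (S t (S s x))) /\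
  (forall x, inM2 x -> (fun h => nrm2M2 (subM2 (S h x) x)) @ 0^'+ --> 0) /\
  (forall x v, inM2 x -> inM2 v ->
     ((fun h => nrm2M2 (subM2 (scaleM2 (h^-1)%:C (subM2 (S h x) x)) v)) @ 0^'+ --> 0
      <-> Ar x v)).

(* B = (b, 0) *)
Definition Bvec n (b : 'cV[R]_n) : M2 n := (toCmx b, fun _ => 0).

(* w in R_T: w = int_0^T e^{At} B u(t) dt for some u in L_2(0,T;C)
   (the M_2-valued integral characterized weakly, tested against all phi) *)
Definition reachable n (S : R -> M2 n -> M2 n) (b : 'cV[R]_n) (T : R) (w : M2 n) : Prop :=
  inM2 w /\ exists u : R -> C, cL2 `[0%R, T] u /\
    forall phi, inM2 phi ->
      ipM2 w phi = cint `[0%R, T] (fun t => u t * ipM2 (S t (Bvec b)) phi).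

(* R_T = D(A) *)
Definition exactly_controllable_at n (S : R -> M2 n -> M2 n) (b : 'cV[R]_n)
    (Am1 : 'M[R]_n) (A2 A3 : R -> 'M[C]_n) (T : R) : Prop :=
  forall x, inM2 x -> (reachable S b T x <-> inDA Am1 A2 A3 x).

(* characteristic matrix Delta_A(lambda) *)
Definition Delta n (Am1 : 'M[R]_n) (A2 A3 : R -> 'M[C]_n) (l : C) : 'M[C]_n :=
  l *: 1%:M - (l * cexp (- l)) *: toCmx Am1
  - l *: mint Iint (fun s => cexp (l * s%:C) *: A2 s)
  - mint Iint (fun s => cexp (l * s%:C) *: A3 s).

(* (b  A b  ...  A^{n-1} b) *)
Definition ctrb n (A : 'M[R]_n) (b : 'cV[R]_n) : 'M[R]_n :=
  \matrix_(i, k) (iter k (mulmx A) b) i 0.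

End Defs.
Arguments Iint {R}.

(* Main.v *)
(** Let [Z] be the response of the system to the initial state [(b, 0)], so that
    [S t (b, 0) = (Z t - A Z (t - 1), Z (t + .))]. It is the sum of the jumps [A^j b] at the
    times [j] and of the primitive of a square integrable [h]. A control [u], reversed into
    [U r = u (- r)], therefore steers [0] to the state with second component [Z * U], whose
    derivative is [rho U = sum_j A^j b U (. - j) + h * U].

    At time [n] the rank condition (ii) makes the sum a bijection between controls and
    derivatives on [[-1, 0]], while [U |-> h * U] is a small operator plus one of finite rank.
    Hence [rho] is Fredholm of index [0]. As a state of [D(A)] is given by its derivative and
    by a constant in [C^n], [R_n] has finite codimension in [D(A)] but is not all of [D(A)].

    For [T > n] the increasing spaces [R_t], [n <= t <= T], must stall: [R_t1 = R_t2 =: V] for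
    some [t1 < t2]. The difference of the control [1_[t1, t2]] and of a control on [[0, t1]]
    reaching the same state steers [0] to [0], and its Laplace transform does not vanish at
    large real [mu]; hence [V] is stable under [(mu - A)^-1] and contains [(mu - A)^-1 (b, 0)].
    The operator induced by [(mu - A)^-1] on the finite-dimensional [D(A) / V] has no nonzero
    eigenvalue by the rank condition (i), and does not have the eigenvalue [0] because the
    jumps [A^j b] of [Z] span [C^n]. Hence [V = D(A)]. *)

From mathcomp Require Import all_boot all_order all_algebra.
From mathcomp Require Import all_classical all_reals all_analysis.
From mathcomp Require Import measurable_realfun complex spectral lra ring.
Require Import Defs.
Import Order.TTheory GRing.Theory Num.Theory.
Import numFieldNormedType.Exports.

Set Implicit Arguments.
Unset Strict Implicit.
Unset Printing Implicit Defensive.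

Local Open Scope ring_scope.
Local Open Scope classical_set_scope.
Local Open Scope complex_scope.

(** * Integrals of matrix-valued functions *)

(** The semigroup [S] is known only through its generator, and [(b, 0)] lies outside D(A) unless
    [b = 0], so the equation does not directly determine its orbit. The state reached under the
    constant control 1 does lie in D(A) and depends differentiably on time. Its increments are
    classical orbits, and their difference quotients identify [S t (b, 0)]. That [S] transports
    classical orbits rests on a bound uniform in time, whereas each [S t] is assumed bounded
    separately; this is the reason for the nested interval argument.

    Kernels are extended by zero to the whole line and taken integrable and square integrable at
    once, so that convolutions have a value at every point and can be compared pointwise. The
    equation is solved up to an integer horizon only, and causality confines every computation to
    it.

    Neither control nor derivative need be bounded, but the corrections that have to be found are:
    [h * U] is bounded for every square integrable [U]. Hence both fixed points, for the density [h]
    and for the Fredholm alternative, are sought in sup norms. *)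

Section Norms.
Context (R : realType).
Local Notation C := R[i].

(** The norm of [R[i]] takes its values in [R[i]]. This equivalent one is real and
    submultiplicative, and it dominates the real and imaginary parts, which are the quantities that
    get integrated. *)
Definition n1 (z : C) : R := `|complex.Re z| + `|complex.Im z|.

Lemma n1_ge0 z : 0 <= n1 z. Proof. exact: addr_ge0. Qed.
Lemma n1_0 : n1 0 = 0. Proof. by rewrite /n1 /= !normr0 addr0. Qed.
Lemma n1_eq0 z : n1 z = 0 -> z = 0.
Proof.
case: z => a b /eqP; rewrite /n1 /= paddr_eq0 // !normr_eq0.
by move=> /andP[/eqP-> /eqP->].
Qed.
Lemma n1D z w : n1 (z + w) <= n1 z + n1 w.
Proof.
case: z w => a b [c d]; rewrite /n1 /= addrACA.
by apply: lerD; exact: ler_normD.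
Qed.
Lemma n1N z : n1 (- z) = n1 z.
Proof. by case: z => a b; rewrite /n1 /= !normrN. Qed.
Lemma n1M z w : n1 (z * w) <= n1 z * n1 w.
Proof.
case: z w => a b [c d]; rewrite /n1 /=.
have h (x y : R) : `|x - y| <= `|x| + `|y| by rewrite -(normrN y) ler_normD.
have := ler_normD (a * d) (b * c); have := h (a * c) (b * d).
rewrite !normrM; nra.
Qed.
Lemma n1_real (r : R) : n1 r%:C = `|r|. Proof. by rewrite /n1 /= normr0 addr0. Qed.
Lemma n1_conj z : n1 z^*%C = n1 z. Proof. by case: z => a b; rewrite /n1 /= normrN. Qed.
Lemma normRe_le z : `|complex.Re z| <= n1 z. Proof. by rewrite /n1 lerDl. Qed.
Lemma normIm_le z : `|complex.Im z| <= n1 z. Proof. by rewrite /n1 lerDr. Qed.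
Lemma n1_sum (I : finType) (P : pred I) (F : I -> C) :
  n1 (\sum_(i | P i) F i) <= \sum_(i | P i) n1 (F i).
Proof.
elim/big_rec2: _ => [|i y z _ h]; first by rewrite n1_0.
exact: le_trans (n1D _ _) (lerD _ _).
Qed.

Section Mn.
Context {m n : nat}.
Implicit Types M : 'M[C]_(m, n).

Definition mn M : R := \sum_i \sum_j n1 (M i j).

Lemma mn_ge0 M : 0 <= mn M.
Proof. by apply: sumr_ge0 => i _; apply: sumr_ge0 => j _; exact: n1_ge0. Qed.
Lemma mn_entry M i j : n1 (M i j) <= mn M.
Proof.
rewrite /mn (bigD1 i) //= (bigD1 j) //= -addrA lerDl addr_ge0 //.
  by apply: sumr_ge0 => k _; exact: n1_ge0.
by apply: sumr_ge0 => k _; apply: sumr_ge0 => l _; exact: n1_ge0.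
Qed.
Lemma mn0 : mn 0 = 0.
Proof. by rewrite /mn big1 // => i _; rewrite big1 // => j _; rewrite mxE n1_0. Qed.
Lemma mn_eq0 M : mn M = 0 -> M = 0.
Proof.
move=> h; apply/matrixP => i j; rewrite mxE; apply: n1_eq0; apply/eqP.
by rewrite eq_le n1_ge0 andbT -h mn_entry.
Qed.
Lemma mn_le0 M : mn M <= 0 -> M = 0.
Proof. by move=> h; apply: mn_eq0; apply/eqP; rewrite eq_le h mn_ge0. Qed.
Lemma mnD M N : mn (M + N) <= mn M + mn N.
Proof.
rewrite /mn -big_split /=; apply: ler_sum => i _.
rewrite -big_split /=; apply: ler_sum => j _; rewrite mxE; exact: n1D.
Qed.
Lemma mnN M : mn (- M) = mn M.
Proof. by apply: eq_bigr => i _; apply: eq_bigr => j _; rewrite mxE n1N. Qed.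
Lemma mnB M N : mn (M - N) <= mn M + mn N.
Proof. by rewrite -(mnN N) mnD. Qed.
Lemma mn_distC M N : mn (M - N) = mn (N - M).
Proof. by rewrite -mnN opprB. Qed.
Lemma mn_sum (I : finType) (P : pred I) (F : I -> 'M[C]_(m, n)) :
  mn (\sum_(i | P i) F i) <= \sum_(i | P i) mn (F i).
Proof.
elim/big_rec2: _ => [|i y z _ h]; first by rewrite mn0.
exact: le_trans (mnD _ _) (lerD _ _).
Qed.
Lemma mnZ a M : mn (a *: M) <= n1 a * mn M.
Proof.
rewrite /mn mulr_sumr; apply: ler_sum => i _; rewrite mulr_sumr.
by apply: ler_sum => j _; rewrite mxE n1M.
Qed.
Lemma mnZr (r : R) M : mn (r%:C *: M) = `|r| * mn M.
Proof.
rewrite /mn mulr_sumr; apply: eq_bigr => i _; rewrite mulr_sumr.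
apply: eq_bigr => j _; rewrite mxE; case: (M i j) => a b; rewrite /n1 /=.
by rewrite !mul0r subr0 addr0 !normrM mulrDr.
Qed.
End Mn.

Lemma mnM m n p (M : 'M[C]_(m, n)) (N : 'M[C]_(n, p)) : mn (M *m N) <= mn M * mn N.
Proof.
rewrite {1}/mn.
apply: (@le_trans _ _ (\sum_i \sum_j \sum_k n1 (M i k) * n1 (N k j))).
  apply: ler_sum => i _; apply: ler_sum => j _; rewrite mxE.
  by apply: (le_trans (n1_sum _ _)); apply: ler_sum => k _; exact: n1M.
rewrite {1}/mn mulr_suml; apply: ler_sum => i _.
rewrite exchange_big /= mulr_suml; apply: ler_sum => k _.
rewrite -mulr_sumr; apply: ler_wpM2l; first exact: n1_ge0.
rewrite {1}/mn (bigD1 k) //= lerDl.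
by apply: sumr_ge0 => l _; apply: sumr_ge0 => j _; exact: n1_ge0.
Qed.

Lemma mn_tr m n (M : 'M[C]_(m, n)) : mn M^T = mn M.
Proof.
rewrite /mn exchange_big /=; apply: eq_bigr => i _; apply: eq_bigr => j _.
by rewrite mxE.
Qed.

Lemma mn_map_conj m n (M : 'M[C]_(m, n)) : mn (map_mx (fun z : C => z^*%C) M) = mn M.
Proof. by apply: eq_bigr => i _; apply: eq_bigr => j _; rewrite mxE n1_conj. Qed.

Lemma mn_scalar n (a : C) : mn (a%:M : 'M[C]_n) = n1 a *+ n.
Proof.
rewrite /mn (eq_bigr (fun=> n1 a)) ?sumr_const ?card_ord // => i _.
rewrite (bigD1 i) //= mxE eqxx mulr1n big1 ?addr0 // => j ji.
by rewrite mxE eq_sym (negbTE ji) mulr0n n1_0.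
Qed.

Lemma mn11 (M : 'M[C]_1) : mn M = n1 (M 0 0).
Proof. by rewrite /mn !big_ord1. Qed.

End Norms.

(** * Integration over the real line *)

Section RealIntegral.
Context (R : realType).
Local Notation mu := (@lebesgue_measure R).
Implicit Types f g : R -> R.

Lemma aeS (P Q : R -> Prop) :
  {ae mu, forall t, P t} -> (forall t, P t -> Q t) -> {ae mu, forall t, Q t}.
Proof. by move=> h k; have F := ae_filter_ringOfSetsType mu; apply: filterS h. Qed.
Lemma aeI (P Q : R -> Prop) : {ae mu, forall t, P t} -> {ae mu, forall t, Q t} ->
  {ae mu, forall t, P t /\ Q t}.
Proof. by move=> h k; have F := ae_filter_ringOfSetsType mu; apply: filterI. Qed.
Lemma aeW (P : R -> Prop) : (forall t, P t) -> {ae mu, forall t, P t}.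
Proof. by move=> h; have F := ae_filter_ringOfSetsType mu; apply: filterE. Qed.

(** Integrals run over the whole line. Intervals enter through the factor [ind], later through
    [cut], so that the rules below carry no domain. *)
Definition ri f : Prop := mu.-integrable setT (EFin \o f).
Definition rI f : R := Rintegral mu setT f.

Lemma ri_meas f : ri f -> measurable_fun setT f.
Proof. by move=> /integrableP[/measurable_EFinP]. Qed.

Lemma ri_le f g : measurable_fun setT f -> (forall t, `|f t| <= g t) -> ri g -> ri f.
Proof.
move=> mf fg; apply: le_integrable => //; first exact/measurable_EFinP.
by move=> x _ /=; rewrite lee_fin (le_trans (fg x)) // ler_norm.
Qed.

Lemma riD f g : ri f -> ri g -> ri (fun t => f t + g t).
Proof. by move=> hf hg; have := integrableD measurableT hf hg. Qed.
Lemma riZ a f : ri f -> ri (fun t => a * f t).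
Proof. by move=> hf; have := integrableZl measurableT a hf. Qed.
Lemma riN f : ri f -> ri (fun t => - f t).
Proof. by move=> /(riZ (-1)); apply: eq_integrable => // x _ /=; rewrite mulN1r. Qed.
Lemma ri_abs f : ri f -> ri (fun t => `|f t|).
Proof. by move=> /integrable_abse. Qed.
Lemma ri_ext f g : f =1 g -> ri f -> ri g.
Proof. by move=> /funext ->. Qed.
Lemma ri0 : ri (fun=> 0).
Proof. exact: integrable0. Qed.
Lemma ri_sum (I : Type) (s : seq I) (F : I -> R -> R) :
  (forall i, ri (F i)) -> ri (fun t => \sum_(i <- s) F i t).
Proof.
move=> h; elim: s => [|i s ih].
  by apply: ri_ext ri0 => t; rewrite big_nil.
by apply: ri_ext (riD (h i) ih) => t; rewrite big_cons.
Qed.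

Lemma rID f g : ri f -> ri g -> rI (fun t => f t + g t) = rI f + rI g.
Proof. by move=> hf hg; rewrite /rI RintegralD. Qed.
Lemma rIZ a f : ri f -> rI (fun t => a * f t) = a * rI f.
Proof. by move=> hf; rewrite /rI RintegralZl. Qed.
Lemma rIB f g : ri f -> ri g -> rI (fun t => f t - g t) = rI f - rI g.
Proof. by move=> hf hg; rewrite /rI RintegralB. Qed.
Lemma le_rI f g : ri f -> ri g -> (forall t, f t <= g t) -> rI f <= rI g.
Proof. by move=> hf hg h; apply: le_Rintegral. Qed.
Lemma rI_ge0 f : (forall t, 0 <= f t) -> 0 <= rI f.
Proof. by move=> h; apply: Rintegral_ge0. Qed.
Lemma rI_abs f : ri f -> `|rI f| <= rI (fun t => `|f t|).
Proof. by move=> hf; apply: le_normr_Rintegral. Qed.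
Lemma rI_ext f g : f =1 g -> rI f = rI g.
Proof. by move=> /funext ->. Qed.
Lemma rI0 : rI (fun=> 0) = 0.
Proof. by rewrite /rI /Rintegral integral0. Qed.

Lemma rI_sum (I : Type) (s : seq I) (F : I -> R -> R) :
  (forall i, ri (F i)) -> rI (fun t => \sum_(i <- s) F i t) = \sum_(i <- s) rI (F i).
Proof.
move=> h; elim: s => [|i s ih].
  by rewrite big_nil -[RHS]rI0; apply: rI_ext => t; rewrite big_nil.
rewrite big_cons -ih -rID //; last exact: ri_sum.
by apply: rI_ext => t; rewrite big_cons.
Qed.

Lemma rI_ae f g : ri f -> measurable_fun setT g -> {ae mu, forall t, f t = g t} ->
  ri g /\ rI f = rI g.
Proof.
move=> hf mg fg.
have mf : measurable_fun setT (EFin \o f) by case/integrableP: hf.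
have mg' : measurable_fun setT (EFin \o g) by exact/measurable_EFinP.
have h : ae_eq mu setT (EFin \o f) (EFin \o g).
  by apply: aeS fg _ => t /= ->.
split; last by congr fine; exact: ae_eq_integral.
apply/integrableP; split => //; case/integrableP: hf => _.
have e : (\int[mu]_x `|(EFin \o f) x| = \int[mu]_x `|(EFin \o g) x|)%E.
  apply: ae_eq_integral => //; [exact: measurableT_comp|exact: measurableT_comp|].
  by apply: aeS fg _ => t /= ->.
by rewrite e.
Qed.

Lemma rI_eq0_ae f : ri f -> (forall t, 0 <= f t) -> rI f = 0 ->
  {ae mu, forall t, f t = 0}.
Proof.
move=> hf f0 h; have [mf _] := integrableP _ _ _ hf.
have /(ae_eq_integral_abs mu measurableT mf) : (\int[mu]_x `|(EFin \o f) x| = 0)%E.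
  have -> : (\int[mu]_x `|(EFin \o f) x| = \int[mu]_x (EFin \o f) x)%E.
    by apply: eq_integral => t _ /=; rewrite ger0_norm.
  move: h; rewrite /rI /Rintegral => h.
  by rewrite -[LHS]fineK ?h //; exact: integrable_fin_num.
by move=> h'; apply: aeS h' _ => t /(_ Logic.I) /= [].
Qed.

Definition ind (a b t : R) : R := ((a <= t <= b)%R)%:R.

Lemma ri_indic (a b : R) : ri (ind a b).
Proof.
apply: ri_ext (integrable_indic_itv a b true false) => t.
by rewrite indicE mem_setE in_itv /ind /=.
Qed.

Lemma rI_indic (a b : R) : a <= b -> rI (ind a b) = b - a.
Proof.
move=> ab; rewrite (@rI_ext _ (\1_(`[a, b]%classic))); last first.
  by move=> t; rewrite indicE mem_setE in_itv.
rewrite /rI /Rintegral integral_indic // setIT.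
have h0 : lebesgue_measure `[a, b]%classic = if a < b then (b - a)%:E else 0%E.
  by rewrite lebesgue_measure_itv /= lte_fin.
transitivity (fine (if a < b then (b - a)%:E else 0%E)); first by congr fine.
by case: ltP => //= h; apply/eqP; rewrite eq_sym subr_eq0 eq_le h ab.
Qed.

Section Transfer.
Variable phi : R -> R.
Hypothesis mphi : measurable_fun setT phi.
Hypothesis pphi : forall a b : R,
  mu (phi @^-1` `]a, b]%classic) = mu `]a, b]%classic.

(** Lebesgue measure is determined by its values on half-open intervals, so [pphi] settles all
    measurable sets. Translations and reflections are the two instances. *)
Lemma transfer_measure (A : set R) : measurable A ->
  pushforward mu (phi : _ -> measurableTypeR R) A = mu A.
Proof.
move=> mA; apply/esym/lebesgue_measure_unique => //= _ [[a b]] _ <- /=.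
by rewrite /pushforward -pphi.
Qed.

Lemma ri_transfer f : ri f -> ri (f \o phi).
Proof.
move=> hf; have mf := ri_meas hf; apply/integrableP; split.
  by apply/measurable_EFinP; exact: measurableT_comp.
case/integrableP: hf => _; apply: le_lt_trans; rewrite le_eqVlt; apply/orP; left.
apply/eqP; have := @ge0_integral_pushforward _ _ (measurableTypeR R) (measurableTypeR R) R phi
  mphi (lebesgue_measure : {measure set (measurableTypeR R) -> \bar R}) setT (fun x => `|(f x)%:E|)%E measurableT.
rewrite preimage_setT => <- //.
- by apply: eq_measure_integral => //= A mA _; exact: transfer_measure.
- by apply: measurableT_comp => //; exact/measurable_EFinP.
Qed.

Lemma rI_transfer f : ri f -> rI (f \o phi) = rI f.
Proof.
move=> hf; have mf := ri_meas hf; congr fine.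
have := @integral_pushforward _ _ (measurableTypeR R) (measurableTypeR R) R phi
  mphi (lebesgue_measure : {measure set (measurableTypeR R) -> \bar R}) setT (EFin \o f) _ _ measurableT.
rewrite preimage_setT => <- //; last 2 first.
- exact/measurable_EFinP.
- exact: ri_transfer.
by apply: eq_measure_integral => //= A mA _; exact: transfer_measure.
Qed.
End Transfer.

Let mshift a : measurable_fun setT (fun x : R => x + a).
Proof. exact: measurable_funD. Qed.
Let pshift a (c d : R) :
  mu ((fun x : R => x + a) @^-1` `]c, d]%classic) = mu `]c, d]%classic.
Proof.
have -> : (fun x : R => x + a) @^-1` `]c, d]%classic = `]c - a, d - a]%classic.
  by apply/seteqP; split => x /=; rewrite !in_itv /=; lra.
rewrite !lebesgue_measure_itv /= !lte_fin ltrD2r; case: ifP => // _.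
by rewrite -EFinD; congr EFin; lra.
Qed.
Let mrefl a : measurable_fun setT (fun x : R => a - x).
Proof. exact: measurable_funB. Qed.
Let prefl a (c d : R) :
  mu ((fun x : R => a - x) @^-1` `]c, d]%classic) = mu `]c, d]%classic.
Proof.
have -> : (fun x : R => a - x) @^-1` `]c, d]%classic = `[a - d, a - c[%classic.
  by apply/seteqP; split => x /=; rewrite !in_itv /=; lra.
rewrite !lebesgue_measure_itv /= !lte_fin ltrD2l ltrN2; case: ifP => // _.
by rewrite -EFinD; congr EFin; lra.
Qed.

Lemma ri_shift a f : ri f -> ri (fun x => f (x + a)).
Proof. exact: (ri_transfer (@mshift a) (@pshift a)). Qed.
Lemma rI_shift a f : ri f -> rI (fun x => f (x + a)) = rI f.
Proof. exact: (rI_transfer (@mshift a) (@pshift a)). Qed.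
Lemma ri_refl a f : ri f -> ri (fun x => f (a - x)).
Proof. exact: (ri_transfer (@mrefl a) (@prefl a)). Qed.
Lemma rI_refl a f : ri f -> rI (fun x => f (a - x)) = rI f.
Proof. exact: (rI_transfer (@mrefl a) (@prefl a)). Qed.

Lemma EFin_rI f : ri f -> (\int[mu]_x (f x)%:E = (rI f)%:E)%E.
Proof.
move=> hf; rewrite /rI /Rintegral fineK //.
exact: (integrable_fin_num measurableT hf).
Qed.

Section Fubini.
Variable F : R * R -> R.
Hypothesis mF : measurable_fun setT F.
Hypothesis F1 : forall y, ri (fun x => F (x, y)).
Hypothesis F2 : forall x, ri (fun y => F (x, y)).
Variable G : R -> R.
Hypothesis F3 : ri G.
Hypothesis F4 : forall y, rI (fun x => `|F (x, y)|) <= G y.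

(** Tonelli: the inner integrals of the absolute value are dominated by [G]. For convolutions [G] is
    a constant times the norm of the last factor. *)
Let iF : (mu \x mu)%E.-integrable setT (EFin \o F).
Proof.
apply/integrable21ltyP; first exact/measurable_EFinP.
have e y : (\int[mu]_x `|(EFin \o F) (x, y)| = (rI (fun x => `|F (x, y)|))%:E)%E.
  by rewrite -EFin_rI //; exact: ri_abs.
case/integrableP: F3 => [mG]; apply: le_lt_trans; apply: ge0_le_integral => //.
- by move=> y _; exact: integral_ge0.
- apply: (@measurable_fun_fubini_tonelli_G _ _ _ _ R mu (abse \o (EFin \o F))) => //.
  by apply: measurableT_comp => //; exact/measurable_EFinP.
- by move=> x; exact: abse_ge0.
- exact: measurableT_comp.
- by move=> y _; rewrite e lee_fin (le_trans (F4 y)) // ler_norm.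
Qed.

Let E1 x : (\int[mu]_y (EFin \o F) (x, y) = (rI (fun y => F (x, y)))%:E)%E.
Proof.
exact: EFin_rI.
Qed.
Let E2 y : (\int[mu]_x (EFin \o F) (x, y) = (rI (fun x => F (x, y)))%:E)%E.
Proof.
exact: EFin_rI.
Qed.

Lemma ri_fubini1 : ri (fun x => rI (fun y => F (x, y))).
Proof.
have := integrable_fubini_F iF; rewrite /fubini_F.
by apply: eq_integrable => // x _; rewrite E1.
Qed.
Lemma rI_fubini : rI (fun x => rI (fun y => F (x, y))) = rI (fun y => rI (fun x => F (x, y))).
Proof.
have h := Fubini iF; congr fine.
have -> : (\int[mu]_x (rI (fun y => F (x, y)))%:E = \int[mu]_x \int[mu]_y (EFin \o F) (x, y))%E.
  by apply: eq_integral => x _; rewrite E1.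
by rewrite h; apply: eq_integral => x _; rewrite E2.
Qed.
End Fubini.

End RealIntegral.

(* Unification would otherwise unfold integrals down to the matrix representation. *)
Fact mI_key : unit. Proof. exact: tt. Qed.

(** * Complex and matrix-valued integrands *)

Section ComplexIntegral.
Context (R : realType).
Local Notation C := R[i].
Local Notation mu := (@lebesgue_measure R).
Local Notation Re := (@complex.Re R).
Local Notation Im := (@complex.Im R).

Lemma cReD (z w : C) : Re (z + w) = Re z + Re w. Proof. by case: z w => a b []. Qed.
Lemma cImD (z w : C) : Im (z + w) = Im z + Im w. Proof. by case: z w => a b []. Qed.
Lemma cReN (z : C) : Re (- z) = - Re z. Proof. by case: z. Qed.
Lemma cImN (z : C) : Im (- z) = - Im z. Proof. by case: z. Qed.
Lemma cReM (z w : C) : Re (z * w) = Re z * Re w - Im z * Im w. Proof. by case: z w => a b []. Qed.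
Lemma cImM (z w : C) : Im (z * w) = Re z * Im w + Im z * Re w. Proof. by case: z w => a b []. Qed.
Lemma ReImP (z w : C) : Re z = Re w -> Im z = Im w -> z = w.
Proof. by case: z w => a b [c d] /= -> ->. Qed.

Definition Ci (f : R -> C) : Prop := ri (fun t => Re (f t)) /\ ri (fun t => Im (f t)).
Definition cI (f : R -> C) : C := rI (fun t => Re (f t)) +i* rI (fun t => Im (f t)).

Lemma Ci_ext f g : f =1 g -> Ci f -> Ci g. Proof. by move=> /funext ->. Qed.
Lemma cI_ext f g : f =1 g -> cI f = cI g. Proof. by move=> /funext ->. Qed.
Lemma Ci0 : Ci (fun=> 0). Proof. by split; exact: ri0. Qed.
Lemma cI0 : cI (fun=> 0) = 0.
Proof. by rewrite /cI (rI0 R). Qed.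
Lemma CiD f g : Ci f -> Ci g -> Ci (fun t => f t + g t).
Proof.
move=> [a b] [c d]; split.
  by apply: ri_ext (riD a c) => t; rewrite cReD.
by apply: ri_ext (riD b d) => t; rewrite cImD.
Qed.
Lemma cID f g : Ci f -> Ci g -> cI (fun t => f t + g t) = cI f + cI g.
Proof.
move=> [a b] [c d]; apply: ReImP; rewrite ?cReD ?cImD /=.
  by rewrite -rID //; apply: rI_ext => t; rewrite cReD.
by rewrite -rID //; apply: rI_ext => t; rewrite cImD.
Qed.
Lemma CiZ z f : Ci f -> Ci (fun t => z * f t).
Proof.
move=> [a b]; split.
  by apply: ri_ext (riD (riZ (Re z) a) (riN (riZ (Im z) b))) => t; rewrite cReM.
by apply: ri_ext (riD (riZ (Re z) b) (riZ (Im z) a)) => t; rewrite cImM.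
Qed.
Lemma cIZ z f : Ci f -> cI (fun t => z * f t) = z * cI f.
Proof.
move=> [a b]; apply: ReImP; rewrite ?cReM ?cImM /=.
  rewrite -!rIZ // -rIB; [|exact: riZ|exact: riZ].
  by apply: rI_ext => t; rewrite cReM.
rewrite -!rIZ // -rID; [|exact: riZ|exact: riZ].
by apply: rI_ext => t; rewrite cImM.
Qed.
Lemma Ci_sum (I : Type) (s : seq I) (F : I -> R -> C) :
  (forall i, Ci (F i)) -> Ci (fun t => \sum_(i <- s) F i t).
Proof.
move=> h; elim: s => [|i s ih].
  by apply: Ci_ext Ci0 => t; rewrite big_nil.
by apply: Ci_ext (CiD (h i) ih) => t; rewrite big_cons.
Qed.
Lemma cI_sum (I : Type) (s : seq I) (F : I -> R -> C) :
  (forall i, Ci (F i)) -> cI (fun t => \sum_(i <- s) F i t) = \sum_(i <- s) cI (F i).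
Proof.
move=> h; elim: s => [|i s ih].
  by rewrite big_nil -[RHS]cI0; apply: cI_ext => t; rewrite big_nil.
rewrite big_cons -ih -cID //; last exact: Ci_sum.
by apply: cI_ext => t; rewrite big_cons.
Qed.
Lemma Ci_n1 f : Ci f -> ri (fun t => n1 (f t)).
Proof. by move=> [a b]; apply: riD; exact: ri_abs. Qed.
Lemma n1_cI f : Ci f -> n1 (cI f) <= rI (fun t => n1 (f t)).
Proof.
move=> [a b]; rewrite /n1 rID; [|exact: ri_abs|exact: ri_abs].
by apply: lerD; exact: rI_abs.
Qed.

Section Matrix.
Context {m n : nat}.

(** The domain is arbitrary because Fubini's theorem asks for measurability on [R * R]. *)
Definition Mm d (T : measurableType d) (f : T -> 'M[C]_(m, n)) : Prop := forall i j,
  measurable_fun setT (fun t => Re (f t i j)) /\ measurable_fun setT (fun t => Im (f t i j)).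
Definition Mi (f : R -> 'M[C]_(m, n)) : Prop := forall i j, Ci (fun t => f t i j).
Definition mI (f : R -> 'M[C]_(m, n)) : 'M[C]_(m, n) :=
  locked_with mI_key (\matrix_(i, j) cI (fun t => f t i j)).

Lemma mIE f i j : mI f i j = cI (fun t => f t i j).
Proof. by rewrite /mI locked_withE mxE. Qed.

Implicit Types f g : R -> 'M[C]_(m, n).

Lemma mI_ext f g : f =1 g -> mI f = mI g. Proof. by move=> /funext ->. Qed.
Lemma Mi_ext f g : f =1 g -> Mi f -> Mi g. Proof. by move=> /funext ->. Qed.
Lemma mI0 : mI (fun=> 0) = 0.
Proof. by apply/matrixP => i j; rewrite mIE [RHS]mxE -[RHS]cI0; apply: cI_ext => t; rewrite mxE. Qed.
Lemma Mi0 : Mi (fun=> 0).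
Proof. by move=> i j; apply: Ci_ext Ci0 => t; rewrite mxE. Qed.
Lemma MiD f g : Mi f -> Mi g -> Mi (fun t => f t + g t).
Proof. by move=> a b i j; apply: Ci_ext (CiD (a i j) (b i j)) => t; rewrite mxE. Qed.
Lemma mID f g : Mi f -> Mi g -> mI (fun t => f t + g t) = mI f + mI g.
Proof.
move=> a b; apply/matrixP => i j; rewrite [RHS]mxE !mIE -(cID (a i j) (b i j)).
by apply: cI_ext => t; rewrite mxE.
Qed.
Lemma MiZ z f : Mi f -> Mi (fun t => z *: f t).
Proof. by move=> a i j; apply: Ci_ext (CiZ z (a i j)) => t; rewrite mxE. Qed.
Lemma mIZ z f : Mi f -> mI (fun t => z *: f t) = z *: mI f.
Proof.
move=> a; apply/matrixP => i j; rewrite [RHS]mxE !mIE -(cIZ _ (a i j)).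
by apply: cI_ext => t; rewrite mxE.
Qed.
Lemma MiN f : Mi f -> Mi (fun t => - f t).
Proof. by move=> /(MiZ (-1)); apply: Mi_ext => t; rewrite scaleN1r. Qed.
Lemma mIN f : Mi f -> mI (fun t => - f t) = - mI f.
Proof. by move=> a; rewrite -scaleN1r -mIZ //; apply: mI_ext => t; rewrite scaleN1r. Qed.
Lemma MiB f g : Mi f -> Mi g -> Mi (fun t => f t - g t).
Proof. by move=> a /MiN; exact: MiD. Qed.
Lemma mIB f g : Mi f -> Mi g -> mI (fun t => f t - g t) = mI f - mI g.
Proof. by move=> a b; rewrite mID ?mIN //; exact: MiN. Qed.
Lemma Mi_sum (I : Type) (s : seq I) (F : I -> R -> 'M[C]_(m, n)) :
  (forall i, Mi (F i)) -> Mi (fun t => \sum_(i <- s) F i t).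
Proof.
move=> h; elim: s => [|i s ih].
  by apply: Mi_ext Mi0 => t; rewrite big_nil.
by apply: Mi_ext (MiD (h i) ih) => t; rewrite big_cons.
Qed.
Lemma mI_sum (I : Type) (s : seq I) (F : I -> R -> 'M[C]_(m, n)) :
  (forall i, Mi (F i)) -> mI (fun t => \sum_(i <- s) F i t) = \sum_(i <- s) mI (F i).
Proof.
move=> h; elim: s => [|i s ih].
  by rewrite big_nil -[RHS]mI0; apply: mI_ext => t; rewrite big_nil.
rewrite big_cons -ih -mID //; last exact: Mi_sum.
by apply: mI_ext => t; rewrite big_cons.
Qed.
Lemma Mi_mn f : Mi f -> ri (fun t => mn (f t)).
Proof. by move=> a; apply: ri_sum => i; apply: ri_sum => j; exact: Ci_n1. Qed.
Lemma mn_mI f : Mi f -> mn (mI f) <= rI (fun t => mn (f t)).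
Proof.
move=> a; rewrite /mn rI_sum; last by move=> i; apply: ri_sum => j; exact: Ci_n1.
apply: ler_sum => i _; rewrite rI_sum; last by move=> j; exact: Ci_n1.
by apply: ler_sum => j _; rewrite mIE; exact: n1_cI.
Qed.

Lemma Mi_Mm f : Mi f -> Mm f.
Proof. by move=> a i j; split; apply: ri_meas; case: (a i j). Qed.
Lemma Mm_mn d (T : measurableType d) (f : T -> 'M[C]_(m, n)) :
  Mm f -> measurable_fun setT (fun t => mn (f t)).
Proof.
move=> a; apply: measurable_sum => i; apply: measurable_sum => j.
by apply: measurable_funD; apply: measurableT_comp => //; case: (a i j).
Qed.
Lemma MiP f (g : R -> R) : Mm f -> (forall t, mn (f t) <= g t) -> ri g -> Mi f.
Proof.
move=> a h hg i j; have [b c] := a i j.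
split; apply: ri_le hg => // t; apply: le_trans (h t).
  exact: le_trans (normRe_le _) (mn_entry _ _ _).
exact: le_trans (normIm_le _) (mn_entry _ _ _).
Qed.

Lemma MmD d (T : measurableType d) (f g : T -> 'M[C]_(m, n)) :
  Mm f -> Mm g -> Mm (fun t => f t + g t).
Proof.
move=> a b i j; have [a1 a2] := a i j; have [b1 b2] := b i j; split.
  by apply: eq_measurable_fun (measurable_funD a1 b1) => t _ /=; rewrite mxE cReD.
by apply: eq_measurable_fun (measurable_funD a2 b2) => t _ /=; rewrite mxE cImD.
Qed.
Lemma Mm_cst d (T : measurableType d) (c : 'M[C]_(m, n)) : Mm (fun _ : T => c).
Proof. by move=> i j; split; exact: measurable_cst. Qed.
Lemma Mm_comp d (T : measurableType d) d' (T' : measurableType d')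
  (f : T -> 'M[C]_(m, n)) (phi : T' -> T) :
  measurable_fun setT phi -> Mm f -> Mm (fun t => f (phi t)).
Proof.
move=> mp a i j; have [a1 a2] := a i j.
by split; [exact: (measurableT_comp a1 mp)|exact: (measurableT_comp a2 mp)].
Qed.
Lemma Mm_scale d (T : measurableType d) (r : T -> R) (f : T -> 'M[C]_(m, n)) :
  measurable_fun setT r -> Mm f -> Mm (fun t => (r t)%:C *: f t).
Proof.
move=> mr a i j; have [a1 a2] := a i j; split.
  apply: eq_measurable_fun (measurable_funM mr a1) => t _ /=.
  by rewrite mxE cReM /= mul0r subr0.
apply: eq_measurable_fun (measurable_funM mr a2) => t _ /=.
by rewrite mxE cImM /= mul0r addr0.
Qed.
Lemma MmN d (T : measurableType d) (f : T -> 'M[C]_(m, n)) : Mm f -> Mm (fun t => - f t).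
Proof.
move=> a; have -> : (fun t => - f t) = (fun t => (-1)%:C *: f t).
  by apply/funext => t; rewrite rmorphN1 scaleN1r.
by apply: (@Mm_scale _ _ (fun=> -1)) => //; exact: measurable_cst.
Qed.
Lemma MmB d (T : measurableType d) (f g : T -> 'M[C]_(m, n)) :
  Mm f -> Mm g -> Mm (fun t => f t - g t).
Proof. by move=> a b; apply: MmD => //; exact: MmN. Qed.
Lemma Mm_lim d (T : measurableType d) (f : nat -> T -> 'M[C]_(m, n)) (g : T -> 'M[C]_(m, n)) :
  (forall k, Mm (f k)) -> (forall t, (fun k => mn (f k t - g t)) @ \oo --> (0 : R)) -> Mm g.
Proof.
move=> a h i j.
have key (p : C -> R) : (forall z w, p (z - w) = p z - p w) -> (forall z, `|p z| <= n1 z) ->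
    forall t, (fun k => p (f k t i j)) @ \oo --> p (g t i j).
  move=> p1 p2 t; apply/cvgrPdist_lt => e e0.
  have /cvgrPdist_lt/(_ e e0) := h t; apply: filterS => k.
  rewrite sub0r normrN ger0_norm ?mn_ge0 //; apply: le_lt_trans.
  rewrite distrC -p1 (le_trans (p2 _)) //.
  by have := mn_entry (f k t - g t) i j; rewrite !mxE.
have kR := key (@complex.Re R) (fun z w => etrans (cReD z (- w)) (congr1 _ (cReN w))) (@normRe_le R).
have kI := key (@complex.Im R) (fun z w => etrans (cImD z (- w)) (congr1 _ (cImN w))) (@normIm_le R).
split.
  by apply: (@measurable_fun_cvg _ _ _ _ (fun k t => Re (f k t i j))) => [k|t _];
    [case: (a k i j)|exact: kR].
by apply: (@measurable_fun_cvg _ _ _ _ (fun k t => Im (f k t i j))) => [k|t _];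
  [case: (a k i j)|exact: kI].
Qed.

Lemma mI_ae f g : Mi f -> Mm g -> {ae mu, forall t, f t = g t} -> Mi g /\ mI f = mI g.
Proof.
move=> a b h.
have k1 i j := rI_ae (a i j).1 (b i j).1 (aeS h (fun t e => congr1 (fun M : 'M[C]_(m, n) => Re (M i j)) e)).
have k2 i j := rI_ae (a i j).2 (b i j).2 (aeS h (fun t e => congr1 (fun M : 'M[C]_(m, n) => Im (M i j)) e)).
split; first by move=> i j; split; [case: (k1 i j)|case: (k2 i j)].
by apply/matrixP => i j; rewrite !mIE; apply: ReImP; [case: (k1 i j)|case: (k2 i j)].
Qed.
Lemma Mi_shift c f : Mi f -> Mi (fun t => f (t + c)).
Proof. by move=> a i j; split; [exact: (ri_shift c (a i j).1)|exact: (ri_shift c (a i j).2)]. Qed.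
Lemma mI_shift c f : Mi f -> mI (fun t => f (t + c)) = mI f.
Proof.
by move=> a; apply/matrixP => i j; rewrite !mIE; apply: ReImP;
  [exact: (rI_shift c (a i j).1)|exact: (rI_shift c (a i j).2)].
Qed.
Lemma mI_refl c f : Mi f -> mI (fun t => f (c - t)) = mI f.
Proof.
by move=> a; apply/matrixP => i j; rewrite !mIE; apply: ReImP;
  [exact: (rI_refl c (a i j).1)|exact: (rI_refl c (a i j).2)].
Qed.

Lemma Mi_fubini (F : R * R -> 'M[C]_(m, n)) (G : R -> R) :
  Mm F -> (forall y, Mi (fun x => F (x, y))) -> (forall x, Mi (fun y => F (x, y))) ->
  ri G -> (forall y, rI (fun x => mn (F (x, y))) <= G y) ->
  Mi (fun x => mI (fun y => F (x, y))) /\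
  mI (fun x => mI (fun y => F (x, y))) = mI (fun y => mI (fun x => F (x, y))).
Proof.
move=> mF F1 F2 hG FG.
have b1 i j y : rI (fun x => `|Re (F (x, y) i j)|) <= G y.
  apply: le_trans (FG y); apply: le_rI.
  - by apply: ri_abs; case: (F1 y i j).
  - exact: Mi_mn.
  - by move=> x; exact: le_trans (normRe_le _) (mn_entry _ _ _).
have b2 i j y : rI (fun x => `|Im (F (x, y) i j)|) <= G y.
  apply: le_trans (FG y); apply: le_rI.
  - by apply: ri_abs; case: (F1 y i j).
  - exact: Mi_mn.
  - by move=> x; exact: le_trans (normIm_le _) (mn_entry _ _ _).
split.
  move=> i j; split.
    have := ri_fubini1 (mF i j).1 (fun y => (F1 y i j).1) (fun x => (F2 x i j).1) hG (b1 i j).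
    by apply: ri_ext => x; rewrite mIE.
  have := ri_fubini1 (mF i j).2 (fun y => (F1 y i j).2) (fun x => (F2 x i j).2) hG (b2 i j).
  by apply: ri_ext => x; rewrite mIE.
apply/matrixP => i j; rewrite [LHS]mIE [RHS]mIE; apply: ReImP.
  have := rI_fubini (mF i j).1 (fun y => (F1 y i j).1) (fun x => (F2 x i j).1) hG (b1 i j).
  move=> h; transitivity (rI (fun x => rI (fun y => Re (F (x, y) i j)))).
    by apply: rI_ext => x; rewrite mIE.
  by rewrite h; apply: rI_ext => x; rewrite mIE.
have := rI_fubini (mF i j).2 (fun y => (F1 y i j).2) (fun x => (F2 x i j).2) hG (b2 i j).
move=> h; transitivity (rI (fun x => rI (fun y => Im (F (x, y) i j)))).
  by apply: rI_ext => x; rewrite mIE.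
by rewrite h; apply: rI_ext => x; rewrite mIE.
Qed.
End Matrix.

Lemma Mm_mul m n p d (T : measurableType d) (f : T -> 'M[C]_(m, n)) (g : T -> 'M[C]_(n, p)) :
  Mm f -> Mm g -> Mm (fun t => f t *m g t).
Proof.
move=> a b i j.
have sR (s : seq 'I_n) (F : 'I_n -> C) : Re (\sum_(k <- s) F k) = \sum_(k <- s) Re (F k).
  by elim: s => [|k s ih]; rewrite ?big_nil // !big_cons cReD ih.
have sI (s : seq 'I_n) (F : 'I_n -> C) : Im (\sum_(k <- s) F k) = \sum_(k <- s) Im (F k).
  by elim: s => [|k s ih]; rewrite ?big_nil // !big_cons cImD ih.
split.
  apply: (@eq_measurable_fun _ _ _ _ _
    (fun t => \sum_k (Re (f t i k) * Re (g t k j) - Im (f t i k) * Im (g t k j)))).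
    by move=> t _; rewrite mxE sR; apply: eq_bigr => k _; rewrite cReM.
  apply: measurable_sum => k; have [a1 a2] := a i k; have [b1 b2] := b k j.
  by apply: measurable_funB; exact: measurable_funM.
apply: (@eq_measurable_fun _ _ _ _ _
  (fun t => \sum_k (Re (f t i k) * Im (g t k j) + Im (f t i k) * Re (g t k j)))).
  by move=> t _; rewrite mxE sI; apply: eq_bigr => k _; rewrite cImM.
apply: measurable_sum => k; have [a1 a2] := a i k; have [b1 b2] := b k j.
by apply: measurable_funD; exact: measurable_funM.
Qed.

Lemma Mi_mull m n p (c : 'M[C]_(m, n)) (f : R -> 'M[C]_(n, p)) : Mi f -> Mi (fun t => c *m f t).
Proof.
move=> a i j; apply: Ci_ext (Ci_sum _ (fun k => CiZ (c i k) (a k j))) => t.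
by rewrite mxE.
Qed.
Lemma mI_mull m n p (c : 'M[C]_(m, n)) (f : R -> 'M[C]_(n, p)) :
  Mi f -> mI (fun t => c *m f t) = c *m mI f.
Proof.
move=> a; apply/matrixP => i j; rewrite mIE [RHS]mxE.
transitivity (\sum_k cI (fun t => c i k * f t k j)).
  rewrite -cI_sum; last by move=> k; apply: CiZ; exact: a.
  by apply: cI_ext => t; rewrite mxE.
by apply: eq_bigr => k _; rewrite mIE; apply: cIZ; exact: a.
Qed.
Lemma Mi_mulr m n p (f : R -> 'M[C]_(m, n)) (c : 'M[C]_(n, p)) : Mi f -> Mi (fun t => f t *m c).
Proof.
move=> a i j; apply: Ci_ext (Ci_sum _ (fun k => CiZ (c k j) (a i k))) => t.
by rewrite mxE; apply: eq_bigr => k _; rewrite mulrC.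
Qed.
Lemma mI_mulr m n p (f : R -> 'M[C]_(m, n)) (c : 'M[C]_(n, p)) :
  Mi f -> mI (fun t => f t *m c) = mI f *m c.
Proof.
move=> a; apply/matrixP => i j; rewrite mIE [RHS]mxE.
transitivity (\sum_k cI (fun t => c k j * f t i k)).
  rewrite -cI_sum; last by move=> k; apply: CiZ; exact: a.
  by apply: cI_ext => t; rewrite mxE; apply: eq_bigr => k _; rewrite mulrC.
by apply: eq_bigr => k _; rewrite mIE mulrC; apply: cIZ; exact: a.
Qed.
End ComplexIntegral.

Fact cnv_key : unit. Proof. exact: tt. Qed.

(** * Convolutions *)

Section Conv.
Context (R : realType).
Local Notation C := R[i].
Local Notation mu := (@lebesgue_measure R).

Lemma sqr_le_sum (s a b : R) : 0 <= s -> s <= a + b -> s ^+ 2 <= 2 * (a ^+ 2 + b ^+ 2).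
Proof.
move=> s0 h; apply: (@le_trans _ _ ((a + b) ^+ 2)).
  by rewrite lerXn2r ?nnegrE // (le_trans s0).
rewrite -subr_ge0 (_ : _ - _ = (a - b) ^+ 2); [exact: sqr_ge0|ring].
Qed.
Lemma mul_le_sqr (a b : R) : a * b <= a ^+ 2 + b ^+ 2.
Proof. have := sqr_ge0 (a + b); have := sqr_ge0 (a - b); nra. Qed.

(** Square integrability makes a convolution defined and bounded at every point, and integrability
    makes it integrable again. The class is closed under [cnv], so the algebra of convolutions holds
    pointwise. *)
Definition K m n (f : R -> 'M[C]_(m, n)) : Prop :=
  [/\ Mm f, ri (fun t => mn (f t)) & ri (fun t => mn (f t) ^+ 2)].

Lemma K_Mi m n (f : R -> 'M[C]_(m, n)) : K f -> Mi f.
Proof. by case=> a b _; apply: MiP b. Qed.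
Lemma K_ext m n (f g : R -> 'M[C]_(m, n)) : f =1 g -> K f -> K g.
Proof. by move=> /funext ->. Qed.
Lemma K_dom m n p q (f : R -> 'M[C]_(m, n)) (g : R -> 'M[C]_(p, q)) c :
  K f -> Mm g -> (forall t, mn (g t) <= c * mn (f t)) -> K g.
Proof.
move=> [a b d] mg h; split => //.
  apply: ri_le (riZ c b) => [|t]; first exact: Mm_mn.
  by rewrite ger0_norm ?mn_ge0.
apply: ri_le (riZ (c ^+ 2) d) => [|t].
  by apply: measurable_funX; exact: Mm_mn.
rewrite ger0_norm ?exprn_ge0 ?mn_ge0 // -exprMn lerXn2r ?nnegrE ?mn_ge0 //.
exact: le_trans (mn_ge0 _) (h t).
Qed.
Lemma KD m n (f g : R -> 'M[C]_(m, n)) : K f -> K g -> K (fun t => f t + g t).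
Proof.
move=> [a b c] [d e h]; have md := MmD a d; split => //.
  apply: ri_le (riD b e) => [|t]; first exact: Mm_mn.
  by rewrite ger0_norm ?mn_ge0 // mnD.
apply: ri_le (riZ 2 (riD c h)) => [|t].
  by apply: measurable_funX; exact: Mm_mn.
rewrite ger0_norm ?exprn_ge0 ?mn_ge0 //.
exact: sqr_le_sum (mn_ge0 _) (mnD _ _).
Qed.
Lemma K_mull m n p (c : 'M[C]_(m, n)) (f : R -> 'M[C]_(n, p)) : K f -> K (fun t => c *m f t).
Proof.
move=> kf; apply: (@K_dom _ _ _ _ f _ (mn c)) => // [|t]; last exact: mnM.
by apply: Mm_mul; [exact: Mm_cst|case: kf].
Qed.
Lemma K_mulr m n p (f : R -> 'M[C]_(m, n)) (c : 'M[C]_(n, p)) : K f -> K (fun t => f t *m c).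
Proof.
move=> kf; apply: (@K_dom _ _ _ _ f _ (mn c)) => // [|t]; last by rewrite mulrC mnM.
by apply: Mm_mul; [case: kf|exact: Mm_cst].
Qed.
Lemma KN m n (f : R -> 'M[C]_(m, n)) : K f -> K (fun t => - f t).
Proof.
move=> kf; apply: (@K_dom _ _ _ _ f _ 1) => // [|t]; last by rewrite mnN mul1r.
by apply: MmN; case: kf.
Qed.
Lemma KB m n (f g : R -> 'M[C]_(m, n)) : K f -> K g -> K (fun t => f t - g t).
Proof. by move=> a /KN; exact: KD. Qed.
Lemma KZ m n c (f : R -> 'M[C]_(m, n)) : K f -> K (fun t => c *: f t).
Proof. by move=> /(K_mull c%:M); apply: K_ext => t; rewrite mul_scalar_mx. Qed.
Lemma K_bounded m n (f : R -> 'M[C]_(m, n)) B : Mi f -> (forall t, mn (f t) <= B) -> K f.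
Proof.
move=> a h; split; [exact: Mi_Mm|exact: Mi_mn|].
apply: ri_le (riZ B (Mi_mn a)) => [|t].
  by apply: measurable_funX; apply: Mm_mn; exact: Mi_Mm.
by rewrite ger0_norm ?exprn_ge0 ?mn_ge0 // expr2 ler_wpM2r ?mn_ge0.
Qed.
Lemma K0 m n : K (fun=> 0 : 'M[C]_(m, n)).
Proof. by apply: (@K_bounded _ _ _ 0) => [|t]; [exact: Mi0|rewrite mn0]. Qed.
Lemma K_sum m n (I : Type) (s : seq I) (F : I -> R -> 'M[C]_(m, n)) :
  (forall i, K (F i)) -> K (fun t => \sum_(i <- s) F i t).
Proof.
move=> h; elim: s => [|i s ih].
  by apply: K_ext (K0 m n) => t; rewrite big_nil.
by apply: K_ext (KD (h i) ih) => t; rewrite big_cons.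
Qed.
Lemma K_shift m n a (f : R -> 'M[C]_(m, n)) : K f -> K (fun t => f (t + a)).
Proof.
move=> [x y z]; split; [|exact: ri_shift y|exact: ri_shift z].
by apply: Mm_comp x; exact: measurable_funD.
Qed.
Lemma K_refl m n a (f : R -> 'M[C]_(m, n)) : K f -> K (fun t => f (a - t)).
Proof.
move=> [x y z]; split; [|exact: ri_refl y|exact: ri_refl z].
by apply: Mm_comp x; exact: measurable_funB.
Qed.

Definition cut m n (a b : R) (f : R -> 'M[C]_(m, n)) t : 'M[C]_(m, n) :=
  if a <= t <= b then f t else 0.

Lemma cutE m n a b (f : R -> 'M[C]_(m, n)) t : cut a b f t = (ind a b t)%:C *: f t.
Proof. by rewrite /cut /ind; case: ifP => _; rewrite ?scale1r ?scale0r. Qed.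
Lemma mn_cut m n a b (f : R -> 'M[C]_(m, n)) t : mn (cut a b f t) <= mn (f t).
Proof. by rewrite /cut; case: ifP => // _; rewrite mn0 mn_ge0. Qed.
Lemma Mm_cut m n a b (f : R -> 'M[C]_(m, n)) : Mm f -> Mm (cut a b f).
Proof.
move=> h; have -> : cut a b f = (fun t => (ind a b t)%:C *: f t).
  by apply/funext => t; exact: cutE.
by apply: Mm_scale => //; apply: ri_meas; exact: ri_indic.
Qed.
Lemma K_cut m n a b (f : R -> 'M[C]_(m, n)) : K f -> K (cut a b f).
Proof.
move=> kf; apply: (@K_dom _ _ _ _ f _ 1) => // [|t]; last by rewrite mul1r mn_cut.
by apply: Mm_cut; case: kf.
Qed.
Lemma K_cutb m n a b (f : R -> 'M[C]_(m, n)) B : Mm f ->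
  (forall t, a <= t <= b -> mn (f t) <= B) -> K (cut a b f).
Proof.
move=> mf h; have mc := Mm_cut a b mf.
have h' t : mn (cut a b f t) <= `|B| * ind a b t.
  rewrite /cut /ind; case: ifP => [/h|_]; last by rewrite mn0 mulr0.
  by rewrite mulr1; move/le_trans; apply; exact: ler_norm.
apply: (@K_bounded _ _ _ `|B|).
  by apply: MiP h' _ => //; apply: riZ; exact: ri_indic.
move=> t; apply: le_trans (h' t) _; rewrite /ind; case: (_ <= _ <= _); by rewrite ?mulr1 ?mulr0.
Qed.

Lemma Mm_sub2 m n (f : R -> 'M[C]_(m, n)) : Mm f -> Mm (fun z : R * R => f (z.1 - z.2)).
Proof.
move=> a; apply: (@Mm_comp R m n _ R _ (R * R)%type f (fun z => z.1 - z.2)) => //.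
by apply: measurable_funB; [exact: measurable_fst|exact: measurable_snd].
Qed.
Lemma Mm_subl2 m n t (f : R -> 'M[C]_(m, n)) : Mm f -> Mm (fun z : R * R => f (t - z.1)).
Proof.
move=> a; apply: (@Mm_comp R m n _ R _ (R * R)%type f (fun z => t - z.1)) => //.
by apply: measurable_funB; [exact: measurable_cst|exact: measurable_fst].
Qed.
Lemma Mm_snd2 m n (f : R -> 'M[C]_(m, n)) : Mm f -> Mm (fun z : R * R => f z.2).
Proof.
move=> a; apply: (@Mm_comp R m n _ R _ (R * R)%type f (fun z => z.2)) => //.
exact: measurable_snd.
Qed.

Section Product.
Context {m n p : nat}.
Implicit Types (f : R -> 'M[C]_(m, n)) (g : R -> 'M[C]_(n, p)).

Lemma K_mulMi f g : K f -> K g -> Mi (fun t => f t *m g t).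
Proof.
move=> [a b c] [d e h]; apply: MiP (riD c h) => [|t]; first exact: Mm_mul.
exact: le_trans (mnM _ _) (mul_le_sqr _ _).
Qed.
Lemma mn_K_mul f g : K f -> K g ->
  mn (mI (fun t => f t *m g t)) <= rI (fun t => mn (f t) ^+ 2) + rI (fun t => mn (g t) ^+ 2).
Proof.
move=> kf kg; have [a b c] := kf; have [d e h] := kg.
apply: le_trans (mn_mI (K_mulMi kf kg)) _; rewrite -rID //; apply: le_rI.
- by apply: Mi_mn; exact: K_mulMi.
- exact: riD.
- by move=> t; exact: le_trans (mnM _ _) (mul_le_sqr _ _).
Qed.

Definition cnv f g : R -> 'M[C]_(m, p) :=
  locked_with cnv_key (fun t => mI (fun r => f (t - r) *m g r)).

Lemma convE f g t : cnv f g t = mI (fun r => f (t - r) *m g r).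
Proof. by rewrite /cnv locked_withE. Qed.
Lemma conv_Mi f g t : K f -> K g -> Mi (fun r => f (t - r) *m g r).
Proof. by move=> /(K_refl t) kf kg; exact: K_mulMi. Qed.
Lemma conv_bound f g t : K f -> K g ->
  mn (cnv f g t) <= rI (fun t => mn (f t) ^+ 2) + rI (fun t => mn (g t) ^+ 2).
Proof.
move=> kf kg; rewrite convE; have := mn_K_mul (K_refl t kf) kg.
by case: kf => a b c; rewrite (rI_refl t c).
Qed.
Lemma conv_flip f g t : K f -> K g -> cnv f g t = mI (fun r => f r *m g (t - r)).
Proof.
move=> kf kg; rewrite convE -(mI_refl t); last exact: conv_Mi.
by apply: mI_ext => r; rewrite subKr.
Qed.
(** Fubini's theorem gives integrability; with the uniform bound [conv_bound] this implies square
    integrability. *)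
Lemma K_conv f g : K f -> K g -> K (cnv f g).
Proof.
move=> kf kg; have [a b c] := kf; have [d e h] := kg.
apply: (K_bounded _ (fun t => conv_bound t kf kg)).
have h1 y : Mi (fun x => f (x - y) *m g y) by exact: (Mi_mulr (g y) (Mi_shift (- y) (K_Mi kf))).
have -> : cnv f g = (fun x => mI (fun y => f (x - y) *m g y)).
  by apply/funext => x; rewrite convE.
apply: (proj1 (@Mi_fubini R m p (fun z => f (z.1 - z.2) *m g z.2) (fun y => rI (fun t => mn (f t)) * mn (g y)) _ _ _ _ _)).
- by apply: Mm_mul; [exact: Mm_sub2|exact: Mm_snd2].
- exact: h1.
- by move=> x; exact: conv_Mi.
- exact: riZ.
- move=> y; rewrite mulrC -(rI_shift (- y) b) -rIZ; last exact: (ri_shift (- y) b).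
  apply: le_rI => [||x]; [exact: (Mi_mn (h1 y))|exact: (riZ _ (ri_shift (- y) b))|].
  by rewrite mulrC; exact: mnM.
Qed.

Lemma conv_shiftl a f g t : cnv (fun s => f (s - a)) g t = cnv f g (t - a).
Proof. by rewrite !convE; apply: mI_ext => r; rewrite addrAC. Qed.
Lemma conv_shiftr a f g t : K f -> K g -> cnv f (fun s => g (s - a)) t = cnv f g (t - a).
Proof.
move=> kf kg; rewrite (conv_flip t kf (K_shift _ kg)) (conv_flip _ kf kg).
by apply: mI_ext => r; rewrite addrAC.
Qed.
Lemma convDl f1 f2 g t : K f1 -> K f2 -> K g ->
  cnv (fun s => f1 s + f2 s) g t = cnv f1 g t + cnv f2 g t.
Proof.
move=> k1 k2 kg; rewrite !convE -mID; [|exact: conv_Mi|exact: conv_Mi].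
by apply: mI_ext => r; rewrite mulmxDl.
Qed.
Lemma convDr f g1 g2 t : K f -> K g1 -> K g2 ->
  cnv f (fun s => g1 s + g2 s) t = cnv f g1 t + cnv f g2 t.
Proof.
move=> kf k1 k2; rewrite !convE -mID; [|exact: conv_Mi|exact: conv_Mi].
by apply: mI_ext => r; rewrite mulmxDr.
Qed.
Lemma conv_suml (I : Type) (s : seq I) (F : I -> R -> 'M[C]_(m, n)) g t :
  (forall i, K (F i)) -> K g ->
  cnv (fun r => \sum_(i <- s) F i r) g t = \sum_(i <- s) cnv (F i) g t.
Proof.
move=> kF kg; rewrite convE; under [RHS]eq_bigr do rewrite convE.
rewrite -mI_sum => [|i]; last exact: conv_Mi.
by apply: mI_ext => r; rewrite mulmx_suml.
Qed.
Lemma conv_sumr (I : Type) (s : seq I) f (G : I -> R -> 'M[C]_(n, p)) t :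
  K f -> (forall i, K (G i)) ->
  cnv f (fun r => \sum_(i <- s) G i r) t = \sum_(i <- s) cnv f (G i) t.
Proof.
move=> kf kG; rewrite convE; under [RHS]eq_bigr do rewrite convE.
rewrite -mI_sum => [|i]; last exact: conv_Mi.
by apply: mI_ext => r; rewrite mulmx_sumr.
Qed.
Lemma convNl f g t : K f -> K g -> cnv (fun s => - f s) g t = - cnv f g t.
Proof.
by move=> kf kg; rewrite !convE -mIN; [apply: mI_ext => r; rewrite mulNmx|exact: conv_Mi].
Qed.
Lemma convNr f g t : K f -> K g -> cnv f (fun s => - g s) t = - cnv f g t.
Proof.
by move=> kf kg; rewrite !convE -mIN; [apply: mI_ext => r; rewrite mulmxN|exact: conv_Mi].
Qed.
Lemma conv_mull q (c : 'M[C]_(q, m)) f g t : K f -> K g ->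
  mI (fun r => (c *m f (t - r)) *m g r) = c *m cnv f g t.
Proof.
move=> kf kg; rewrite !convE -mI_mull; last exact: conv_Mi.
by apply: mI_ext => r; rewrite mulmxA.
Qed.
Lemma conv_mulr q (c : 'M[C]_(p, q)) f g t : K f -> K g ->
  mI (fun r => f (t - r) *m (g r *m c)) = cnv f g t *m c.
Proof.
move=> kf kg; rewrite !convE -mI_mulr; last exact: conv_Mi.
by apply: mI_ext => r; rewrite mulmxA.
Qed.
(** An operator bound in the sup norm with weight [w]. For an exponential weight the integral is
    [w t] times a Laplace transform of the norm of [f]; for [w = 1] it is the integral norm of the
    kernel. *)
Lemma conv_wbound f g (w : R -> R) M t : K f -> K g ->
  ri (fun r => mn (f r) * w (t - r)) -> (forall r, mn (g r) <= M * w r) ->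
  mn (cnv f g t) <= M * rI (fun r => mn (f r) * w (t - r)).
Proof.
move=> kf kg hw h; rewrite conv_flip // -rIZ //.
have hi : Mi (fun r => f r *m g (t - r)) by apply: K_mulMi => //; exact: K_refl.
apply: le_trans (mn_mI hi) _; apply: le_rI => [||r]; [exact: (Mi_mn hi)|exact: riZ|].
rewrite mulrCA; apply: le_trans (mnM _ _) _.
by apply: ler_wpM2l; [exact: mn_ge0|exact: h].
Qed.
End Product.

Lemma convA m n p q (f : R -> 'M[C]_(m, n)) (g : R -> 'M[C]_(n, p)) (h : R -> 'M[C]_(p, q)) t :
  K f -> K g -> K h -> cnv f (cnv g h) t = cnv (cnv f g) h t.
Proof.
move=> kf kg kh; have [a1 b1 c1] := kf; have [a2 b2 c2] := kg; have [a3 b3 c3] := kh.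
transitivity (mI (fun x => mI (fun y => f (t - x) *m (g (x - y) *m h y)))).
  by rewrite convE; apply: mI_ext => x; rewrite convE mI_mull //; exact: conv_Mi.
have h1 y : Mi (fun x => f (t - x) *m g (x - y)).
  by apply: K_mulMi; [exact: K_refl|exact: K_shift].
have h2 y : Mi (fun x => f (t - x) *m (g (x - y) *m h y)).
  by apply: Mi_ext (Mi_mulr (h y) (h1 y)) => x; rewrite mulmxA.
pose B := rI (fun t => mn (f t) ^+ 2) + rI (fun t => mn (g t) ^+ 2).
rewrite (proj2 (@Mi_fubini R m q (fun z => f (t - z.1) *m (g (z.1 - z.2) *m h z.2))
  (fun y => B * mn (h y)) _ _ _ _ _)) /=.
- rewrite convE; apply: mI_ext => y; rewrite convE -mI_mulr; last exact: conv_Mi.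
  rewrite -(mI_shift y (h2 y)); apply: mI_ext => x.
  by rewrite addrK mulmxA opprD addrA addrAC.
- apply: Mm_mul; first exact: Mm_subl2.
  by apply: Mm_mul; [exact: Mm_sub2|exact: Mm_snd2].
- exact: h2.
- by move=> x; apply: Mi_mull; exact: conv_Mi.
- exact: riZ.
- move=> y; rewrite /B -(rI_refl t c1) -(rI_shift (- y) c2) -rID; last 2 first.
  + exact: (ri_refl t c1).
  + exact: (ri_shift (- y) c2).
  rewrite mulrC -rIZ; last by apply: riD; [exact: (ri_refl t c1)|exact: (ri_shift (- y) c2)].
  apply: le_rI => [||x].
  + exact: (Mi_mn (h2 y)).
  + exact: (riZ _ (riD (ri_refl t c1) (ri_shift (- y) c2))).
  rewrite mulmxA; apply: le_trans (mnM _ _) _; rewrite mulrC.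
  apply: ler_wpM2l; first exact: mn_ge0.
  exact: le_trans (mnM _ _) (mul_le_sqr _ _).
Qed.

End Conv.

(** * Fixed points of contractions in weighted sup norms *)

Section Neumann.
Context (R : realType).
Local Notation C := R[i].

(** With [e k = 2 * B / 2 ^+ k], the intervals of radius [e k] around [u k] are nested, because
    [e k - e k.+1 = B / 2 ^+ k]. The limit is the supremum of their left ends, and the rate comes
    for free. *)
Lemma geo_lim (u : nat -> R) (B : R) :
  (forall k, `|u k.+1 - u k| <= B / 2 ^+ k) ->
  exists l, forall k, `|u k - l| <= 2 * B / 2 ^+ k.
Proof.
move=> h; pose e k : R := 2 * B / 2 ^+ k.
have he k : e k.+1 = e k - B / 2 ^+ k.
  by rewrite /e exprS invfM; field; rewrite expf_neq0.
have e0 k : 0 <= e k by rewrite /e -mulrA mulr_ge0 // (le_trans _ (h k)).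
have ha i k : u i - e i <= u (i + k)%N - e (i + k)%N.
  elim: k => [|k ih]; rewrite ?addn0 // addnS; apply: le_trans ih _.
  by rewrite he; have := h (i + k)%N; rewrite ler_norml => /andP[] *; lra.
have hb i k : u (i + k)%N + e (i + k)%N <= u i + e i.
  elim: k => [|k ih]; rewrite ?addn0 // addnS; apply: le_trans ih.
  by rewrite he; have := h (i + k)%N; rewrite ler_norml => /andP[] *; lra.
have hab i j : u i - e i <= u j + e j.
  have := ha i j; have := hb j i; have := e0 (i + j)%N; rewrite (addnC j i).
  move: (u (i + j)%N) (e (i + j)%N) => x y *; lra.
pose A := [set x | exists k, x = u k - e k].
have A0 : A !=set0 by exists (u 0%N - e 0%N), 0%N.
exists (sup A) => k; rewrite ler_norml -/(e k).
have h1 : sup A <= u k + e k by apply: ge_sup => // _ [i ->].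
have h2 : u k - e k <= sup A.
  by apply: ub_le_sup; [exists (u k + e k) => _ [i ->]|exists k].
by apply/andP; split; lra.
Qed.

Lemma geo_le0 (x c : R) : (forall k, x <= c / 2 ^+ k) -> x <= 0.
Proof.
move=> h; rewrite leNgt; apply/negP => x0.
have c0 : 0 <= c by have := h 0%N; rewrite expr0 divr1; lra.
pose k := Num.bound (c / x).
have hk : c / x < k%:R by apply: archi_boundP; exact: divr_ge0 c0 (ltW x0).
have h2 : (k%:R : R) <= 2 ^+ k by rewrite -natrX ler_nat ltnW // ltn_expl.
have := h k; rewrite ler_pdivlMr ?exprn_gt0 // => h3.
move: hk; rewrite ltr_pdivrMr // => hk; nra.
Qed.

Context {m n : nat}.
Variable w : R -> R.

Definition BMw (f : R -> 'M[C]_(m, n)) : Prop :=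
  Mm f /\ exists M, forall t, mn (f t) <= M * w t.

Variable T : (R -> 'M[C]_(m, n)) -> R -> 'M[C]_(m, n).
Hypothesis TB : forall f, BMw f -> BMw (T f).
Hypothesis Tc : forall f g M, BMw f -> BMw g -> (forall t, mn (f t - g t) <= M * w t) ->
  forall t, mn (T f t - T g t) <= M / 2 * w t.

(** Iteration from 0. The limit is taken entrywise at every point, so it is measurable and the fixed
    point equation holds everywhere. *)
Lemma contraction_fixpoint : exists f, BMw f /\ forall t, f t = T f t.
Proof.
pose F k := iter k T (fun=> 0).
have F0 : BMw (F 0%N).
  by split; [exact: Mm_cst|exists 0 => t; rewrite mn0 mul0r].
have FB k : BMw (F k) by elim: k => // k; exact: TB.
have [M0 h0] := (FB 1%N).2.
have hF k t : mn (F k.+1 t - F k t) <= M0 / 2 ^+ k * w t.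
  elim: k t => [|k ih] t; first by rewrite expr0 divr1 subr0.
  rewrite exprSr invfM mulrA; exact: (Tc (FB k.+1) (FB k) ih).
have hn t k i j : n1 (F k.+1 t i j - F k t i j) <= (M0 * w t) / 2 ^+ k.
  rewrite mulrAC; apply: le_trans (hF k t).
  have := mn_entry (F k.+1 t - F k t) i j; move: (F k.+1 t) (F k t) => P Q.
  by rewrite !mxE.
have hr' t i j : exists l, forall k, `|complex.Re (F k t i j) - l| <= 2 * (M0 * w t) / 2 ^+ k.
  apply: geo_lim => k; apply: le_trans (hn t k i j).
  rewrite -[complex.Re (F k.+1 t i j) - _](etrans (cReD _ _) (congr1 _ (cReN _))); exact: normRe_le.
have hi' t i j : exists l, forall k, `|complex.Im (F k t i j) - l| <= 2 * (M0 * w t) / 2 ^+ k.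
  apply: geo_lim => k; apply: le_trans (hn t k i j).
  rewrite -[complex.Im (F k.+1 t i j) - _](etrans (cImD _ _) (congr1 _ (cImN _))); exact: normIm_le.
pose g t : 'M[C]_(m, n) := \matrix_(i, j) (sval (cid (hr' t i j)) +i* sval (cid (hi' t i j))).
(* In each entry the real and the imaginary part are off by at most [2 * (M0 * w t) / 2 ^+ k]. *)
pose c := \sum_(i < m) \sum_(j < n) (4 * M0).
have hg k t : mn (F k t - g t) <= c / 2 ^+ k * w t.
  rewrite -mulrA /c mulr_suml; apply: ler_sum => i _; rewrite mulr_suml.
  apply: ler_sum => j _; have -> : (F k t - g t) i j = F k t i j - (sval (cid (hr' t i j)) +i* sval (cid (hi' t i j))).
    by rewrite /g; move: (F k t) => P; rewrite !mxE.
  case: (cid (hr' t i j)) => a ha; case: (cid (hi' t i j)) => b hb /=.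
  move: (ha k) (hb k); rewrite /n1; case: (F k t i j) => x y /= h1 h2.
  apply: le_trans (lerD h1 h2) _; rewrite le_eqVlt; apply/orP; left; apply/eqP.
  by field; rewrite expf_neq0.
have mg : Mm g.
  apply: (@Mm_lim _ _ _ _ _ F) => [k|t]; first by case: (FB k).
  apply/cvgrPdist_lt => e e0.
  pose k0 := Num.bound (`|c * w t| / e).
  have hk0 : `|c * w t| / e < k0%:R by apply: archi_boundP; rewrite divr_ge0 // ltW.
  exists k0 => // k /= kk; rewrite sub0r normrN ger0_norm ?mn_ge0 //.
  apply: le_lt_trans (hg k t) _; rewrite mulrAC ltr_pdivrMr ?exprn_gt0 //.
  apply: le_lt_trans (ler_norm _) _; rewrite ltr_pdivrMr // in hk0.
  apply: lt_le_trans hk0 _; rewrite mulrC; apply: ler_wpM2l; first exact: ltW.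
  rewrite -natrX ler_nat; apply: leq_trans kk _; apply: ltnW; exact: ltn_expl.
have Bg : BMw g.
  split=> //; exists c => t; have := hg 0%N t.
  by rewrite sub0r mnN expr0 divr1.
exists g; split => // t; apply/esym/subr0_eq; apply: mn_le0.
apply: (@geo_le0 _ (c * w t)) => k.
have h1 : mn (T g t - T (F k) t) <= c / 2 ^+ k / 2 * w t.
  by apply: Tc => // s; rewrite mn_distC.
have h2 := hg k.+1 t; rewrite exprSr invfM mulrA in h2.
rewrite -(subrKA (T (F k) t)); apply: le_trans (mnD _ _) _.
apply: le_trans (lerD h1 h2) _.
by rewrite le_eqVlt; apply/orP; left; apply/eqP; field; rewrite expf_neq0.
Qed.

End Neumann.

(** * Chains and pencils of subspaces *)

Section LinearAlgebra.
Context (F : numClosedFieldType) (L : lmodType F).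
Implicit Types V U D M : L -> Prop.

Definition subspace V : Prop := V 0 /\ forall a x y, V x -> V y -> V (a *: x + y).

Lemma sspD V x y : subspace V -> V x -> V y -> V (x + y).
Proof. by case=> _ h hx hy; rewrite -[x]scale1r; exact: h. Qed.
Lemma sspZ V a x : subspace V -> V x -> V (a *: x).
Proof. by case=> h0 h hx; rewrite -[_ *: _]addr0; exact: h. Qed.
Lemma sspB V x y : subspace V -> V x -> V y -> V (x - y).
Proof. by move=> h hx hy; apply: sspD => //; rewrite -scaleN1r; exact: sspZ. Qed.
Lemma ssp_sum V (I : finType) (f : I -> L) (a : I -> F) :
  subspace V -> (forall i, V (f i)) -> V (\sum_i a i *: f i).
Proof.
move=> h hf; elim/big_ind : _ => [|x y|i _]; [by case: h|exact: sspD|exact: sspZ].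
Qed.

Let zid1 (x p q s : L) : x - (q - s) = (x - (p + q)) + (p + s).
Proof.
by rewrite opprB opprD -[RHS]addrA [X in x + X = _]addrC [X in _ = _ + X]addrACA addNr add0r.
Qed.
Let zid2 (x y s1 s2 p s3 : L) :
  y - (s2 - s3) = (y - (x - p)) + ((x - s1) + ((s1 - s2) + (- p + s3))).
Proof.
have -> : (x - s1) + ((s1 - s2) + (- p + s3)) = x + (- s2 + (- p + s3)).
  by rewrite -[s1 - s2 + _]addrA subrKA.
have -> : y - (x - p) = (y + p) - x by rewrite opprB addrA.
by rewrite subrKA -[RHS]addrA opprB [X in _ = y + X]addrCA addNKr [s3 - _]addrC.
Qed.

Definition spans_mod V D d (f : 'I_d -> L) : Prop :=
  forall x, D x -> exists a : 'I_d -> F, V (x - \sum_i a i *: f i).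

(** Every strict inclusion uses up a generator: a vector of [V 1] outside [V 0] has a nonzero
    coefficient along some [f k], which can then be eliminated modulo [V 1]. *)
Lemma chain_stalls d (f : 'I_d -> L) D (V : nat -> L -> Prop) :
  (forall i, subspace (V i)) -> (forall i x, V i x -> V i.+1 x) ->
  (forall i x, V i x -> D x) -> spans_mod (V 0%N) D f ->
  exists2 i, (i <= d)%N & forall x, V i.+1 x -> V i x.
Proof.
elim: d f V => [|d ih] f V sV incV VD sp.
  exists 0%N => // x Vx; have [a] := sp x (VD _ _ Vx).
  by rewrite big_ord0 subr0.
have [h|/existsNP[v /not_implyP[Vv nVv]]] := pselect (forall x, V 1%N x -> V 0%N x).
  by exists 0%N.
have [a ha] := sp v (VD _ _ Vv).
have [k ak] : exists k, a k != 0.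
  apply/existsP; rewrite -[[exists _, _]]negbK negb_exists; apply/negP => /forallP h.
  apply: nVv; move: ha; rewrite big1 ?subr0 // => i _.
  by have := h i; rewrite negbK => /eqP ->; rewrite scale0r.
have [||||i id h] := ih (fun j => f (lift k j)) (fun i => V i.+1).
- by move=> i; exact: sV.
- by move=> i x; exact: incV.
- by move=> i x; exact: VD.
(* Subtracting [c] times the combination that represents [v] cancels the coefficient of [f k]; [v]
   itself lies in [V 1]. *)
- move=> x Dx; have [b hb] := sp x Dx; pose c := b k / a k.
  exists (fun j => b (lift k j) - c * a (lift k j)).
  have -> : x - \sum_i (b (lift k i) - c * a (lift k i)) *: f (lift k i) =
      (x - \sum_i b i *: f i) + c *: (v - (v - \sum_i a i *: f i)).
    rewrite subKr (bigD1_ord k) //= [in X in c *: X](bigD1_ord k) //=.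
    rewrite scalerDr scalerA /c divfK // scaler_sumr -zid1; congr (_ - _).
    by rewrite -sumrB; apply: eq_bigr => j _; rewrite scalerBl scalerA.
  apply: sspD => //; first exact: incV.
  by apply: sspZ => //; apply: sspB => //; exact: incV.
by exists i.+1.
Qed.

(* The hypothesis on the pencil [x - nu *: Pr x] says that the operator induced by
   the inverse of [Pr] on the finite-dimensional quotient [M / U] has no eigenvalue. *)
Lemma pencil_trivial D U M (Pr : L -> L -> Prop) d (g : 'I_d -> L) :
  subspace U -> subspace D -> (forall x, D x -> M x) ->
  (forall a x y x' y', Pr x y -> Pr x' y' -> Pr (a *: x + x') (a *: y + y')) -> Pr 0 0 ->
  (forall x y, D x -> Pr x y -> M y) ->
  (forall y, M y -> exists2 x, D x & Pr x y) ->
  (forall x y, D x -> Pr x y -> U y -> U x) ->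
  (forall nu y, M y -> exists x p, [/\ D x, Pr x p & U (y - (x - nu *: p))]) ->
  (forall i, M (g i)) -> subspace M -> spans_mod U M g -> forall y, M y -> U y.
Proof.
move=> sU sD DM linP P0 PM surj inj pen; elim: d g => [|d ih] g gM sM sp.
  by move=> y /sp[a]; rewrite big_ord0 subr0.
have hx i : exists x, D x /\ Pr x (g i) by have [x] := surj _ (gM i); exists x.
have [X hX] := choice hx.
have [G hG] := choice (fun i => sp (X i) (DM _ (hX i).1)).
pose A := \matrix_(i, j) G i j : 'M[F]_d.+1.
(* On coefficients, [A] describes the inverse of [Pr] modulo [U]. An eigenvector of the transpose is
   a linear form [q] on coefficients which vanishes on the image of that operator minus [nu]. *)
have [nu /eigenvalueP[q hq q0]] := @eigenvalue_closed F d.+1 A^T isT.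
have hq' i : \sum_j G i j * q 0 j = nu * q 0 i.
  move/matrixP: hq => /(_ 0 i); rewrite !mxE => <-.
  by apply: eq_bigr => j _; rewrite !mxE mulrC.
have [k qk] : exists k, q 0 k != 0 by apply/rV0Pn.
(* Since the pencil is onto at this [nu], every element has, modulo [U], coefficients annihilated by
   [q]. As [q 0 k] is nonzero, these are combinations of one generator fewer. *)
apply: (ih (fun j => g (lift k j) - (q 0 (lift k j) / q 0 k) *: g k)) => //.
  by move=> j; apply: sspB => //; exact: sspZ.
move=> y My; have [x [p [Dx Pxp hy]]] := pen nu y My.
have [c hc] := sp p (PM _ _ Dx Pxp).
pose e j := \sum_i c i * G i j - nu * c j.
have Pc : Pr (\sum_i c i *: X i) (\sum_i c i *: g i).
  elim/big_ind2 : _ => [//|x1 y1 x2 y2 h1 h2|i _].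
    by have := linP 1 _ _ _ _ h1 h2; rewrite !scale1r.
  by have := linP (c i) _ _ _ _ (hX i).2 P0; rewrite !addr0.
have DX : D (\sum_i c i *: X i) by apply: ssp_sum => // i; case: (hX i).
have hxU : U (x - \sum_i c i *: X i).
  apply: (inj _ (p - \sum_i c i *: g i)) => //; first exact: sspB.
  by have := linP (-1) _ _ _ _ Pc Pxp; rewrite !scaleN1r ![- _ + _]addrC.
have hXU : U (\sum_i c i *: X i - \sum_j (\sum_i c i * G i j) *: g j).
  have -> : \sum_i c i *: X i - \sum_j (\sum_i c i * G i j) *: g j =
      \sum_i c i *: (X i - \sum_j G i j *: g j).
    under [in RHS]eq_bigr do rewrite scalerBr scaler_sumr.
    rewrite sumrB; congr (_ - _); rewrite exchange_big /=; apply: eq_bigr => j _.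
    by rewrite scaler_suml; apply: eq_bigr => i _; rewrite scalerA.
  exact: ssp_sum.
have hU : U (y - \sum_j e j *: g j).
  have -> : y - \sum_j e j *: g j = (y - (x - nu *: p)) + ((x - \sum_i c i *: X i) +
     ((\sum_i c i *: X i - \sum_j (\sum_i c i * G i j) *: g j) + (- nu) *: (p - \sum_i c i *: g i))).
    have -> : \sum_j e j *: g j = \sum_j (\sum_i c i * G i j) *: g j - nu *: \sum_i c i *: g i.
      by rewrite scaler_sumr -sumrB; apply: eq_bigr => j _; rewrite scalerBl scalerA.
    move: (\sum_i c i *: X i) (\sum_j (\sum_i c i * G i j) *: g j) (\sum_i c i *: g i) => s1 s2 s3.
    rewrite scalerBr !scaleNr opprK; exact: zid2.
  by do 2 (apply: sspD => //); apply: sspD => //; exact: sspZ.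
exists (fun j => e (lift k j)); suff -> : \sum_(i < d) e (lift k i) *:
   (g (lift k i) - (q 0 (lift k i) / q 0 k) *: g k) = \sum_j e j *: g j by [].
rewrite [RHS](bigD1_ord k) //=.
under eq_bigr do rewrite scalerBr scalerA.
rewrite sumrB -scaler_suml [LHS]addrC -scaleNr; congr (_ *: _ + _).
have : \sum_j e j * q 0 j = 0.
  under eq_bigr do rewrite /e mulrBl mulr_suml.
  rewrite sumrB exchange_big /=; apply/eqP; rewrite subr_eq0; apply/eqP.
  apply: eq_bigr => i _; under eq_bigr do rewrite -mulrA.
  by rewrite -mulr_sumr hq' mulrA [c i * nu]mulrC.
rewrite (bigD1_ord k) //= => /eqP; rewrite addrC addr_eq0 => /eqP h.
under eq_bigr do rewrite mulrA.
by rewrite -mulr_suml h mulNr opprK mulfK.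
Qed.

End LinearAlgebra.

(** * Exponential integrals *)

Section Exponential.
Context (R : realType).
Local Notation C := R[i].
Local Notation mu := (@lebesgue_measure R).

Lemma ind_patch s t (f : R -> R) : (fun r => ind s t r * f r) = (f \_ `[s, t]%classic).
Proof.
apply/funext => r; rewrite patchE /ind mem_setE in_itv /=.
by case: (_ <= _ <= _); rewrite ?mul1r ?mul0r.
Qed.

Lemma ri_onP s t (f : R -> R) :
  ri (fun r => ind s t r * f r) <-> mu.-integrable `[s, t]%classic (EFin \o f).
Proof.
rewrite ind_patch /ri.
have -> : EFin \o (f \_ `[s, t]%classic) = ((EFin \o f) \_ `[s, t]%classic).
  by apply/funext => r /=; rewrite !patchE; case: ifP.
have mi : measurable (`[s, t]%classic : set R) by exact: measurable_itv.
by have [h1 h2] := @integrable_mkcond _ (measurableTypeR R) R mu _ (EFin \o f) mi; split; [exact: h2|exact: h1].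
Qed.

Lemma rI_onE s t (f : R -> R) :
  rI (fun r => ind s t r * f r) = Rintegral mu `[s, t]%classic f.
Proof. by rewrite ind_patch [RHS]Rintegral_mkcond. Qed.

Lemma rI_FTC (F f : R -> R) s t : s <= t -> (forall x : R, is_derive x 1 F (f x)) ->
  (forall x : R, derivable f x 1) ->
  ri (fun r => ind s t r * f r) /\ rI (fun r => ind s t r * f r) = F t - F s.
Proof.
move=> st hF hf.
have cf : {within `[s, t]%classic, continuous f}.
  by apply: derivable_within_continuous => x _; exact: hf.
split.
  apply/ri_onP; apply: continuous_compact_integrable => //; exact: segment_compact.
rewrite rI_onE; move: st; rewrite le_eqVlt => /orP[/eqP ->|st].
  by rewrite subrr set_itv1 Rintegral_set1.
rewrite /Rintegral (@continuous_FTC2 _ f F) //.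
  have cF (x : R) : {for x, continuous F}.
    by apply/differentiable_continuous/derivable1_diffP; exact: ex_derive.
  split; first by move=> x _; exact: ex_derive.
    exact: cvg_at_right_filter (cF s).
  exact: cvg_at_left_filter (cF t).
by move=> x _; rewrite derive1E; exact: derive_val.
Qed.

Lemma cReZr (r : R) (z : C) : @complex.Re R (r%:C * z) = r * @complex.Re R z.
Proof. by case: z => x y /=; rewrite mul0r subr0. Qed.
Lemma cImZr (r : R) (z : C) : @complex.Im R (r%:C * z) = r * @complex.Im R z.
Proof. by case: z => x y /=; rewrite mul0r addr0. Qed.

Section Cexp.
Variable l : C.
Let a := complex.Re l.
Let b := complex.Im l.

Let dlin (c x : R) : is_derive x 1 (fun y : R => c * y) c.
Proof. by apply: is_derive_eq; rewrite /GRing.scale /= mulr1. Qed.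
Let dE (x : R) : is_derive x 1 (fun y => expR (a * y)) (expR (a * x) * a).
Proof. exact: (is_derive1_comp (is_derive_expR (a * x)) (dlin a x)). Qed.
Let dC (x : R) : is_derive x 1 (fun y => cos (b * y)) (- sin (b * x) * b).
Proof. exact: (is_derive1_comp (is_derive_cos (b * x)) (dlin b x)). Qed.
Let dS (x : R) : is_derive x 1 (fun y => sin (b * y)) (cos (b * x) * b).
Proof. exact: (is_derive1_comp (is_derive_sin (b * x)) (dlin b x)). Qed.
Let fR (x : R) : R := expR (a * x) * cos (b * x).
Let fI (x : R) : R := expR (a * x) * sin (b * x).
Let dfR (x : R) : is_derive x 1 fR (a * fR x - b * fI x).
Proof.
apply: is_derive_eq (is_deriveM (dE x) (dC x)) _.
by rewrite /GRing.scale /= /fR /fI; ring.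
Qed.
Let dfI (x : R) : is_derive x 1 fI (a * fI x + b * fR x).
Proof.
apply: is_derive_eq (is_deriveM (dE x) (dS x)) _.
by rewrite /GRing.scale /= /fR /fI; ring.
Qed.

Lemma cexpE (t : R) : cexp (l * t%:C) = fR t +i* fI t.
Proof.
have aux (z : C) : cexp (z * t%:C) = (expR (complex.Re z * t) * cos (complex.Im z * t)) +i*
    (expR (complex.Re z * t) * sin (complex.Im z * t)).
  by case: z => x y; rewrite /cexp /= !mulr0 subr0 add0r.
exact: aux.
Qed.

Lemma cexp_FTC s t : s <= t ->
  let f := fun r => (ind s t r)%:C * (l * cexp (l * r%:C)) in
  Ci f /\ cI f = cexp (l * t%:C) - cexp (l * s%:C).
Proof.
move=> st f.
have d1 (x : R) : derivable (fun y => a * fR y - b * fI y) x 1.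
  have h1 := dfR x; have h2 := dfI x; exact: ex_derive.
have d2 (x : R) : derivable (fun y => a * fI y + b * fR y) x 1.
  have h1 := dfR x; have h2 := dfI x; exact: ex_derive.
have [i1 e1] := rI_FTC st dfR d1; have [i2 e2] := rI_FTC st dfI d2.
have E1 : (fun r => complex.Re (f r)) = (fun r => ind s t r * (a * fR r - b * fI r)).
  by apply/funext => r; rewrite /f cReZr cexpE cReM.
have E2 : (fun r => complex.Im (f r)) = (fun r => ind s t r * (a * fI r + b * fR r)).
  by apply/funext => r; rewrite /f cImZr cexpE cImM.
split; first by split; rewrite ?E1 ?E2.
by rewrite /cI E1 E2 e1 e2 !cexpE.
Qed.

Lemma cexp_Mm m : Mm (fun t : R => (cexp (l * t%:C))%:M : 'M[C]_m).
Proof.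
have cR : measurable_fun setT fR.
  apply: continuous_measurable_fun => x.
  have h := dfR x; by apply/differentiable_continuous/derivable1_diffP; exact: ex_derive.
have cI' : measurable_fun setT fI.
  apply: continuous_measurable_fun => x.
  have h := dfI x; by apply/differentiable_continuous/derivable1_diffP; exact: ex_derive.
move=> i j; split.
  apply: (@eq_measurable_fun _ _ _ _ _ (fun t => (i == j)%:R * fR t)).
    by move=> t _; rewrite mxE cexpE; case: eqP; rewrite ?mulr1n ?mulr0n /= ?mul1r ?mul0r.
  by apply: measurable_funM => //; exact: measurable_cst.
apply: (@eq_measurable_fun _ _ _ _ _ (fun t => (i == j)%:R * fI t)).
  by move=> t _; rewrite mxE cexpE; case: eqP; rewrite ?mulr1n ?mulr0n /= ?mul1r ?mul0r.
by apply: measurable_funM => //; exact: measurable_cst.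
Qed.

Lemma n1_cexp (t : R) : n1 (cexp (l * t%:C)) <= 2 * expR (a * t).
Proof.
rewrite cexpE /n1 /= /fR /fI !normrM (ger0_norm (expR_ge0 _)) -mulrDr mulrC.
apply: ler_wpM2r; first exact: expR_ge0.
have h1 := cos_max (b * t); have h2 := sin_max (b * t); lra.
Qed.
End Cexp.

Lemma cexp0 : cexp (0 : C) = 1.
Proof. by rewrite /cexp /= expR0 cos0 sin0 mulr1 mulr0. Qed.

Lemma expR_rI (c L : R) : 0 < c -> 0 <= L ->
  ri (fun r => ind 0 L r * expR (- c * r)) /\
  rI (fun r => ind 0 L r * expR (- c * r)) <= c^-1.
Proof.
move=> c0 L0.
have dlin (k x : R) : is_derive x 1 (fun y : R => k * y) k.
  by apply: is_derive_eq; rewrite /GRing.scale /= mulr1.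
have d1 (x : R) : is_derive x 1 (fun y => expR (- c * y)) (expR (- c * x) * - c).
  exact: (is_derive1_comp (is_derive_expR (- c * x)) (dlin (- c) x)).
have d2 (x : R) : derivable (fun y => expR (- c * y) * - c) x 1.
  have h1 := d1 x; exact: ex_derive.
have [i1 e1] := rI_FTC L0 d1 d2.
have E : (fun r => ind 0 L r * expR (- c * r)) =
    (fun r => (- c^-1) * (ind 0 L r * (expR (- c * r) * - c))).
  by apply/funext => r; field; rewrite gt_eqF.
rewrite E; split; first exact: riZ.
rewrite rIZ // e1 mulr0 expR0 mulNr -mulrN opprB.
apply: ler_piMr; first by rewrite invr_ge0 ltW.
by rewrite gerBl expR_ge0.
Qed.

(** The Laplace transform of a kernel tends to 0. This makes the convolution with it a contraction
    in the sup norm weighted by [expR (s * t)], for [s] large. *)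
Lemma decay m n (f : R -> 'M[C]_(m, n)) (L e : R) : K f -> 0 <= L ->
  (forall t, ~~ (0 <= t <= L) -> f t = 0) -> 0 < e ->
  exists s0 : R, 0 < s0 /\ forall s, s0 <= s ->
    ri (fun r => mn (f r) * expR (- s * r)) /\ rI (fun r => mn (f r) * expR (- s * r)) <= e.
Proof.
move=> [mf f1 f2] L0 supp e0.
pose Q := rI (fun t => mn (f t) ^+ 2); have Q0 : 0 <= Q by apply: rI_ge0 => t; exact: sqr_ge0.
(* AM-GM with a parameter [k]: [x y <= k x^2 + y^2 / (4 k)] *)
pose k := e / (2 * (Q + 1)).
have k0 : 0 < k by rewrite divr_gt0 // mulr_gt0 //; lra.
have ke : 0 < 4 * k * e by apply: mulr_gt0 => //; apply: mulr_gt0 => //; lra.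
exists ((4 * k * e)^-1); split; first by rewrite invr_gt0.
move=> s hs; have s0 : 0 < s by apply: lt_le_trans hs; rewrite invr_gt0.
have [i1 e1] := @expR_rI (2 * s) L (mulr_gt0 (ltr0Sn _ 1) s0) L0.
have i2 := riD (riZ k f2) (riZ (4 * k)^-1 i1).
have bd r : mn (f r) * expR (- s * r) <=
    k * mn (f r) ^+ 2 + (4 * k)^-1 * (ind 0 L r * expR (- (2 * s) * r)).
  rewrite /ind; case: (boolP (0 <= r <= L)) => h; last first.
    rewrite supp // mn0 mul0r mul0r mulr0 addr0 expr0n mulr0 //.
  rewrite mul1r (_ : - (2 * s) * r = - s * r + - s * r); last by ring.
  rewrite expRD; move: (mn (f r)) (expR (- s * r)) => x y.
  rewrite -subr_ge0 (_ : _ - _ = (4 * k)^-1 * (2 * k * x - y) ^+ 2).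
    by rewrite mulr_ge0 ?sqr_ge0 // invr_ge0 mulr_ge0 // ltW.
  by field; rewrite gt_eqF.
have mE : measurable_fun setT (fun r : R => mn (f r) * expR (- s * r)).
  apply: measurable_funM; first exact: Mm_mn.
  by apply: measurableT_comp => //; exact: measurable_funM.
have i3 : ri (fun r => mn (f r) * expR (- s * r)).
  by apply: ri_le i2 => // r; rewrite ger0_norm ?bd // mulr_ge0 ?mn_ge0 ?expR_ge0.
split=> //; apply: le_trans (le_rI i3 i2 bd) _.
rewrite rID; [|exact: riZ|exact: riZ]; rewrite !rIZ // -/Q.
have h1 : k * Q <= e / 2.
  rewrite /k mulrAC ler_pdivrMr; last by rewrite mulr_gt0 //; lra.
  by rewrite (_ : e / 2 * (2 * (Q + 1)) = e * (Q + 1)); [nra|field].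
have h2 : (4 * k)^-1 * rI (fun r => ind 0 L r * expR (- (2 * s) * r)) <= e / 2.
  apply: le_trans (ler_wpM2l _ e1) _; first by rewrite invr_ge0 mulr_ge0 // ltW.
  have hs' : 1 <= s * (4 * k * e) by rewrite -ler_pdivrMr // div1r.
  have k4 : 0 < 4 * k by apply: mulr_gt0 => //; lra.
  have s2 : 0 < 2 * s by apply: mulr_gt0 => //; lra.
  rewrite -invfM -div1r ler_pdivrMr; last exact: mulr_gt0.
  by rewrite (_ : e / 2 * (4 * k * (2 * s)) = s * (4 * k * e)) //; field.
apply: le_trans (lerD h1 h2) _; lra.
Qed.

End Exponential.

(** * Causal convolutions and primitives *)

Section Heaviside.
Context (R : realType).
Local Notation C := R[i].
Local Notation mu := (@lebesgue_measure R).

Lemma ae_neq (s : R) : {ae mu, forall r, r <> s}.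
Proof.
exists [set s]; split; [exact: measurable_set1|exact: lebesgue_measure_set1|].
by move=> r /= /contrapT.
Qed.

Lemma conv_local_l m n p (f f' : R -> 'M[C]_(m, n)) (g : R -> 'M[C]_(n, p)) c t :
  (forall r, r < c -> g r = 0) -> (forall s, s <= t - c -> f s = f' s) ->
  cnv f g t = cnv f' g t.
Proof.
move=> hg hf; rewrite !convE; apply: mI_ext => r.
have [rc|cr] := ltP r c; first by rewrite hg // !mulmx0.
by rewrite hf //; lra.
Qed.
Lemma conv_local_r m n p (f : R -> 'M[C]_(m, n)) (g g' : R -> 'M[C]_(n, p)) c t :
  (forall s, s < c -> f s = 0) -> (forall r, r <= t - c -> g r = g' r) ->
  cnv f g t = cnv f g' t.
Proof.
move=> hf hg; rewrite !convE; apply: mI_ext => r.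
have [rc|cr] := ltP (t - r) c; first by rewrite hf // !mul0mx.
by rewrite hg //; lra.
Qed.
Lemma conv_causal m n p (f : R -> 'M[C]_(m, n)) (g : R -> 'M[C]_(n, p)) a c t :
  (forall s, s < a -> f s = 0) -> (forall r, r < c -> g r = 0) -> t < a + c ->
  cnv f g t = 0.
Proof.
move=> hf hg tac; rewrite convE -[RHS](@mI0 R m p); apply: mI_ext => r.
have [rc|cr] := ltP r c; first by rewrite hg // mulmx0.
by rewrite hf ?mul0mx //; lra.
Qed.

Variable L : R.
(* The Heaviside function, truncated at [L] to be integrable; convolving with it takes
   primitives of functions supported in [[t - L, t]]. *)
Definition Hv p : R -> 'M[C]_p := cut 0 L (fun=> 1%:M).

Lemma HvE p t : Hv p t = ((ind 0 L t)%:C)%:M.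
Proof. by rewrite /Hv cutE scale_scalar_mx mulr1. Qed.
Lemma Hv1 p t : 0 <= t <= L -> Hv p t = 1%:M.
Proof. by rewrite /Hv /cut => ->. Qed.
Lemma Hv0 p t : t < 0 -> Hv p t = 0.
Proof. by rewrite /Hv /cut; case: ifP => // /andP[h _]; rewrite ltNge h. Qed.
Lemma K_Hv p : K (Hv p).
Proof. by apply: (@K_cutb _ _ _ _ _ _ (mn (1%:M : 'M[C]_p))) => //; exact: Mm_cst. Qed.
Lemma Hv_mulC m n t (M : 'M[C]_(m, n)) : Hv m t *m M = M *m Hv n t.
Proof. by rewrite !HvE scalar_mxC. Qed.

Lemma conv_Hv m n (f : R -> 'M[C]_(m, n)) t : cnv (Hv m) f t = mI (cut (t - L) t f).
Proof.
rewrite convE; apply: mI_ext => r; rewrite /Hv /cut.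
have -> : (0 <= t - r <= L) = (t - L <= r <= t) by apply/idP/idP; lra.
by case: ifP => _; rewrite ?mul1mx ?mul0mx.
Qed.
Lemma conv_HvC m n (f : R -> 'M[C]_(m, n)) t : K f -> cnv (Hv m) f t = cnv f (Hv n) t.
Proof.
move=> kf; rewrite (conv_flip t kf (K_Hv n)) convE.
by apply: mI_ext => r; rewrite Hv_mulC.
Qed.
Lemma conv_Hv_mull m n p (c : 'M[C]_(m, n)) (f : R -> 'M[C]_(n, p)) t : K f ->
  cnv (Hv m) (fun r => c *m f r) t = c *m cnv (Hv n) f t.
Proof.
move=> kf; rewrite !convE -mI_mull; last exact: (conv_Mi _ (K_Hv n) kf).
by apply: mI_ext => r; rewrite mulmxA Hv_mulC -mulmxA.
Qed.
Lemma conv_Hv_conv m n p (f : R -> 'M[C]_(m, n)) (g : R -> 'M[C]_(n, p)) t : K f -> K g ->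
  cnv (Hv m) (cnv f g) t = cnv f (cnv (Hv n) g) t.
Proof.
move=> kf kg; rewrite (convA t (K_Hv m) kf kg) (convA t kf (K_Hv n) kg).
have -> // : cnv (Hv m) f = cnv f (Hv n) by apply/funext => s; exact: conv_HvC.
Qed.

(** As [t - L <= c], the window of length [L] before [t] reaches back to where [f] starts, so the
    truncation of the Heaviside function is not felt. *)
Lemma Hv_diff m n (f : R -> 'M[C]_(m, n)) c s t : K f -> (forall r, r < c -> f r = 0) ->
  s <= t -> t - L <= c -> cnv (Hv m) f t - cnv (Hv m) f s = mI (cut s t f).
Proof.
move=> kf f0 st tc; rewrite !conv_Hv -mIB; [|exact: K_Mi (K_cut _ _ kf)|exact: K_Mi (K_cut _ _ kf)].
apply: (proj2 (mI_ae _ _ _)).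
- by apply: MiB; exact: K_Mi (K_cut _ _ kf).
- by have [] := K_cut s t kf.
(* The closed intervals ending and starting at [s] overlap there. *)
apply: aeS (ae_neq s) _ => r rs; rewrite /cut.
have [rc|cr] := ltP r c; first by rewrite f0 //; do 3 case: ifP => _; rewrite ?subrr ?subr0.
have -> : (t - L <= r <= t) = (r <= t) by apply/idP/idP; lra.
have -> : (s - L <= r <= s) = (r < s).
  by apply/idP/idP => [/andP[_]|]; [rewrite le_eqVlt => /orP[/eqP|]|move=> h; apply/andP; lra].
have [rs'|sr] := ltP r s.
  by rewrite (le_trans (ltW rs') st) subrr.
by rewrite subr0.
Qed.

End Heaviside.

(** * The fundamental solution *)

Section Fundamental.
Context (R : realType) (n : nat).
Local Notation C := R[i].
Variables (A : 'M[C]_n) (b : 'cV[C]_n) (k : R -> 'M[C]_n) (N : nat).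
Hypothesis kK : K k.
Variable L' : R.
Hypothesis L'0 : 0 <= L'.
Hypothesis k0 : forall t, ~~ (0 <= t <= L') -> k t = 0.

Definition Apow i : 'M[C]_n := iter i (mulmx A) 1%:M.
(* The jump [A^i b] of the fundamental solution at time [i]. *)
Definition bj i : 'cV[C]_n := iter i (mulmx A) b.
Lemma ApowS i : Apow i.+1 = A *m Apow i. Proof. by []. Qed.
Lemma bjS i : bj i.+1 = A *m bj i. Proof. by []. Qed.

Let kneg t : t < 0 -> k t = 0.
Proof. by move=> h; apply: k0; apply/negP => /andP[]; lra. Qed.

(** The convolution of [k] with the point masses [bj j] at the times [j]: the forcing that the jumps
    exert on the absolutely continuous part. *)
Definition kap t : 'cV[C]_n := \sum_(j < N.+1) k (t - j%:R) *m bj j.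
(** The solution of the equation without its convolution term, obtained by unrolling the delay. The
    forcing [kap] may be unbounded and does not fit a sup norm; [h1] absorbs it and leaves the
    bounded forcing [cnv k h1]. *)
Definition h1 t : 'cV[C]_n := \sum_(i < N.+1) Apow i *m kap (t - i%:R).

Lemma K_kap : K kap.
Proof. by apply: K_sum => j; apply: K_mulr; exact: K_shift. Qed.
Lemma kap_neg t : t < 0 -> kap t = 0.
Proof.
move=> h; rewrite /kap big1 // => j _; rewrite kneg ?mul0mx //.
by have : (0 : R) <= j%:R by []; lra.
Qed.
Lemma K_h1 : K h1.
Proof. by apply: K_sum => j; apply: K_mull; apply: K_shift; exact: K_kap. Qed.
Lemma h1_neg t : t < 0 -> h1 t = 0.
Proof.
move=> h; rewrite /h1 big1 // => j _; rewrite kap_neg ?mulmx0 //.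
by have : (0 : R) <= j%:R by []; lra.
Qed.
Lemma h1_eq t : t <= N%:R -> h1 t = A *m h1 (t - 1) + kap t.
Proof.
move=> tN; rewrite /h1 big_ord_recl mul1mx subr0 addrC; congr (_ + _).
rewrite mulmx_sumr [RHS]big_ord_recr [X in _ = _ + X](_ : _ = 0) ?addr0; last first.
  by rewrite kap_neg ?mulmx0 //=; lra.
apply: eq_bigr => i _; rewrite !lift0 ApowS mulmxA -natr1; congr (_ *m kap _).
by rewrite /=; lra.
Qed.

Let r t := cnv k h1 t.
Lemma exists_density_bounded_part : exists g : R -> 'cV[C]_n,
  [/\ K g, (forall t, t < 0 -> g t = 0) &
   forall t, 0 <= t <= N%:R -> g t = A *m g (t - 1) + cnv k g t + r t].
Proof.
have q0 : (0 : R) < 1 / 4 by lra.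
have [s0 [s00 hs]] := decay kK L'0 k0 q0.
(* The contraction factor 1/2 is shared equally: 1/4 for the convolution, by [decay], and 1/4 for
   the delay, since [expR (- s) * mn A <= 1 / 4] follows from [1 + s <= expR s]. *)
pose s := s0 + 4 * (mn A + 1).
have mA := mn_ge0 A.
have [ik Ik] := hs s ltac:(rewrite /s; lra).
pose w t : R := expR (s * t).
have w0 t : 0 < w t by exact: expR_gt0.
pose cg (g : R -> 'cV[C]_n) := cut 0 N%:R g.
have Kc g : BMw w g -> K (cg g).
  move=> [mg [M hM]]; apply: (@K_cutb _ _ _ _ _ _ (`|M| * w N%:R)) => // t /andP[t0 tN].
  apply: le_trans (hM t) _; apply: (@le_trans _ _ (`|M| * w t)).
    by apply: ler_wpM2r; [exact: ltW|exact: ler_norm].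
  apply: ler_wpM2l => //; rewrite ler_expR; apply: ler_wpM2l => //; rewrite /s; lra.
pose T g := cut 0 N%:R (fun t => A *m cg g (t - 1) + cnv k (cg g) t + r t).
have Kr : K r by apply: K_conv => //; exact: K_h1.
have w1 t : 0 <= t -> 1 <= w t.
  by move=> t0; rewrite -expR0 ler_expR mulr_ge0 // /s; lra.
have cgw g M t : (forall t, mn (g t) <= M * w t) -> mn (cg g t) <= M * w t.
  by move=> h; exact: le_trans (mn_cut _ _ _ _) (h t).
have wA : expR (- s) * mn A <= 1 / 4.
  rewrite expRN; have h := expR_ge1Dx s; rewrite mulrC ler_pdivrMr ?expR_gt0 //.
  rewrite /s in h *; nra.
have est g M t : K (cg g) -> 0 <= M -> (forall t, mn (g t) <= M * w t) ->
    mn (A *m cg g (t - 1) + cnv k (cg g) t) <= M / 2 * w t.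
  move=> kg M0 hg; have hc t' := cgw _ _ t' hg.
  have e1 : mn (A *m cg g (t - 1)) <= M * (1 / 4) * w t.
    apply: le_trans (mnM _ _) _; apply: le_trans (ler_wpM2l mA (hc _)) _.
    rewrite /w mulrBr mulr1 expRD -mulrA mulrCA; apply: ler_wpM2l => //.
    by rewrite mulrCA mulrC; apply: ler_wpM2r; [exact: expR_ge0|rewrite mulrC].
  have ew : (fun r => mn (k r) * w (t - r)) = (fun r => w t * (mn (k r) * expR (- s * r))).
    by apply/funext => x; rewrite /w mulrBr expRD mulrCA mulNr.
  have e2 : mn (cnv k (cg g) t) <= M * (1 / 4) * w t.
    apply: le_trans (@conv_wbound _ _ _ _ _ _ w M t kK kg _ hc) _.
      by rewrite ew; exact: riZ.
    rewrite ew rIZ // -mulrA; apply: ler_wpM2l => //.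
    by rewrite mulrC; apply: ler_wpM2r => //; exact: ltW.
  apply: le_trans (mnD _ _) _; apply: le_trans (lerD e1 e2) _.
  by rewrite -mulrDl; apply: ler_wpM2r; [exact: ltW|lra].
have TB g : BMw w g -> BMw w (T g).
  move=> Bg; have kg := Kc _ Bg; have [mg [M hM]] := Bg; split.
    have kA := K_mull A (K_shift (-1) kg).
    by have [] := K_cut 0 N%:R (KD (KD kA (K_conv kK kg)) Kr).
  exists (`|M| / 2 + (rI (fun t => mn (k t) ^+ 2) + rI (fun t => mn (h1 t) ^+ 2))) => t.
  rewrite /T /cut; case: ifP => [/andP[t0 _]|_]; last first.
    rewrite mn0; apply: mulr_ge0; last exact: ltW.
    apply: addr_ge0; first by apply: divr_ge0.
    by apply: addr_ge0; apply: rI_ge0 => x; exact: sqr_ge0.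
  apply: le_trans (mnD _ _) _; rewrite mulrDl; apply: lerD.
    apply: est => // t'; apply: le_trans (hM t') _.
    by apply: ler_wpM2r; [exact: ltW|exact: ler_norm].
  apply: le_trans (conv_bound t kK K_h1) _; rewrite ler_peMr ?w1 //.
  by apply: addr_ge0; apply: rI_ge0 => x; exact: sqr_ge0.
have Tc f g M : BMw w f -> BMw w g -> (forall t, mn (f t - g t) <= M * w t) ->
    forall t, mn (T f t - T g t) <= M / 2 * w t.
  move=> Bf Bg h t; have kf := Kc _ Bf; have kg := Kc _ Bg.
  have M0 : 0 <= M.
    have := le_trans (mn_ge0 _) (h 0); by rewrite pmulr_lge0.
  have kfg : K (cg (fun t => f t - g t)).
    apply: K_ext (KB kf kg) => x; rewrite /cg /cut; case: ifP => //; by rewrite subr0.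
  pose U g := A *m cg g (t - 1) + cnv k (cg g) t + r t.
  have TE g' : T g' t = (ind 0 N%:R t)%:C *: U g' by exact: cutE.
  rewrite (TE f) (TE g) -scalerBr mnZr {TE}.
  have i1 : `|ind 0 N%:R t| <= 1 by rewrite /ind; case: (_ <= _ <= _); rewrite ?normr1 ?normr0.
  apply: le_trans (ler_piMl (mn_ge0 _) i1) _.
  rewrite (_ : U f - U g = A *m cg (fun t => f t - g t) (t - 1) + cnv k (cg (fun t => f t - g t)) t); first exact: est.
  rewrite /U; have -> : cg (fun t => f t - g t) = (fun x => cg f x - cg g x).
    by apply/funext => x; rewrite /cg /cut; case: ifP => //; rewrite subr0.
  rewrite (convDr _ kK kf (KN kg)) (convNr _ kK kg) mulmxBr.
  move: (A *m _) (A *m _) (cnv _ _ _) (cnv _ _ _) (r t) => a1 a2 c1 c2 q.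
  by rewrite opprD addrACA subrr addr0 opprD addrACA.
have [g [Bg gT]] := contraction_fixpoint TB Tc.
have eg t : g t = cg g t.
  by rewrite /cg /cut; case: ifP => // h; rewrite gT /T /cut h.
have Eg : cg g = g by apply/funext => t; rewrite -eg.
have Kg : K g by rewrite -Eg; exact: Kc.
exists g; split=> // [t t0|t ht].
  by rewrite eg /cg /cut; case: ifP => // /andP[h _]; move: t0; rewrite ltNge h.
by rewrite gT /T /cut ht Eg.
Qed.

Lemma exists_density : exists h : R -> 'cV[C]_n,
  [/\ K h, (forall t, t < 0 -> h t = 0) &
   forall t, t <= N%:R -> h t = A *m h (t - 1) + cnv k h t + kap t].
Proof.
have [g [Kg gneg ge]] := exists_density_bounded_part.
exists (fun t => h1 t + g t); split.
- exact: KD K_h1 Kg.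
- by move=> t t0; rewrite h1_neg // gneg // addr0.
move=> t tN; rewrite (convDr t kK K_h1 Kg) mulmxDr.
have [t0|t0] := ltP t 0.
  have -> : cnv k g t = 0 by apply: conv_causal kneg gneg _; lra.
  have -> : cnv k h1 t = 0 by apply: conv_causal kneg h1_neg _; lra.
  by rewrite kap_neg // !h1_neg ?gneg ?mulmx0 ?addr0 //; lra.
rewrite ge ?t0 // {1}h1_eq // -/(r t).
move: (A *m _) (kap t) (A *m _) (cnv _ _ _) (r t) => a1 a2 a3 a4 a5.
by rewrite -!addrA; congr (_ + _); rewrite addrC -!addrA; congr (_ + _); rewrite addrCA.
Qed.

End Fundamental.

(* [s2] and [s3] are [A2] and [A3] reflected to [[0, 1]], [sN] is a time horizon, and [sh]
   is the density of the absolutely continuous part of the fundamental solution. *)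
Record sys (R : realType) (n : nat) := Sys {
  sA : 'M[R[i]]_n; sb : 'cV[R[i]]_n;
  s2 : R -> 'M[R[i]]_n; s3 : R -> 'M[R[i]]_n; sN : nat; sh : R -> 'cV[R[i]]_n;
  s2K : K s2; s3K : K s3;
  s2_supp : forall t, ~~ (0 <= t <= 1) -> s2 t = 0;
  s3_supp : forall t, ~~ (0 <= t <= 1) -> s3 t = 0;
  shK : K sh; sh_neg : forall t, t < 0 -> sh t = 0;
  sh_eq : forall t, t <= sN%:R -> sh t = sA *m sh (t - 1) +
    cnv (fun s => s2 s + cnv (Hv sN.+1%:R n) s3 s) sh t +
    kap sA sb (fun s => s2 s + cnv (Hv sN.+1%:R n) s3 s) sN t }.

Section MakeSys.
Context (R : realType) (n : nat).
Lemma exists_sys (A : 'M[R[i]]_n) (b : 'cV[R[i]]_n) (a2 a3 : R -> 'M[R[i]]_n) (N : nat) :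
  K a2 -> K a3 -> (forall t, ~~ (0 <= t <= 1) -> a2 t = 0) ->
  (forall t, ~~ (0 <= t <= 1) -> a3 t = 0) ->
  exists D : sys R n, [/\ sA D = A, sb D = b, s2 D = a2, s3 D = a3 & sN D = N].
Proof.
move=> k2 k3 h2 h3; pose k t := a2 t + cnv (Hv N.+1%:R n) a3 t.
have N0 : (0 : R) <= N.+1%:R by [].
have kH : K (Hv (N.+1%:R : R) n) by exact: K_Hv.
have kk : K k by apply: KD => //; exact: K_conv.
have k0 t : ~~ (0 <= t <= N.+1%:R + 1) -> k t = 0.
  move=> ht; rewrite /k h2 ?add0r; last first.
    by apply: contra ht => /andP[x y]; apply/andP; split => //; lra.
  rewrite convE -[RHS](@mI0 R n n); apply: mI_ext => r.
  case: (boolP (0 <= r <= 1)) => hr; last by rewrite h3 // mulmx0.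
  rewrite /Hv /cut; case: ifP; rewrite ?mul0mx // => /andP[x y].
  by case/negP: ht; move/andP: hr => [u v]; apply/andP; split; lra.
have N1 : (0 : R) <= N.+1%:R + 1 by lra.
have [h [Kh hneg he]] := exists_density A b N kk N1 k0.
by exists (@Sys R n A b a2 a3 N h k2 k3 h2 h3 Kh hneg he).
Qed.
End MakeSys.

Fact sys_key : unit. Proof. exact: tt. Qed.

(** * The response Z, its primitive, and the convolutions of Z with controls *)

Section SysTheory.
Context (R : realType) (n : nat) (D : sys R n).
Local Notation C := R[i].
Local Notation A := (sA D).
Local Notation b := (sb D).
Local Notation a2 := (s2 D).
Local Notation a3 := (s3 D).
Local Notation N := (sN D).
Local Notation h := (sh D).
Local Notation bj := (bj A b).
Definition sL : R := N.+1%:R.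
Local Notation L := sL.
Local Notation H := (Hv L).

(** Integrating the equation once turns both distributed delays into the convolution with this
    single kernel; see [sk_Z]. *)
Definition sk t : 'M[C]_n := a2 t + cnv (H n) a3 t.
Definition ZJ : R -> 'cV[C]_n :=
  locked_with sys_key (fun t => \sum_(j < N.+1) H n (t - j%:R) *m bj j).
Definition Z : R -> 'cV[C]_n := locked_with sys_key (fun t => ZJ t + cnv (H n) h t).
(** Up to the horizon, the response of the system at rest to the constant control 1. *)
Definition zz : R -> 'cV[C]_n := locked_with sys_key (cnv (H n) Z).
Lemma ZJE : ZJ = (fun t => \sum_(j < N.+1) H n (t - j%:R) *m bj j).
Proof. by rewrite /ZJ locked_withE. Qed.
Lemma ZE : Z = (fun t => ZJ t + cnv (H n) h t).
Proof. by rewrite /Z locked_withE. Qed.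
Lemma zzE : zz = cnv (H n) Z.
Proof. by rewrite /zz locked_withE. Qed.

Lemma sL0 : 0 <= L. Proof. by []. Qed.
Lemma K_H p : K (H p). Proof. exact: K_Hv. Qed.
Lemma a2neg t : t < 0 -> a2 t = 0.
Proof. by move=> t0; apply: s2_supp; apply/negP => /andP[]; lra. Qed.
Lemma a3neg t : t < 0 -> a3 t = 0.
Proof. by move=> t0; apply: s3_supp; apply/negP => /andP[]; lra. Qed.
Lemma K_sk : K sk. Proof. by apply: KD; [exact: s2K|apply: K_conv; [exact: K_H|exact: s3K]]. Qed.
Lemma sk_neg t : t < 0 -> sk t = 0.
Proof.
move=> t0; rewrite /sk a2neg // add0r.
by apply: conv_causal (@Hv0 R L n) a3neg _; rewrite addr0.
Qed.
Lemma sk_supp t : ~~ (0 <= t <= L + 1) -> sk t = 0.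
Proof.
move=> ht; rewrite /sk s2_supp ?add0r; last first.
  by apply: contra ht => /andP[x y]; have h0 := sL0; apply/andP; split => //; lra.
rewrite convE -[RHS](@mI0 R n n); apply: mI_ext => r.
case: (boolP (0 <= r <= 1)) => hr; last by rewrite s3_supp // mulmx0.
rewrite /Hv /cut; case: ifP; rewrite ?mul0mx // => /andP[x y].
by case/negP: ht; move/andP: hr => [u v]; apply/andP; split; lra.
Qed.
Lemma K_ZJ : K ZJ. Proof. by rewrite ZJE; apply: K_sum => j; apply: K_mulr; apply: K_shift; exact: K_H. Qed.
Lemma K_Z : K Z. Proof. by rewrite ZE; apply: KD; [exact: K_ZJ|apply: K_conv; [exact: K_H|exact: shK]]. Qed.
Lemma ZJ_neg t : t < 0 -> ZJ t = 0.
Proof.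
move=> t0; rewrite ZJE big1 // => j _; rewrite Hv0 ?mul0mx //.
by have : (0 : R) <= j%:R by []; lra.
Qed.
Lemma Z_neg t : t < 0 -> Z t = 0.
Proof.
move=> t0; rewrite ZE ZJ_neg // add0r.
by apply: conv_causal (@Hv0 R L n) (@sh_neg _ _ D) _; rewrite addr0.
Qed.
Lemma K_zz : K zz. Proof. by rewrite zzE; apply: K_conv; [exact: K_H|exact: K_Z]. Qed.
Lemma ZJ_eq t : t <= N%:R -> ZJ t = A *m ZJ (t - 1) + H n t *m b.
Proof.
move=> tN; rewrite ZJE big_ord_recl [_ *m bj ord0](_ : _ = H n t *m b); last by rewrite subr0.
rewrite addrC; congr (_ + _).
rewrite mulmx_sumr [RHS]big_ord_recr [X in _ = _ + X](_ : _ = 0) ?addr0; last first.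
  by rewrite Hv0 ?mul0mx ?mulmx0 //=; lra.
apply: eq_bigr => i _; rewrite !lift0 bjS mulmxA Hv_mulC -natr1 -mulmxA; congr (_ *m (Hv _ _ _ *m _)).
by rewrite /=; lra.
Qed.

Lemma cnv_kap t : cnv (H n) (kap A b sk N) t = cnv sk ZJ t.
Proof.
have Ks := K_sk; have KH := K_H n.
rewrite ZJE (conv_sumr _ _ Ks); last by move=> j; apply: K_mulr; apply: K_shift; exact: K_H.
rewrite /kap (conv_sumr _ _ KH); last by move=> j; apply: K_mulr; exact: K_shift.
apply: eq_bigr => j _.
transitivity (cnv (H n) sk (t - j%:R) *m bj j).
  by rewrite -(conv_shiftr _ _ KH Ks) -(conv_mulr _ _ KH (K_shift _ Ks)) convE.
rewrite (conv_HvC _ _ Ks).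
by rewrite -(conv_shiftr _ _ Ks KH) -(conv_mulr _ _ Ks (K_shift _ KH)) convE.
Qed.
Lemma skZ_cum t : cnv sk Z t = cnv (H n) (kap A b sk N) t + cnv sk (cnv (H n) h) t.
Proof. by rewrite cnv_kap ZE; exact: (convDr _ K_sk K_ZJ (K_conv (K_H n) (shK D))). Qed.

(** The integrated neutral equation. Its absolutely continuous part is [sh_eq] convolved with the
    Heaviside function, its jumps obey [ZJ_eq], and [cnv_kap] identifies the forcing by the jumps
    with [cnv sk ZJ]. *)
Lemma Z_eq t : t <= N%:R -> Z t = A *m Z (t - 1) + H n t *m b + cnv sk Z t.
Proof.
move=> tN.
have e1 : cnv (H n) h t = cnv (H n) (fun s => A *m h (s - 1) + cnv sk h s + kap A b sk N s) t.
  apply: (@conv_local_r _ _ _ _ _ _ _ 0) => [s|r rt]; first exact: Hv0.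
  by apply: sh_eq; lra.
have Ks := K_sk; have Kh := shK D; have KH := K_H n.
have Kkap : K (kap A b sk N) by exact: K_kap.
have KA : K (fun s => A *m h (s - 1)) by apply: K_mull; exact: K_shift.
have Kc := K_conv Ks Kh; have KHh := K_conv KH Kh.
rewrite (convDr _ KH (KD KA Kc) Kkap) (convDr _ KH KA Kc) in e1.
rewrite (conv_Hv_mull _ _ _ (K_shift (-1) Kh)) (conv_shiftr _ _ KH Kh) in e1.
rewrite (conv_Hv_conv _ _ Ks Kh) in e1.
have EZ s : Z s = ZJ s + cnv (H n) h s by rewrite ZE.
rewrite skZ_cum (EZ t) (EZ (t - 1)) (ZJ_eq tN) e1 mulmxDr.
have zid (p q r s u : 'cV[C]_n) : (p + q) + (r + s + u) = (p + r) + q + (u + s).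
  by rewrite -[r + s + u]addrA addrACA [s + u]addrC addrA.
exact: zid.
Qed.

Lemma cnv_sk (m : nat) (f : R -> 'M[C]_(n, m)) t : K f ->
  cnv sk f t = cnv a2 f t + cnv (cnv (H n) a3) f t.
Proof. by move=> Kf; exact: (convDl _ (s2K D) (K_conv (K_H n) (s3K D)) Kf). Qed.
Lemma cnv_Z m (U : R -> 'M[C]_(1, m)) t : K U -> cnv Z U t = cnv ZJ U t + cnv (cnv (H n) h) U t.
Proof. by move=> KU; rewrite ZE; exact: (convDl _ K_ZJ (K_conv (K_H n) (shK D)) KU). Qed.
Lemma sk_Z t : cnv sk Z t = cnv a2 Z t + cnv a3 zz t.
Proof.
have K2 := s2K D; have K3 := s3K D; have KH := K_H n.
have e3 : cnv (H n) a3 = cnv a3 (H n) by apply/funext => s; exact: conv_HvC.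
by rewrite (cnv_sk _ K_Z) e3 -(convA _ K3 KH K_Z) zzE.
Qed.

(* The derivative of [cnv Z U], see [zeta_diff]. *)
Definition rho (U : R -> 'M[C]_1) : R -> 'cV[C]_n := locked_with sys_key
  (fun t => \sum_(j < N.+1) bj j *m U (t - j%:R) + cnv h U t).
Lemma rhoE U : rho U = (fun t => \sum_(j < N.+1) bj j *m U (t - j%:R) + cnv h U t).
Proof. by rewrite /rho locked_withE. Qed.

Lemma K_rho U : K U -> K (rho U).
Proof.
move=> KU; rewrite rhoE; apply: KD; last by apply: K_conv => //; exact: shK.
by apply: K_sum => j; apply: K_mull; exact: K_shift.
Qed.
Lemma rho_neg U c : (forall t, t < c -> U t = 0) -> forall t, t < c -> rho U t = 0.
Proof.
move=> U0 t tc; rewrite rhoE big1 ?add0r; last first.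
  move=> j _; rewrite U0 ?mulmx0 //; have : (0 : R) <= j%:R by []; lra.
by apply: conv_causal (@sh_neg _ _ D) U0 _; rewrite add0r.
Qed.
(** [Z] is the Heaviside function convolved with the point masses [bj j] and with [h]; [rho]
    convolves the control with the latter two. *)
Lemma zeta_rho U t : K U -> cnv Z U t = cnv (H n) (rho U) t.
Proof.
move=> KU; have KH := K_H n; have Kh := shK D.
have Ks (j : 'I_N.+1) : K (fun r => bj j *m U (r - j%:R)) by apply: K_mull; exact: K_shift.
have e1 : cnv (H n) (rho U) t =
    cnv (H n) (fun s => \sum_(j < N.+1) bj j *m U (s - j%:R)) t + cnv (H n) (cnv h U) t.
  by rewrite rhoE; exact: (convDr _ KH (K_sum _ Ks) (K_conv Kh KU)).
have e2 := cnv_Z t KU.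
have Kj (j : 'I_N.+1) : K (fun s => H n (s - j%:R) *m bj j).
  by apply: K_mulr; exact: K_shift.
have e3 : cnv ZJ U t = \sum_(j < N.+1) cnv (fun s => H n (s - j%:R) *m bj j) U t.
  by rewrite ZJE; exact: (conv_suml _ _ Kj KU).
rewrite e1 e2 e3 (convA _ KH Kh KU) (conv_sumr _ _ KH Ks).
have -> // : \sum_(j < N.+1) cnv (fun s => H n (s - j%:R) *m bj j) U t =
  \sum_(j < N.+1) cnv (H n) (fun r => bj j *m U (r - j%:R)) t.
apply: eq_bigr => j _; rewrite (conv_shiftr j%:R t KH (K_mull (bj j) KU)) !convE.
by apply: mI_ext => r; rewrite -mulmxA addrAC.
Qed.
(** The Heaviside window of length [N + 1] reaches back from [t <= 1] to [- N], where the control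
    starts. *)
Lemma zeta_diff U s t : K U -> (forall r, r < - N%:R -> U r = 0) -> s <= t -> t <= 1 ->
  cnv Z U t - cnv Z U s = mI (cut s t (rho U)).
Proof.
move=> KU U0 st t1; rewrite !zeta_rho //.
apply: (@Hv_diff _ _ _ _ _ (- N%:R)) => //; first exact: K_rho.
  exact: rho_neg.
by rewrite /L -natr1; lra.
Qed.
Lemma zz_conv_diff (V : R -> 'M[C]_1) s t : K V -> (forall r, r < - N%:R -> V r = 0) -> s <= t -> t <= 1 ->
  cnv zz V t - cnv zz V s = mI (cut s t (cnv Z V)).
Proof.
move=> KV V0 st t1; rewrite zzE -!(convA _ (K_H n) K_Z KV).
apply: (@Hv_diff _ _ _ _ _ (- N%:R)) => //; first exact: K_conv K_Z KV.
  by move=> r rc; apply: conv_causal Z_neg V0 _; rewrite add0r.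
by rewrite /L -natr1; lra.
Qed.
Lemma zz_diff s t : s <= t -> t <= L -> zz t - zz s = mI (cut s t Z).
Proof.
move=> st tL; rewrite zzE; apply: (@Hv_diff _ _ _ _ _ 0) => //; first exact: K_Z.
  exact: Z_neg.
lra.
Qed.
Lemma zeta_tail (V : R -> 'M[C]_1) t : K V -> cnv Z (cnv (H 1) V) t = cnv zz V t.
Proof.
move=> KV; rewrite (convA _ K_Z (K_H 1) KV) zzE.
by have -> : cnv Z (H 1) = cnv (H n) Z by apply/funext => s; rewrite (conv_HvC _ _ K_Z).
Qed.

End SysTheory.

(** * The state space *)

Section L2Bridge.
Context (R : realType).
Local Notation C := R[i].
Local Notation mu := (@lebesgue_measure R).

Lemma cutRe m n a b (f : R -> 'M[C]_(m, n)) i j :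
  (fun t => complex.Re (cut a b f t i j)) = (fun t => ind a b t * complex.Re (f t i j)).
Proof. by apply/funext => t; rewrite cutE mxE cReZr. Qed.
Lemma cutIm m n a b (f : R -> 'M[C]_(m, n)) i j :
  (fun t => complex.Im (cut a b f t i j)) = (fun t => ind a b t * complex.Im (f t i j)).
Proof. by apply/funext => t; rewrite cutE mxE cImZr. Qed.

Lemma cint_itv a b (f : R -> C) : cint `[a, b]%classic f = cI (fun t => (ind a b t)%:C * f t).
Proof.
rewrite /cint /cI -!rI_onE; congr (_ +i* _); apply: rI_ext => t.
  by rewrite cReZr.
by rewrite cImZr.
Qed.
Lemma cut_cint m n a b (f : R -> 'M[C]_(m, n)) i j :
  mI (cut a b f) i j = cint `[a, b]%classic (fun t => f t i j).
Proof. by rewrite mIE cint_itv; apply: cI_ext => t; rewrite cutE mxE. Qed.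
Lemma vintE n a b (f : R -> 'cV[C]_n) : vint `[a, b]%classic f = mI (cut a b f).
Proof. by apply/matrixP => i j; rewrite mxE (ord1 j) cut_cint. Qed.
Lemma mintE n a b (f : R -> 'M[C]_n) : mint `[a, b]%classic f = mI (cut a b f).
Proof. by apply/matrixP => i j; rewrite mxE cut_cint. Qed.

Lemma cabs2_ge0 (z : C) : 0 <= cabs2 z.
Proof. by rewrite /cabs2 addr_ge0 ?sqr_ge0. Qed.
Lemma n1_cabs2 (z : C) : n1 z ^+ 2 <= 2 * cabs2 z.
Proof.
rewrite /cabs2 /n1 -(real_normK (num_real (complex.Re z))) -(real_normK (num_real (complex.Im z))).
exact: sqr_le_sum (addr_ge0 _ _) (lexx _).
Qed.
Lemma cabs2_n1 (z : C) : cabs2 z <= n1 z ^+ 2.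
Proof.
rewrite /cabs2 /n1 -(real_normK (num_real (complex.Re z))) -(real_normK (num_real (complex.Im z))).
have := normr_ge0 (complex.Re z); have := normr_ge0 (complex.Im z).
move: (`|_|) (`|_|) => x y x0 y0; nra.
Qed.
Lemma measurable_ind a b (f : R -> R) :
  measurable_fun (`[a, b]%classic : set R) f <-> measurable_fun setT (fun t => ind a b t * f t).
Proof.
have mi : measurable (`[a, b]%classic : set R) by exact: measurable_itv.
by rewrite ind_patch; exact: (@measurable_restrictT _ _ _ _ _ f mi).
Qed.

Lemma K_entries m n (f : R -> 'M[C]_(m, n)) :
  (forall i j, K (fun t => (f t i j)%:M : 'M[C]_1)) -> K f.
Proof.
move=> hf.
have -> : f = (fun t => \sum_i \sum_j f t i j *: delta_mx i j).
  by apply/funext => t; rewrite {1}(matrix_sum_delta (f t)).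
apply: K_sum => i; apply: K_sum => j; have [mf _ _] := hf i j.
apply: (@K_dom _ _ _ _ _ _ _ (mn (delta_mx i j : 'M[C]_(m, n))) (hf i j)).
  move=> k l; have [m1 m2] := mf 0 0; split.
    apply: (@eq_measurable_fun _ _ _ _ _ (fun t => ((k == i) && (l == j))%:R *
       complex.Re ((f t i j)%:M 0 0 : C))).
      move=> t _; rewrite !mxE eqxx mulr1n; case: (_ && _); by rewrite ?mulr1 ?mulr0 ?mul1r ?mul0r.
    exact: (measurable_funM (measurable_cst _) m1).
  apply: (@eq_measurable_fun _ _ _ _ _ (fun t => ((k == i) && (l == j))%:R *
     complex.Im ((f t i j)%:M 0 0 : C))).
    move=> t _; rewrite !mxE eqxx mulr1n; case: (_ && _); by rewrite ?mulr1 ?mulr0 ?mul1r ?mul0r.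
  exact: (measurable_funM (measurable_cst _) m2).
move=> t; rewrite mn11 mxE eqxx mulr1n mulrC; exact: mnZ.
Qed.

Lemma cL2_K a b (g : R -> C) : cL2 `[a, b]%classic g <-> K (cut a b (fun t => (g t)%:M : 'M[C]_1)).
Proof.
have e00 t : cut a b (fun t => (g t)%:M : 'M[C]_1) t 0 0 = (ind a b t)%:C * g t.
  by rewrite cutE !mxE eqxx mulr1n.
have nE t : mn (cut a b (fun t => (g t)%:M : 'M[C]_1) t) = ind a b t * n1 (g t).
  rewrite mn11 e00 /n1 cReZr cImZr !normrM mulrDr.
  by rewrite /ind; case: (_ <= _ <= _); rewrite ?normr1 ?normr0.
have i2 t : ind a b t ^+ 2 = ind a b t by rewrite /ind; case: (_ <= _ <= _); rewrite ?expr1n ?expr0n.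
have i0 t : 0 <= ind a b t by rewrite /ind ler0n.
split=> [[m1 m2 i]|[mc h1 h2]].
  have mc : Mm (cut a b (fun t => (g t)%:M : 'M[C]_1)).
    move=> i' j; rewrite (ord1 i') (ord1 j) cutRe cutIm; split; apply/measurable_ind.
      by apply: eq_measurable_fun m1 => t _; rewrite mxE eqxx mulr1n.
    by apply: eq_measurable_fun m2 => t _; rewrite mxE eqxx mulr1n.
  have i' : ri (fun t => ind a b t * cabs2 (g t)) by apply/ri_onP.
  split=> //.
    (* On a bounded interval square integrable functions are integrable, as [x <= 1 + x ^+ 2]. *)
    apply: ri_le (riD (ri_indic a b) (riZ 2 i')) => [|t]; first exact: Mm_mn.
    rewrite ger0_norm ?mn_ge0 // nE (_ : _ + _ = ind a b t * (1 + 2 * cabs2 (g t))); last by ring.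
    apply: ler_wpM2l => //.
    by have := n1_cabs2 (g t); have := sqr_ge0 (n1 (g t) - 1); nra.
  apply: ri_le (riZ 2 i') => [|t]; first by apply: measurable_funX; exact: Mm_mn.
  rewrite ger0_norm ?sqr_ge0 // nE exprMn i2 [leRHS](_ : _ = ind a b t * (2 * cabs2 (g t))); last by ring.
  by apply: ler_wpM2l => //; exact: n1_cabs2.
have [m1 m2] := mc 0 0; rewrite cutRe in m1; rewrite cutIm in m2.
move/measurable_ind in m1; move/measurable_ind in m2.
have m1' : measurable_fun (`[a, b]%classic : set R) (fun t => complex.Re (g t)).
  by apply: eq_measurable_fun m1 => t _; rewrite mxE eqxx mulr1n.
have m2' : measurable_fun (`[a, b]%classic : set R) (fun t => complex.Im (g t)).
  by apply: eq_measurable_fun m2 => t _; rewrite mxE eqxx mulr1n.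
split => //; apply/(@ri_onP _ a b (fun t => cabs2 (g t))); apply: ri_le h2.
  apply/measurable_ind; apply: measurable_funD; exact: measurable_funX.
move=> t; rewrite ger0_norm ?mulr_ge0 ?cabs2_ge0 // nE exprMn i2 ler_wpM2l //.
exact: cabs2_n1.
Qed.

Lemma mxL2_K m n a b (f : R -> 'M[C]_(m, n)) :
  (forall i j, cL2 `[a, b]%classic (fun t => f t i j)) <-> K (cut a b f).
Proof.
split=> [h|kf i j].
  apply: K_entries => i j; have /cL2_K := h i j; apply: K_ext => t.
  by rewrite !cutE mxE scale_scalar_mx.
apply/cL2_K; apply: (@K_dom _ _ _ _ _ (cut a b f) _ 1) => //.
  have [mc _ _] := kf; have [m1 m2] := mc i j; rewrite cutRe in m1; rewrite cutIm in m2.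
  move=> i' j'; rewrite (ord1 i') (ord1 j') cutRe cutIm; split.
    by apply: eq_measurable_fun m1 => t _; rewrite mxE eqxx mulr1n.
  by apply: eq_measurable_fun m2 => t _; rewrite mxE eqxx mulr1n.
move=> t; rewrite mul1r !cutE mn11 !mxE eqxx mulr1n.
by have := mn_entry ((ind a b t)%:C *: f t) i j; rewrite mxE.
Qed.

Lemma vL2_K n a b (f : R -> 'cV[C]_n) : vL2 `[a, b]%classic f <-> K (cut a b f).
Proof.
split=> [h|/mxL2_K h i]; last exact: h.
by apply/mxL2_K => i j; rewrite (ord1 j); exact: h.
Qed.
Lemma mL2_K n a b (f : R -> 'M[C]_n) : mL2 `[a, b]%classic f <-> K (cut a b f).
Proof. exact: mxL2_K. Qed.
Lemma inM2_K n (x : M2 R n) : inM2 x <-> K (cut (-1) 0 x.2).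
Proof. exact: vL2_K. Qed.

Lemma eqM2_refl n (x : M2 R n) : eqM2 x x. Proof. by split=> //; exact: aeW. Qed.
Lemma eqM2_sym n (x y : M2 R n) : eqM2 x y -> eqM2 y x.
Proof. by move=> [a c]; split=> //; apply: aeS c _ => t h ht; rewrite h. Qed.
Lemma eqM2_trans n (y x w : M2 R n) : eqM2 x y -> eqM2 y w -> eqM2 x w.
Proof.
move=> [a c] [d e]; split; first by rewrite a.
by apply: aeS (aeI c e) _ => t [h1 h2] ht; rewrite h1 // h2.
Qed.
Lemma eqM2_add n (x y x' y' : M2 R n) : eqM2 x x' -> eqM2 y y' -> eqM2 (addM2 x y) (addM2 x' y').
Proof.
move=> [a c] [d e]; split; first by rewrite /= a d.
by apply: aeS (aeI c e) _ => t [h1 h2] ht /=; rewrite h1 // h2.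
Qed.
Lemma eqM2_scale n a (x x' : M2 R n) : eqM2 x x' -> eqM2 (scaleM2 a x) (scaleM2 a x').
Proof.
move=> [c d]; split; first by rewrite /= c.
by apply: aeS d _ => t h ht /=; rewrite h.
Qed.
Lemma eqM2_sub n (x y x' y' : M2 R n) : eqM2 x x' -> eqM2 y y' -> eqM2 (subM2 x y) (subM2 x' y').
Proof. by move=> a c; apply: eqM2_add => //; exact: eqM2_scale. Qed.

Lemma cut_ae n (x y : M2 R n) : eqM2 x y -> {ae mu, forall t, cut (-1) 0 x.2 t = cut (-1) 0 y.2 t}.
Proof.
move=> [_ h]; apply: aeS h _ => t ht; rewrite /cut; case: ifP => // tt; apply: ht.
Qed.
Lemma inM2_add n (x y : M2 R n) : inM2 x -> inM2 y -> inM2 (addM2 x y).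
Proof.
move=> /inM2_K a /inM2_K c; apply/inM2_K; apply: K_ext (KD a c) => t.
by rewrite /cut /=; case: ifP; rewrite ?addr0.
Qed.
Lemma inM2_scale n a (x : M2 R n) : inM2 x -> inM2 (scaleM2 a x).
Proof.
move=> /inM2_K c; apply/inM2_K; apply: K_ext (KZ a c) => t.
by rewrite /cut /=; case: ifP; rewrite ?scaler0.
Qed.
Lemma inM2_sub n (x y : M2 R n) : inM2 x -> inM2 y -> inM2 (subM2 x y).
Proof. by move=> a c; apply: inM2_add => //; exact: inM2_scale. Qed.
Lemma K_inM2 n (c : 'cV[C]_n) (f : R -> 'cV[C]_n) : K f -> inM2 (c, f).
Proof. by move=> kf; apply/inM2_K; exact: K_cut. Qed.

End L2Bridge.

(** * Norm and inner product of the state space *)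

Section M2Norm.
Context (R : realType) (n : nat).
Local Notation C := R[i].
Local Notation mu := (@lebesgue_measure R).
Local Notation M2 := (M2 R n).
Implicit Types (v : 'cV[C]_n) (x y phi : M2).

Definition q2 v : R := \sum_i cabs2 (v i 0).

Lemma q2_ge0 v : 0 <= q2 v. Proof. by apply: sumr_ge0 => i _; exact: cabs2_ge0. Qed.
Lemma q2_0 : q2 0 = 0.
Proof. by rewrite /q2 big1 // => i _; rewrite mxE /cabs2 /= expr0n addr0. Qed.
(** Young's inequality with a free parameter replaces the triangle inequality, norms being squared
    throughout. *)
Lemma q2_add (e : R) v w : 0 < e -> q2 (v + w) <= (1 + e) * q2 v + (1 + e^-1) * q2 w.
Proof.
move=> e0; rewrite /q2 !mulr_sumr -big_split /=; apply: ler_sum => i _; rewrite mxE.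
have key (a b : R) : (a + b) ^+ 2 <= (1 + e) * a ^+ 2 + (1 + e^-1) * b ^+ 2.
  rewrite -subr_ge0 (_ : _ - _ = e^-1 * (e * a - b) ^+ 2).
    by rewrite mulr_ge0 ?sqr_ge0 // invr_ge0 ltW.
  by field; rewrite gt_eqF.
case: (v i 0) (w i 0) => a b [c d]; rewrite /cabs2 /=.
have := key a c; have := key b d; lra.
Qed.
Lemma q2_scale a v : q2 (a *: v) = cabs2 a * q2 v.
Proof.
rewrite /q2 mulr_sumr; apply: eq_bigr => i _; rewrite mxE.
by case: a (v i 0) => a b [c d]; rewrite /cabs2 /=; ring.
Qed.
Lemma q2_mn v : q2 v <= mn v ^+ 2.
Proof.
have e : mn v = \sum_i n1 (v i 0) by apply: eq_bigr => i _; rewrite big_ord1.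
rewrite e; have : 0 <= \sum_i n1 (v i 0) /\ q2 v <= (\sum_i n1 (v i 0)) ^+ 2; last by case.
rewrite /q2; elim/big_ind2 : _ => [|x1 x2 y1 y2 [a b] [c d]|i _].
- by rewrite expr0n.
- split; [exact: addr_ge0|nra].
- by split; [exact: n1_ge0|exact: cabs2_n1].
Qed.
Lemma q2_eq0 v : q2 v <= 0 -> v = 0.
Proof.
move=> h; apply/matrixP => i j; rewrite (ord1 j) mxE.
have : cabs2 (v i 0) <= 0.
  apply: le_trans h; rewrite /q2 (bigD1 i) //= lerDl.
  by apply: sumr_ge0 => k _; exact: cabs2_ge0.
case: (v i 0) => a b; rewrite /cabs2 /= => h'.
have [ha hb] : a = 0 /\ b = 0 by split; nra.
by rewrite ha hb.
Qed.

Lemma q2_cut (f : R -> 'cV[C]_n) t : q2 (cut (-1) 0 f t) = ind (-1) 0 t * q2 (f t).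
Proof. by rewrite /cut /ind; case: (_ <= _ <= _); rewrite ?mul1r ?mul0r // q2_0. Qed.
Lemma ri_q2 (f : R -> 'cV[C]_n) : K f -> ri (fun t => q2 (f t)).
Proof.
move=> [mf _ h]; apply: ri_le h => [|t].
  apply: measurable_sum => i; have [m1 m2] := mf i 0.
  by apply: measurable_funD; exact: measurable_funX.
by rewrite ger0_norm ?q2_ge0 // q2_mn.
Qed.

Lemma nrm2E x : nrm2M2 x = q2 x.1 + rI (fun t => q2 (cut (-1) 0 x.2 t)).
Proof.
rewrite /nrm2M2 /Iint -rI_onE; congr (_ + _).
by apply: rI_ext => t; rewrite q2_cut.
Qed.
Lemma nrm2_ge0 x : 0 <= nrm2M2 x.
Proof. by rewrite nrm2E addr_ge0 ?q2_ge0 //; apply: rI_ge0 => t; exact: q2_ge0. Qed.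

Let cutD (f g : R -> 'cV[C]_n) t :
  cut (-1) 0 (fun t => f t + g t) t = cut (-1) 0 f t + cut (-1) 0 g t.
Proof. by rewrite /cut; case: ifP; rewrite ?addr0. Qed.
Let cutZ a (f : R -> 'cV[C]_n) t : cut (-1) 0 (fun t => a *: f t) t = a *: cut (-1) 0 f t.
Proof. by rewrite /cut; case: ifP; rewrite ?scaler0. Qed.

Lemma nrm2_add (e : R) x y : 0 < e -> inM2 x -> inM2 y ->
  nrm2M2 (addM2 x y) <= (1 + e) * nrm2M2 x + (1 + e^-1) * nrm2M2 y.
Proof.
move=> e0 /inM2_K kx /inM2_K ky; rewrite !nrm2E /=.
have i1 := riZ (1 + e) (ri_q2 kx); have i2 := riZ (1 + e^-1) (ri_q2 ky).
have h2 : rI (fun t => q2 (cut (-1) 0 (fun t => x.2 t + y.2 t) t)) <=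
    (1 + e) * rI (fun t => q2 (cut (-1) 0 x.2 t)) + (1 + e^-1) * rI (fun t => q2 (cut (-1) 0 y.2 t)).
  rewrite -(rIZ _ (ri_q2 kx)) -(rIZ _ (ri_q2 ky)) -rID //; apply: le_rI.
  - by apply: (ri_ext _ (ri_q2 (KD kx ky))) => t; rewrite cutD.
  - exact: riD.
  - by move=> t; rewrite cutD; exact: q2_add.
have h1 := q2_add x.1 y.1 e0; move: h1 h2.
move: (q2 (x.1 + y.1)) (rI (fun t => q2 (cut _ _ (fun _ => _) t))) => p1 p2.
by rewrite !mulrDr; lra.
Qed.
Lemma nrm2_scale a x : inM2 x -> nrm2M2 (scaleM2 a x) = cabs2 a * nrm2M2 x.
Proof.
move=> /inM2_K kx; rewrite !nrm2E /= q2_scale mulrDr; congr (_ + _).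
rewrite -(rIZ _ (ri_q2 kx)); apply: rI_ext => t.
by rewrite cutZ q2_scale.
Qed.
Lemma cabs2_real (r : R) : cabs2 r%:C = r ^+ 2.
Proof. by rewrite /cabs2 /= expr0n addr0. Qed.
Lemma nrm2_sub x y : inM2 x -> inM2 y -> nrm2M2 (subM2 x y) <= 2 * nrm2M2 x + 2 * nrm2M2 y.
Proof.
move=> hx hy; have := nrm2_add ltr01 hx (inM2_scale (-1) hy).
by rewrite nrm2_scale // invr1 (_ : cabs2 (-1) = 1) ?mul1r // /cabs2 /= oppr0 expr0n addr0 sqrrN expr1n.
Qed.
Lemma nrm2_eq x y : inM2 x -> inM2 y -> eqM2 x y -> nrm2M2 x = nrm2M2 y.
Proof.
move=> /inM2_K kx /inM2_K ky e; rewrite !nrm2E; case: (e) => -> _; congr (_ + _).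
have my := ri_meas (ri_q2 ky).
apply: (proj2 (rI_ae (ri_q2 kx) my _)).
by apply: aeS (cut_ae e) _ => t ->.
Qed.
Lemma nrm2_eq0 x : inM2 x -> nrm2M2 x <= 0 -> eqM2 x (0, fun=> 0).
Proof.
move=> /inM2_K kx; rewrite nrm2E => h.
have h1 := q2_ge0 x.1.
have h2 : 0 <= rI (fun t => q2 (cut (-1) 0 x.2 t)) by apply: rI_ge0 => t; exact: q2_ge0.
split; first by apply: q2_eq0; lra.
have := rI_eq0_ae (ri_q2 kx) (fun t => q2_ge0 _) _.
move=> /(_ ltac:(lra)) ae0; apply: aeS ae0 _ => t ht It /=.
have : cut (-1) 0 x.2 t = 0 by apply: q2_eq0; rewrite ht.
by rewrite /cut; move: It; rewrite /Iint /= in_itv /= => ->.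
Qed.

Definition adj m (M : 'M[C]_(m, 1)) : 'M[C]_(1, m) := (map_mx (fun z : C => z^*%C) M)^T.
Lemma mn_adj m (M : 'M[C]_(m, 1)) : mn (adj M) = mn M.
Proof. by rewrite /adj mn_tr mn_map_conj. Qed.
Lemma K_adj (f : R -> 'cV[C]_n) : K f -> K (fun t => adj (f t)).
Proof.
move=> kf; apply: (@K_dom _ _ _ _ _ f _ 1) => // [i j|t]; last by rewrite mul1r mn_adj.
have [mf _ _] := kf; have [m1 m2] := mf j 0; rewrite (ord1 i); split.
  by apply: eq_measurable_fun m1 => t _; rewrite !mxE; case: (f t j 0).
apply: (@eq_measurable_fun _ _ _ _ _ (fun t => - complex.Im (f t j 0))).
  by move=> t _; rewrite !mxE; case: (f t j 0).
exact: measurableT_comp.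
Qed.
Lemma adj_mul v (w : 'cV[C]_n) : (adj v *m w) 0 0 = \sum_i w i 0 * (v i 0)^*.
Proof. by rewrite mxE; apply: eq_bigr => i _; rewrite !mxE mulrC. Qed.

Definition ip x phi : 'M[C]_1 := adj phi.1 *m x.1 +
  mI (fun t => adj (cut (-1) 0 phi.2 t) *m cut (-1) 0 x.2 t).

Lemma ipE x phi : ipM2 x phi = ip x phi 0 0.
Proof.
rewrite /ipM2 /ip mxE adj_mul mIE /Iint cint_itv; congr (_ + _); apply: cI_ext => t.
rewrite adj_mul /cut /ind; case: (_ <= _ <= _); first by rewrite mul1r.
by rewrite mul0r big1 // => i _; rewrite mxE mul0r.
Qed.
Lemma ip_Mi x phi : inM2 x -> inM2 phi ->
  Mi (fun t => adj (cut (-1) 0 phi.2 t) *m cut (-1) 0 x.2 t).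
Proof. by move=> /inM2_K kx /inM2_K kp; apply: K_mulMi => //; exact: K_adj. Qed.
Lemma ip_add a x y phi : inM2 x -> inM2 y -> inM2 phi ->
  ip (addM2 (scaleM2 a x) y) phi = a *: ip x phi + ip y phi.
Proof.
move=> hx hy hp; have i1 := ip_Mi hx hp; have i2 := ip_Mi hy hp.
have e : mI (fun t => adj (cut (-1) 0 phi.2 t) *m cut (-1) 0 (addM2 (scaleM2 a x) y).2 t) =
  a *: mI (fun t => adj (cut (-1) 0 phi.2 t) *m cut (-1) 0 x.2 t) +
  mI (fun t => adj (cut (-1) 0 phi.2 t) *m cut (-1) 0 y.2 t).
  rewrite -mIZ // -mID //; last exact: MiZ.
  by apply: mI_ext => t; rewrite cutD cutZ mulmxDr -scalemxAr.
rewrite /ip e /= mulmxDr -scalemxAr.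
by move: (mI _) (mI _) (_ *m x.1) (_ *m y.1) => p1 p2 p3 p4; rewrite scalerDr addrACA.
Qed.
Lemma ip_sub x y phi : inM2 x -> inM2 y -> inM2 phi -> ip (subM2 x y) phi = ip x phi - ip y phi.
Proof.
move=> hx hy hp; have -> : subM2 x y = addM2 (scaleM2 (-1) y) x.
  by rewrite /subM2 /addM2 /=; congr pair; [exact: addrC|apply/funext => t; exact: addrC].
by rewrite ip_add // scaleN1r addrC.
Qed.
Lemma ip_scale a x phi : inM2 x -> inM2 phi -> ip (scaleM2 a x) phi = a *: ip x phi.
Proof.
move=> hx hp; have -> : scaleM2 a x = addM2 (scaleM2 (a - 1) x) x.
  rewrite /addM2 /scaleM2 /=; congr pair; first by rewrite scalerBl scale1r subrK.
  by apply/funext => t; rewrite scalerBl scale1r subrK.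
by rewrite ip_add // scalerBl scale1r subrK.
Qed.
Lemma ip_eq x y phi : inM2 x -> inM2 y -> inM2 phi -> eqM2 x y -> ip x phi = ip y phi.
Proof.
move=> hx hy hp e; have i1 := ip_Mi hx hp; have i2 := ip_Mi hy hp.
have e2 := proj2 (mI_ae i1 (Mi_Mm i2) (aeS (cut_ae e) (fun t h => congr1 _ h))).
by rewrite /ip e2; case: e => ->.
Qed.
Lemma ip_self x : inM2 x -> complex.Re (ip x x 0 0) = nrm2M2 x.
Proof.
move=> hx; have kx := (inM2_K x).1 hx.
have key v : complex.Re ((adj v *m v) 0 0) = q2 v.
  rewrite adj_mul /q2; elim/big_ind2 : _ => [//|a b c d <- <-|i _].
    by rewrite cReD.
  by case: (v i 0) => a b; rewrite /cabs2 /=; ring.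
rewrite /ip mxE cReD key nrm2E mIE; congr (_ + _).
by rewrite /cI; apply: rI_ext => t; rewrite key.
Qed.
(** The Cauchy-Schwarz inequality for squared norms, again with a parameter: [e] is fixed first to
    absorb [phi], then [x] is made small. *)
Lemma mn_ip (e : R) x phi : 0 < e -> inM2 x -> inM2 phi ->
  mn (ip x phi) <= nrm2M2 x / e + e * nrm2M2 phi.
Proof.
move=> e0 hx hp; have kx := (inM2_K x).1 hx; have kp := (inM2_K phi).1 hp.
have key v (w : 'cV[C]_n) : mn (adj v *m w) <= e^-1 * q2 w + e * q2 v.
  rewrite mn11 adj_mul; apply: le_trans (n1_sum _ _) _.
  rewrite /q2 !mulr_sumr -big_split /=; apply: ler_sum => i _.
  apply: le_trans (n1M _ _) _; rewrite n1_conj.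
  have := n1_cabs2 (w i 0); have := n1_cabs2 (v i 0).
  move: (n1 (v i 0)) (n1 (w i 0)) (cabs2 (v i 0)) (cabs2 (w i 0)) => a b c d h1 h2.
  apply: (@le_trans _ _ (e^-1 * b ^+ 2 / 2 + e * a ^+ 2 / 2)).
    rewrite -subr_ge0 (_ : _ - _ = (2 * e)^-1 * (b - e * a) ^+ 2).
      by rewrite mulr_ge0 ?sqr_ge0 // invr_ge0 mulr_ge0 // ltW.
    by field; rewrite gt_eqF.
  have ei : 0 < e^-1 by rewrite invr_gt0.
  by rewrite -!mulrA; apply: lerD; apply: ler_wpM2l; (exact: ltW || lra).
apply: le_trans (mnD _ _) _; rewrite !nrm2E.
have i1 := ip_Mi hx hp; have j1 := riZ e^-1 (ri_q2 kx); have j2 := riZ e (ri_q2 kp).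
have h2 : mn (mI (fun t => adj (cut (-1) 0 phi.2 t) *m cut (-1) 0 x.2 t)) <=
    e^-1 * rI (fun t => q2 (cut (-1) 0 x.2 t)) + e * rI (fun t => q2 (cut (-1) 0 phi.2 t)).
  rewrite -(rIZ _ (ri_q2 kx)) -(rIZ _ (ri_q2 kp)) -rID //.
  apply: le_trans (mn_mI i1) _; apply: le_rI; [exact: Mi_mn i1|exact: riD|].
  by move=> t; exact: key.
apply: le_trans (lerD (key _ _) h2) _.
by rewrite [_ / e]mulrC !mulrDr addrACA.
Qed.
Lemma ip_faithful x : inM2 x -> (forall phi, inM2 phi -> ip x phi = 0) -> eqM2 x (0, fun=> 0).
Proof.
move=> hx h; apply: nrm2_eq0 => //; by rewrite -ip_self // h // mxE.
Qed.

End M2Norm.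

(** * Functions with vanishing right derivative *)

Section RightDerivative.
Context (R : realType).
Local Notation C := R[i].

(** For a given slope [e], let [c] be the last time up to which the increments from 0 stay below
    [e]. By left continuity [c] itself qualifies, and the right derivative at [c] allows one to pass
    it. Right derivatives are what a semigroup provides. *)
Lemma right_derivative0_constant m n (f : R -> 'M[C]_(m, n)) (L : R) : 0 <= L ->
  (forall s, 0 < s -> s <= L -> forall e, 0 < e -> exists2 d, 0 < d &
     forall s', 0 <= s' -> s - d < s' -> s' <= s -> mn (f s' - f s) <= e) ->
  (forall s, 0 <= s -> s < L -> forall e, 0 < e -> exists2 d, 0 < d &
     forall s', s <= s' -> s' < s + d -> s' <= L -> mn (f s' - f s) <= e * (s' - s)) ->
  f L = f 0.
Proof.
move=> L0 lc rd; apply: subr0_eq; apply: mn_le0; rewrite leNgt; apply/negP => pos.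
(* A slope with [e * L < mn (f L - f 0)]: staying below it up to [L] is contradictory. *)
pose e := mn (f L - f 0) / (2 * (L + 1)).
have L1 : 0 < 2 * (L + 1) by rewrite mulr_gt0 //; lra.
have e0 : 0 < e by rewrite divr_gt0.
pose E := [set s | [/\ 0 <= s, s <= L & forall r, 0 <= r -> r <= s -> mn (f r - f 0) <= e * r]].
have E0 : E 0.
  split=> // r r0 r0'; have -> : r = 0 by apply/eqP; rewrite eq_le r0 r0'.
  by rewrite subrr mn0 mulr0.
have hE : has_sup E by split; [exists 0|exists L => s []].
pose c := sup E.
have c0 : 0 <= c by apply: ub_le_sup => //; case: hE.
have cL : c <= L by apply: ge_sup; [exists 0|move=> s []].
have ltc r : 0 <= r -> r < c -> mn (f r - f 0) <= e * r.
  move=> r0 rc; have [s [s0 sL hs] rs] := sup_adherent (eps := c - r) ltac:(lra) hE.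
  by apply: hs => //; rewrite -/c in rs; lra.
have Ec : E c.
  split=> // r r0; rewrite le_eqVlt => /orP[/eqP ->|]; last exact: ltc.
  have [->|c1] := eqVneq c 0; first by rewrite subrr mn0 mulr0.
  have c2 : 0 < c by rewrite lt_def c1.
  rewrite leNgt; apply/negP => hc; pose e' := (mn (f c - f 0) - e * c) / 2.
  have e'0 : 0 < e' by rewrite divr_gt0 // subr_gt0.
  have [d d0 hd] := lc c c2 cL e' e'0.
  pose s := Num.max (c - d / 2) (c / 2).
  have s1 : 0 <= s by rewrite le_max; apply/orP; right; lra.
  have s2 : c - d < s by rewrite lt_max; apply/orP; left; lra.
  have s3 : s < c by rewrite gt_max; apply/andP; split; lra.
  have h1 := hd s s1 s2 (ltW s3); have h2 := ltc s s1 s3.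
  have h3 : mn (f c - f 0) <= mn (f s - f c) + mn (f s - f 0).
    rewrite (mn_distC (f s) (f c)); apply: le_trans (mnD _ _).
    by rewrite subrKA.
  have h4 : e * s <= e * c by apply: ler_wpM2l; apply: ltW.
  by rewrite /e' in h1; lra.
have [cL'|Lc] := ltP c L; last first.
  have ecL : c = L by apply/eqP; rewrite eq_le cL.
  have [_ _ h] := Ec; have := h L L0; rewrite ecL => /(_ (lexx _)).
  rewrite leNgt => /negP; apply; rewrite /e mulrAC ltr_pdivrMr //; nra.
have [d d0 hd] := rd c c0 cL' e e0.
pose s := Num.min (c + d / 2) L.
have s1 : c < s by rewrite lt_min; apply/andP; split => //; lra.
have s2 : s < c + d by rewrite gt_min; apply/orP; left; lra.
have s3 : s <= L by rewrite ge_min lexx orbT.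
have : E s.
  split=> //; first lra.
  move=> r r0 rs; have [_ _ hc] := Ec; have [rc|cr] := leP r c; first exact: hc.
  have h1 := hd r (ltW cr) ltac:(lra) ltac:(lra); have h2 := hc c c0 (lexx c).
  have h3 : mn (f r - f 0) <= mn (f r - f c) + mn (f c - f 0).
    by apply: le_trans (mnD _ _); rewrite subrKA.
  lra.
move=> /(ub_le_sup (proj2 hE)); rewrite -/c; lra.
Qed.
End RightDerivative.

(** * The semigroup *)

Section Semigroup.
Context (R : realType) (n : nat).
Local Notation C := R[i].
Local Notation M2 := (M2 R n).
Variables (S : R -> M2 -> M2) (Ar : M2 -> M2 -> Prop).
Hypothesis SA : C0_semigroup_generated_by S Ar.

Lemma S_in t x : 0 <= t -> inM2 x -> inM2 (S t x). Proof. exact: (proj1 SA). Qed.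
Lemma S_eq t x w : 0 <= t -> inM2 x -> inM2 w -> eqM2 x w -> eqM2 (S t x) (S t w).
Proof. by case: SA => _ [h _]; exact: h. Qed.
Lemma S_lin t a x w : 0 <= t -> inM2 x -> inM2 w ->
  eqM2 (S t (addM2 (scaleM2 a x) w)) (addM2 (scaleM2 a (S t x)) (S t w)).
Proof. by case: SA => _ [_ [h _]]; exact: h. Qed.
Lemma S_bd t : 0 <= t -> exists M : R, forall x, inM2 x -> nrm2M2 (S t x) <= M * nrm2M2 x.
Proof. by case: SA => _ [_ [_ [h _]]]; exact: h. Qed.
Lemma S_add t s x : 0 <= t -> 0 <= s -> inM2 x -> eqM2 (S (t + s) x) (S t (S s x)).
Proof. by case: SA => _ [_ [_ [_ [_ [h _]]]]]; exact: h. Qed.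

Lemma subM2K (u v : M2) : subM2 u (subM2 u v) = v.
Proof.
rewrite /subM2 /addM2 /scaleM2 /=; case: v => v1 v2 /=; congr pair.
  by rewrite !scaleN1r subKr.
by apply/funext => r; rewrite !scaleN1r subKr.
Qed.
Lemma right_lim (f : R -> R) : (f @ 0^'+ --> (0 : R)) ->
  forall e, 0 < e -> exists2 d, 0 < d & forall h, 0 < h -> h < d -> `|f h| <= e.
Proof.
move=> /cvgrPdist_lt h e e0; have := h e e0; rewrite near_withinE => -[d /= d0 hd].
exists d => // t t0 td; have := hd t; rewrite /ball_ /= sub0r normrN gtr0_norm //.
by move=> /(_ td t0); rewrite sub0r normrN => /ltW.
Qed.
Lemma S_cont0 x e : inM2 x -> 0 < e ->
  exists2 d, 0 < d & forall h, 0 < h -> h < d -> nrm2M2 (subM2 (S h x) x) <= e.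
Proof.
move=> hx e0; have h := (proj1 (proj2 (proj2 (proj2 (proj2 (proj2 (proj2 SA))))))) x hx.
have [d d0 hd] := right_lim h e0; exists d => // t t0 td.
exact: le_trans (ler_norm _) (hd t t0 td).
Qed.
Lemma S_gen x v e : inM2 x -> inM2 v -> Ar x v -> 0 < e ->
  exists2 d, 0 < d & forall h, 0 < h -> h < d ->
    nrm2M2 (subM2 (scaleM2 (h^-1)%:C (subM2 (S h x) x)) v) <= e.
Proof.
move=> hx hv a e0; have h := proj2 ((proj2 (proj2 (proj2 (proj2 (proj2 (proj2 (proj2 SA))))))) x v hx hv) a.
have [d d0 hd] := right_lim h e0; exists d => // t t0 td.
exact: le_trans (ler_norm _) (hd t t0 td).
Qed.

Let sub_lin (x y : M2) : subM2 x y = addM2 (scaleM2 (-1) y) x.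
Proof. by rewrite /subM2 /addM2 /=; congr pair; [exact: addrC|apply/funext => t; exact: addrC]. Qed.
Lemma S_sub t x y : 0 <= t -> inM2 x -> inM2 y -> eqM2 (S t (subM2 x y)) (subM2 (S t x) (S t y)).
Proof. by move=> t0 hx hy; rewrite !sub_lin; exact: S_lin. Qed.

(** Right continuity at [t] uses the bound of the single operator [S t]; left continuity would ask
    for a bound uniform near [t]. *)
Lemma S_right_cont t x e : 0 <= t -> inM2 x -> 0 < e ->
  exists2 d, 0 < d & forall h, 0 < h -> h < d -> nrm2M2 (subM2 (S (t + h) x) (S t x)) <= e.
Proof.
move=> t0 hx e0; have [M hM] := S_bd t0.
have e1 : 0 < e / (`|M| + 1) by rewrite divr_gt0 // ltr_wpDl.
have [d d0 hd] := S_cont0 hx e1; exists d => // h h0 hhd.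
have hS := S_in (ltW h0) hx; have h1 := inM2_sub hS hx.
have hth : 0 <= t + h by lra.
have E : eqM2 (subM2 (S (t + h) x) (S t x)) (S t (subM2 (S h x) x)).
  apply: eqM2_trans (eqM2_sub (S_add t0 (ltW h0) hx) (eqM2_refl _)) _.
  exact: eqM2_sym (S_sub t0 hS hx).
rewrite (nrm2_eq _ _ E); [|by apply: inM2_sub; exact: S_in|exact: S_in].
apply: le_trans (hM _ h1) _; apply: (@le_trans _ _ (`|M| * nrm2M2 (subM2 (S h x) x))).
  by apply: ler_wpM2r; [exact: nrm2_ge0|exact: ler_norm].
have := hd h h0 hhd; rewrite ler_pdivlMr ?ltr_wpDl // => h2.
by have := nrm2_ge0 (subM2 (S h x) x); nra.
Qed.

Definition bd t (M : R) := forall x, inM2 x -> nrm2M2 (S t x) <= M * nrm2M2 x.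

(* A nested interval argument: were [S] unbounded on every subinterval, right continuity
   would produce a point at which the single operator [S t] is unbounded. *)
Lemma S_bounded_somewhere a b : 0 <= a -> a < b ->
  exists c d M, [/\ a <= c, c < d, d <= b & forall t, c <= t -> t <= d -> bd t M].
Proof.
move=> a0 ab; apply: contrapT => nex.
have un c d M : a <= c -> c < d -> d <= b -> exists t x,
    [/\ c <= t, t <= d, inM2 x & M * nrm2M2 x < nrm2M2 (S t x)].
  move=> ac cd db; apply: contrapT => nex'; apply: nex; exists c, d, M; split=> // t ct td x hx.
  by rewrite leNgt; apply/negP => h; apply: nex'; exists t, x.
have shrink (k : nat) (p : R * R) : exists p' : R * R, a <= p.1 -> p.1 < p.2 -> p.2 <= b ->
    [/\ p.1 <= p'.1, p'.1 < p'.2, p'.2 <= p.2 & exists2 x, inM2 x & forall t, p'.1 <= t -> t <= p'.2 ->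
      k%:R * nrm2M2 x < nrm2M2 (S t x)].
  case: p => c d /=; have [h|h] := pselect [/\ a <= c, c < d & d <= b]; last first.
    by exists (c, d) => ac cd db; exfalso; apply: h.
  have [ac cd db] := h.
  (* The factor 2 in front of [k] makes up for the one lost by [nrm2_sub] in passing from [S t] to a
     nearby [S s]. Taking [t] in the left half leaves room to its right. *)
  have [t [x [ct td hx hlt]]] := un c ((c + d) / 2) (2 * k%:R) ac ltac:(lra) ltac:(lra).
  have t0 : 0 <= t by lra.
  pose e := (nrm2M2 (S t x) / 2 - k%:R * nrm2M2 x) / 2.
  have e0 : 0 < e by rewrite divr_gt0 //; lra.
  have [dl dl0 hdl] := S_right_cont t0 hx e0.
  pose d' := t + Num.min (dl / 2) ((d - c) / 4).
  have m0 : 0 < Num.min (dl / 2) ((d - c) / 4) by rewrite lt_min; apply/andP; split; lra.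
  have m1 : Num.min (dl / 2) ((d - c) / 4) <= dl / 2 by rewrite ge_min lexx.
  have m2 : Num.min (dl / 2) ((d - c) / 4) <= (d - c) / 4 by rewrite ge_min lexx orbT.
  exists (t, d') => _ _ _ /=; split => //; rewrite /d'; try lra.
  exists x => // s ts sd.
  have [->|ns] := eqVneq s t; first by have := nrm2_ge0 x; have := ler0n R k; nra.
  have h0 : 0 < s - t by rewrite subr_gt0 lt_def ns.
  have := hdl (s - t) h0 ltac:(lra); rewrite subrKC => hs.
  have i1 : inM2 (S s x) by apply: S_in => //; lra.
  have i2 : inM2 (S t x) by exact: S_in.
  have : nrm2M2 (S t x) <= 2 * nrm2M2 (S s x) + 2 * nrm2M2 (subM2 (S s x) (S t x)).
    by have := nrm2_sub i1 (inM2_sub i1 i2); rewrite subM2K.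
  rewrite /e in hs; lra.
have [F hF] := choice (fun kp : nat * (R * R) => shrink kp.1 kp.2).
pose p := fix p k := if k is k'.+1 then F (k', p k') else (a, b).
have inv k : [/\ a <= (p k).1, (p k).1 < (p k).2 & (p k).2 <= b].
  elim: k => [|k [h1 h2 h3]] //=; have [g1 g2 g3 _] := hF (k, p k) h1 h2 h3.
  by split=> //; [exact: le_trans g1|exact: le_trans h3].
have step k : [/\ (p k).1 <= (p k.+1).1, (p k.+1).2 <= (p k).2 & exists2 x, inM2 x &
    forall t, (p k.+1).1 <= t -> t <= (p k.+1).2 -> k%:R * nrm2M2 x < nrm2M2 (S t x)].
  by have [h1 h2 h3] := inv k; have [g1 g2 g3 g4] := hF (k, p k) h1 h2 h3.
have mono1 i j : (p i).1 <= (p (i + j)%N).1.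
  by elim: j => [|j ih]; rewrite ?addn0 // addnS (le_trans ih) //; case: (step (i + j)%N).
have mono2 i j : (p (i + j)%N).2 <= (p i).2.
  by elim: j => [|j ih]; rewrite ?addn0 // addnS (le_trans _ ih) //; case: (step (i + j)%N).
have cross i j : (p i).1 <= (p j).2.
  apply: le_trans (mono1 i j) _; have [_ h _] := inv (i + j)%N; apply: le_trans (ltW h) _.
  by rewrite addnC; exact: mono2.
pose E := [set x | exists k, x = (p k).1].
have Ene : E !=set0 by exists (p 0%N).1, 0%N.
pose t := sup E.
have t1 k : (p k).1 <= t by apply: ub_le_sup; [exists b => _ [i ->]; have [_ h1 h2] := inv i; lra|exists k].
have t2 k : t <= (p k).2 by apply: ge_sup => // _ [i ->].
have t0 : 0 <= t by apply: le_trans (t1 0%N).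
have [M hM] := S_bd t0.
pose k := Num.bound `|M|.
have hk : `|M| < k%:R by apply: archi_boundP.
have [_ _ [x hx hlt]] := step k.
have := hlt t (t1 _) (t2 _); have := hM x hx; have := nrm2_ge0 x.
have := ler_norm M; nra.
Qed.

(** One interval [[c, d]] with a uniform bound suffices: a time [t] is a multiple of [d - c] plus a
    remainder in [[c, d]], and only finitely many multiples occur up to [T]. The remainder is at
    least [c], which is found below [e], whence [e <= t]. *)
Lemma S_locally_bounded e T : 0 < e -> exists M, 0 <= M /\ forall t, e <= t -> t <= T -> bd t M.
Proof.
move=> e0; have [c [d [M [c0 cd de hM]]]] := S_bounded_somewhere (lexx 0) e0.
pose dl := d - c; have dl0 : 0 < dl by rewrite subr_gt0.
have hk (k : nat) : exists Mk : R, bd (k%:R * dl) Mk.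
  by apply: S_bd; apply: mulr_ge0 => //; exact: ltW.
have [Mk hMk] := choice hk.
pose k0 := Num.bound (`|T| / dl).
have hk0 : `|T| / dl < k0%:R by apply: archi_boundP; rewrite divr_ge0 // ltW.
pose B := \sum_(i < k0.+1) `|Mk i|.
have B0 : 0 <= B by apply: sumr_ge0.
exists (B * `|M|); split; first exact: mulr_ge0.
move=> t et tT x hx; pose k := Num.trunc ((t - c) / dl).
have tc : 0 <= (t - c) / dl by apply: divr_ge0; [lra|exact: ltW].
have /andP[k1 k2] := truncn_itv tc; rewrite -/k in k1 k2.
rewrite ler_pdivlMr // in k1; rewrite ltr_pdivrMr // -natr1 mulrDl mul1r in k2.
have kk : (k < k0.+1)%N.
  rewrite ltnS -(ler_nat R); apply: ltW; apply: le_lt_trans hk0.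
  rewrite ler_pdivlMr //; apply: le_trans k1 _; have := ler_norm T; lra.
pose r := t - k%:R * dl.
have rc : c <= r by rewrite /r; lra.
have rd : r <= d by rewrite /r; move: k2; rewrite {2}/dl; lra.
have r0 : 0 <= r by lra.
have kd0 : 0 <= k%:R * dl by apply: mulr_ge0 => //; exact: ltW.
have -> : t = k%:R * dl + r by rewrite /r subrKC.
have iS := S_in r0 hx.
rewrite (nrm2_eq _ _ (S_add kd0 r0 hx)); [|by apply: S_in => //; lra|exact: S_in].
apply: le_trans (hMk k _ iS) _; rewrite -mulrA.
have hB : Mk k <= B.
  apply: le_trans (ler_norm _) _; rewrite /B (bigD1 (Ordinal kk)) //= lerDl.
  exact: sumr_ge0.
have n0 := nrm2_ge0 (S r x); have n1 := nrm2_ge0 x.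
apply: (@le_trans _ _ (B * nrm2M2 (S r x))); first exact: ler_wpM2r.
apply: ler_wpM2l => //; apply: le_trans (hM r rc rd x hx) _.
by apply: ler_wpM2r => //; exact: ler_norm.
Qed.

End Semigroup.

(** * Classical orbits are orbits of the semigroup *)

Section Orbit.
Context (R : realType) (n : nat).
Local Notation C := R[i].
Local Notation M2 := (M2 R n).
Variables (S : R -> M2 -> M2) (Ar : M2 -> M2 -> Prop).
Hypothesis SA : C0_semigroup_generated_by S Ar.

Variables (W dW : R -> M2) (L : R).
Hypothesis L0 : 0 <= L.
Hypothesis WM : forall s, 0 <= s -> s <= L -> [/\ inM2 (W s), inM2 (dW s) & Ar (W s) (dW s)].
Hypothesis WD : forall s, 0 <= s -> s <= L -> forall e, 0 < e -> exists2 d, 0 < d &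
  forall s', 0 <= s' -> s' <= L -> s' != s -> `|s' - s| < d ->
    nrm2M2 (subM2 (scaleM2 ((s' - s)^-1)%:C (subM2 (W s') (W s))) (dW s)) <= e.

Let Win s : 0 <= s -> s <= L -> inM2 (W s). Proof. by move=> a b; case: (WM a b). Qed.

Lemma W_left_cont s e : 0 <= s -> s <= L -> 0 < e -> exists2 d, 0 < d &
  forall s', 0 <= s' -> s - d < s' -> s' <= s -> nrm2M2 (subM2 (W s') (W s)) <= e.
Proof.
move=> s0 sL e0; have [d d0 hd] := WD s0 sL ltr01; have [h1 h2 _] := WM s0 sL.
have n0 := nrm2_ge0 (dW s).
pose K0 := 2 + 2 * nrm2M2 (dW s).
have K1 : 1 <= K0 by rewrite /K0; lra.
pose d' := Num.min d (Num.min 1 (e / K0)).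
have d'0 : 0 < d' by rewrite !lt_min d0 ltr01 divr_gt0 //; lra.
exists d' => // s' s'0 s's ss.
have [->|ne] := eqVneq s' s.
  have -> : subM2 (W s) (W s) = scaleM2 0 (W s).
    rewrite /subM2 /addM2 /scaleM2 /=; congr pair; first by rewrite scaleN1r scale0r subrr.
    by apply/funext => r; rewrite scaleN1r scale0r subrr.
  rewrite nrm2_scale ?Win // (_ : cabs2 0 = 0) ?mul0r ?ltW //.
  by rewrite /cabs2 /= expr0n addr0.
have dd : `|s' - s| < d'.
  by rewrite ler0_norm; lra.
have [dd1 dd2 dd3] : [/\ `|s' - s| < d, `|s' - s| < 1 & `|s' - s| < e / K0].
  by move: dd; rewrite !lt_min => /and3P[].
have sL' : s' <= L by lra.
have hq := hd s' s'0 sL' ne dd1.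
pose a := ((s' - s)^-1)%:C; pose b := (s' - s)%:C.
have i1 := Win s'0 sL'; have i2 := inM2_sub i1 h1.
have i3 := inM2_scale a i2; have i4 := inM2_sub i3 h2.
have -> : subM2 (W s') (W s) = scaleM2 b (addM2 (subM2 (scaleM2 a (subM2 (W s') (W s))) (dW s)) (dW s)).
  have ab : b * a = 1.
    by rewrite /a /b -rmorphM /= mulfV ?subr_eq0.
  rewrite /subM2 /scaleM2 /addM2 /=; congr pair.
    by rewrite [(-1) *: (dW s).1]scaleN1r subrK scalerA ab scale1r.
  by apply/funext => r; rewrite [(-1) *: (dW s).2 r]scaleN1r subrK scalerA ab scale1r.
rewrite nrm2_scale; last exact: inM2_add.
rewrite /b cabs2_real -real_normK ?num_real //.
have hK : nrm2M2 (addM2 (subM2 (scaleM2 a (subM2 (W s') (W s))) (dW s)) (dW s)) <= K0.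
  by apply: le_trans (nrm2_add ltr01 i4 h2) _; rewrite invr1 /K0; lra.
have x0 := normr_ge0 (s' - s); rewrite ltr_pdivlMr in dd3; last by lra.
move: (`|s' - s|) (nrm2M2 _) (nrm2_ge0 (addM2 (subM2 (scaleM2 a (subM2 (W s') (W s))) (dW s)) (dW s))) x0 dd2 dd3 hK => x y y0 x0 x1 x2 yK.
have : x ^+ 2 <= x by nra.
nra.
Qed.

(** The function [S (t - s) (W s)], tested against [phi], is left continuous in [s] and has right
    derivative 0, so it is constant. *)
Lemma orbit : eqM2 (S L (W 0)) (W L).
Proof.
have S_in' := S_in SA.
have hW0 := Win (lexx 0) L0; have hWL := Win L0 (lexx L).
pose y := subM2 (W L) (S L (W 0)).
have hSL := S_in' _ _ L0 hW0; have hy : inM2 y by exact: inM2_sub.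
suff key e : 0 < e -> eqM2 (S e y) (0, fun=> 0).
  have y0 : eqM2 y (0, fun=> 0).
    apply: nrm2_eq0 => //; rewrite leNgt; apply/negP => pos.
    have e0 : 0 < nrm2M2 y / 4 by rewrite divr_gt0.
    have [d d0 hd] := S_cont0 SA hy e0.
    have dd : 0 < d / 2 by rewrite divr_gt0.
    have h1 := hd (d / 2) dd ltac:(lra).
    have hS := S_in' _ _ (ltW dd) hy.
    have z0 : nrm2M2 (S (d / 2) y) = 0.
      have iz : inM2 ((0, fun=> 0) : M2) by apply: K_inM2; exact: K0.
      rewrite (nrm2_eq hS iz (key _ dd)) nrm2E /= q2_0 add0r -[RHS](@rI0 R); apply: rI_ext => t.
      by rewrite /cut; case: ifP; rewrite q2_0.
    have := nrm2_sub hS (inM2_sub hS hy).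
    rewrite (_ : subM2 (S (d / 2) y) (subM2 (S (d / 2) y) y) = y).
      rewrite z0; lra.
    exact: subM2K.
  case: y0 => a b; split.
    by apply/esym/subr0_eq; rewrite -scaleN1r.
  apply: aeS b _ => t h It; apply/esym/subr0_eq; rewrite -scaleN1r; exact: h.
(* The delay [e] keeps all times [t - s] away from 0, where no uniform bound is known. It is removed
   at the end by strong continuity at 0. *)
move=> e0; pose t := L + e.
have [M [M0 hM]] := S_locally_bounded SA t e0.
have tS s : 0 <= s -> s <= L -> 0 <= t - s by rewrite /t; lra.
have hS s : 0 <= s -> s <= L -> inM2 (S (t - s) (W s)).
  by move=> a b; apply: S_in'; [exact: tS|exact: Win].
apply: ip_faithful => [|phi hp]; first exact: (S_in' _ _ (ltW e0) hy).
pose f s := ip (S (t - s) (W s)) phi.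
suff fL : f L = f 0.
  have E : eqM2 (S e y) (subM2 (S (t - L) (W L)) (S (t - 0) (W 0))).
    have -> : t - L = e by rewrite /t addrC addKr.
    apply: eqM2_trans (S_sub SA (ltW e0) hWL hSL) _; apply: eqM2_sub (eqM2_refl _) _.
    have -> : t - 0 = e + L by rewrite subr0 /t addrC.
    exact: eqM2_sym (S_add SA (ltW e0) L0 hW0).
  rewrite (ip_eq _ _ hp E); last 2 first.
  - exact: (S_in' _ _ (ltW e0) hy).
  - by apply: inM2_sub; [exact: (hS _ L0 (lexx L))|exact: (hS _ (lexx 0) L0)].
  rewrite (ip_sub (hS _ L0 (lexx L)) (hS _ (lexx 0) L0) hp).
  by rewrite /f in fL; rewrite fL subrr.
have np := nrm2_ge0 phi.
apply: right_derivative0_constant => // [s s0 sL ep ep0|s s0 sL ep ep0].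
  (* Left continuity: [f s' - f s] splits into [P], due to the motion of [W], and [Q], due to the
     motion of the semigroup on the fixed state [W s]. Here [s' < s], so [Q] falls under right
     continuity at [t - s]. *)
  pose eta := ep / (2 * (nrm2M2 phi + 1)).
  have eta0 : 0 < eta by rewrite divr_gt0 // mulr_gt0 //; lra.
  pose e1 := ep * eta / (8 * (M + 1)).
  have M1 : 0 < 8 * (M + 1) by rewrite mulr_gt0 //; lra.
  have e10 : 0 < e1 by rewrite divr_gt0 // mulr_gt0.
  pose e2 := ep * eta / 8; have e20 : 0 < e2 by rewrite divr_gt0 // mulr_gt0.
  have [d1 d10 h1] := W_left_cont (ltW s0) sL e10.
  have hWs := Win (ltW s0) sL.
  have [d2 d20 h2] := S_right_cont SA (tS s (ltW s0) sL) hWs e20.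
  exists (Num.min d1 d2); first by rewrite lt_min d10.
  move=> s' s'0 sd ss; have [a1 a2] : s - d1 < s' /\ s - d2 < s'.
    have m1 : Num.min d1 d2 <= d1 by rewrite ge_min lexx.
    have m2 : Num.min d1 d2 <= d2 by rewrite ge_min lexx orbT.
    by split; lra.
  have [->|ne] := eqVneq s' s; first by rewrite subrr mn0 ltW.
  have lt : s' < s by rewrite lt_def eq_sym ne.
  have sL' : s' <= L by lra.
  have hWs' := Win s'0 sL'.
  have t1 : 0 <= t - s' by exact: tS.
  pose P := S (t - s') (subM2 (W s') (W s)).
  pose Q := subM2 (S (t - s') (W s)) (S (t - s) (W s)).
  have iP : inM2 P by apply: S_in' => //; exact: inM2_sub.
  have iSs : inM2 (S (t - s') (W s)) by exact: S_in'.
  have iQ : inM2 Q by apply: inM2_sub => //; exact: hS (ltW s0) sL.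
  have E : f s' - f s = ip P phi + ip Q phi.
    rewrite /f /Q ip_sub //; last exact: hS (ltW s0) sL.
    rewrite (ip_eq iP _ hp (S_sub SA t1 hWs' hWs)); last by apply: inM2_sub; exact: S_in'.
    by rewrite ip_sub //; [rewrite subrKA|exact: S_in'].
  have ts1 : e <= t - s' by rewrite /t; lra.
  have ts2 : t - s' <= t by lra.
  have nP : nrm2M2 P <= ep * eta / 8.
    apply: le_trans (hM _ ts1 ts2 _ (inM2_sub hWs' hWs)) _.
    have := h1 s' s'0 a1 ss; rewrite /e1 ler_pdivlMr // => hh.
    have := nrm2_ge0 (subM2 (W s') (W s)); rewrite ler_pdivlMr //; nra.
  have nQ : nrm2M2 Q <= ep * eta / 8.
    have := h2 (s - s') ltac:(lra) ltac:(lra).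
    by rewrite (_ : t - s + (s - s') = t - s') //; lra.
  rewrite E; apply: le_trans (mnD _ _) _.
  apply: le_trans (lerD (mn_ip (divr_gt0 eta0 (ltr0Sn _ 1)) iP hp) (mn_ip (divr_gt0 eta0 (ltr0Sn _ 1)) iQ hp)) _.
  have hh : eta * nrm2M2 phi <= ep / 2.
    rewrite /eta mulrAC ler_pdivrMr; last by rewrite mulr_gt0 //; lra.
    by rewrite (_ : ep / 2 * (2 * (nrm2M2 phi + 1)) = ep * (nrm2M2 phi + 1)); [nra|field].
  have qq (x : R) : x <= ep * eta / 8 -> x / (eta / 2) <= ep / 4.
    move=> hx; rewrite ler_pdivrMr; last exact: divr_gt0.
    by rewrite (_ : ep / 4 * (eta / 2) = ep * eta / 8) //; field.
  have := qq _ nP; have := qq _ nQ; lra.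
(* Right derivative: the quotient of [f] is [S (t - s')] applied to the difference of the quotients
   of [W] and of the semigroup at [W s], both of which are close to [dW s]. *)
pose eta := ep / (2 * (nrm2M2 phi + 1)).
have eta0 : 0 < eta by rewrite divr_gt0 // mulr_gt0 //; lra.
pose e1 := ep * eta / (8 * (M + 1)).
have M1 : 0 < 8 * (M + 1) by rewrite mulr_gt0 //; lra.
have e10 : 0 < e1 by rewrite divr_gt0 // mulr_gt0.
have hh : eta * nrm2M2 phi <= ep / 2.
  rewrite /eta mulrAC ler_pdivrMr; last by rewrite mulr_gt0 //; lra.
  by rewrite (_ : ep / 2 * (2 * (nrm2M2 phi + 1)) = ep * (nrm2M2 phi + 1)); [nra|field].
have [hWs hdW hAr] := WM s0 (ltW sL).
have [d1 d10 h1] := WD s0 (ltW sL) e10.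
have [d2 d20 h2] := S_gen SA hWs hdW hAr e10.
exists (Num.min d1 d2); first by rewrite lt_min d10.
move=> s' ss sd sL'; have [->|ne] := eqVneq s' s; first by rewrite !subrr mn0 mulr0.
have m1 : Num.min d1 d2 <= d1 by rewrite ge_min lexx.
have m2 : Num.min d1 d2 <= d2 by rewrite ge_min lexx orbT.
have d0 : 0 < s' - s by rewrite subr_gt0 lt_def ne.
pose dl := s' - s; pose a := (dl^-1)%:C.
have s'0 : 0 <= s' by lra.
have ts1 : e <= t - s' by rewrite /t; lra.
have ts2 : t - s' <= t by lra.
have ets : t - s = (t - s') + dl by rewrite /dl; lra.
have dld2 : dl < d2 by rewrite /dl; lra.
have dld1 : `|s' - s| < d1 by rewrite gtr0_norm //; lra.
have hWs' := Win s'0 sL'.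
have [q1 q1E] : {q | q = subM2 (scaleM2 a (subM2 (W s') (W s))) (dW s)} by eexists.
have [q2' q2E] : {q | q = subM2 (scaleM2 a (subM2 (S dl (W s)) (W s))) (dW s)} by eexists.
have iSd : inM2 (S dl (W s)) by apply: S_in' => //; exact: ltW.
have i1 : inM2 q1 by rewrite q1E; apply: inM2_sub => //; apply: inM2_scale; exact: inM2_sub.
have i2 : inM2 q2' by rewrite q2E; apply: inM2_sub => //; apply: inM2_scale; exact: inM2_sub.
have nq1 : nrm2M2 q1 <= e1 by rewrite q1E; exact: (h1 s' s'0 sL' ne dld1).
have nq2 : nrm2M2 q2' <= e1 by rewrite q2E; exact: (h2 dl d0 dld2).
have t1 : 0 <= t - s' by exact: tS.
pose P := S (t - s') (subM2 q1 q2').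
have iq := inM2_sub i1 i2.
have iP : inM2 P by exact: S_in'.
have nP : nrm2M2 P <= ep * eta / 2.
  apply: le_trans (hM _ ts1 ts2 _ iq) _.
  apply: le_trans (ler_wpM2l M0 (nrm2_sub i1 i2)) _.
  rewrite /e1 in nq1 nq2; rewrite ler_pdivlMr // in nq1; rewrite ler_pdivlMr // in nq2.
  move: (nrm2M2 q1) (nrm2M2 q2') (nrm2_ge0 q1) (nrm2_ge0 q2') nq1 nq2 => u v u0 v0.
  by move: (ep * eta) => X hu hv; lra.
have E : f s' - f s = dl%:C *: ip P phi.
  have hs1 := hS s' s'0 sL'; have hs2 := hS s s0 (ltW sL).
  rewrite -(ip_scale _ iP hp); transitivity (ip (subM2 (S (t - s') (W s')) (S (t - s) (W s))) phi).
    by rewrite (ip_sub hs1 hs2 hp).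
  apply: (ip_eq (inM2_sub hs1 hs2) (inM2_scale _ iP) hp).
  have ib : inM2 (subM2 (W s') (S dl (W s))) by exact: inM2_sub.
  have e3 : eqM2 (scaleM2 dl%:C P) (S (t - s') (subM2 (W s') (S dl (W s)))).
    have ez : subM2 (W s') (S dl (W s)) = addM2 (scaleM2 (dl%:C - 1) (subM2 q1 q2')) (subM2 q1 q2').
      have ab : dl%:C * a = 1 by rewrite /a -rmorphM /= mulfV // gt_eqF.
      have gen (u v w d : 'cV[C]_n) : u + (-1) *: v =
        (dl%:C - 1) *: ((a *: (u + (-1) *: w) + (-1) *: d) + (-1) *: (a *: (v + (-1) *: w) + (-1) *: d))
        + ((a *: (u + (-1) *: w) + (-1) *: d) + (-1) *: (a *: (v + (-1) *: w) + (-1) *: d)).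
        rewrite scalerBl scale1r subrK !scaleN1r.
        have -> : a *: (u - w) - d - (a *: (v - w) - d) = a *: (u - v).
          by rewrite opprB subrKA -scalerBr opprB subrKA.
        by rewrite scalerA ab scale1r.
      rewrite q1E q2E /subM2 /addM2 /scaleM2 /=; congr pair; first exact: gen.
      by apply/funext => r; exact: gen.
    rewrite ez; apply: eqM2_sym; apply: eqM2_trans (S_lin SA _ t1 iq iq) _.
    have -> : scaleM2 dl%:C P = addM2 (scaleM2 (dl%:C - 1) P) P; last exact: eqM2_refl.
    rewrite /addM2 /scaleM2 /=; congr pair; first by rewrite scalerBl scale1r subrK.
    by apply/funext => r; rewrite scalerBl scale1r subrK.
  apply: eqM2_sym; apply: eqM2_trans e3 _; apply: eqM2_trans (S_sub SA t1 hWs' iSd) _.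
  apply: eqM2_sub (eqM2_refl _) _; apply: eqM2_sym.
  rewrite ets.
  exact (S_add SA t1 (ltW d0) hWs).
rewrite E mnZr gtr0_norm // mulrC; apply: ler_wpM2r; first exact: ltW.
apply: le_trans (mn_ip eta0 iP hp) _.
have hP : nrm2M2 P / eta <= ep / 2 by rewrite ler_pdivrMr // mulrAC.
by rewrite [leRHS]splitr; exact: lerD.
Qed.

End Orbit.

(** * Difference quotients of primitives *)

Section Quotients.
Context (R : realType) (n : nat).
Local Notation C := R[i].

Lemma mI_const (v : 'cV[C]_n) a b : a <= b -> mI (cut a b (fun=> v)) = (b - a)%:C *: v.
Proof.
move=> ab; apply/matrixP => i j; rewrite mIE mxE.
have -> : (fun t => cut a b (fun=> v) t i j) = (fun t => v i j * (ind a b t)%:C).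
  by apply/funext => t; rewrite cutE mxE mulrC.
have hi : Ci (fun t => (ind a b t)%:C : C) by split; [exact: ri_indic|exact: ri0].
rewrite cIZ // mulrC; congr (_ * _); apply: ReImP => /=; first exact: rI_indic.
exact: rI0.
Qed.

(** The increment of a primitive of a square integrable function is small by Cauchy-Schwarz, here
    with a free parameter in place of the square root. *)
Lemma cum_small m p (f : R -> 'M[C]_(m, p)) s t e : K f -> s <= t -> 0 < e ->
  mn (mI (cut s t f)) <= e * rI (fun r => mn (f r) ^+ 2) + (t - s) / e.
Proof.
move=> kf st e0; have [mf f1 f2] := kf; have kc := K_cut s t kf.
apply: le_trans (mn_mI (K_Mi kc)) _.
rewrite -rIZ // mulrC -(rI_indic st) -(rIZ _ (ri_indic s t)) -rID; last 2 first.
- exact: riZ.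
- by apply: riZ; exact: ri_indic.
apply: le_rI; first exact: Mi_mn (K_Mi kc).
  by apply: riD; apply: riZ => //; exact: ri_indic.
move=> r; rewrite /cut /ind; case: (_ <= _ <= _); last first.
  by rewrite mn0 mulr0 addr0 mulr_ge0 ?sqr_ge0 // ltW.
rewrite mulr1 -subr_ge0; move: (mn (f r)) => x.
have -> : e * x ^+ 2 + e^-1 - x = e^-1 * ((e * x - 1 / 2) ^+ 2 + 3 / 4).
  by field; rewrite gt_eqF.
by apply: mulr_ge0; [rewrite invr_ge0 ltW|rewrite addr_ge0 ?sqr_ge0 //; lra].
Qed.

Lemma quot_bound (F f : R -> 'cV[C]_n) lo hi (v : 'cV[C]_n) be : K f ->
  F hi - F lo = mI (cut lo hi f) -> lo <= hi ->
  (forall r, lo <= r -> r <= hi -> mn (f r - v) <= be) ->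
  mn (F hi - F lo - (hi - lo)%:C *: v) <= (hi - lo) * be.
Proof.
move=> kf E lh h.
have kv : K (cut lo hi (fun=> v)) by apply: (@K_cutb _ _ _ _ _ _ (mn v)) => //; exact: Mm_cst.
have kc := K_cut lo hi kf.
have k3 := KB kc kv.
rewrite E -(mI_const v lh) -(mIB (K_Mi kc) (K_Mi kv)).
apply: le_trans (mn_mI (K_Mi k3)) _.
rewrite mulrC -(rI_indic lh) -(rIZ _ (ri_indic lo hi)); apply: le_rI.
- exact: Mi_mn (K_Mi k3).
- by apply: riZ; exact: ri_indic.
move=> r; rewrite /cut /ind; case: (boolP (lo <= r <= hi)) => hr.
  by rewrite mulr1; move/andP: hr => [h1 h2]; exact: h.
by rewrite subr0 mn0 mulr0.
Qed.

(** The mean value inequality. The hypothesis covers both orders of [s] and [s'], so that left and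
    right quotients are treated at once. *)
Lemma quot_near (F f : R -> 'cV[C]_n) s s' be : K f ->
  (forall lo hi, (lo = s /\ hi = s') \/ (lo = s' /\ hi = s) -> lo <= hi ->
     F hi - F lo = mI (cut lo hi f)) -> s' != s ->
  (forall r, `|r - s| <= `|s' - s| -> Num.min s s' <= r -> r <= Num.max s s' ->
     mn (f r - f s) <= be) ->
  mn (((s' - s)^-1)%:C *: (F s' - F s) - f s) <= be.
Proof.
move=> kf E ne h; have ne' : s' - s != 0 by rewrite subr_eq0.
have -> : ((s' - s)^-1)%:C *: (F s' - F s) - f s =
    ((s' - s)^-1)%:C *: (F s' - F s - (s' - s)%:C *: f s).
  by rewrite [RHS]scalerBr scalerA -rmorphM /= mulVf // scale1r.
rewrite mnZr normfV mulrC ler_pdivrMr ?normr_gt0 // mulrC.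
case: (ltgtP s s') => ss; last by rewrite ss eqxx in ne.
  rewrite gtr0_norm ?subr_gt0 //; apply: (quot_bound kf); [by apply: E; [left|exact: ltW]|exact: ltW|].
  move=> r h1 h2; apply: h.
  - rewrite !ger0_norm ?subr_ge0 //; [by rewrite lerD2r|exact: ltW].
  - by rewrite ge_min h1.
  - by rewrite le_max h2 orbT.
have -> : F s' - F s - (s' - s)%:C *: f s = - (F s - F s' - (s - s')%:C *: f s).
  rewrite -(opprB s s') rmorphN scaleNr opprK opprB [RHS]addrC; congr (_ + _).
  by rewrite opprB.
rewrite mnN distrC gtr0_norm ?subr_gt0 //; apply: (quot_bound kf).
- by apply: E; [right|exact: ltW].
- exact: ltW.
- move=> r h1 h2; apply: h.
  + rewrite distrC ger0_norm ?subr_ge0 // distrC ger0_norm ?subr_ge0 //; last exact: ltW.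
    by rewrite lerD2l lerN2.
  + by rewrite ge_min h1 orbT.
  + by rewrite le_max h2.
Qed.

End Quotients.

(** * The step response and its derivative *)

Section Step.
Context (R : realType) (n : nat) (D : sys R n).
Local Notation C := R[i].
Local Notation A := (sA D).
Local Notation b := (sb D).
Local Notation N := (sN D).
Local Notation h := (sh D).
Local Notation Z := (Z D).
Local Notation zz := (zz D).
Local Notation H := (Hv (sL D)).

Definition emb (f : R -> 'cV[C]_n) : M2 R n := (f 0 - A *m f (-1), f).
(** The state at time [s] under the constant control 1. It lies in D(A) because [zz] is a primitive,
    whereas the second component of its time derivative [dX s] may jump. *)
Definition X s : M2 R n := emb (fun r => zz (s + r)).
Definition dX s : M2 R n := emb (fun r => Z (s + r)).
Definition Bv : M2 R n := (b, fun=> 0).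
Definition Yf : R -> 'cV[C]_n := locked_with sys_key (fun t => Z t - A *m Z (t - 1)).
Definition yf : R -> 'cV[C]_n := locked_with sys_key (fun t => zz t - A *m zz (t - 1)).
Definition ee : R -> 'cV[C]_n :=
  locked_with sys_key (fun t => kap A b (sk D) N t + cnv (sk D) h t).
Lemma YfE t : Yf t = Z t - A *m Z (t - 1). Proof. by rewrite /Yf locked_withE. Qed.
Lemma yfE t : yf t = zz t - A *m zz (t - 1). Proof. by rewrite /yf locked_withE. Qed.
Lemma eeE : ee = (fun t => kap A b (sk D) N t + cnv (sk D) h t).
Proof. by rewrite /ee locked_withE. Qed.

Lemma K_ee : K ee.
Proof.
rewrite eeE; apply: KD; first by apply: K_kap; exact: K_sk.
by apply: K_conv; [exact: K_sk|exact: shK].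
Qed.
Lemma ee_neg t : t < 0 -> ee t = 0.
Proof.
move=> t0; rewrite eeE (kap_neg A b N (@sk_supp _ _ D) t0).
by rewrite add0r; apply: conv_causal (@sk_neg _ _ D) (@sh_neg _ _ D) _; rewrite addr0.
Qed.
Lemma cnv_ee t : cnv (H n) ee t = cnv (H n) (kap A b (sk D) N) t + cnv (H n) (cnv (sk D) h) t.
Proof.
rewrite eeE; exact: (convDr _ (K_H D n) (K_kap A b N (K_sk D)) (K_conv (K_sk D) (shK D))).
Qed.
Lemma skZ_ee t : cnv (sk D) Z t = cnv (H n) ee t.
Proof.
by rewrite cnv_ee (skZ_cum D t) (conv_Hv_conv _ _ (K_sk D) (shK D)).
Qed.
(** The jumps of [Z] cancel in [Z t - A *m Z (t - 1)], apart from [b] at time 0. The first component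
    of [dX] is therefore continuous, with derivative [ee]. *)
Lemma Yf_eq t : 0 <= t <= N%:R -> Yf t = b + cnv (H n) ee t.
Proof.
move=> /andP[t0 tN]; rewrite YfE (Z_eq tN) skZ_ee Hv1 ?mul1mx; last first.
  by rewrite t0 /sL -natr1; lra.
by rewrite addrC !addrA addNr add0r.
Qed.
Lemma cum_ee_osc s t e : s <= t -> t <= sL D -> 0 < e ->
  mn (cnv (H n) ee t - cnv (H n) ee s) <= e * rI (fun r => mn (ee r) ^+ 2) + (t - s) / e.
Proof.
move=> st tL e0; rewrite (Hv_diff (c := 0) K_ee ee_neg st); last by lra.
exact: cum_small K_ee st e0.
Qed.
Lemma cum_h_osc s t e : s <= t -> t <= sL D -> 0 < e ->
  mn (cnv (H n) h t - cnv (H n) h s) <= e * rI (fun r => mn (h r) ^+ 2) + (t - s) / e.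
Proof.
move=> st tL e0; rewrite (Hv_diff (c := 0) (shK D) (@sh_neg _ _ D) st); last by lra.
exact: cum_small (shK D) st e0.
Qed.
Lemma yf_diff s t : s <= t -> t <= sL D -> yf t - yf s = mI (cut s t Yf).
Proof.
move=> st tL; have KZ := K_Z D.
have e1 := zz_diff st tL.
have e2 : zz (t - 1) - zz (s - 1) = mI (cut (s - 1) (t - 1) Z) by apply: zz_diff; lra.
have k1 := K_cut s t KZ; have k2 := K_cut (s - 1) (t - 1) KZ.
have e3 : mI (cut s t (fun r => Z (r - 1))) = mI (cut (s - 1) (t - 1) Z).
  transitivity (mI (fun r => cut (s - 1) (t - 1) Z (r + -1))); last exact: (mI_shift (-1) (K_Mi k2)).
  apply: mI_ext => r; rewrite /cut.
  by have -> : (s - 1 <= r - 1 <= t - 1) = (s <= r <= t) by rewrite !lerD2r.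
have k3 := K_cut s t (K_shift (-1) KZ).
have -> : mI (cut s t Yf) = mI (cut s t Z) - A *m mI (cut s t (fun r => Z (r - 1))).
  have pt r : cut s t Yf r = cut s t Z r - A *m cut s t (fun r => Z (r - 1)) r.
    by rewrite /cut YfE; case: ifP => // _; rewrite mulmx0 subr0.
  by rewrite (mI_ext pt) (mIB (K_Mi k1) (K_Mi (K_mull A k3))) (mI_mull A (K_Mi k3)).
have -> : mI (cut s t Z) = zz t - zz s by rewrite e1.
have -> : mI (cut s t (fun r => Z (r - 1))) = zz (t - 1) - zz (s - 1) by rewrite e3 e2.
rewrite mulmxBr !yfE.
have zid (p q u v : 'cV[C]_n) : p - u - (q - v) = (p - q) - (u - v).
  by rewrite !opprB addrACA [RHS]addrACA [- u - q]addrC.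
exact: zid.
Qed.

Definition cJ : R := \sum_(j < N.+1) mn (bj A b j).
Definition Qh : R := rI (fun r => mn (h r) ^+ 2).
Definition Qe : R := rI (fun r => mn (ee r) ^+ 2).
Lemma cJ_ge0 : 0 <= cJ. Proof. by apply: sumr_ge0 => j _; exact: mn_ge0. Qed.
Lemma Qh_ge0 : 0 <= Qh. Proof. by apply: rI_ge0 => j; exact: sqr_ge0. Qed.
Lemma Qe_ge0 : 0 <= Qe. Proof. by apply: rI_ge0 => j; exact: sqr_ge0. Qed.

Lemma Hv_jump m d s t (v : 'cV[C]_m) : s <= sL D -> t <= sL D -> `|t - s| <= d ->
  mn (H m t *m v - H m s *m v) <= mn v * ind (- d) d s.
Proof.
move=> sl tl ts; rewrite /Hv /cut /ind.
have h1 : t - s <= d by apply: le_trans ts; exact: ler_norm.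
have h2 : s - t <= d by apply: le_trans ts; rewrite distrC; exact: ler_norm.
rewrite sl tl !andbT; case: (ltP t 0) => t0; case: (ltP s 0) => s0;
  rewrite /= ?mul1mx ?mul0mx ?subrr ?mn0 ?subr0 ?sub0r ?mnN;
  try by (apply: mulr_ge0; [exact: mn_ge0|case: (_ && _)]).
  have -> : (- d <= s) && (s <= d) by apply/andP; split; lra.
  by rewrite mulr1.
have -> : (- d <= s) && (s <= d) by apply/andP; split; lra.
by rewrite mulr1.
Qed.

(** A bound for the change of the jump part [ZJ] between [s] and times at distance at most [d]. It
    is not small near a jump, but its integral over [s] is proportional to [d]; see [rI_osc]. *)
Definition osc d s : R := \sum_(j < N.+1) mn (bj A b j) * ind (j%:R - d) (j%:R + d) s.

Lemma osc_le d s : osc d s <= cJ.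
Proof.
apply: ler_sum => j _; rewrite -[leRHS]mulr1; apply: ler_wpM2l; first exact: mn_ge0.
by rewrite /ind; case: (_ <= _ <= _).
Qed.
Lemma osc_ge0 d s : 0 <= osc d s.
Proof. by apply: sumr_ge0 => j _; rewrite mulr_ge0 ?mn_ge0 // /ind ler0n. Qed.

Lemma Z_osc d e s t : s <= N%:R -> t <= N%:R -> `|t - s| <= d -> 0 < e ->
  mn (Z t - Z s) <= osc d s + (e * Qh + d / e).
Proof.
move=> sN tN ts e0; have NL : N%:R <= sL D by rewrite /sL -natr1; lra.
have -> : Z t - Z s = (ZJ D t - ZJ D s) + (cnv (H n) h t - cnv (H n) h s).
  by rewrite (ZE D) opprD addrACA.
apply: le_trans (mnD _ _) _; apply: lerD.
  rewrite (ZJE D) -sumrB; apply: le_trans (mn_sum _ _) _; apply: ler_sum => j _.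
  have j0 : (0 : R) <= j%:R by [].
  have := @Hv_jump n d (s - j%:R) (t - j%:R) (bj A b j); rewrite opprD addrACA subrr addr0.
  have -> : ind (- d) d (s - j%:R) = ind (j%:R - d) (j%:R + d) s.
    by rewrite /ind; congr (_%:R); congr nat_of_bool; apply/idP/idP; lra.
  by apply => //; lra.
have de : 0 <= d by apply: le_trans ts.
have [st|st] := leP s t.
  apply: le_trans (cum_h_osc st _ e0) _; first lra.
  by rewrite lerD2l ler_wpM2r ?invr_ge0 ?(ltW e0) //; apply: le_trans ts; exact: ler_norm.
rewrite mn_distC; apply: le_trans (cum_h_osc (ltW st) _ e0) _; first lra.
rewrite lerD2l ler_wpM2r ?invr_ge0 ?(ltW e0) //; apply: le_trans ts.
by rewrite distrC; exact: ler_norm.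
Qed.

Lemma Yf_osc d e s t : 0 <= s -> s <= N%:R -> 0 <= t -> t <= N%:R -> `|t - s| <= d -> 0 < e ->
  mn (Yf t - Yf s) <= e * Qe + d / e.
Proof.
move=> s0 sN t0 tN ts e0; have NL : N%:R <= sL D by rewrite /sL -natr1; lra.
rewrite !Yf_eq ?s0 ?t0 //.
have -> : b + cnv (H n) ee t - (b + cnv (H n) ee s) = cnv (H n) ee t - cnv (H n) ee s.
  by rewrite opprD addrACA subrr add0r.
have [st|st] := leP s t.
  apply: le_trans (cum_ee_osc st _ e0) _; first lra.
  by rewrite lerD2l ler_wpM2r ?invr_ge0 ?(ltW e0) //; apply: le_trans ts; exact: ler_norm.
rewrite mn_distC; apply: le_trans (cum_ee_osc (ltW st) _ e0) _; first lra.
rewrite lerD2l ler_wpM2r ?invr_ge0 ?(ltW e0) //; apply: le_trans ts.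
by rewrite distrC; exact: ler_norm.
Qed.

Definition Xq s s' : M2 R n := subM2 (scaleM2 ((s' - s)^-1)%:C (subM2 (X s') (X s))) (dX s).

Lemma Xq1 s s' : (Xq s s').1 = ((s' - s)^-1)%:C *: (yf s' - yf s) - Yf s.
Proof. by rewrite /Xq /subM2 /addM2 /scaleM2 /= !addr0 !yfE YfE !scaleN1r. Qed.
Lemma Xq2 s s' r : (Xq s s').2 r = ((s' - s)^-1)%:C *: (zz (s' + r) - zz (s + r)) - Z (s + r).
Proof. by rewrite /Xq /subM2 /addM2 /scaleM2 /= !scaleN1r. Qed.
Lemma K_Xq s s' : K (Xq s s').2.
Proof.
have k1 := K_shift s' (K_zz D); have k2 := K_shift s (K_zz D); have k3 := K_shift s (K_Z D).
apply: K_ext (KB (KZ ((s' - s)^-1)%:C (KB k1 k2)) k3) => r.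
by rewrite Xq2 [s' + r]addrC [s + r]addrC.
Qed.

Lemma Xq1_le s s' e : 0 <= s -> s <= N%:R -> 0 <= s' -> s' <= N%:R -> s' != s -> 0 < e ->
  mn (Xq s s').1 <= e * Qe + `|s' - s| / e.
Proof.
move=> s0 sN s'0 s'N ne e0; have NL : N%:R <= sL D by rewrite /sL -natr1; lra.
have KY : K Yf.
  have k2 := K_mull A (K_shift (-1) (K_Z D)).
  by apply: K_ext (KB (K_Z D) k2) => r; rewrite YfE.
rewrite Xq1; apply: quot_near => //.
  move=> lo hi hh lh; apply: yf_diff => //; case: hh => -[_ ->]; lra.
move=> r rs; rewrite ge_min le_max => r1 r2; apply: Yf_osc => //.
- by case/orP: r1; lra.
- by case/orP: r2; lra.
Qed.

Lemma Xq2_le s s' e r : s <= N%:R -> s' <= N%:R -> s' != s -> 0 < e -> r <= 0 ->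
  mn ((Xq s s').2 r) <= osc `|s' - s| (s + r) + (e * Qh + `|s' - s| / e).
Proof.
move=> sN s'N ne e0 r0; have NL : N%:R <= sL D by rewrite /sL -natr1; lra.
rewrite Xq2; have d : (s' + r) - (s + r) = s' - s by lra.
rewrite -{1}d; have ne' : s' + r != s + r by rewrite (inj_eq (addIr r)).
apply: (quot_near (K_Z D)) => //.
  move=> lo hi hh lh; apply: zz_diff => //; case: hh => -[_ ->]; lra.
move=> x; rewrite d ge_min le_max => xs r1 r2; apply: Z_osc => //; first lra.
by case/orP: r2; lra.
Qed.

Lemma ri_osc d s : ri (fun r => osc d (s + r)).
Proof.
apply: ri_sum => j; apply: riZ; apply: ri_ext (ri_indic (j%:R - d - s) (j%:R + d - s)) => r.
by rewrite /ind; congr (_%:R); congr nat_of_bool; apply/idP/idP; lra.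
Qed.
Lemma rI_osc d s : 0 <= d -> rI (fun r => osc d (s + r)) = cJ * (2 * d).
Proof.
move=> d0; have e (j : 'I_N.+1) : (fun r => mn (bj A b j) * ind (j%:R - d) (j%:R + d) (s + r)) =
    (fun r => mn (bj A b j) * ind (j%:R - d - s) (j%:R + d - s) r).
  apply/funext => r; congr (_ * _).
  by rewrite /ind; congr (_%:R); congr nat_of_bool; apply/idP/idP; lra.
rewrite /osc rI_sum; last by move=> j; rewrite e; apply: riZ; exact: ri_indic.
rewrite /cJ mulr_suml; apply: eq_bigr => j _; rewrite e rIZ; last exact: ri_indic.
by rewrite rI_indic; [congr (_ * _); lra|lra].
Qed.

(** Near a jump the quotient of [zz] does not approach [Z], but the error stays bounded and its
    integral is small. The square is hence estimated by a supremum times an integral. *)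
Lemma X_quot_bound s s' e : 0 <= s -> s <= N%:R -> 0 <= s' -> s' <= N%:R -> s' != s -> 0 < e ->
  nrm2M2 (Xq s s') <= (e * Qe + `|s' - s| / e) ^+ 2 +
    (cJ + (e * Qh + `|s' - s| / e)) * (cJ * (2 * `|s' - s|) + (e * Qh + `|s' - s| / e)).
Proof.
move=> s0 sN s'0 s'N ne e0; rewrite nrm2E; have kq := K_Xq s s'.
have w0 : 0 <= e * Qh + `|s' - s| / e.
  by apply: addr_ge0; [apply: mulr_ge0; [exact: ltW|exact: Qh_ge0]|apply: divr_ge0 => //; exact: ltW].
apply: lerD.
  apply: le_trans (q2_mn _) _; rewrite lerXn2r ?nnegrE ?mn_ge0 //; last exact: Xq1_le.
  exact: le_trans (mn_ge0 _) (Xq1_le s0 sN s'0 s'N ne e0).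
set w := e * Qh + _ in w0 *.
have io := ri_osc `|s' - s| s; have ii := ri_indic (-1 : R) 0.
have i1 := riZ (cJ + w) (riD io (riZ w ii)).
have -> : (cJ + w) * (cJ * (2 * `|s' - s|) + w) =
    rI (fun r => (cJ + w) * (osc `|s' - s| (s + r) + w * ind (-1) 0 r)).
  rewrite rIZ; last exact: riD io (riZ w ii).
  rewrite (rID io (riZ w ii)) (rIZ _ ii) rI_osc // rI_indic; last by lra.
  by rewrite sub0r opprK mulr1.
apply: le_rI i1 _; first exact: ri_q2 (K_cut _ _ kq).
move=> r; rewrite /cut /ind; case: (boolP (-1 <= r <= 0)) => hr; last first.
  rewrite q2_0 mulr0 addr0 mulr_ge0 ?osc_ge0 // addr_ge0 ?cJ_ge0 //.
apply: le_trans (q2_mn _) _; move/andP: hr => [_ r0].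
have hb := Xq2_le sN s'N ne e0 r0; rewrite -/w in hb.
have m0 := mn_ge0 ((Xq s s').2 r); have o1 := osc_le `|s' - s| (s + r).
rewrite mulr1 expr2; apply: ler_pM => //; lra.
Qed.

Lemma X_deriv s ep : 0 <= s -> s <= N%:R -> 0 < ep -> exists2 d, 0 < d &
  forall s', 0 <= s' -> s' <= N%:R -> s' != s -> `|s' - s| < d -> nrm2M2 (Xq s s') <= ep.
Proof.
move=> s0 sN ep0; have c0 := cJ_ge0; have q0 := Qh_ge0; have q1 := Qe_ge0.
(* The two terms of [X_quot_bound] will be at most [eta] and [(cJ + 1) * (2 * eta)], which add up to
   [eta * (2 * cJ + 3)]. *)
pose eta := Num.min 1 (ep / (2 * cJ + 3)).
have den : 0 < 2 * cJ + 3 by lra.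
have et0 : 0 < eta by rewrite lt_min ltr01 divr_gt0.
have et1 : eta <= 1 by rewrite ge_min lexx.
have et2 : eta * (2 * cJ + 3) <= ep by rewrite -ler_pdivlMr // ge_min lexx orbT.
pose e := eta / (2 * (Qh + Qe + 1)).
have den2 : 0 < 2 * (Qh + Qe + 1) by rewrite mulr_gt0 //; lra.
have e0 : 0 < e by rewrite divr_gt0.
have eQ : e * (2 * (Qh + Qe + 1)) = eta by rewrite /e divfK // gt_eqF.
pose d := Num.min (e * eta / 2) (eta / (2 * (cJ + 1))).
have den3 : 0 < 2 * (cJ + 1) by rewrite mulr_gt0 //; lra.
exists d.
  by rewrite lt_min; apply/andP; split; [rewrite divr_gt0 // mulr_gt0|rewrite divr_gt0].
move=> s' s'0 s'N ne; rewrite lt_min => /andP[h1 h2].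
apply: le_trans (X_quot_bound s0 sN s'0 s'N ne e0) _.
have x0 := normr_ge0 (s' - s); move: (`|s' - s|) x0 h1 h2 => x x0 h1 h2.
have xe : x / e <= eta / 2 by rewrite ler_pdivrMr // mulrC mulrA ltW.
have h3 : x * (2 * (cJ + 1)) <= eta by rewrite -ler_pdivlMr // ltW.
have w0 : 0 <= x / e by apply: divr_ge0 => //; exact: ltW.
move: (x / e) xe w0 => y xe w0.
have a1 : e * Qe <= eta / 2 by nra.
have a2 : e * Qh <= eta / 2 by nra.
have b1 : 0 <= e * Qe by apply: mulr_ge0 => //; exact: ltW.
have b2 : 0 <= e * Qh by apply: mulr_ge0 => //; exact: ltW.
move: (e * Qe) (e * Qh) a1 a2 b1 b2 => u v a1 a2 b1 b2.
have g1 : (u + y) ^+ 2 <= eta.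
  have : 0 <= u + y <= eta by apply/andP; split; lra.
  by move=> /andP[]; nra.
have g2 : cJ * (2 * x) + (v + y) <= 2 * eta by nra.
have g3 : (cJ + (v + y)) * (cJ * (2 * x) + (v + y)) <= (cJ + 1) * (2 * eta).
  apply: ler_pM => //; [lra|apply: addr_ge0; [apply: mulr_ge0 => //; lra|lra]|lra].
nra.
Qed.

End Step.

Lemma cnv_shift0 (R : realType) m n p (F : R -> 'M[R[i]]_(m, n)) (f : R -> 'M[R[i]]_(n, p)) s :
  K F -> K f -> cnv F (fun r => f (s + r)) 0 = cnv F f s.
Proof.
move=> kF kf; have kf' : K (fun r => f (s + r)).
  by apply: K_ext (K_shift s kf) => r; rewrite addrC.
rewrite (conv_flip 0 kF kf') (conv_flip s kF kf).
by apply: mI_ext => r; rewrite sub0r.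
Qed.

Lemma cut_lin (R : realType) m n u v a (p q : R -> 'M[R[i]]_(m, n)) t :
  cut u v (fun t => a *: p t + q t) t = a *: cut u v p t + cut u v q t.
Proof. by rewrite /cut; case: ifP; rewrite ?scaler0 ?addr0. Qed.

Lemma cnv_lin_r (R : realType) m n p (F : R -> 'M[R[i]]_(m, n)) a (f g : R -> 'M[R[i]]_(n, p)) t :
  K F -> K f -> K g -> cnv F (fun r => a *: f r + g r) t = a *: cnv F f t + cnv F g t.
Proof.
move=> kF kf kg; rewrite (convDr _ kF (KZ a kf) kg); congr (_ + _).
rewrite !convE -mIZ; last exact: conv_Mi.
by apply: mI_ext => r; rewrite scalemxAr.
Qed.

Lemma cnv_cut0 (R : realType) m n p (F : R -> 'M[R[i]]_(m, n)) (f : R -> 'M[R[i]]_(n, p)) :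
  (forall t, ~~ (0 <= t <= 1) -> F t = 0) -> cnv F f 0 = cnv F (cut (-1) 0 f) 0.
Proof.
move=> h; rewrite !convE; apply: mI_ext => r; rewrite /cut; case: ifP => // hr.
by rewrite h ?mul0mx //; apply: contraFN hr; lra.
Qed.

(** * The generator in terms of convolutions *)

Section Model.
Context (R : realType) (n : nat).
Local Notation C := R[i].
Variables (Am1 : 'M[R]_n) (b : 'cV[R]_n) (A2 A3 : R -> 'M[C]_n) (D : sys R n).
Hypothesis hA : sA D = toCmx Am1.
Hypothesis hb : sb D = toCmx b.
Hypothesis h2 : s2 D = cut 0 1 (fun r => A2 (- r)).
Hypothesis h3 : s3 D = cut 0 1 (fun r => A3 (- r)).
Local Notation Ar := (Arel Am1 A2 A3).
Local Notation N := (sN D).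
Local Notation emb := (emb D).

(** A distributed delay is the value at 0 of a convolution with the reflected kernel. Associativity
    of convolutions then computes the generator on states built from [Z] and [zz]. *)
Let reflect_cnv (F : R -> 'M[C]_n) (f : R -> 'cV[C]_n) :
  cnv (cut 0 1 (fun r => F (- r))) f 0 = vint Iint (fun t => F t *m f t).
Proof.
rewrite /Iint vintE convE; apply: mI_ext => r; rewrite /cut.
have -> : (0 <= 0 - r <= 1) = (-1 <= r <= 0) by apply/idP/idP; lra.
by case: ifP => _; rewrite ?mul0mx // sub0r opprK.
Qed.
Lemma Lop_cnv zt zd : Lop A2 A3 zt zd = cnv (s2 D) zd 0 + cnv (s3 D) zt 0.
Proof. by rewrite /Lop h2 h3 !reflect_cnv. Qed.

Definition primitive_on (f g : R -> 'cV[C]_n) : Prop :=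
  K (cut (-1) 0 g) /\ forall t, -1 <= t <= 0 -> f t - f (-1) = mI (cut (-1) t g).

Lemma Arel_emb f g v : primitive_on f g -> eqM2 v (cnv (s2 D) g 0 + cnv (s3 D) f 0, g) ->
  Ar (emb f) v.
Proof.
move=> [kg h] e; exists f, g; split.
- split; first exact/vL2_K.
    move=> t; rewrite /Iint /= in_itv /= => It; rewrite vintE -h // addrC subrK //.
  exact: aeW.
- by rewrite /emb /= hA.
- by rewrite Lop_cnv.
Qed.
Lemma Arel_inv x v : Ar x v -> exists f g, [/\ primitive_on f g, eqM2 x (emb f) &
  eqM2 v (cnv (s2 D) g 0 + cnv (s3 D) f 0, g)].
Proof.
move=> [f [g [[hg hf xf] x1 e]]]; exists f, g; split.
- split; first exact/vL2_K.
  move=> t It; have := hf t; rewrite /Iint /= in_itv /= => /(_ It) ->.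
  by rewrite vintE [f (-1) + _]addrC addrK.
- by split=> //=; rewrite hA.
- by rewrite -Lop_cnv.
Qed.
(** On the interval [f] is a constant plus a Heaviside integral of [g], which supplies measurability
    and a bound. *)
Lemma primitive_bounded f g : primitive_on f g -> inM2 (emb f).
Proof.
move=> [kg h]; apply/inM2_K => /=.
have mf : Mm (cut (-1) 0 (fun t => f (-1) + cnv (Hv 1 n) (cut (-1) 0 g) t)).
  apply: Mm_cut; apply: MmD; first exact: Mm_cst.
  by have [] := K_conv (K_Hv 1 n) kg.
have E t : cut (-1) 0 f t = cut (-1) 0 (fun t => f (-1) + cnv (Hv 1 n) (cut (-1) 0 g) t) t.
  rewrite /cut; case: ifP => // It; rewrite conv_Hv.
  have -> : mI (cut (t - 1) t (cut (-1) 0 g)) = mI (cut (-1) t g).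
    apply: mI_ext => r; rewrite /cut; case: (boolP (-1 <= r <= t)) => hr.
      have -> : t - 1 <= r <= t by lra.
      by have -> : -1 <= r <= 0 by lra.
    case: ifP => // hr'; case: ifP => // hr''; case/negP: hr; lra.
  by rewrite -h // addrC subrK.
have kc := K_conv (K_Hv 1 n) kg.
apply: K_ext (fun t => esym (E t)) _.
apply: (@K_cutb _ _ _ _ _ _ (mn (f (-1)) + (rI (fun t => mn (Hv 1 n t) ^+ 2) +
  rI (fun t => mn (cut (-1) 0 g t) ^+ 2)))).
  by apply: MmD; [exact: Mm_cst|case: kc].
by move=> t _; apply: le_trans (mnD _ _) _; rewrite lerD2l; exact: conv_bound (K_Hv 1 n) kg.
Qed.
Lemma inDA_emb x : inM2 x -> inDA Am1 A2 A3 x <-> exists f g, primitive_on f g /\ eqM2 x (emb f).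
Proof.
move=> hx; split=> [[_ [v /Arel_inv[f [g [h e _]]]]]|[f [g [h [e1 e2]]]]]; first by exists f, g.
split=> //; exists (Lop A2 A3 f g, g); exists f, g; have [kg hd] := h; split.
- split; [exact/vL2_K| |exact: e2].
  by move=> t; rewrite /Iint /= in_itv /= => It; rewrite vintE -hd // addrC subrK.
- by rewrite e1 /emb /= hA.
- exact: eqM2_refl.
Qed.

(** The equation [X' = A X + (b, 0)] of the step response, solved for [A X]. *)
Lemma Arel_X s : 0 <= s -> s <= N%:R -> Ar (X D s) (subM2 (dX D s) (Bv D)).
Proof.
move=> s0 sN; have NL : N%:R <= sL D by rewrite /sL -natr1; lra.
have KZ := K_Z D; have Kz := K_zz D.
apply: (Arel_emb (g := fun r => Z D (s + r))).
  split.
    by apply: K_cut; apply: K_ext (K_shift s KZ) => r; rewrite addrC.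
  move=> t /andP[t1 t2]; rewrite (zz_diff (s := s + -1) (t := s + t)); [|lra|lra].
  have k1 := K_cut (s + -1) (s + t) KZ.
  rewrite -(mI_shift s (K_Mi k1)); apply: mI_ext => r; rewrite /cut [r + s]addrC.
  by have -> : (s + -1 <= s + r <= s + t) = (-1 <= r <= t) by rewrite !lerD2l.
have e2 := cnv_shift0 s (s2K D) KZ; have e3 := cnv_shift0 s (s3K D) Kz.
split.
  have Y : Z D s - sA D *m Z D (s - 1) = sb D + cnv (Hv (sL D) n) (ee D) s.
    by rewrite -YfE; apply: Yf_eq; rewrite s0.
  rewrite /= e2 e3 -sk_Z skZ_ee addr0 Y scaleN1r.
  by move: (sb D) (cnv _ _ _) => p q; rewrite addrC addKr.
by apply: aeW => t _; rewrite /= scaler0 addr0.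
Qed.

Lemma X_in s : inM2 (X D s).
Proof. by apply: K_inM2; apply: K_ext (K_shift s (K_zz D)) => r; rewrite addrC. Qed.
Lemma dX_in s : inM2 (dX D s).
Proof. by apply: K_inM2; apply: K_ext (K_shift s (K_Z D)) => r; rewrite addrC. Qed.
Lemma Bv_in : inM2 (Bv D). Proof. by apply: K_inM2; exact: K0. Qed.

Lemma primitive_lin a f g f' g' : primitive_on f g -> primitive_on f' g' ->
  primitive_on (fun t => a *: f t + f' t) (fun t => a *: g t + g' t).
Proof.
move=> [kg h] [kg' h']; split.
  by apply: K_ext (KD (KZ a kg) kg') => t; rewrite cut_lin.
have kt t (p : R -> 'cV[C]_n) : -1 <= t <= 0 -> K (cut (-1) 0 p) -> K (cut (-1) t p).
  move=> It kp; apply: K_ext (K_cut (-1) t kp) => r; rewrite /cut; case: (boolP (-1 <= r <= t)) => // hr.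
  by have -> : -1 <= r <= 0 by lra.
move=> t It; have k1 := K_Mi (kt _ _ It kg); have k2 := K_Mi (kt _ _ It kg').
have -> : mI (cut (-1) t (fun t => a *: g t + g' t)) = a *: mI (cut (-1) t g) + mI (cut (-1) t g').
  by rewrite -(mIZ a k1) -(mID (MiZ a k1) k2); apply: mI_ext => r; rewrite cut_lin.
by rewrite -h // -h' // scalerBr opprD addrACA.
Qed.

Lemma emb_lin a f f' : emb (fun t => a *: f t + f' t) = addM2 (scaleM2 a (emb f)) (emb f').
Proof.
rewrite /emb /addM2 /scaleM2 /=; congr pair.
by rewrite mulmxDr -scalemxAr scalerBr opprD addrACA.
Qed.

Lemma Arel_eq x y v w : Ar x v -> eqM2 x y -> eqM2 v w -> Ar y w.
Proof.
move=> [f [g [[hg hf xf] x1 e]]] [e1 e2] e'; exists f, g; split.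
- by split=> //; apply: aeS (aeI xf e2) _ => t [p q] It; rewrite -q // p.
- by rewrite -e1.
- exact: eqM2_trans (eqM2_sym e') e.
Qed.

Lemma Arel_lin a x v y w : Ar x v -> Ar y w ->
  Ar (addM2 (scaleM2 a x) y) (addM2 (scaleM2 a v) w).
Proof.
move=> /Arel_inv[f [g [h ex ev]]] /Arel_inv[f' [g' [h' ey ew]]].
have p := primitive_lin a h h'.
have kf := (inM2_K _).1 (primitive_bounded h); have kf' := (inM2_K _).1 (primitive_bounded h').
have [kg _] := h; have [kg' _] := h'.
apply: Arel_eq (Arel_emb p (eqM2_refl _)) _ _.
  rewrite emb_lin; exact: eqM2_sym (eqM2_add (eqM2_scale a ex) ey).
apply: eqM2_sym; apply: eqM2_trans (eqM2_add (eqM2_scale a ev) ew) _.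
split=> /=; last by apply: aeW.
have c2 : cnv (s2 D) (fun t => a *: g t + g' t) 0 = a *: cnv (s2 D) g 0 + cnv (s2 D) g' 0.
  rewrite (cnv_cut0 _ (@s2_supp _ _ D)) (cnv_cut0 g (@s2_supp _ _ D)) (cnv_cut0 g' (@s2_supp _ _ D)).
  rewrite -(cnv_lin_r _ _ (s2K D) kg kg'); congr (cnv _ _ _).
  by apply/funext => t; rewrite cut_lin.
have c3 : cnv (s3 D) (fun t => a *: f t + f' t) 0 = a *: cnv (s3 D) f 0 + cnv (s3 D) f' 0.
  rewrite (cnv_cut0 _ (@s3_supp _ _ D)) (cnv_cut0 f (@s3_supp _ _ D)) (cnv_cut0 f' (@s3_supp _ _ D)).
  rewrite -(cnv_lin_r _ _ (s3K D) kf kf'); congr (cnv _ _ _).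
  by apply/funext => t; rewrite cut_lin.
by rewrite c2 c3 scalerDr addrACA.
Qed.
Lemma subM2E (x y : M2 R n) : subM2 x y = addM2 (scaleM2 (-1) y) x.
Proof. by rewrite /subM2 /addM2 /=; congr pair; [exact: addrC|apply/funext => t; exact: addrC]. Qed.
Lemma Arel_sub x v y w : Ar x v -> Ar y w -> Ar (subM2 x y) (subM2 v w).
Proof. by move=> hx hy; rewrite !subM2E; exact: Arel_lin. Qed.

End Model.

(** * Identification of the orbit of (b, 0) *)

Section StepResponse.
Context (R : realType) (n : nat).
Local Notation C := R[i].
Variables (Am1 : 'M[R]_n) (b : 'cV[R]_n) (A2 A3 : R -> 'M[C]_n) (D : sys R n).
Hypothesis hA : sA D = toCmx Am1.
Hypothesis hb : sb D = toCmx b.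
Hypothesis h2 : s2 D = cut 0 1 (fun r => A2 (- r)).
Hypothesis h3 : s3 D = cut 0 1 (fun r => A3 (- r)).
Local Notation Ar := (Arel Am1 A2 A3).
Local Notation N := (sN D).
Local Notation emb := (emb D).
Variable S : R -> M2 R n -> M2 R n.
Hypothesis SA : C0_semigroup_generated_by S Ar.

Lemma cum_at0 (f : R -> 'cV[C]_n) L : K f -> (forall t, t < 0 -> f t = 0) -> cnv (Hv L n) f 0 = 0.
Proof.
move=> kf f0; rewrite conv_Hv -[RHS](@mI0 R n 1); apply: (proj2 (mI_ae (K_Mi (K_cut _ _ kf)) _ _)).
  exact: Mm_cst.
apply: aeS (@ae_neq R 0) _ => r r0; rewrite /cut; case: ifP => // /andP[_ r1].
by apply: f0; rewrite lt_neqAle r1 andbT; apply/eqP.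
Qed.

(** [Z] has just jumped to [b] at the right end of the interval. This is invisible in the second
    component, but it is the whole of the first. *)
Lemma dX0 : eqM2 (dX D 0) (Bv D).
Proof.
split.
  have := @Yf_eq _ _ D 0; rewrite lexx ler0n => /(_ isT).
  rewrite (cum_at0 _ (K_ee D) (@ee_neg _ _ D)) addr0 YfE add0r => Y.
  by rewrite /= !add0r.
apply: aeS (@ae_neq R 0) _ => r r0; rewrite /Iint /= in_itv /= => /andP[_ r1].
by rewrite add0r; apply: Z_neg; rewrite lt_neqAle r1 andbT; apply/eqP.
Qed.

Let dif_eq (a : C) (p' p q' q dp dq : 'cV[C]_n) :
  a *: ((p' + (-1) *: p) + (-1) *: (q' + (-1) *: q)) + (-1) *: (dp + (-1) *: dq) =
  (a *: (p' + (-1) *: q') + (-1) *: dp) + (-1) *: (a *: (p + (-1) *: q) + (-1) *: dq).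
Proof.
rewrite !scaleN1r !opprB.
have -> : a *: (p' - p + (q - q')) = a *: (p' - q') - a *: (p - q).
  rewrite -scalerBr; congr (_ *: _).
  by rewrite opprB addrACA [RHS]addrACA [- q' + _]addrC.
move: (a *: _) (a *: _) => u v.
by rewrite addrACA [RHS]addrACA [X in _ = _ + X]addrC.
Qed.

(** The forcing [(b, 0)] cancels in the increment of [X] over a time [e], which is thus a classical
    orbit of the homogeneous equation. *)
Lemma S_X t e : 0 <= t -> 0 < e -> t + e <= N%:R ->
  eqM2 (S t (subM2 (X D e) (X D 0))) (subM2 (X D (t + e)) (X D t)).
Proof.
move=> t0 e0 te.
pose W s := subM2 (X D (s + e)) (X D s); pose dW s := subM2 (dX D (s + e)) (dX D s).
have Wx s := X_in D s; have dWx s := dX_in D s.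
have -> : subM2 (X D e) (X D 0) = W 0 by rewrite /W add0r.
apply: (@orbit _ _ _ _ SA W dW t t0) => [s s0 st|s s0 st ep ep0].
  split; [exact: inM2_sub|exact: inM2_sub|].
  have a1 := @Arel_X _ _ Am1 A2 A3 D hA h2 h3 (s + e) ltac:(lra) ltac:(lra).
  have a2 := @Arel_X _ _ Am1 A2 A3 D hA h2 h3 s ltac:(lra) ltac:(lra).
  apply: (Arel_eq (Arel_sub hA h2 h3 a1 a2) (eqM2_refl _)).
  have gen (p q v : 'cV[C]_n) : p + (-1) *: v + (-1) *: (q + (-1) *: v) = p + (-1) *: q.
    by rewrite !scaleN1r opprB subrKA.
  split; first exact: gen.
  by apply: aeW => r _; exact: gen.
have ep4 : 0 < ep / 4 by rewrite divr_gt0.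
have [d1 d10 k1] := @X_deriv _ _ D (s + e) (ep / 4) ltac:(lra) ltac:(lra) ep4.
have [d2 d20 k2] := @X_deriv _ _ D s (ep / 4) ltac:(lra) ltac:(lra) ep4.
exists (Num.min d1 d2); first by rewrite lt_min d10.
move=> s' s'0 s't ne; rewrite lt_min => /andP[b1 b2].
have dd : s' + e - (s + e) = s' - s by lra.
have g1 := k1 (s' + e) ltac:(lra) ltac:(lra).
rewrite dd (inj_eq (addIr e)) in g1.
have g2 := k2 s' s'0 ltac:(lra) ne b2.
have -> : subM2 (scaleM2 ((s' - s)^-1)%:C (subM2 (W s') (W s))) (dW s) =
    subM2 (Xq D (s + e) (s' + e)) (Xq D s s').
  rewrite /Xq dd /W /dW /subM2 /addM2 /scaleM2 /=; congr pair; first exact: dif_eq.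
  by apply/funext => r; exact: dif_eq.
have i1 : inM2 (Xq D (s + e) (s' + e)) by apply: K_inM2; exact: K_Xq.
have i2 : inM2 (Xq D s s') by apply: K_inM2; exact: K_Xq.
apply: le_trans (nrm2_sub i1 i2) _.
have z2 : (0 : R) <= 2 by [].
apply: le_trans (lerD (ler_wpM2l z2 (g1 ne b1)) (ler_wpM2l z2 g2)) _.
by rewrite (_ : 2 * (ep / 4) + 2 * (ep / 4) = ep) //; field.
Qed.

(** [orbit] does not apply to [(b, 0)] directly. By [S_X], however, [S t] carries the difference
    quotients of [X] at 0, which tend to [dX 0], to those at [t], which tend to [dX t]. *)
Lemma S_Bvec t : 0 <= t -> t < N%:R -> eqM2 (S t (Bvec b)) (dX D t).
Proof.
move=> t0 tN; have -> : Bvec b = Bv D by rewrite /Bvec /Bv hb.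
have Sd : eqM2 (S t (Bv D)) (S t (dX D 0)).
  by apply: (S_eq SA t0 (Bv_in D) (dX_in D 0)); exact: eqM2_sym dX0.
apply: eqM2_trans Sd _.
have iS := S_in SA t0 (dX_in D 0); have id := dX_in D t.
have iy : inM2 (subM2 (S t (dX D 0)) (dX D t)) by exact: inM2_sub.
suff : eqM2 (subM2 (S t (dX D 0)) (dX D t)) (0, fun=> 0).
  case=> a c; split.
    by apply: subr0_eq; rewrite -scaleN1r.
  by apply: aeS c _ => r h Ir; apply: subr0_eq; rewrite -scaleN1r; exact: h.
apply: nrm2_eq0 => //; rewrite leNgt; apply/negP => pos.
have [M hM] := S_bd SA t0.
(* The errors of the two quotients contribute at most 2 (1 + |M|) [ep], a quarter of the norm
   assumed positive. *)
pose ep := nrm2M2 (subM2 (S t (dX D 0)) (dX D t)) / (8 * (`|M| + 1)).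
have M1 : 0 < 8 * (`|M| + 1) by rewrite mulr_gt0 // ltr_wpDl.
have ep0 : 0 < ep by rewrite divr_gt0.
have N0 : (0 : R) <= N%:R by [].
have [d1 d10 k1] := @X_deriv _ _ D t ep t0 (ltW tN) ep0.
have [d2 d20 k2] := @X_deriv _ _ D 0 ep (lexx 0) N0 ep0.
pose e := Num.min (Num.min d1 d2 / 2) (N%:R - t).
have e0 : 0 < e by rewrite lt_min divr_gt0 ?lt_min ?d10 //= subr_gt0.
have e1 : e <= Num.min d1 d2 / 2 by rewrite ge_min lexx.
have e2 : e <= N%:R - t by rewrite ge_min lexx orbT.
have m1 : Num.min d1 d2 <= d1 by rewrite ge_min lexx.
have m2 : Num.min d1 d2 <= d2 by rewrite ge_min lexx orbT.
have ed1 : e < d1 by lra.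
have ed2 : e < d2 by lra.
have te : t + e <= N%:R by lra.
have eN : e <= N%:R by lra.
have te0 : 0 <= t + e by lra.
have g1 : nrm2M2 (Xq D t (t + e)) <= ep.
  apply: k1 => //; first by rewrite -subr_eq0 addrC addKr gt_eqF.
  by rewrite addrC addKr gtr0_norm.
have g2 : nrm2M2 (Xq D 0 e) <= ep.
  by apply: k2 => //; [exact: ltW|rewrite gt_eqF|rewrite subr0 gtr0_norm].
have iq1 : inM2 (Xq D t (t + e)) by apply: K_inM2; exact: K_Xq.
have iq2 : inM2 (Xq D 0 e) by apply: K_inM2; exact: K_Xq.
pose a := (e^-1)%:C : C.
have iX : inM2 (subM2 (X D e) (X D 0)) by apply: inM2_sub; exact: X_in.
have iSq := S_in SA t0 iq2; have iSX := S_in SA t0 iX.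
have E0 : dX D 0 = addM2 (scaleM2 a (subM2 (X D e) (X D 0))) (scaleM2 (-1) (Xq D 0 e)).
  have gen (p q v : 'cV[C]_n) : v = a *: (p + (-1) *: q) + (-1) *: (a *: (p + (-1) *: q) + (-1) *: v).
    by rewrite !scaleN1r subKr.
  rewrite /Xq subr0 /subM2 /addM2 /scaleM2 /=; congr pair; first exact: gen.
  by apply/funext => r; exact: gen.
have iN : inM2 (scaleM2 (-1) (Xq D 0 e)) by exact: inM2_scale.
have E1 : eqM2 (S t (dX D 0)) (addM2 (scaleM2 a (S t (subM2 (X D e) (X D 0)))) (S t (scaleM2 (-1) (Xq D 0 e)))).
  by rewrite {1}E0; exact (S_lin SA a t0 iX iN).
have E2 : eqM2 (S t (scaleM2 (-1) (Xq D 0 e))) (scaleM2 (-1) (S t (Xq D 0 e))).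
  have iz : inM2 (scaleM2 0 (Xq D 0 e)) by exact: inM2_scale.
  have s1 (x : M2 R n) : scaleM2 (-1) x = addM2 (scaleM2 (-2) x) x.
    rewrite /addM2 /scaleM2 /=; congr pair; first by rewrite -[X in _ = _ + X]scale1r -scalerDl; congr (_ *: _); ring.
    by apply/funext => r; rewrite -[X in _ = _ + X]scale1r -scalerDl; congr (_ *: _); ring.
  rewrite s1; apply: eqM2_trans (S_lin SA _ t0 iq2 iq2) _; rewrite -s1; exact: eqM2_refl.
have E3 : eqM2 (subM2 (S t (dX D 0)) (dX D t)) (subM2 (Xq D t (t + e)) (S t (Xq D 0 e))).
  apply: eqM2_trans (eqM2_sub (eqM2_trans E1 (eqM2_add (eqM2_scale a (S_X t0 e0 te)) E2)) (eqM2_refl _)) _.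
  have gen (p q v w : 'cV[C]_n) : a *: (p + (-1) *: q) + (-1) *: w + (-1) *: v =
      a *: (p + (-1) *: q) + (-1) *: v + (-1) *: w by rewrite addrAC.
  have ae : a = ((t + e - t)^-1)%:C by rewrite /a [t + e]addrC addrK.
  rewrite /Xq -ae; split; first exact: gen.
  by apply: aeW => r _; exact: gen.
have i3 := inM2_sub iq1 iSq.
have h := nrm2_eq iy i3 E3.
have h4 := nrm2_sub iq1 iSq; have h5 := hM _ iq2.
have n2 := nrm2_ge0 (Xq D 0 e); have M0 := ler_norm M; have M2 := normr_ge0 M.
have epE : ep * (8 * (`|M| + 1)) = nrm2M2 (subM2 (S t (dX D 0)) (dX D t)) by rewrite /ep divfK // gt_eqF.
rewrite h in epE pos; move: (nrm2M2 (subM2 (Xq D t (t + e)) (S t (Xq D 0 e)))) epE pos h4 => w.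
move: (nrm2M2 (Xq D t (t + e))) (nrm2M2 (S t (Xq D 0 e))) (nrm2M2 (Xq D 0 e)) g1 g2 h5 n2 => u v x g1 g2 h5 n2 epE pos h4.
have : M * x <= `|M| * ep by nra.
nra.
Qed.

End StepResponse.

(** * Reachable states *)

Section Reachable.
Context (R : realType) (n : nat).
Local Notation C := R[i].
Variables (Am1 : 'M[R]_n) (b : 'cV[R]_n) (A2 A3 : R -> 'M[C]_n) (D : sys R n).
Hypothesis hA : sA D = toCmx Am1.
Hypothesis hb : sb D = toCmx b.
Hypothesis h2 : s2 D = cut 0 1 (fun r => A2 (- r)).
Hypothesis h3 : s3 D = cut 0 1 (fun r => A3 (- r)).
Local Notation Ar := (Arel Am1 A2 A3).
Local Notation N := (sN D).
Local Notation emb := (emb D).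
Variable S : R -> M2 R n -> M2 R n.
Hypothesis SA : C0_semigroup_generated_by S Ar.
Local Notation Z := (Z D).
Local Notation zz := (zz D).

Definition Wst (U : R -> 'M[C]_1) : M2 R n := emb (cnv Z U).
(* Reversed controls: [U r] stands for [u (- r)]. *)
Definition ctrl (T : R) (U : R -> 'M[C]_1) : Prop :=
  K U /\ forall r, ~~ (- T <= r <= 0) -> U r = 0.

Lemma Wst_in U : K U -> inM2 (Wst U).
Proof. by move=> kU; apply: K_inM2; exact: K_conv (K_Z D) kU. Qed.

Lemma ip_dX phi s : inM2 phi -> ip (dX D s) phi = adj phi.1 *m Yf D s +
  cnv (fun r => adj (cut (-1) 0 phi.2 (- r))) Z s.
Proof.
move=> /inM2_K kp; have ka := K_adj kp.
have ka' : K (fun r => adj (cut (-1) 0 phi.2 (- r))).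
  by apply: K_ext (K_refl 0 ka) => r; rewrite sub0r.
rewrite /ip (conv_flip s ka' (K_Z D)) YfE /= addr0; congr (_ + _).
have ki : Mi (fun r => adj (cut (-1) 0 phi.2 (- r)) *m Z (s - r)).
  exact: (K_mulMi ka' (K_refl s (K_Z D))).
rewrite -(mI_refl 0 ki); apply: mI_ext => r; rewrite !sub0r !opprK.
rewrite {2}/cut; case: ifP => // hr; rewrite /cut hr mulmx0.
have -> : adj (0 : 'cV[C]_n) = 0 by rewrite /adj map_mx0 trmx0.
by rewrite mul0mx.
Qed.

(** The pairing with the second component of [phi] is again a convolution at 0, with the reflected
    adjoint of [phi]. Associativity then takes the integral over the control out of the pairing. *)
Lemma ip_Wst phi U : inM2 phi -> K U ->
  Mi (fun r => ip (dX D (- r)) phi *m U r) /\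
  ip (Wst U) phi = mI (fun r => ip (dX D (- r)) phi *m U r).
Proof.
move=> hp kU; have kp := (inM2_K phi).1 hp; have ka := K_adj kp.
have ka' : K (fun r => adj (cut (-1) 0 phi.2 (- r))).
  by apply: K_ext (K_refl 0 ka) => r; rewrite sub0r.
have kZ := K_Z D; have kaZ := K_conv ka' kZ; have kZU := K_conv kZ kU.
pose al r := adj (cut (-1) 0 phi.2 (- r)).
have kY : K (Yf D).
  by apply: K_ext (KB kZ (K_mull (sA D) (K_shift (-1) kZ))) => r; rewrite YfE.
have k1 : K (fun r => adj phi.1 *m Yf D r) by exact: K_mull.
have k2 : K (fun r => adj phi.1 *m Yf D r + cnv al Z r) by exact: KD.
have E r : ip (dX D (- r)) phi *m U r = (adj phi.1 *m Yf D (0 - r) + cnv al Z (0 - r)) *m U r.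
  by rewrite (ip_dX _ hp) sub0r.
have i := conv_Mi 0 k2 kU; split; first by apply: Mi_ext i => r; rewrite E.
have -> : mI (fun r => ip (dX D (- r)) phi *m U r) = cnv (fun r => adj phi.1 *m Yf D r + cnv al Z r) U 0.
  by rewrite convE; apply: mI_ext => r; exact: E.
rewrite (convDl _ k1 kaZ kU) -(convA _ ka' kZ kU) /ip; congr (_ + _).
  have -> : cnv (fun r => adj phi.1 *m Yf D r) U 0 = adj phi.1 *m cnv (Yf D) U 0.
    by rewrite convE (conv_mull _ _ kY kU).
  congr (_ *m _).
  have -> : cnv (Yf D) U 0 = cnv (fun t => Z t - sA D *m Z (t - 1)) U 0.
    by rewrite !convE; apply: mI_ext => r; rewrite YfE.
  have kz1 := K_shift (-1) kZ; have kAz := K_mull (sA D) kz1.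
  rewrite (convDl _ kZ (KN kAz) kU) (convNl _ kAz kU) /=; congr (_ - _).
  by rewrite [in RHS]convE (conv_mull _ _ kz1 kU) conv_shiftl sub0r.
rewrite convE /=; apply: mI_ext => r; rewrite /al sub0r opprK {2}/cut; case: ifP => // hr.
rewrite /cut hr mulmx0.
have -> : adj (0 : 'cV[C]_n) = 0 by rewrite /adj map_mx0 trmx0.
by rewrite mul0mx.
Qed.

(** By [S_Bvec] and [ip_Wst] the weak integral has the same pairings as [Wst U], and pairings
    separate states by [ip_faithful]. *)
Lemma reachableP T w : 0 <= T -> T < N%:R ->
  reachable S b T w <-> inM2 w /\ exists U, ctrl T U /\ eqM2 w (Wst U).
Proof.
move=> T0 TN; have iB : inM2 (Bvec b) by apply: K_inM2; exact: K0.
have key (u : R -> C) (U : R -> 'M[C]_1) phi : inM2 phi -> K U ->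
    (forall r, U r = cut 0 T (fun t => (u t)%:M) (- r)) ->
    cint `[0%R, T]%classic (fun t => u t * ipM2 (S t (Bvec b)) phi) = ip (Wst U) phi 0 0.
  move=> hp kU EU; have [i ->] := ip_Wst hp kU.
  rewrite -(mI_refl 0 i) mIE cint_itv; apply: cI_ext => t.
  rewrite sub0r opprK EU opprK /cut /ind; case: (boolP (0 <= t <= T)) => ht; last first.
    by rewrite mulmx0 mul0r mxE.
  move/andP: ht => [t0 tT]; rewrite mul1r ipE.
  have iS := S_in SA t0 iB; have tN : t < N%:R by lra.
  rewrite (ip_eq iS (dX_in D t) hp (S_Bvec hA hb h2 h3 SA t0 tN)).
  move: (ip (dX D t) phi) => M; by rewrite mul_mx_scalar mxE.
split=> [[hw [u [hu h]]]|[hw [U [[kU U0] e]]]].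
  have ku := (cL2_K _ _ _).1 hu.
  pose U r := cut 0 T (fun t => (u t)%:M : 'M[C]_1) (- r).
  have kU : K U by apply: K_ext (K_refl 0 ku) => r; rewrite sub0r.
  split=> //; exists U; split.
    split=> // r hr; rewrite /U /cut; case: ifP => // hr'; case/negP: hr; lra.
  have iW := Wst_in kU; have iy := inM2_sub hw iW.
  suff : eqM2 (subM2 w (Wst U)) (0, fun=> 0).
    case=> a c; split; first by apply: subr0_eq; rewrite -scaleN1r.
    by apply: aeS c _ => r h' Ir; apply: subr0_eq; rewrite -scaleN1r; exact: h'.
  apply: (ip_faithful iy) => phi hp; rewrite (ip_sub hw iW hp).
  have m1 (P Q : 'M[C]_1) : P 0 0 = Q 0 0 -> P - Q = 0.
    move=> e; apply/matrixP => i j; rewrite (ord1 i) (ord1 j) !mxE e subrr //.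
  exact: m1 (etrans (esym (ipE w phi)) (etrans (h phi hp) (key u U phi hp kU (fun r => erefl)))).
split=> //; pose u t := U (- t) 0 0; exists u.
have EU r : U r = cut 0 T (fun t => (u t)%:M) (- r).
  rewrite /cut /u opprK; case: ifP => hr.
    by apply/matrixP => i j; rewrite (ord1 i) (ord1 j) mxE eqxx mulr1n.
  by apply: U0; apply: contraFN hr; lra.
split.
  apply/cL2_K; apply: K_ext (K_refl 0 kU) => r; rewrite sub0r EU opprK //.
move=> phi hp; rewrite (key u U phi hp kU EU) ipE.
by rewrite (ip_eq hw (Wst_in kU) hp e).
Qed.

Lemma ctrl_neg T U : T <= N%:R -> ctrl T U -> forall r, r < - N%:R -> U r = 0.
Proof. by move=> TN [_ h] r hr; apply: h; apply/negP => /andP[]; lra. Qed.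

Lemma zeta_primitive T U : T <= N%:R -> ctrl T U -> primitive_on (cnv Z U) (rho D U).
Proof.
move=> TN hU; have kU := hU.1; split; first by apply: K_cut; exact: K_rho.
by move=> t /andP[t1 t2]; apply: zeta_diff => //; [exact: ctrl_neg TN hU|lra].
Qed.

Lemma Arel_Wst T U : T <= N%:R -> ctrl T U ->
  Ar (Wst U) (cnv (s2 D) (rho D U) 0 + cnv (s3 D) (cnv Z U) 0, rho D U).
Proof.
by move=> TN hU; apply: (Arel_emb hA h2 h3 (zeta_primitive TN hU)); exact: eqM2_refl.
Qed.

(** The superposition of [Arel_X] with weight [V]: each [X (- r)] contributes [dX (- r)] minus
    [(b, 0)]. It serves to compute resolvents of reachable states. *)
Lemma Arel_zz T V : T <= N%:R -> ctrl T V ->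
  Ar (emb (cnv zz V)) (subM2 (Wst V) (sb D *m mI V, fun=> 0)).
Proof.
move=> TN hV; have kV := hV.1; have V0 := ctrl_neg TN hV.
have kZ := K_Z D; have kz := K_zz D; have K2 := s2K D; have K3 := s3K D.
have pr : primitive_on (cnv zz V) (cnv Z V).
  split; first by apply: K_cut; exact: K_conv.
  by move=> t /andP[t1 t2]; apply: zz_conv_diff => //; lra.
apply: (Arel_emb hA h2 h3 pr); split; last first.
  by apply: aeW => t _; rewrite /= scaler0 addr0.
rewrite /= (convA _ K2 kZ kV) (convA _ K3 kz kV) -(convDl _ (K_conv K2 kZ) (K_conv K3 kz) kV).
have -> : cnv (fun s => cnv (s2 D) Z s + cnv (s3 D) zz s) V 0 =
    cnv (fun t => Z t - sA D *m Z (t - 1)) V 0 - sb D *m mI V.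
  have kY := KB kZ (K_mull (sA D) (K_shift (-1) kZ)).
  rewrite !convE -(mI_mull _ (K_Mi kV)) -mIB; [|exact: (conv_Mi 0 kY kV)|exact: Mi_mull (K_Mi kV)].
  apply: mI_ext => r; rewrite -mulmxBl -sk_Z.
  case: (boolP (- T <= r <= 0)) => hr; last by rewrite (hV.2 r hr) !mulmx0.
  congr (_ *m _); move/andP: hr => [r1 r2].
  have hr : 0 <= 0 - r <= N%:R by apply/andP; split; lra.
  have := @Yf_eq _ _ D (0 - r) hr; rewrite YfE -skZ_ee => ->.
  by move: (sb D) (cnv _ _ _) => p q; rewrite addrAC subrr add0r.
have kz1 := K_shift (-1) kZ; have kAz := K_mull (sA D) kz1.
rewrite (convDl _ kZ (KN kAz) kV) (convNl _ kAz kV).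
have -> : cnv (fun t => sA D *m Z (t - 1)) V 0 = sA D *m cnv Z V (-1).
  by rewrite convE (conv_mull _ _ kz1 kV) conv_shiftl sub0r.
by rewrite scaleN1r.
Qed.

End Reachable.

(** * The Fredholm alternative *)

Section ContinuousApproximation.
Context (R : realType).
Local Notation C := R[i].
Local Notation mu := (@lebesgue_measure R).

(** Heine's theorem by continuous induction: were the supremum [c] of the good right ends below [b],
    continuity at [c] would extend the property beyond it. *)
Lemma uniform_continuity (f : R -> R) (a b w : R) : a <= b -> continuous f -> 0 < w ->
  exists2 d, 0 < d & forall s t, a <= s <= b -> a <= t <= b -> `|s - t| <= d -> `|f s - f t| <= w.
Proof.
move=> ab cf w0.
pose P x := exists2 d, 0 < d & forall s t, a <= s <= x -> a <= t <= x -> `|s - t| <= d -> `|f s - f t| <= w.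
pose E := [set x | a <= x <= b /\ P x].
have Ea : E a.
  split; first by rewrite lexx ab.
  exists 1 => // s t; rewrite -!eq_le => /eqP <- /eqP <- _; by rewrite subrr normr0 ltW.
have hE : has_sup E by split; [exists a|exists b => x [/andP[]]].
pose c := sup E.
have ac : a <= c by apply: ub_le_sup => //; case: hE.
have [dc dc0 hc] : exists2 d, 0 < d & forall y, `|y - c| < d -> `|f y - f c| <= w / 2.
  have /cvgrPdist_lt/(_ (w / 2)) := cf c; rewrite divr_gt0 // => /(_ isT) [d /= d0 hd].
  exists d => // y yc; have := hd y; rewrite /ball_ /= distrC => /(_ yc) /ltW.
  by rewrite distrC.
have dc2 : 0 < dc / 2 by rewrite divr_gt0.
have [x [/andP[ax xb] [dx dx0 hx]] xc] := sup_adherent dc2 hE; rewrite -/c in xc.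
pose y := Num.min b (c + dc / 2).
have yb : y <= b by rewrite ge_min lexx.
have yc : y <= c + dc / 2 by rewrite ge_min lexx orbT.
have Py : P y.
  exists (Num.min dx (dc / 4)); first by rewrite lt_min dx0 divr_gt0.
  move=> s t /andP[as' sy] /andP[at' ty]; rewrite le_min => /andP[st1 st2].
  have [/andP[sx tx]|nst] := boolP ((s <= x) && (t <= x)).
    by apply: hx => //; rewrite ?as' ?at'.
  have s1 : s - t <= dc / 4 by apply: le_trans st2; exact: ler_norm.
  have s2 : t - s <= dc / 4 by apply: le_trans st2; rewrite distrC; exact: ler_norm.
  have big : c - dc < s /\ c - dc < t.
    move: nst; rewrite negb_and -!ltNge => /orP[h|h]; split; lra.
  have [b1 b2] := big.
  have c1 : `|s - c| < dc by rewrite ltr_norml; apply/andP; split; lra.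
  have c2 : `|t - c| < dc by rewrite ltr_norml; apply/andP; split; lra.
  have -> : f s - f t = (f s - f c) - (f t - f c) by lra.
  apply: le_trans (ler_normB _ _) _.
  have := hc s c1; have := hc t c2; lra.
have Ey : E y.
  by split=> //; rewrite yb andbT le_min ab /=; lra.
have yle : y <= c by apply: ub_le_sup => //; case: hE.
have yE : y = b.
  rewrite /y; case: (leP b (c + dc / 2)) => // h.
  by exfalso; move: yle; rewrite /y min_r ?(ltW h) //; lra.
by case: Py => d d0 hd; exists d => // s t hs ht; apply: hd; rewrite yE.
Qed.

Lemma L1_continuous_approx (f : R -> R) (a b e : R) : 0 < e -> ri (fun t => ind a b t * f t) ->
  exists g : R -> R, [/\ continuous g, ri (fun t => ind a b t * g t) &
    rI (fun t => `|ind a b t * f t - ind a b t * g t|) <= e].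
Proof.
move=> e0 fi; have mi : measurable (`[a, b]%classic : set R) by exact: measurable_itv.
have fE : mu.-integrable `[a, b]%classic (EFin \o f) by apply/ri_onP.
have mlt : (mu `[a, b]%classic < +oo)%E.
  by rewrite lebesgue_measure_itv /=; case: ifP => _; rewrite ?ltry.
have [g_ [cg ig lim]] := approximation_continuous_integrable mi mlt fE.
have /fine_cvgP[_ /cvgrPdist_lt/(_ e e0)] := lim; move=> [k _ /(_ k (leqnn k))] /=.
rewrite sub0r normrN => hk; exists (g_ k); split=> //; first exact/ri_onP.
rewrite (@rI_ext _ _ (fun t => ind a b t * `|f t - g_ k t|)); last first.
  by move=> t; rewrite -mulrBr normrM ger0_norm // /ind ler0n.
rewrite rI_onE; apply: ltW; apply: le_lt_trans hk; apply: le_trans (ler_norm _).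
by rewrite /Rintegral.
Qed.

Lemma K_continuous_approx m n (f : R -> 'M[C]_(m, n)) (a b e : R) : a <= b -> 0 < e -> K f ->
  exists g : R -> 'M[C]_(m, n), [/\ K (cut a b g),
    forall w, 0 < w -> exists2 d, 0 < d & forall s t, a <= s <= b -> a <= t <= b ->
      `|s - t| <= d -> mn (g s - g t) <= w &
    rI (fun t => mn (cut a b f t - cut a b g t)) <= e].
Proof.
move=> ab e0 kf; have kc := K_cut a b kf.
pose c : R := \sum_(i < m) \sum_(j < n) 2.
have c0 : 0 <= c by apply: sumr_ge0 => i _; apply: sumr_ge0.
pose e1 := e / (c + 1).
have e10 : 0 < e1 by rewrite divr_gt0 // ltr_wpDl.
have hR i j : exists g : R -> R, [/\ continuous g, ri (fun t => ind a b t * g t) &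
    rI (fun t => `|ind a b t * complex.Re (f t i j) - ind a b t * g t|) <= e1].
  apply: L1_continuous_approx => //; have [r _] := K_Mi kc i j.
  by apply: ri_ext r => t; have /(congr1 (fun F => F t)) := cutRe a b f i j.
have hI i j : exists g : R -> R, [/\ continuous g, ri (fun t => ind a b t * g t) &
    rI (fun t => `|ind a b t * complex.Im (f t i j) - ind a b t * g t|) <= e1].
  apply: L1_continuous_approx => //; have [_ r] := K_Mi kc i j.
  by apply: ri_ext r => t; have /(congr1 (fun F => F t)) := cutIm a b f i j.
have [gR hgR] := choice (fun ij : 'I_m * 'I_n => hR ij.1 ij.2).
have [gI hgI] := choice (fun ij : 'I_m * 'I_n => hI ij.1 ij.2).
pose g t : 'M[C]_(m, n) := \matrix_(i, j) (gR (i, j) t +i* gI (i, j) t).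
have unif (w : R) : 0 < w -> exists2 d, 0 < d & forall s t, a <= s <= b -> a <= t <= b ->
    `|s - t| <= d -> mn (g s - g t) <= w.
  move=> w0; pose w1 := w / (c + 1).
  have w10 : 0 < w1 by rewrite divr_gt0 // ltr_wpDl.
  have hd (ij : 'I_m * 'I_n) : exists d, 0 < d /\ forall s t, a <= s <= b -> a <= t <= b ->
      `|s - t| <= d -> `|gR ij s - gR ij t| <= w1 /\ `|gI ij s - gI ij t| <= w1.
    have [cR _ _] := hgR ij; have [cI' _ _] := hgI ij.
    have [d1 d10 k1] := uniform_continuity ab cR w10.
    have [d2 d20 k2] := uniform_continuity ab cI' w10.
    exists (Num.min d1 d2); split; first by rewrite lt_min d10.
    by move=> s t hs ht; rewrite le_min => /andP[x y]; split; [exact: k1|exact: k2].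
  have [dd hdd] := choice hd.
  pose d := \big[Num.min/1]_(ij : 'I_m * 'I_n) dd ij.
  have d0 : 0 < d.
    by rewrite /d; elim/big_ind : _ => // [x y x0 y0|ij _]; [rewrite lt_min x0|case: (hdd ij)].
  have dle ij : d <= dd ij by apply: bigmin_le_cond.
  exists d => // s t hs ht st.
  apply: (@le_trans _ _ (\sum_(i < m) \sum_(j < n) (2 * w1))).
    apply: ler_sum => i _; apply: ler_sum => j _.
    have [_ /(_ s t hs ht (le_trans st (dle _))) [p q]] := hdd (i, j).
    rewrite !mxE /n1 /=; lra.
  have -> : \sum_(i < m) \sum_(j < n) (2 * w1) = c * w1.
    by rewrite /c mulr_suml; apply: eq_bigr => i _; rewrite mulr_suml.
  rewrite /w1 mulrA ler_pdivrMr ?ltr_wpDl //; nra.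
have mg : Mm g.
  move=> i j; split.
    apply: (@eq_measurable_fun _ _ _ _ _ (gR (i, j))); first by move=> t _; rewrite mxE.
    by apply: continuous_measurable_fun; case: (hgR (i, j)).
  apply: (@eq_measurable_fun _ _ _ _ _ (gI (i, j))); first by move=> t _; rewrite mxE.
  by apply: continuous_measurable_fun; case: (hgI (i, j)).
have bnd (k : R -> R) : continuous k -> exists B, forall t, a <= t <= b -> `|k t| <= B.
  move=> ck; have ck' : {within `[a, b], continuous (fun t => `|k t|)}.
    apply: continuous_subspaceT => x; apply: continuous_comp; first exact: ck.
    exact: norm_continuous.
  have [x _ hx] := EVT_max ab ck'; exists `|k x| => t ht.
  by apply: hx; rewrite in_itv.
have [BR hBR] := choice (fun ij : 'I_m * 'I_n => bnd (gR ij) (let: And3 p _ _ := hgR ij in p)).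
have [BI hBI] := choice (fun ij : 'I_m * 'I_n => bnd (gI ij) (let: And3 p _ _ := hgI ij in p)).
have kg : K (cut a b g).
  apply: (@K_cutb _ _ _ _ _ _ (\sum_(i < m) \sum_(j < n) (BR (i, j) + BI (i, j)))) => // t ht.
  apply: ler_sum => i _; apply: ler_sum => j _; rewrite mxE /n1 /=.
  by apply: lerD; [exact: hBR|exact: hBI].
exists g; split=> //; have kd := KB kc kg.
have E t : mn (cut a b f t - cut a b g t) = \sum_(i < m) \sum_(j < n)
   (`|ind a b t * complex.Re (f t i j) - ind a b t * gR (i, j) t| +
    `|ind a b t * complex.Im (f t i j) - ind a b t * gI (i, j) t|).
  apply: eq_bigr => i _; apply: eq_bigr => j _.
  have -> : (cut a b f t - cut a b g t) i j = (ind a b t)%:C * (f t i j - (gR (i, j) t +i* gI (i, j) t)).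
    by rewrite !cutE -scalerBr !mxE.
  rewrite /n1 cReZr cImZr cReD cImD cReN cImN /= !mulrDr !mulrN //.
have rR i j : ri (fun t => `|ind a b t * complex.Re (f t i j) - ind a b t * gR (i, j) t|).
  apply: ri_abs; have [_ r _] := hgR (i, j); apply: riD; last exact: riN.
  by have [r' _] := K_Mi kc i j; apply: ri_ext r' => t; have /(congr1 (fun F => F t)) := cutRe a b f i j.
have rIm i j : ri (fun t => `|ind a b t * complex.Im (f t i j) - ind a b t * gI (i, j) t|).
  apply: ri_abs; have [_ r _] := hgI (i, j); apply: riD; last exact: riN.
  by have [_ r'] := K_Mi kc i j; apply: ri_ext r' => t; have /(congr1 (fun F => F t)) := cutIm a b f i j.
rewrite (rI_ext E) rI_sum; last by move=> i; apply: ri_sum => j; exact: riD.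
apply: (@le_trans _ _ (\sum_(i < m) \sum_(j < n) (2 * e1))).
  apply: ler_sum => i _; rewrite rI_sum; last by move=> j; exact: riD.
  apply: ler_sum => j _; rewrite rID //.
  have [_ _ p] := hgR (i, j); have [_ _ q] := hgI (i, j).
  by rewrite mulrDl mul1r; exact: lerD.
have -> : \sum_(i < m) \sum_(j < n) (2 * e1) = c * e1.
  by rewrite /c mulr_suml; apply: eq_bigr => i _; rewrite mulr_suml.
rewrite /e1 mulrA ler_pdivrMr ?ltr_wpDl //; nra.
Qed.

End ContinuousApproximation.

Section HalfOpen.
Context (R : realType).
Local Notation C := R[i].

(** Half-open, so that the integer translates of []-1, 0]] tile []- n, 0]] without overlap. *)
Definition hcut m n (a c : R) (f : R -> 'M[C]_(m, n)) t : 'M[C]_(m, n) :=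
  cut a c f t - cut a a f t.
Lemma hcutE m n a c (f : R -> 'M[C]_(m, n)) t : a <= c ->
  hcut a c f t = if a < t <= c then f t else 0.
Proof.
move=> ac; rewrite /hcut /cut; have [->|ne] := eqVneq t a.
  by rewrite lexx ac ltxx /= subrr.
have -> : (a <= t <= a) = false.
  by apply/negP => /andP[x y]; case/negP: ne; rewrite eq_le x y.
have -> : (a < t <= c) = (a <= t <= c) by rewrite lt_def ne.
by rewrite subr0.
Qed.
Lemma K_hcut m n a c (f : R -> 'M[C]_(m, n)) : K (cut a c f) -> a <= c -> K (hcut a c f).
Proof.
move=> kf ac; apply: KB => //; apply: K_ext (K_cut a a kf) => t; rewrite /cut.
case: (boolP (a <= t <= a)) => // /andP[x y].
by have -> : a <= t <= c by rewrite x (le_trans y).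
Qed.
Lemma Mm_hcut m n a c (f : R -> 'M[C]_(m, n)) : Mm f -> Mm (hcut a c f).
Proof. by move=> mf; apply: MmB; exact: Mm_cut. Qed.
Lemma mn_hcut m n a c (f : R -> 'M[C]_(m, n)) t : a <= c -> mn (hcut a c f t) <= mn (f t).
Proof. by move=> ac; rewrite hcutE //; case: ifP => // _; rewrite mn0 mn_ge0. Qed.

(** Preimages of the unit vectors form a one-sided inverse of the matrix of [P], whose rank then has
    to be [#|J|]. *)
Lemma no_surjection (I J : finType) (P : I -> J -> C) :
  (forall y : J -> C, exists e : I -> C, forall j, y j = \sum_i e i * P i j) ->
  (#|J| <= #|I|)%N.
Proof.
move=> h.
pose M := \matrix_(a < #|I|, c < #|J|) P (enum_val a) (enum_val c).
have h' (k : 'I_#|J|) : exists e : I -> C, forall j, (j == enum_val k)%:R = \sum_i e i * P i j.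
  exact: h (fun j => (j == enum_val k)%:R).
have [E hE] := choice h'.
pose EM := \matrix_(k < #|J|, a < #|I|) E k (enum_val a).
have EMM : EM *m M = 1%:M.
  apply/matrixP => k c; rewrite !mxE.
  have := hE k (enum_val c); rewrite (inj_eq enum_val_inj) eq_sym => ->.
  rewrite (reindex _ (onW_bij _ (@enum_val_bij I))) /=.
  by apply: eq_bigr => a _; rewrite !mxE.
rewrite -(mxrank1 C #|J|) -EMM; apply: leq_trans (mxrankM_maxl _ _) _.
exact: rank_leq_col.
Qed.
End HalfOpen.

(** * Inverting the jump operator *)

Section Fredholm.
Context (R : realType) (n : nat) (D : sys R n).
Local Notation C := R[i].
Local Notation A := (sA D).
Local Notation b := (sb D).
Local Notation N := (sN D).
Local Notation h := (sh D).
Local Notation bj := (bj A b).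
Hypothesis nN : (n <= N.+1)%N.
Variable Q : 'M[C]_n.
Hypothesis hQ : (\matrix_(i < n, k < n) bj k i 0) *m Q = 1%:M.

(** The basis dual to [b], [A b], ..., [A^(n-1) b], continued by 0 to all indices so that it pairs
    with sums up to the horizon. *)
Definition rq (j : nat) : 'rV[C]_n := if insub j is Some i then row i Q else 0.
Lemma rq_row (i : 'I_n) : rq i = row i Q.
Proof. by rewrite /rq insubT //= => hi; congr (row _ Q); apply: val_inj. Qed.
Lemma rq0 j : (n <= j)%N -> rq j = 0.
Proof. by move=> nj; rewrite /rq insubF // ltnNge nj. Qed.

Lemma bj_rq : \sum_(j < n) bj j *m rq j = 1%:M.
Proof.
rewrite -hQ; apply/matrixP => i l; rewrite summxE [RHS]mxE; apply: eq_bigr => j _.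
by rewrite rq_row !mxE big_ord1 !mxE.
Qed.
Lemma rq_bj (i j : nat) : (i < n)%N -> (j < n)%N -> rq i *m bj j = ((i == j)%:R)%:M.
Proof.
move=> hi hj; have := mulmx1C hQ => /matrixP/(_ (Ordinal hi) (Ordinal hj)).
rewrite !mxE => e; apply/matrixP => k l; rewrite (ord1 k) (ord1 l).
have -> : rq i = row (Ordinal hi) Q by exact: (rq_row (Ordinal hi)).
rewrite !mxE eqxx mulr1n; transitivity ((Ordinal hi == Ordinal hj)%:R : C); last by [].
by rewrite -e; apply: eq_bigr => t _; rewrite !mxE.
Qed.

(** The inverse of [Jop] on controls living in []- n, 0]]: for [t] in []-1, 0]], the values of [U]
    at the points [t - j] are the coordinates of [f t] in the basis of the [bj j]. *)
Definition Jinv (f : R -> 'cV[C]_n) r : 'M[C]_1 := \sum_(j < n) rq j *m hcut (-1) 0 f (r + j%:R).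
Definition Jop (U : R -> 'M[C]_1) t : 'cV[C]_n := \sum_(j < N.+1) bj j *m U (t - j%:R).
Definition ctrl' (U : R -> 'M[C]_1) := K U /\ forall r, ~~ (- n%:R < r <= 0) -> U r = 0.

Let l10 : (-1 : R) <= 0. Proof. by rewrite lerN10. Qed.

Lemma K_Jinv f : K (cut (-1) 0 f) -> K (Jinv f).
Proof. by move=> kf; apply: K_sum => j; apply: K_mull; apply: K_shift; exact: K_hcut. Qed.
Lemma Jinv_ctrl f : K (cut (-1) 0 f) -> ctrl' (Jinv f).
Proof.
move=> kf; split; first exact: K_Jinv.
move=> r hr; rewrite /Jinv big1 // => j _; rewrite hcutE //; case: ifP; rewrite ?mulmx0 // => hj.
case/negP: hr; have j0 : (0 : R) <= j%:R by [].
have jn : (j%:R : R) + 1 <= n%:R by rewrite natr1 ler_nat.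
by apply/andP; split; lra.
Qed.
Lemma block_unique (i j : nat) (t : R) : -1 < t -> t <= 0 -> (-1 < t - i%:R + j%:R <= 0) = (i == j).
Proof.
move=> t1 t0; case: (ltngtP i j) => ij.
- have : (i%:R : R) + 1 <= j%:R by rewrite natr1 ler_nat.
  by move=> x; apply/negP => /andP[]; lra.
- have : (j%:R : R) + 1 <= i%:R by rewrite natr1 ler_nat.
  by move=> x; apply/negP => /andP[]; lra.
- by rewrite ij subrK t1 t0.
Qed.
Lemma Jinv_block f (i : nat) t : -1 < t -> t <= 0 -> Jinv f (t - i%:R) = rq i *m f t.
Proof.
move=> t1 t0; have E (j : 'I_n) : rq j *m hcut (-1) 0 f (t - i%:R + j%:R) =
    if i == j then rq j *m f t else 0.
  rewrite hcutE // block_unique //; case: eqP => [->|_]; last by rewrite mulmx0.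
  by rewrite subrK.
rewrite /Jinv (eq_bigr _ (fun j _ => E j)); have [ni|hi] := leqP n i.
  rewrite rq0 // mul0mx big1 // => j _; case: eqP => // e.
  by move: (ltn_ord j); rewrite -e ltnNge ni.
rewrite (bigD1 (Ordinal hi)) //= eqxx big1 ?addr0 // => j ji.
by case: eqP => // e; case/eqP: ji; apply: val_inj.
Qed.
Lemma Jop_Jinv f t : -1 < t -> t <= 0 -> Jop (Jinv f) t = f t.
Proof.
move=> t1 t0; rewrite /Jop.
have E (j : 'I_N.+1) : bj j *m Jinv f (t - j%:R) = bj j *m (rq j *m f t).
  by rewrite Jinv_block.
rewrite (eq_bigr _ (fun j _ => E j)) -[RHS]mul1mx -bj_rq mulmx_suml.
rewrite [RHS](eq_bigr (fun j : 'I_n => bj j *m (rq j *m f t))); last by move=> j _; rewrite mulmxA.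
rewrite [RHS](big_ord_widen N.+1 (fun j => bj j *m (rq j *m f t)) nN).
rewrite [RHS]big_mkcond /=; apply: eq_bigr => j _; case: ifP => // /negbT.
by rewrite -leqNgt => nj; rewrite rq0 // mul0mx mulmx0.
Qed.
Lemma Jinv_Jop U r : ctrl' U -> Jinv (Jop U) r = U r.
Proof.
move=> [kU U0]; have [hr|hr] := boolP (- n%:R < r <= 0); last first.
  rewrite U0 // /Jinv big1 // => j _; rewrite hcutE //; case: ifP; rewrite ?mulmx0 // => hj.
  case/negP: hr; have j0 : (0 : R) <= j%:R by [].
  have jn : (j%:R : R) + 1 <= n%:R by rewrite natr1 ler_nat.
  by apply/andP; split; lra.
(* [i] is the number of the unit block that contains [r], counted back from 0. *)
move/andP: hr => [r1 r0]; pose i := Num.trunc (- r).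
have nr0 : 0 <= - r by lra.
have /andP[i1 i2] := truncn_itv nr0; rewrite -/i -natr1 in i1 i2.
have hi : (i < n)%N by rewrite -(ltr_nat R); lra.
have -> : r = (r + i%:R) - i%:R by rewrite addrK.
have t1 : -1 < r + i%:R by lra.
have t0 : r + i%:R <= 0 by lra.
rewrite Jinv_block // /Jop mulmx_sumr.
have E (j : 'I_N.+1) : rq i *m (bj j *m U (r + i%:R - j%:R)) = if i == j then U (r + i%:R - i%:R) else 0.
  have [hj|nj] := ltnP j n.
    rewrite mulmxA rq_bj //; case: eqP => [->|_]; first by rewrite mul1mx.
    by rewrite raddf0 mul0mx.
  rewrite U0 ?mulmx0; last first.
    have : (n%:R : R) <= j%:R by rewrite ler_nat.
    by move=> x; apply/negP => /andP[]; lra.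
  by case: eqP => // e; move: hi; rewrite e ltnNge nj.
rewrite (eq_bigr _ (fun j _ => E j)).
have iN : (i < N.+1)%N by exact: leq_trans hi nN.
rewrite (bigD1 (Ordinal iN)) //= eqxx big1 ?addr0 // => j ji.
by case: eqP => // e; case/eqP: ji; apply: val_inj.
Qed.
Definition cQ : R := \sum_(j < n) mn (rq j).
Lemma cQ_ge0 : 0 <= cQ. Proof. by apply: sumr_ge0 => j _; exact: mn_ge0. Qed.
Lemma Jinv_bound f M r : (forall t, mn (f t) <= M) -> mn (Jinv f r) <= cQ * M.
Proof.
move=> hf; apply: le_trans (mn_sum _ _) _; rewrite /cQ mulr_suml; apply: ler_sum => j _.
apply: le_trans (mnM _ _) _; apply: ler_wpM2l; first exact: mn_ge0.
exact: le_trans (mn_hcut _ _ l10) (hf _).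
Qed.
Lemma Jinv_lin a f g r : Jinv (fun t => a *: f t + g t) r = a *: Jinv f r + Jinv g r.
Proof.
rewrite /Jinv scaler_sumr -big_split /=; apply: eq_bigr => j _.
have -> : hcut (-1) 0 (fun t => a *: f t + g t) (r + j%:R) =
    a *: hcut (-1) 0 f (r + j%:R) + hcut (-1) 0 g (r + j%:R).
  by rewrite /hcut !cut_lin scalerBr opprD addrACA.
by rewrite mulmxDr -scalemxAr.
Qed.

End Fredholm.

(** * Step functions on the delay interval *)

Section Steps.
Context (R : realType).
Local Notation C := R[i].

Lemma hcutB m n (a c : R) (f g : R -> 'M[C]_(m, n)) t :
  hcut a c f t - hcut a c g t = hcut a c (fun s => f s - g s) t.
Proof. by rewrite /hcut /cut; do 2 case: ifP => _; rewrite ?subrr ?subr0 ?subrr // !sub0r opprK opprB addrC. Qed.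
Lemma hcut_bound m n (a c M : R) (f : R -> 'M[C]_(m, n)) t : a <= c -> 0 <= M ->
  (forall s, a < s -> s <= c -> mn (f s) <= M) -> mn (hcut a c f t) <= M.
Proof. by move=> ac M0 H; rewrite hcutE //; case: ifP => [/andP[x y]|_]; [exact: H|rewrite mn0]. Qed.

Lemma conv_ae m n p (f : R -> 'M[C]_(m, n)) (g g' : R -> 'M[C]_(n, p)) t : K f -> K g -> K g' ->
  {ae @lebesgue_measure R, forall r, g r = g' r} -> cnv f g t = cnv f g' t.
Proof.
move=> kf kg kg' e; rewrite !convE.
have e2 : {ae @lebesgue_measure R, forall r, f (t - r) *m g r = f (t - r) *m g' r}.
  exact: (aeS e (fun r er => congr1 (mulmx (f (t - r))) er)).
exact: (mI_ae (conv_Mi t kf kg) (Mi_Mm (conv_Mi t kf kg')) e2).2.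
Qed.

(** The value [v] on the [i]-th of the [m] equal blocks of []-1, 0]], counted back from 0. *)
Definition stp p q (m i : nat) (v : 'M[C]_(p, q)) : R -> 'M[C]_(p, q) :=
  hcut (- (i.+1%:R / m%:R)) (- (i%:R / m%:R)) (fun=> v).

Lemma stp_le (m i : nat) : (- (i.+1%:R / m%:R) : R) <= - (i%:R / m%:R).
Proof. by rewrite lerN2 ler_wpM2r ?invr_ge0 // ler_nat. Qed.
Lemma stpE p q m i (v : 'M[C]_(p, q)) t :
  stp m i v t = if - (i.+1%:R / m%:R) < t <= - (i%:R / m%:R) then v else 0.
Proof. by rewrite /stp hcutE // stp_le. Qed.
Lemma K_stp p q m i (v : 'M[C]_(p, q)) : K (stp m i v).
Proof.
apply: K_hcut; last exact: stp_le.
by apply: (@K_cutb _ _ _ _ _ _ (mn v)) => //; exact: Mm_cst.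
Qed.
Lemma mn_stp p q m i (v : 'M[C]_(p, q)) t : mn (stp m i v t) <= mn v.
Proof. by apply: mn_hcut; exact: stp_le. Qed.
Lemma stp_lin p q m i a (v w : 'M[C]_(p, q)) t :
  stp m i (a *: v + w) t = a *: stp m i v t + stp m i w t.
Proof. by rewrite !stpE; case: ifP; rewrite ?scaler0 ?addr0. Qed.

(* [Num.trunc (- t * m)] is the only block containing [t]. *)
Lemma stp_sum p q m (F : 'I_m -> 'M[C]_(p, q)) (t : R) : (0 < m)%N -> -1 < t -> t <= 0 ->
  exists i : 'I_m, - (i.+1%:R / m%:R) < t <= - (i%:R / m%:R) /\ \sum_(j < m) stp m j (F j) t = F i.
Proof.
move=> m0 t1 t0; have m0R : (0 : R) < m%:R by rewrite ltr0n.
have H (j : nat) : (- (j.+1%:R / m%:R) < t <= - (j%:R / m%:R)) = (Num.trunc (- t * m%:R) == j).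
  have tm0 : 0 <= - t * m%:R by apply: mulr_ge0; [lra|exact: ltW].
  rewrite truncn_eq // ltrNl lerNr ltr_pdivlMr // ler_pdivrMr //.
  by rewrite andbC.
have hi : (Num.trunc (- t * m%:R) < m)%N.
  rewrite -(ltr_nat R); apply: (@le_lt_trans _ _ (- t * m%:R)).
    by rewrite truncn_le; apply: mulr_ge0; [lra|exact: ltW].
  by rewrite -[X in _ < X]mul1r ltr_pM2r //; lra.
exists (Ordinal hi); split; first by rewrite H.
rewrite (bigD1 (Ordinal hi)) //= stpE H eqxx big1 ?addr0 // => j ji.
rewrite stpE H; case: eqP => // e; case/eqP: ji; exact: val_inj.
Qed.
End Steps.

(** * Finite-rank approximation and solvability *)

Section FredholmAlternative.
Context (R : realType) (n : nat) (D : sys R n).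
Local Notation C := R[i].
Local Notation mu := (@lebesgue_measure R).
Local Notation h := (sh D).
Local Notation bj := (bj (sA D) (sb D)).
Hypothesis nN : (n <= (sN D).+1)%N.
Variable Q : 'M[C]_n.
Hypothesis hQ : (\matrix_(i < n, k < n) bj k i 0) *m Q = 1%:M.
Local Notation ctrl' := (@ctrl' R n).

(** Half of [e] pays for replacing [h] by a continuous kernel close in the integral norm. The other
    half pays for moving from [t] to a sampling point, by the modulus of continuity of that kernel
    times the length [n] of the support of [U]. *)
Lemma kernel_approx (e : R) : 0 < e -> exists m (hc : R -> 'cV[C]_n), [/\ (0 < m)%N, K hc &
  forall U (M t s : R), ctrl' U -> (forall r, mn (U r) <= M) -> -1 <= t <= 0 -> -1 <= s <= 0 ->
    `|t - s| <= m%:R^-1 -> mn (cnv h U t - cnv hc U s) <= e * M].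
Proof.
move=> e0; have kh := shK D.
have n0 : (0 : R) <= n%:R by [].
(* This interval contains [x - r] for all [x] in [[-1, 0]] and [r] in []- n, 0]]. *)
have an : (-2 : R) <= n%:R + 1 by lra.
have e20 : 0 < e / 2 by lra.
have [g [kg gc gh]] := K_continuous_approx an e20 kh.
have w0 : 0 < e / 2 / (n%:R + 1) by apply: divr_gt0 => //; lra.
have [d d0 hd] := gc _ w0.
exists (Num.trunc d^-1).+1, (cut (-2) (n%:R + 1) g); split => // U M t s [kU U0] UM ht hs ts.
have M0 : 0 <= M by exact: le_trans (mn_ge0 _) (UM 0).
have dm : ((Num.trunc d^-1).+1%:R)^-1 <= d.
  rewrite -[X in _ <= X]invrK lef_pV2 ?posrE ?invr_gt0 ?ltr0n //.
  by apply: ltW; apply: truncnS_gt.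
have kc := K_cut (-2) (n%:R + 1) kh.
move: ht hs => /andP[t1 t2] /andP[s1 s2].
have Er (r x : R) : -1 <= x -> x <= 0 -> - n%:R < r <= 0 -> -2 <= x - r <= n%:R + 1.
  by move=> x1 x2 /andP[r1 r2]; apply/andP; split; lra.
have e1 : cnv h U t = cnv (cut (-2) (n%:R + 1) h) U t.
  rewrite !convE; apply: mI_ext => r; have [hr|hr] := boolP (- n%:R < r <= 0).
    by rewrite /cut Er.
  by rewrite U0 // !mulmx0.
rewrite e1.
apply: (@le_trans _ _ (mn (cnv (cut (-2) (n%:R + 1) h) U t - cnv (cut (-2) (n%:R + 1) g) U t) +
  mn (cnv (cut (-2) (n%:R + 1) g) U t - cnv (cut (-2) (n%:R + 1) g) U s))).
  apply: le_trans (mnD _ _); rewrite addrA subrK //.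
have -> : e * M = e / 2 * M + e / 2 * M by rewrite -mulrDl; congr (_ * _); lra.
apply: lerD.
  have e2 := convDl t kc (KN kg) kU; rewrite (convNl t kg kU) in e2; rewrite -e2.
  have kd := KB kc kg.
  have wb := @conv_wbound R n 1 1 _ U (fun=> 1) M t kd kU.
  apply: le_trans (wb _ _) _.
  - by apply: ri_ext (Mi_mn (K_Mi kd)) => r; rewrite mulr1.
  - by move=> r; rewrite mulr1.
  - rewrite mulrC; apply: (ler_wpM2r M0); apply: le_trans gh.
    by under rI_ext do rewrite mulr1.
rewrite !convE -mIB; [|exact: conv_Mi|exact: conv_Mi].
have mi := MiB (conv_Mi t kg kU) (conv_Mi s kg kU).
apply: le_trans (mn_mI mi) _.
have ri1 := riZ (e / 2 / (n%:R + 1) * M) (ri_indic (- n%:R) (0 : R)).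
apply: (@le_trans _ _ (rI (fun r => (e / 2 / (n%:R + 1) * M) * ind (- n%:R) 0 r))).
  apply: (le_rI (Mi_mn mi) ri1) => r; have [hr|hr] := boolP (- n%:R < r <= 0); last first.
    rewrite (U0 _ hr) !mulmx0 subrr mn0; apply: mulr_ge0; first by apply: mulr_ge0; [exact: ltW|exact: M0].
    by rewrite /ind; case: (_ && _).
  rewrite /ind; have -> : - n%:R <= r <= 0 by move/andP: hr => [x y]; rewrite (ltW x) y.
  rewrite mulr1 -mulmxBl; apply: le_trans (mnM _ _) _.
  apply: ler_pM; [exact: mn_ge0|exact: mn_ge0| |exact: UM].
  rewrite /cut (Er _ _ t1 t2 hr) (Er _ _ s1 s2 hr); apply: hd; [exact: Er|exact: Er|].
  by rewrite opprB addrA addrNK; exact: le_trans ts dm.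
rewrite rIZ; last exact: ri_indic.
rewrite rI_indic ?opprK ?add0r; last by lra.
rewrite -mulrA [M * _]mulrC mulrA; apply: (ler_wpM2r M0).
rewrite -mulrA -[X in _ <= X]mulr1; apply: ler_wpM2l; first exact: ltW.
by rewrite mulrC ler_pdivrMr; lra.
Qed.

(** It depends on [U] only through the [m] vectors sampled from [cnv hc U], hence has rank at most
    [m * n]. *)
Definition fin_rank m (hc : R -> 'cV[C]_n) (U : R -> 'M[C]_1) t : 'cV[C]_n :=
  \sum_(i < m) stp m i (cnv hc U (- (i%:R / m%:R))) t.

Lemma K_fin_rank m hc U : K (fin_rank m hc U).
Proof. by apply: K_sum => i; exact: K_stp. Qed.
Lemma fin_rank_lin m hc a U V t : K hc -> K U -> K V ->
  fin_rank m hc (fun r => a *: U r + V r) t = a *: fin_rank m hc U t + fin_rank m hc V t.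
Proof.
move=> k1 k2 k3; rewrite /fin_rank scaler_sumr -big_split /=; apply: eq_bigr => i _.
by rewrite cnv_lin_r // stp_lin.
Qed.

Fact residual_key : unit. Proof. by []. Qed.
Definition residual m hc (U : R -> 'M[C]_1) : R -> 'cV[C]_n := locked_with residual_key
  (fun t => cnv h U t - fin_rank m hc U t).
Lemma residualE m hc U : residual m hc U = (fun t => cnv h U t - fin_rank m hc U t).
Proof. by rewrite /residual unlock. Qed.

Lemma residual_bound m hc e : (0 < m)%N ->
  (forall U (M t s : R), ctrl' U -> (forall r, mn (U r) <= M) -> -1 <= t <= 0 -> -1 <= s <= 0 ->
    `|t - s| <= m%:R^-1 -> mn (cnv h U t - cnv hc U s) <= e * M) ->
  forall U (M t : R), ctrl' U -> (forall r, mn (U r) <= M) -> -1 < t -> t <= 0 ->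
    mn (residual m hc U t) <= e * M.
Proof.
move=> m0 H U M t cU UM t1 t0.
have m0R : (0 : R) < m%:R by rewrite ltr0n.
rewrite residualE /fin_rank; have [i [/andP[i1 i2] ->]] := stp_sum (fun i : 'I_m => cnv hc U (- (i%:R / m%:R))) m0 t1 t0.
rewrite -natr1 mulrDl mul1r in i1.
have h1 : (i%:R / m%:R : R) <= 1 by rewrite ler_pdivrMr // mul1r ler_nat ltnW.
have h2 : (0 : R) <= i%:R / m%:R by rewrite divr_ge0 // ltW.
move: (i%:R / m%:R) i1 i2 h1 h2 => x i1 i2 h1 h2.
have a1 : -1 <= t <= 0 by rewrite (ltW t1) t0.
have a2 : -1 <= - x <= 0 by apply/andP; split; lra.
have a3 : `|t - - x| <= m%:R^-1.
  rewrite ler_norml; move: (m%:R^-1) i1 => y i1; apply/andP; split; lra.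
exact: H cU UM a1 a2 a3.
Qed.

Section Contraction.
Variables (m : nat) (hc : R -> 'cV[C]_n) (e : R).
Hypothesis khc : K hc.
Hypothesis eQ : e * cQ Q <= 2^-1.
Hypothesis HB : forall U (M t : R), ctrl' U -> (forall r, mn (U r) <= M) -> -1 < t -> t <= 0 ->
    mn (residual m hc U t) <= e * M.
Local Notation res := (residual m hc).

Lemma K_res U : K U -> K (res U).
Proof. by move=> kU; rewrite residualE; apply: KB; [apply: K_conv => //; exact: shK|exact: K_fin_rank]. Qed.
Lemma res_lin a U V t : K U -> K V -> res (fun r => a *: U r + V r) t = a *: res U t + res V t.
Proof.
move=> kU kV; rewrite !residualE (cnv_lin_r _ _ (shK D) kU kV) (fin_rank_lin _ _ _ khc kU kV).
by rewrite scalerBr opprD addrACA.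
Qed.
Lemma res_bounded U : K U -> exists B, forall t, mn (res U t) <= B.
Proof.
move=> kU; exists (rI (fun t => mn (h t) ^+ 2) + rI (fun t => mn (U t) ^+ 2) +
  \sum_(i < m) mn (cnv hc U (- (i%:R / m%:R)))) => t.
rewrite residualE; apply: le_trans (mnB _ _) _; apply: lerD; first exact: (conv_bound t (shK D) kU).
by apply: le_trans (mn_sum _ _) _; apply: ler_sum => i _; exact: mn_stp.
Qed.
Lemma K_cut_bounded (g : R -> 'cV[C]_n) M : Mm g -> (forall t, mn (g t) <= M) -> K (cut (-1) 0 g).
Proof. by move=> mg gM; apply: (K_cutb (B := M)) mg _ => t _. Qed.
Lemma res_Jinv (g : R -> 'cV[C]_n) (M t : R) : Mm g -> (forall t, mn (g t) <= M) ->
  -1 < t -> t <= 0 -> mn (res (Jinv Q g) t) <= M / 2.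
Proof.
move=> mg gM t1 t0; have M0 : 0 <= M by exact: le_trans (mn_ge0 _) (gM 0).
have cU := Jinv_ctrl Q (K_cut_bounded mg gM).
have := HB cU (fun r => Jinv_bound Q r gM) t1 t0 => le1.
apply: le_trans le1 _; rewrite mulrA mulrC; exact: ler_wpM2l.
Qed.
Lemma JinvB f g r : Jinv Q (fun t => f t - g t) r = Jinv Q f r - Jinv Q g r.
Proof.
have := Jinv_lin Q (-1) g f r; rewrite scaleN1r addrC => <-; congr (Jinv Q _ r).
by apply/funext => t; rewrite scaleN1r addrC.
Qed.
Lemma resB U V t : K U -> K V -> res (fun r => U r - V r) t = res U t - res V t.
Proof.
move=> kU kV; have := res_lin (-1) t kV kU; rewrite scaleN1r addrC => <-.
by congr (residual m hc _ t); apply/funext => r; rewrite scaleN1r addrC.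
Qed.

Lemma resN U t : K U -> res (fun r => - U r) t = - res U t.
Proof.
move=> kU; have zid p (x : 'M[C]_(n, p)) : - x = (-2) *: x + x.
  by rewrite -[X in _ + X]scale1r -scalerDl -scaleN1r; congr (_ *: _); ring.
have zid1 (x : 'M[C]_1) : - x = (-2) *: x + x.
  by rewrite -[X in _ + X]scale1r -scalerDl -scaleN1r; congr (_ *: _); ring.
rewrite zid -(res_lin (-2) t kU kU); congr (residual m hc _ t).
by apply/funext => r; exact: zid1.
Qed.

Lemma res_ae U V t : K U -> K V -> {ae mu, forall r, U r = V r} -> res U t = res V t.
Proof.
move=> kU kV aV; rewrite !residualE /fin_rank (conv_ae t (shK D) kU kV aV); congr (_ - _).
by apply: eq_bigr => i _; have -> := conv_ae (- (i%:R / m%:R)) khc kU kV aV.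
Qed.

(** With [U = Jinv (f - g)] the equation becomes [g = res (Jinv f) - res (Jinv g)] on []-1, 0]].
    Although [f] may be unbounded, [res] produces bounded functions, and [res] after [Jinv] halves
    the sup norm, so a bounded [g] exists. *)
Lemma fredholm_solve f : K (cut (-1) 0 f) ->
  exists U, ctrl' U /\ forall t, -1 < t -> t <= 0 -> rho D U t = f t + fin_rank m hc U t.
Proof.
move=> kf; have kJf := K_Jinv Q kf.
have l10 : (-1 : R) <= 0 by rewrite lerN10.
pose T (g : R -> 'cV[C]_n) := hcut (-1) 0 (fun t => res (Jinv Q f) t - res (Jinv Q g) t).
have BK g : BMw (fun=> 1) g -> K (Jinv Q g).
  move=> [mg [M gM]]; apply: K_Jinv; apply: (@K_cut_bounded _ M) mg _ => t.
  by rewrite -[M]mulr1; exact: gM.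
have TB g : BMw (fun=> 1) g -> BMw (fun=> 1) (T g).
  move=> Bg; have kJ := BK g Bg; have [B1 h1] := res_bounded kJf; have [B2 h2] := res_bounded kJ.
  split; first by apply: Mm_hcut; apply: MmB; [case: (K_res kJf)|case: (K_res kJ)].
  exists (B1 + B2) => t; rewrite mulr1; apply: le_trans (mn_hcut _ _ l10) _.
  by apply: le_trans (mnB _ _) _; exact: lerD.
have Tc g1 g2 (M : R) : BMw (fun=> 1) g1 -> BMw (fun=> 1) g2 -> (forall t, mn (g1 t - g2 t) <= M * 1) ->
    forall t, mn (T g1 t - T g2 t) <= M / 2 * 1.
  move=> b1 b2 hM t; have M0 : 0 <= M by have := hM 0; rewrite mulr1; apply: le_trans; exact: mn_ge0.
  rewrite mulr1 hcutB; apply: (hcut_bound _ l10) => [|s s1 s0]; first exact: (divr_ge0 M0 (ler0n _ 2)).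
  have E := resB s (BK _ b1) (BK _ b2).
  have zid (p q r : 'cV[C]_n) : p - q - (p - r) = - (q - r) by rewrite opprB addrC addrA addrNK opprB.
  have E2 := zid (res (Jinv Q f) s) (res (Jinv Q g1) s) (res (Jinv Q g2) s).
  have -> := E2; rewrite mnN -E.
  have -> : (fun r => Jinv Q g1 r - Jinv Q g2 r) = Jinv Q (fun t => g1 t - g2 t).
    by apply/funext => r; rewrite JinvB.
  apply: res_Jinv s1 s0; first by apply: MmB; [exact: b1.1|exact: b2.1].
  by move=> x; rewrite -[M]mulr1; exact: hM.
have [g [Bg gE]] := contraction_fixpoint TB Tc.
have kJg := BK g Bg.
exists (Jinv Q (fun t => f t - g t)).
have eU : Jinv Q (fun t => f t - g t) = (fun r => Jinv Q f r - Jinv Q g r).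
  by apply/funext => r; exact: JinvB.
split.
  apply: Jinv_ctrl; have [mg [M gM]] := Bg.
  have kg : K (cut (-1) 0 g).
    by apply: (@K_cut_bounded _ M) mg _ => t; rewrite -[M]mulr1; exact: gM.
  apply: K_ext (KB kf kg) => t; rewrite /cut; case: ifP => // _; exact: subr0.
move=> t t1 t0; rewrite rhoE.
have := Jop_Jinv nN hQ (fun t => f t - g t) t1 t0; rewrite /Jop => ->.
have := gE t; rewrite /T (hcutE _ _ l10) t1 t0 /= -(resB t kJf kJg) -eU residualE => {1}->.
have zid (p c k : 'cV[C]_n) : p - (c - k) + c = p + k by rewrite opprB -addrA addrNK.
exact: zid.
Qed.

Lemma Jinv_ae0 (F : R -> 'cV[C]_n) : K (hcut (-1) 0 F) ->
  {ae mu, forall t, hcut (-1) 0 F t = 0} -> {ae mu, forall r, Jinv Q F r = 0}.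
Proof.
move=> kF F0; have kJ : K (Jinv Q F) by apply: K_sum => j; apply: K_mull; exact: K_shift.
have riF := Mi_mn (K_Mi kF).
have F0' : rI (fun t => mn (hcut (-1) 0 F t)) = 0.
  have z0 : {ae mu, forall t, mn (hcut (-1) 0 F t) = 0} by apply: (aeS F0) => t ->; rewrite mn0.
  by rewrite (rI_ae riF (ri_meas (ri0 R)) z0).2 rI0.
have riS (j : nat) : ri (fun r => mn (rq Q j) * mn (hcut (-1) 0 F (r + j%:R))).
  by apply: riZ; exact: (ri_shift j%:R riF).
have le0 : rI (fun r => mn (Jinv Q F r)) <= 0.
  have riT : ri (fun r => \sum_(j < n) mn (rq Q j) * mn (hcut (-1) 0 F (r + j%:R))).
    by apply: ri_sum => j; exact: riS.
  apply: le_trans (le_rI (Mi_mn (K_Mi kJ)) riT _) _.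
    by move=> r; apply: le_trans (mn_sum _ _) _; apply: ler_sum => j _; exact: mnM.
  rewrite rI_sum; last by move=> j; exact: riS.
  rewrite big1 // => j _; rewrite rIZ; last exact: (ri_shift j%:R riF).
  by rewrite (rI_shift j%:R riF) F0' mulr0.
have e0' : rI (fun r => mn (Jinv Q F r)) = 0.
  by apply/eqP; rewrite eq_le le0 rI_ge0 // => r; exact: mn_ge0.
have := rI_eq0_ae (Mi_mn (K_Mi kJ)) (fun r => mn_ge0 _) e0'.
by move=> H; apply: (aeS H) => r; exact: mn_eq0.
Qed.

(** Applying [Jinv] to the equation gives [V = - Jinv (res V)] almost everywhere. Then [res V] is
    bounded and equals [- res (Jinv (res V))], which halves any bound for it on []-1, 0]]; so it
    vanishes there. *)
Lemma fredholm_inj V : ctrl' V ->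
  {ae mu, forall t, -1 < t <= 0 -> rho D V t = fin_rank m hc V t} -> {ae mu, forall r, V r = 0}.
Proof.
move=> cV HV; have kV := cV.1; have l10 : (-1 : R) <= 0 by rewrite lerN10.
have kr := K_res kV; have kJ : K (Jop D V) by apply: K_sum => j; apply: K_mull; exact: K_shift.
have kF : K (fun t => Jop D V t + res V t) by exact: KD.
have rE t : rho D V t = Jop D V t + cnv h V t by rewrite rhoE.
have V1 : {ae mu, forall r, Jinv Q (fun t => Jop D V t + res V t) r = 0}.
  apply: Jinv_ae0; first by apply: K_hcut l10; exact: K_cut.
  apply: (aeS HV) => t; rewrite (hcutE _ _ l10); case: ifP => // _ /(_ isT).
  by rewrite rE residualE addrA => ->; rewrite subrr.
have [B hB] := res_bounded kV.
have hcc r : hcut (-1) 0 (fun t => hcut (-1) 0 (res V) t) r = hcut (-1) 0 (res V) r.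
  rewrite !(hcutE _ _ l10); by case: (-1 < r <= 0).
have JG r : Jinv Q (fun t => hcut (-1) 0 (res V) t) r = Jinv Q (res V) r.
  by apply: eq_bigr => j _; rewrite hcc.
have VE r : Jinv Q (fun t => Jop D V t + res V t) r = V r + Jinv Q (res V) r.
  by have := Jinv_lin Q 1 (Jop D V) (res V) r; rewrite scale1r (Jinv_Jop nN hQ r cV) => <-;
    congr (Jinv Q _ r); apply/funext => t; rewrite scale1r.
have aV : {ae mu, forall r, V r = - Jinv Q (hcut (-1) 0 (res V)) r}.
  by apply: (aeS V1) => r; rewrite VE -JG => /eqP; rewrite addr_eq0 => /eqP.
have mh : Mm (hcut (-1) 0 (res V)) by apply: Mm_hcut; case: kr.
have kJh : K (Jinv Q (hcut (-1) 0 (res V))).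
  by apply: K_ext (K_Jinv Q (K_cut (-1) 0 kr)) => r; rewrite JG.
have rV t : res V t = - res (Jinv Q (hcut (-1) 0 (res V))) t.
  by rewrite -(resN t kJh); exact: (res_ae t kV (KN kJh) aV).
have hk k : forall t, mn (hcut (-1) 0 (res V) t) <= B / 2 ^+ k.
  elim: k => [|k IH] t; first by rewrite expr0 divr1; exact: le_trans (mn_hcut _ _ l10) (hB _).
  have B0 : 0 <= B / 2 ^+ k.+1.
    by apply: divr_ge0; [exact: le_trans (mn_ge0 _) (hB 0)|exact: exprn_ge0].
  apply: (hcut_bound _ l10 B0) => s s1 s0; rewrite rV mnN.
  have -> : B / 2 ^+ k.+1 = B / 2 ^+ k / 2 by rewrite exprS invfM mulrA mulrAC.
  exact: (res_Jinv mh IH s1 s0).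
have h0 t : hcut (-1) 0 (res V) t = 0 by apply: mn_le0; apply: (@geo_le0 _ _ B) => k; exact: hk.
apply: (aeS aV) => r ->; rewrite /Jinv big1 ?oppr0 // => j _.
by rewrite hcc h0 mulmx0.
Qed.

End Contraction.

Lemma fredholm : exists m (hc : R -> 'cV[C]_n), [/\ (0 < m)%N, K hc,
  forall f, K (cut (-1) 0 f) -> exists U, ctrl' U /\
    forall t, -1 < t -> t <= 0 -> rho D U t = f t + fin_rank m hc U t &
  forall V, ctrl' V -> {ae mu, forall t, -1 < t <= 0 -> rho D V t = fin_rank m hc V t} ->
    {ae mu, forall r, V r = 0}].
Proof.
have c0 := cQ_ge0 Q; pose e : R := (2 * (cQ Q + 1))^-1.
have e0 : 0 < e by rewrite invr_gt0; lra.
have eQ : e * cQ Q <= 2^-1.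
  by rewrite /e mulrC ler_pdivrMr; lra.
have [m [hc [m0 khc H]]] := kernel_approx e0.
have HB := residual_bound m0 H.
exists m, hc; split => //.
  by move=> f; exact: (fredholm_solve khc eQ HB).
by move=> V; exact: (fredholm_inj khc eQ HB).
Qed.
End FredholmAlternative.

Section Combinations.
Context (R : realType).
Local Notation C := R[i].

Lemma linear_comb p q (Phi : (R -> 'M[C]_1) -> 'M[C]_(p, q)) :
  (forall a U V, K U -> K V -> Phi (fun r => a *: U r + V r) = a *: Phi U + Phi V) ->
  forall (I : Type) (s : seq I) (e : I -> C) (W : I -> R -> 'M[C]_1) U, K U -> (forall i, K (W i)) ->
  Phi (fun r => U r - \sum_(i <- s) e i *: W i r) = Phi U - \sum_(i <- s) e i *: Phi (W i).
Proof.
move=> lin I s e W U kU kW; elim: s => [|i s IH].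
  rewrite big_nil subr0; congr Phi; apply/funext => r; by rewrite big_nil subr0.
have kV : K (fun r => U r - \sum_(i <- s) e i *: W i r).
  by apply: KB kU _; apply: K_sum => j; exact: KZ.
have -> : (fun r => U r - \sum_(i <- i :: s) e i *: W i r) =
    (fun r => - e i *: W i r + (U r - \sum_(i <- s) e i *: W i r)).
  by apply/funext => r; rewrite big_cons opprD addrCA scaleNr.
by rewrite lin // IH big_cons opprD addrCA scaleNr.
Qed.

Lemma rho_lin n (D : sys R n) a U V t : K U -> K V ->
  rho D (fun r => a *: U r + V r) t = a *: rho D U t + rho D V t.
Proof.
move=> kU kV; rewrite !rhoE (cnv_lin_r _ _ (shK D) kU kV) scalerDr addrACA; congr (_ + _).
rewrite scaler_sumr -big_split /=; apply: eq_bigr => j _.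
by rewrite mulmxDr scalemxAr.
Qed.

Definition prim n (g : R -> 'cV[C]_n) t := mI (cut (-1) t g).
Lemma prim0 n (g : R -> 'cV[C]_n) : K g -> prim g (-1) = 0.
Proof.
move=> kg; have ae0 : {ae @lebesgue_measure R, forall t, (0 : 'cV[C]_n) = cut (-1) (-1) g t}.
  apply: (aeS (@ae_neq R (-1))) => r r1; rewrite /cut; case: ifP => // /andP[x y].
  by case: r1; apply/eqP; rewrite eq_le x y.
by rewrite /prim -((mI_ae (@Mi0 R n 1) (Mi_Mm (K_Mi (K_cut _ _ kg))) ae0).2) mI0.
Qed.
Lemma prim_primitive n (g : R -> 'cV[C]_n) : K g -> primitive_on (prim g) g.
Proof. by move=> kg; split; [exact: K_cut|move=> t _; rewrite (prim0 kg) subr0]. Qed.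
End Combinations.

(** * Times at most n *)

Section Uniqueness.
Context (R : realType) (n : nat).
Local Notation C := R[i].
Variables (Am1 : 'M[R]_n) (b : 'cV[R]_n) (A2 A3 : R -> 'M[C]_n) (D : sys R n).
Hypothesis hA : sA D = toCmx Am1.
Hypothesis hb : sb D = toCmx b.
Hypothesis h2 : s2 D = cut 0 1 (fun r => A2 (- r)).
Hypothesis h3 : s3 D = cut 0 1 (fun r => A3 (- r)).
Local Notation Ar := (Arel Am1 A2 A3).
Local Notation N := (sN D).
Local Notation emb := (emb D).
Variable S : R -> M2 R n -> M2 R n.
Hypothesis SA : C0_semigroup_generated_by S Ar.

(** A generator is single-valued, its value being a limit of quotients. Applied to states [emb f],
    this says that an absolutely continuous function determines its derivative almost everywhere. *)
Lemma Arel_unique x v w : inM2 x -> inM2 v -> inM2 w -> Ar x v -> Ar x w -> eqM2 v w.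
Proof.
move=> hx hv hw av aw.
have le0 : nrm2M2 (subM2 v w) <= 0.
  rewrite leNgt; apply/negP => p0.
  have [p ep] : exists p, p = nrm2M2 (subM2 v w) by eexists.
  rewrite -ep in p0.
  have e0 : 0 < p / 8 by apply: divr_gt0.
  have [d1 d10 h1] := S_gen SA hx hv av e0; have [d2 d20 h2'] := S_gen SA hx hw aw e0.
  have [d [d0 dd1 dd2]] : exists d, [/\ 0 < d, d < d1 & d < d2].
    exists (Num.min d1 d2 / 2); have m0 : 0 < Num.min d1 d2 by rewrite lt_min d10 d20.
    have ml : Num.min d1 d2 <= d1 by rewrite ge_min lexx.
    have mr : Num.min d1 d2 <= d2 by rewrite ge_min lexx orbT.
    by move: (Num.min d1 d2) m0 ml mr => y y0 y1 y2; split; lra.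
  have := h1 _ d0 dd1; have := h2' _ d0 dd2.
  have : inM2 (scaleM2 (d^-1)%:C (subM2 (S d x) x)).
    by apply: inM2_scale; apply: inM2_sub => //; exact: (S_in SA (ltW d0) hx).
  move: (scaleM2 _ _) => q hq n1 n2.
  have := nrm2_sub (inM2_sub hq hw) (inM2_sub hq hv).
  have -> : subM2 (subM2 q w) (subM2 q v) = subM2 v w.
    have zid (a c e : 'cV[C]_n) : a + (-1) *: c + (-1) *: (a + (-1) *: e) = e + (-1) *: c.
      by rewrite !scaleN1r opprB addrC addrA addrNK.
    rewrite /subM2 /addM2 /scaleM2 /=; congr pair; first exact: zid.
    by apply/funext => r; exact: zid.
  move: n1 n2; rewrite -ep; move: (nrm2M2 (subM2 q w)) (nrm2M2 (subM2 q v)) => x1 x2 y1 y2 y3.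
  lra.
have [z1 z2] := nrm2_eq0 (inM2_sub hv hw) le0; split.
  by apply/eqP; rewrite -subr_eq0 -scaleN1r; apply/eqP.
apply: (aeS z2) => t h It; have := h It; rewrite /= scaleN1r => /eqP; rewrite subr_eq0.
by move/eqP.
Qed.
End Uniqueness.

(** * The dimension count at time n *)

Section ShortTime.
Context (R : realType) (n : nat).
Local Notation C := R[i].
Variables (Am1 : 'M[R]_n) (b : 'cV[R]_n) (A2 A3 : R -> 'M[C]_n) (D : sys R n).
Hypothesis hA : sA D = toCmx Am1.
Hypothesis hb : sb D = toCmx b.
Hypothesis h2 : s2 D = cut 0 1 (fun r => A2 (- r)).
Hypothesis h3 : s3 D = cut 0 1 (fun r => A3 (- r)).
Local Notation Ar := (Arel Am1 A2 A3).
Local Notation N := (sN D).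
Local Notation emb := (emb D).
Variable S : R -> M2 R n -> M2 R n.
Hypothesis SA : C0_semigroup_generated_by S Ar.
Local Notation mu := (@lebesgue_measure R).
Hypothesis n0 : (0 < n)%N.
Hypothesis nN : (n <= N)%N.
Variable Q : 'M[C]_n.
Hypothesis hQ : (\matrix_(i < n, k < n) bj (sA D) (sb D) k i 0) *m Q = 1%:M.
Local Notation ctrl' := (@ctrl' R n).

Lemma ctrl'_ctrl U : ctrl' U -> ctrl n%:R U.
Proof.
move=> [kU U0]; split=> // r hr; apply: U0; apply: contra hr => /andP[x y].
by rewrite (ltW x) y.
Qed.
Lemma ctrl'_comb (I : finType) (e : I -> C) (W : I -> R -> 'M[C]_1) U : ctrl' U ->
  (forall i, ctrl' (W i)) -> ctrl' (fun r => U r - \sum_i e i *: W i r).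
Proof.
move=> [kU U0] cW; split.
  by apply: (KB kU); apply: K_sum => i; apply: KZ; exact: (cW i).1.
move=> r hr; rewrite U0 // big1 ?subr0 // => i _.
by rewrite (cW i).2 // scaler0.
Qed.
Lemma ctrl_halfopen U : ctrl n%:R U -> exists2 U', ctrl' U' & forall t, cnv (Z D) U t = cnv (Z D) U' t.
Proof.
move=> [kU U0]; have n00 : - n%:R <= (0 : R) by rewrite oppr_le0.
have kU' : K (hcut (- n%:R) 0 U) by apply: (K_hcut _ n00); exact: K_cut.
exists (hcut (- n%:R) 0 U).
  by split=> // r hr; rewrite (hcutE _ _ n00) (negbTE hr).
move=> t; apply: (conv_ae t (K_Z D) kU kU').
apply: (aeS (@ae_neq R (- n%:R))) => r rn; rewrite (hcutE _ _ n00).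
case: ifP => // hr; apply: U0; apply/negP => /andP[x y].
by move: hr; rewrite y andbT lt_def x andbT => /negbT; rewrite negbK => /eqP.
Qed.

(** The free constant of a state is read off from its mean, which, unlike a point value, does not
    depend on the representative. *)
Definition mean (f : R -> 'cV[C]_n) := mI (cut (-1) 0 f).
Lemma mean_lin a U V : K U -> K V ->
  mean (cnv (Z D) (fun r => a *: U r + V r)) = a *: mean (cnv (Z D) U) + mean (cnv (Z D) V).
Proof.
move=> kU kV; rewrite /mean.
have k1 := K_cut (-1) 0 (K_conv (K_Z D) kU); have k2 := K_cut (-1) 0 (K_conv (K_Z D) kV).
rewrite -(mIZ a (K_Mi k1)) -(mID (MiZ a (K_Mi k1)) (K_Mi k2)).
by apply: mI_ext => t; rewrite -cut_lin /cut; case: ifP => // _; rewrite (cnv_lin_r _ _ (K_Z D) kU kV).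
Qed.

Lemma step_state m (c : 'cV[C]_n) (a : 'I_m -> 'cV[C]_n) :
  exists2 f, primitive_on f (fun t => \sum_(i < m) stp m i (a i) t) & mean f = c.
Proof.
pose g t := \sum_(i < m) stp m i (a i) t.
have kg : K g by apply: K_sum => i; exact: K_stp.
have e1 := prim0 kg; have p0 := prim_primitive kg.
have /inM2_K kf0 := primitive_bounded D p0.
pose d := c - mean (prim g).
exists (fun t => prim g t + d).
  split; first exact: K_cut.
  by move=> t _; rewrite opprD addrACA subrr addr0 e1 subr0.
have kc : Mi (cut (-1) 0 (fun=> d)).
  by apply: K_Mi; apply: (@K_cutb _ _ _ _ _ _ (mn d)) => //; exact: Mm_cst.
have -> : mean (fun t => prim g t + d) = mean (prim g) + mI (cut (-1) 0 (fun=> d)).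
  rewrite /mean -(mID (K_Mi kf0) kc); apply: mI_ext => t; rewrite /cut.
  by case: ifP => // _; rewrite addr0.
by rewrite mI_const ?lerN10 // opprK add0r scale1r addrC subrK.
Qed.

Lemma K_primitive U : ctrl' U -> K (cut (-1) 0 (cnv (Z D) U)).
Proof. by move=> cU; apply: K_cut; apply: K_conv; [exact: K_Z|exact: cU.1]. Qed.

Lemma mean_ae (f f' : R -> 'cV[C]_n) : K (cut (-1) 0 f) -> K (cut (-1) 0 f') ->
  {ae mu, forall t, Iint t -> f t = f' t} -> mean f = mean f'.
Proof.
move=> k1 k2 e.
suff ae0 : {ae mu, forall t, cut (-1) 0 f t = cut (-1) 0 f' t}.
  exact: (mI_ae (K_Mi k1) (Mi_Mm (K_Mi k2)) ae0).2.
apply: (aeS e) => t h; rewrite /cut; case: ifP => // It; exact: h.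
Qed.

(** Let [W ik] solve the equation of [fredholm] for the step functions. A control reaching a state
    whose derivative is a step function is, by injectivity, a combination of these [m * n] controls.
    But such states have [m * n] free values of the derivative and [n] free values of the mean. *)
Lemma not_all_reached :
  ~ (forall f g, primitive_on f g -> exists2 U, ctrl n%:R U & eqM2 (emb f) (Wst D U)).
Proof.
move=> H; have [m [hc [m0 khc sol inj]]] := fredholm (leqW nN) hQ.
have hW (ik : 'I_m * 'I_n) : exists U, ctrl' U /\ forall t, -1 < t -> t <= 0 ->
    rho D U t = stp m ik.1 (delta_mx ik.2 0) t + fin_rank m hc U t.
  by apply: sol; apply: K_cut; exact: K_stp.
have [W hW'] := choice hW.
have kW ik : K (W ik) by have [] := hW' ik => -[].
(* The row of [W ik]: the mean it produces, and the values of its derivative on the [m] blocks,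
   namely a unit vector plus the samples entering [fin_rank]. *)
pose P (ik : 'I_m * 'I_n) (j : 'I_n + 'I_m * 'I_n) : C :=
  match j with inl k => mean (cnv (Z D) (W ik)) k 0
  | inr ik' => (ik == ik')%:R + cnv hc (W ik) (- (ik'.1%:R / m%:R)) ik'.2 0 end.
have := @no_surjection R _ _ P.
suff surj : forall y : 'I_n + 'I_m * 'I_n -> C, exists e, forall j, y j = \sum_i e i * P i j.
  move=> /(_ surj); rewrite card_sum !card_prod !card_ord.
  by rewrite -[X in (_ <= X)%N]add0n leq_add2r leqNgt n0.
move=> y; pose c := \col_k y (inl k); pose a (i : 'I_m) := \col_k y (inr (i, k)).
have [f pf fc] := step_state c a.
have [U0 cU0 eU0] := H _ _ pf.
have [U cU ZU] := ctrl_halfopen cU0.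
have eU : eqM2 (emb f) (Wst D U).
  have -> : Wst D U = Wst D U0 by have -> : Wst D U = emb (cnv (Z D) U0); [rewrite /Wst; congr (emb _); apply/funext => t; rewrite ZU|].
  exact: eU0.
have nNR : (n%:R : R) <= N%:R by rewrite ler_nat.
have cUc := ctrl'_ctrl cU.
have kU := cU.1.
have aeg : {ae mu, forall t, Iint t -> \sum_(i < m) stp m i (a i) t = rho D U t}.
  have i1 : inM2 (cnv (s2 D) (fun t => \sum_(i < m) stp m i (a i) t) 0 + cnv (s3 D) f 0,
      (fun t => \sum_(i < m) stp m i (a i) t)).
    by apply: K_inM2; apply: K_sum => i; exact: K_stp.
  have i2 : inM2 (cnv (s2 D) (rho D U) 0 + cnv (s3 D) (cnv (Z D) U) 0, rho D U).
    by apply: K_inM2; exact: K_rho.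
  have a1 := Arel_emb hA h2 h3 pf (eqM2_refl _).
  have a2 := Arel_eq (Arel_Wst hA h2 h3 nNR cUc) (eqM2_sym eU) (eqM2_refl _).
  exact: (Arel_unique SA (primitive_bounded D pf) i1 i2 a1 a2).2.
have kfc : K (cut (-1) 0 f) by have /inM2_K := primitive_bounded D pf.
have ef := mean_ae kfc (K_primitive cU) eU.2.
pose co (U : R -> 'M[C]_1) (i : 'I_m) := cnv hc U (- (i%:R / m%:R)).
(* With these coefficients the step functions cancel, and [V] solves the homogeneous equation. *)
pose e (ik : 'I_m * 'I_n) : C := (a ik.1 - co U ik.1) ik.2 0.
pose V r := U r - \sum_ik e ik *: W ik r.
have cV : ctrl' V by apply: ctrl'_comb cU _ => ik; have [] := hW' ik.
have kV := cV.1.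
have decomp (i : 'I_m) : a i - co U i = \sum_(k < n) e (i, k) *: delta_mx k 0.
  rewrite {1}[a i - co U i]matrix_sum_delta; apply: eq_bigr => k _.
  by rewrite big_ord1.
have rhoV : {ae mu, forall t, -1 < t <= 0 -> rho D V t = fin_rank m hc V t}.
  apply: (aeS aeg) => t ht /andP[t1 t0].
  have It : Iint t by rewrite /Iint /= in_itv /= (ltW t1) t0.
  rewrite /V (linear_comb (fun a U V kU kV => rho_lin D a t kU kV) _ _ kU kW).
  rewrite (linear_comb (fun a U V kU kV => fin_rank_lin m a t khc kU kV) _ _ kU kW).
  rewrite -(ht It).
  have E ik : e ik *: rho D (W ik) t = stp m ik.1 (e ik *: delta_mx ik.2 0) t +
      e ik *: fin_rank m hc (W ik) t.
    rewrite (hW' ik).2 // scalerDr; congr (_ + _).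
    by rewrite !stpE; case: ifP => //; rewrite scaler0.
  rewrite (eq_bigr _ (fun ik _ => E ik)). rewrite [X in _ - X = _]big_split /= opprD addrA; congr (_ - _).
  rewrite -(pair_bigA _ (fun (i : 'I_m) (k : 'I_n) => stp m i (e (i, k) *: delta_mx k 0) t)) /=.
  rewrite /fin_rank -sumrB; apply: eq_bigr => i _.
  have -> : \sum_(k < n) stp m i (e (i, k) *: delta_mx k 0) t = stp m i (a i - co U i) t.
    rewrite decomp stpE; case: ifP => ht'; last by rewrite big1 // => k _; rewrite stpE ht'.
    by apply: eq_bigr => k _; rewrite stpE ht'.
  by rewrite !stpE; case: ifP => _; rewrite ?subr0 // subKr.
have V0 := inj V cV rhoV.
have k0 := K0 R 1 1.
have cV0 p (F : R -> 'M[C]_(p, 1)) t : K F -> cnv F V t = 0.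
  move=> kF; rewrite (conv_ae t kF kV k0 V0) convE -(@mI0 R p 1).
  by apply: mI_ext => r; rewrite mulmx0.
exists e => -[k|[i k]] /=.
  have eV := linear_comb mean_lin (index_enum _) e kU kW.
  have mV : mean (cnv (Z D) V) = 0.
    rewrite /mean -(@mI0 R n 1); apply: mI_ext => t; rewrite /cut (cV0 _ _ _ (K_Z D)).
    by case: ifP.
  move: eV; rewrite -/V mV => /esym/eqP; rewrite subr_eq0 -ef fc => /eqP /matrixP /(_ k 0).
  rewrite summxE mxE => ->; apply: eq_bigr => ik _; by rewrite mxE.
have eV := linear_comb (fun a U V kU kV => cnv_lin_r a (- (i%:R / m%:R)) khc kU kV) (index_enum _) e kU kW.
move: eV; rewrite -/V (cV0 _ _ _ khc) => /esym/eqP; rewrite subr_eq0 => /eqP /matrixP /(_ k 0).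
rewrite summxE => eV.
have -> : \sum_ik e ik * ((ik == (i, k))%:R + cnv hc (W ik) (- (i%:R / m%:R)) k 0) =
    e (i, k) + co U i k 0.
  under eq_bigr do rewrite mulrDr; rewrite big_split /=; congr (_ + _).
    rewrite (bigD1 (i, k)) //= eqxx mulr1 big1 ?addr0 // => j /negbTE ->; exact: mulr0.
  by rewrite /co eV; apply: eq_bigr => ik _; rewrite mxE.
by rewrite /e !mxE subrK.
Qed.

Lemma not_controllable_short T : (n < N)%N -> 0 < T -> T <= n%:R ->
  ~ exactly_controllable_at S b Am1 A2 A3 T.
Proof.
move=> nN' T0 Tn H; apply: not_all_reached => f g pf.
have TN : T < N%:R by apply: le_lt_trans Tn _; rewrite ltr_nat.
have hf := primitive_bounded D pf.
have /(H _ hf) : inDA Am1 A2 A3 (emb f).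
  by apply/(inDA_emb hA h2 h3 hf); exists f, g; split=> //; exact: eqM2_refl.
move=> /(reachableP hA hb h2 h3 SA _ (ltW T0) TN) [_ [U [[kU U0] eU]]].
exists U => //; split=> // r hr; apply: U0; apply: contra hr => /andP[x y].
by rewrite y andbT; apply: le_trans x; rewrite lerN2.
Qed.
End ShortTime.

(** * The resolvent *)

Section ExponentialKernel.
Context (R : realType).
Local Notation C := R[i].
Variables (L : R) (l : C).

Definition Ex p : R -> 'M[C]_p := cut 0 L (fun t => (cexp (l * t%:C))%:M).

Lemma cexp_bounded (a c : R) : exists B, forall t, a <= t <= c -> n1 (cexp (l * t%:C)) <= B.
Proof.
exists (2 * expR (`|complex.Re l| * (`|a| + `|c|))) => t /andP[at_ tc].
apply: le_trans (n1_cexp _ _) _; apply: ler_wpM2l => //; rewrite ler_expR.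
apply: (@le_trans _ _ (`|complex.Re l| * `|t|)); first by rewrite -normrM ler_norm.
apply: ler_wpM2l => //; rewrite ler_norml; apply/andP; split.
  have : - `|a| <= a by rewrite lerNl -normrN ler_norm.
  have : 0 <= `|c| by []. lra.
have := ler_norm c; have : 0 <= `|a| by []. lra.
Qed.
Lemma K_cexp a c p : K (cut a c (fun t => (cexp (l * t%:C))%:M : 'M[C]_p)).
Proof.
have [B hB] := cexp_bounded a c.
apply: (@K_cutb _ _ _ _ _ _ (B *+ p)); first exact: cexp_Mm.
by move=> t /hB h; rewrite mn_scalar lerMn2r h orbT.
Qed.
Lemma K_Ex p : K (Ex p). Proof. exact: K_cexp. Qed.

Lemma mI_cexp p (s t : R) : s <= t ->
  l *: mI (cut s t (fun r => (cexp (l * r%:C))%:M : 'M[C]_p)) = (cexp (l * t%:C) - cexp (l * s%:C))%:M.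
Proof.
move=> st; have [_ e] := cexp_FTC l st; rewrite -mIZ; last exact: K_Mi (K_cexp _ _ _).
apply/matrixP => i j; rewrite mIE [RHS]mxE -e; have [->|ij] := eqVneq i j.
  by rewrite mulr1n; apply: cI_ext => r; rewrite cutE !mxE eqxx mulr1n mulrCA.
rewrite mulr0n -[RHS](@cI0 R); apply: cI_ext => r.
by rewrite cutE !mxE (negbTE ij) mulr0n !mulr0.
Qed.

(** The integral form of [y' = l y], [y 0 = 1]. *)
Lemma Ex_eq p t : t <= L -> Ex p t = Hv L p t + l *: cnv (Hv L p) (Ex p) t.
Proof.
move=> tL; have [t0|t0] := ltP t 0.
  rewrite Hv0 // add0r (conv_causal (@Hv0 R L p) (c := 0)) ?scaler0 ?addr0 //.
    by rewrite /Ex /cut leNgt t0.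
  by move=> r r0; rewrite /Ex /cut leNgt r0.
rewrite conv_Hv Hv1 ?t0 //.
have -> : cut (t - L) t (Ex p) = cut 0 t (fun r => (cexp (l * r%:C))%:M).
  apply/funext => r; rewrite /Ex /cut; case: (boolP (0 <= r <= t)) => hr.
    have -> : t - L <= r <= t by move/andP: hr => [x y]; apply/andP; split; lra.
    by have -> : 0 <= r <= L by move/andP: hr => [x y]; apply/andP; split; lra.
  case: ifP => // /andP[_ h1]; case: ifP => // /andP[h2 _].
  by case/negP: hr; rewrite h1 h2.
rewrite mI_cexp // mulr0 cexp0 /Ex /cut t0 tL raddfB /= addrC subrK //.
Qed.

Lemma conv_Ex m p (F : R -> 'M[C]_(m, p)) c t : K F -> (forall r, r < c -> F r = 0) -> t - c <= L ->
  cnv (Ex m) F t = cnv (Hv L m) F t + l *: cnv (Hv L m) (cnv (Ex m) F) t.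
Proof.
move=> kF F0 tc; have kE := K_Ex m; have kH := K_Hv L m; have kHE := K_conv kH kE.
have e1 : cnv (Ex m) F t = cnv (fun s => Hv L m s + l *: cnv (Hv L m) (Ex m) s) F t.
  by apply: (conv_local_l F0) => s sc; apply: Ex_eq; exact: le_trans sc tc.
rewrite e1 (convDl t kH (KZ l kHE) kF); congr (_ + _).
rewrite (convA t kH kE kF) !convE -(mIZ l (conv_Mi t kHE kF)).
by apply: mI_ext => r; rewrite scalemxAl.
Qed.
End ExponentialKernel.

Section Resolvent.
Context (R : realType) (n : nat).
Local Notation C := R[i].
Variables (Am1 : 'M[R]_n) (b : 'cV[R]_n) (A2 A3 : R -> 'M[C]_n) (D : sys R n).
Hypothesis hA : sA D = toCmx Am1.
Hypothesis hb : sb D = toCmx b.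
Hypothesis h2 : s2 D = cut 0 1 (fun r => A2 (- r)).
Hypothesis h3 : s3 D = cut 0 1 (fun r => A3 (- r)).
Local Notation Ar := (Arel Am1 A2 A3).
Local Notation N := (sN D).
Local Notation emb := (emb D).
Variable l : C.
Local Notation E p := (Ex (sL D) l p).
Local Notation H p := (Hv (sL D) p).
Local Notation Z := (Z D).

Lemma eqM2_emb f g : (forall t, -1 <= t -> t <= 0 -> f t = g t) -> eqM2 (emb f) (emb g).
Proof.
move=> e; have l10 : (-1 : R) <= 0 by rewrite lerN10.
split; first by rewrite /= (e 0 l10 (lexx _)) (e (-1) (lexx _) l10).
by apply: aeW => t; rewrite /Iint /= in_itv /= => /andP[x y]; exact: e.
Qed.

(** In terms of [u t = U (- t)]: the integral of [(exp(l t) - exp(A t)) (b, 0) u t] lies in the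
    range of [l - A]. Its preimage is, up to sign, the state reached by the control [P] with
    [P' = l P - U] which starts from 0 at [- T]. *)
Lemma resolvent_control T U : 0 <= T -> T <= N%:R -> ctrl T U -> exists P, ctrl T P /\
  Ar (Wst D P) (subM2 (scaleM2 l (Wst D P)) (subM2 (Wst D U) (sb D *m cnv (E 1) U 0, fun=> 0))).
Proof.
move=> T0 TN cU; have [kU U0] := cU.
have kE := @K_Ex _ (sL D) l 1; have kEU := K_conv kE kU; have kH := K_H D 1.
have kP0 : K (fun r => - cnv (E 1) U r) by exact: KN.
have Uneg r : r < - T -> U r = 0.
  by move=> rT; apply: U0; apply/negP => /andP[x _]; move: rT; rewrite ltNge x.
have Eneg r : r < 0 -> E 1 r = 0 by move=> r0; rewrite /Ex /cut leNgt r0.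
have Pneg r : r < - T -> - cnv (E 1) U r = 0.
  by move=> rT; rewrite (conv_causal Eneg Uneg) ?oppr0 // add0r.
have [P eP] : exists P, P = cut (- T) 0 (fun r => - cnv (E 1) U r) by eexists.
have cP : ctrl T P.
  split; first by rewrite eP; exact: K_cut.
  by move=> r hr; rewrite eP /cut (negbTE hr).
have kP := cP.1.
have hP r : r <= 0 -> P r = - cnv (E 1) U r.
  move=> r0; rewrite eP /cut r0 andbT; case: ifP => // /negbT; rewrite -ltNge => rT.
  by rewrite Pneg.
(* [V] is the derivative of [P]. Its integral is the value [P 0] at which [P] is cut off, and this
   produces the term along [b]. *)
have [V eV] : exists V, V = (fun r => l *: P r - U r) by eexists.
have kV : K V by rewrite eV; apply: KB kU; exact: KZ.
have cV : ctrl T V by split=> // r hr; rewrite eV cP.2 // U0 // scaler0 subr0.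
have key r : r <= 0 -> P r = cnv (H 1) V r.
  move=> r0; rewrite hP //.
  have rL : r - - T <= sL D by rewrite /sL -natr1; lra.
  rewrite (conv_Ex l kU Uneg rL).
  have -> : cnv (H 1) V r = cnv (H 1) (fun r => - l *: cnv (E 1) U r + (- U r)) r.
    apply: (conv_local_r (@Hv0 R (sL D) 1)); rewrite subr0 => s sr.
    by rewrite eV hP ?scalerN ?scaleNr //; exact: le_trans sr r0.
  by rewrite (cnv_lin_r _ _ kH kEU (KN kU)) (convNr _ kH kU) scaleNr opprD addrC.
have intV : mI V = - cnv (E 1) U 0.
  rewrite -(hP _ (lexx 0)) (key _ (lexx 0)) conv_Hv; apply: mI_ext => r.
  rewrite /cut sub0r; case: ifP => // /negbT hr; apply: cV.2; apply: contra hr => /andP[x y].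
  by rewrite y andbT; apply: le_trans x; rewrite lerN2 /sL -natr1; lra.
exists P; split=> //.
have a := Arel_zz hA h2 h3 TN cV.
apply: Arel_eq a _ _.
  apply: eqM2_emb => t t1 t0; rewrite -(zeta_tail D t kV).
  apply: (conv_local_r (@Z_neg _ _ D)); rewrite subr0 => s st.
  by rewrite key //; exact: le_trans st t0.
have ez t : cnv Z V t = l *: cnv Z P t - cnv Z U t.
  have -> : V = (fun r => l *: P r + (- U r)) by rewrite eV.
  by rewrite (cnv_lin_r _ _ (K_Z D) kP (KN kU)) (convNr _ (K_Z D) kU).
rewrite /subM2 /addM2 /scaleM2 /=; split => /=.
  rewrite !ez intV mulmxN !scaleN1r opprK mulmxBr -scalemxAr scalerBr opprD opprB opprK.
  move: (sb D *m _) (l *: cnv Z P 0) (cnv Z U 0) (l *: (_ *m cnv Z P _)) (_ *m cnv Z U _) => p q r s t.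
  by rewrite opprB addrACA -[LHS]addrA; congr (_ + _); rewrite addrC [t - r]addrC.
by apply: aeW => t _ /=; rewrite ez !scaler0 !addr0 scaleN1r.
Qed.

Let K_cut_refl (F : R -> 'M[C]_n) : K (cut 0 1 (fun r => F (- r))) -> K (cut (-1) 0 F).
Proof.
move=> k; apply: K_ext (K_refl 0 k) => t; rewrite /cut sub0r opprK.
by rewrite oppr_ge0 lerNl andbC.
Qed.
Lemma K_cexp_scale (F : R -> 'M[C]_n) : K (cut (-1) 0 F) ->
  K (cut (-1) 0 (fun s => cexp (l * s%:C) *: F s)).
Proof.
move=> kF; have [B hB] := cexp_bounded l (-1) 0.
apply: (K_dom (f := cut (-1) 0 F) (c := B)) => //.
  have -> : cut (-1) 0 (fun s => cexp (l * s%:C) *: F s) =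
      (fun s => (cexp (l * s%:C))%:M *m cut (-1) 0 F s).
    by apply/funext => s; rewrite mul_scalar_mx /cut; case: ifP; rewrite ?scaler0.
  by apply: Mm_mul; [exact: cexp_Mm|case: kF].
move=> t; rewrite /cut; case: ifP => ht; last by rewrite !mn0 mulr0.
by apply: le_trans (mnZ _ _) _; apply: ler_wpM2r; [exact: mn_ge0|exact: hB].
Qed.
Lemma vint_exp (F : R -> 'M[C]_n) (c : 'cV[C]_n) : K (cut (-1) 0 F) ->
  vint Iint (fun t => F t *m (cexp (l * t%:C) *: c)) = mint Iint (fun s => cexp (l * s%:C) *: F s) *m c.
Proof.
move=> kF; rewrite vintE mintE -mI_mulr; last exact: K_Mi (K_cexp_scale kF).
apply: mI_ext => t; rewrite /cut; case: ifP => _; last by rewrite mul0mx.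
by rewrite -scalemxAr scalemxAl.
Qed.
Lemma primitive_exp (c : 'cV[C]_n) :
  primitive_on (fun t => cexp (l * t%:C) *: c) (fun t => cexp (l * t%:C) *: (l *: c)).
Proof.
have E0 t (v : 'cV[C]_n) : cut (-1) t (fun r => cexp (l * r%:C) *: v) =
    (fun r => cut (-1) t (fun r => (cexp (l * r%:C))%:M) r *m v).
  by apply/funext => r; rewrite /cut; case: ifP => _; rewrite ?mul_scalar_mx ?mul0mx.
split; first by rewrite E0; apply: K_mulr; exact: K_cexp.
move=> t /andP[t1 t0]; rewrite E0 mI_mulr; last exact: K_Mi (K_cexp _ _ _ _).
by rewrite -scalemxAr scalemxAl mI_cexp // mul_scalar_mx scalerBl.
Qed.

(** Differentiation multiplies the exponential by [l], so [l - A] only leaves a first component,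
    which is [Delta] applied to [c]. *)
Lemma resolvent_exp (c : 'cV[C]_n) (x := emb (fun t => cexp (l * t%:C) *: c)) :
  Ar x (subM2 (scaleM2 l x) (Delta Am1 A2 A3 l *m c, fun=> 0)).
Proof.
have k2 : K (cut (-1) 0 A2) by apply: K_cut_refl; rewrite -h2; exact: s2K.
have k3 : K (cut (-1) 0 A3) by apply: K_cut_refl; rewrite -h3; exact: s3K.
apply: (Arel_emb hA h2 h3 (primitive_exp c)); rewrite -(Lop_cnv h2 h3) /Lop.
rewrite !vint_exp //; split; last first.
  by apply: aeW => t _ /=; rewrite !scaler0 addr0 !scalerA mulrC.
rewrite /= hA mulr0 cexp0 scale1r rmorphN1 mulrN1 scaleN1r /Delta.
rewrite !mulmxBl -!scalemxAl mul1mx -!scalemxAr scalerBr scalerA.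
move: (mint _ _) (mint _ _) => p q.

move: (l *: c - _) (l *: (q *m c)) (p *m c) => x1 x2 x3.
by rewrite -addrA -opprD subKr.
Qed.

(** Variation of constants solves [f' = l f - y.2] exactly; the first component is whatever it turns
    out to be. *)
Lemma resolvent_inhomogeneous (y : M2 R n) : inM2 y ->
  exists f g, primitive_on f g /\ exists c, Ar (emb f) (subM2 (scaleM2 l (emb f)) (c, y.2)).
Proof.
move=> /inM2_K kw; have [w ew] : exists w, cut (-1) 0 y.2 = w by eexists.
rewrite ew in kw.
have kE := @K_Ex _ (sL D) l n; have kEw := K_conv kE kw; have kH := K_H D n.
have w0 r : r < -1 -> w r = 0.
  by move=> r1; rewrite -ew /cut; case: ifP => // /andP[]; rewrite leNgt r1.
have E0 r : r < 0 -> E n r = 0 by move=> r0; rewrite /Ex /cut leNgt r0.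
have [f ef] : exists f, f = (fun r => - cnv (E n) w r) by eexists.
have kf : K f by rewrite ef; exact: KN.
have f0 r : r < -1 -> f r = 0.
  by move=> r1; rewrite ef (conv_causal E0 w0) ?oppr0 // add0r.
have [g eg] : exists g, g = (fun r => l *: f r + (- w r)) by eexists.
have kg : K g by rewrite eg; apply: KD; [exact: KZ|exact: KN].
have g0 r : r < -1 -> g r = 0 by move=> r1; rewrite eg f0 // w0 // scaler0 oppr0 addr0.
have sL1 : 1 <= sL D by rewrite /sL ler1n.
have fg t : t <= 0 -> f t = cnv (H n) g t.
  move=> t0; rewrite eg (cnv_lin_r _ _ kH kf (KN kw)) (convNr _ kH kw) {1}ef.
  have tL : t - -1 <= sL D by lra.
  rewrite (conv_Ex l kw w0 tL) opprD addrC -scalerN; congr (_ *: _ - _).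
  by rewrite -(convNr _ kH kEw) -ef.
have pfg : primitive_on f g.
  split; first exact: K_cut.
  move=> t /andP[t1 t0]; have l10 : (-1 : R) <= 0 by rewrite lerN10.
  have tL : t - sL D <= -1 by lra.
  by rewrite !fg // (Hv_diff kg g0 t1 tL).
exists f, g; split=> //; exists (l *: (f 0 - sA D *m f (-1)) - (cnv (s2 D) g 0 + cnv (s3 D) f 0)).
apply: (Arel_emb hA h2 h3 pfg); split; first by rewrite /= scaleN1r opprB addrC subrK.
apply: aeW => t; rewrite /Iint /= in_itv /= => It; rewrite eg -ew /cut It scaleN1r //.
Qed.
End Resolvent.

Lemma expR_quotient (R : realType) (m s e : R) : 0 < e -> exists2 d, 0 < d &
  forall h, h != 0 -> `|h| < d ->
    `|h^-1 * (expR (m * (s + h)) - expR (m * s)) - m * expR (m * s)| <= e.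
Proof.
move=> e0; pose f (y : R) := expR (m * y).
have dl : is_derive s 1 (fun y : R => m * y) m.
  by have := is_deriveZ m (is_derive_id s (1 : R)); rewrite /GRing.scale /= mulr1.
have df : is_derive s 1 f (m * expR (m * s)).
  have := is_derive1_comp (is_derive_expR (m * s)) dl.
  by rewrite /GRing.scale /= mulrC.
have [df1 df2] := df.
have := df1; rewrite /derivable => c; move: df2; rewrite /derive => df2.
have /cvgrPdist_le := c; rewrite df2 => /(_ e e0).
rewrite near_withinE => -[d /= d0 hd].
exists d => // h h0 hd'; have := hd h; rewrite /ball_ /= sub0r normrN => /(_ hd' h0).
by rewrite distrC /GRing.scale /= mulr1 /f [h + s]addrC.
Qed.

(** * Consequences of the rank condition and of boundedness *)

Section ResolventRank.
Context (R : realType) (n : nat).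
Local Notation C := R[i].
Variables (Am1 : 'M[R]_n) (b : 'cV[R]_n) (A2 A3 : R -> 'M[C]_n) (D : sys R n).
Hypothesis hA : sA D = toCmx Am1.
Hypothesis hb : sb D = toCmx b.
Hypothesis h2 : s2 D = cut 0 1 (fun r => A2 (- r)).
Hypothesis h3 : s3 D = cut 0 1 (fun r => A3 (- r)).
Local Notation Ar := (Arel Am1 A2 A3).
Local Notation N := (sN D).
Local Notation emb := (emb D).
Variable S : R -> M2 R n -> M2 R n.
Hypothesis SA : C0_semigroup_generated_by S Ar.

(** The defect of [resolvent_inhomogeneous] is a vector of [C^n]. By the rank hypothesis an
    exponential state corrects it through [Delta], up to a multiple of [b]. *)
Lemma resolvent_rank (l : C) y : \rank (row_mx (Delta Am1 A2 A3 l) (toCmx b)) = n -> inM2 y ->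
  exists x (s : C), inM2 x /\ Ar x (subM2 (scaleM2 l x) (subM2 y (s *: sb D, fun=> 0))).
Proof.
move=> rk hy; have [f [g [pf [c a0]]]] := resolvent_inhomogeneous hA h2 h3 l hy.
have [B hB] : exists B, row_mx (Delta Am1 A2 A3 l) (toCmx b) *m B = 1%:M.
  by apply/row_freeP; rewrite /row_free rk.
have [w1 [w2 ew]] : exists w1 (w2 : 'M[C]_1), y.1 - c = Delta Am1 A2 A3 l *m w1 + toCmx b *m w2.
  exists (usubmx (B *m (y.1 - c))), (dsubmx (B *m (y.1 - c))).
  by rewrite -mul_row_col vsubmxK mulmxA hB mul1mx.
have a1 := resolvent_exp hA h2 h3 l w1.
have x1 := primitive_bounded D pf.
have x2 := primitive_bounded D (primitive_exp l w1).
have a2 := Arel_lin hA h2 h3 1 a0 a1.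
exists (addM2 (scaleM2 1 (emb f)) (emb (fun t => cexp (l * t%:C) *: w1))), (w2 0 0).
split; first by apply: inM2_add => //; exact: inM2_scale.
apply: Arel_eq a2 (eqM2_refl _) _; move: (emb f) (emb _) => p q.
have e1 : c + Delta Am1 A2 A3 l *m w1 = y.1 - w2 0 0 *: sb D.
  rewrite hb; have -> : w2 0 0 *: toCmx b = toCmx b *m w2.
    by rewrite [in RHS](mx11_scalar w2) mul_mx_scalar.
  by rewrite -[y.1](subrK c) ew addrAC addrK addrC.
have zid (u v s t : 'cV[C]_n) : 1 *: (l *: u + (-1) *: s) + (l *: v + (-1) *: t) =
    l *: (1 *: u + v) + (-1) *: (s + t).
  by rewrite !scale1r !scaleN1r scalerDr opprD addrACA.
split; rewrite /subM2 /addM2 /scaleM2 /=; first by rewrite [-1 *: (w2 0 0 *: _)]scaleN1r -e1; exact: zid.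
by apply: aeW => t _ /=; rewrite zid scaler0.
Qed.

(** An eigenvector for [m] has the orbit [expR (m * s)] times itself; at [s = 1] this exceeds the
    bound of [S 1] when [m] is large. *)
Lemma resolvent_inj : exists2 m0 : R, 0 < m0 & forall (m : R) x, m0 <= m -> inM2 x ->
  Ar x (scaleM2 m%:C x) -> eqM2 x (0, fun=> 0).
Proof.
have [M hM] := S_bd SA (ler01 : 0 <= (1 : R)).
exists (`|M| + 1); first by have : 0 <= `|M| by []; lra.
move=> m x mM hx ax; have M0 : 0 <= `|M| by [].
pose W s := scaleM2 (expR (m * s))%:C x; pose dW s := scaleM2 (m * expR (m * s))%:C x.
have WM s : 0 <= s -> s <= 1 -> [/\ inM2 (W s), inM2 (dW s) & Ar (W s) (dW s)].
  move=> _ _; split; [exact: inM2_scale|exact: inM2_scale|].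
  have z : Ar (0, fun=> 0) (0, fun=> 0).
    have := Arel_sub hA h2 h3 ax ax; rewrite /subM2 /addM2 /scaleM2 /=.
    have -> : x.1 + -1 *: x.1 = 0 by rewrite scaleN1r subrr.
    have -> : (fun t => x.2 t + -1 *: x.2 t) = (fun=> 0) by apply/funext => t; rewrite scaleN1r subrr.
    rewrite scaleN1r subrr.
    by have -> : (fun t => m%:C *: x.2 t + -1 *: (m%:C *: x.2 t)) = (fun=> 0)
      by apply/funext => t; rewrite scaleN1r subrr.
  have := Arel_lin hA h2 h3 (expR (m * s))%:C ax z.
  rewrite /W /dW /addM2 /scaleM2 /=.
  have -> : (fun t => (expR (m * s))%:C *: x.2 t + 0) = (fun t => (expR (m * s))%:C *: x.2 t).
    by apply/funext => t; rewrite addr0.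
  have -> : (fun t => (expR (m * s))%:C *: (m%:C *: x.2 t) + 0) = (fun t => (m * expR (m * s))%:C *: x.2 t).
    by apply/funext => t; rewrite addr0 scalerA -rmorphM mulrC.
  have -> : (expR (m * s))%:C *: (m%:C *: x.1) = (m * expR (m * s))%:C *: x.1.
    by rewrite scalerA -rmorphM mulrC.
  by rewrite !addr0.
have nx := nrm2_ge0 x.
have WD s : 0 <= s -> s <= 1 -> forall e, 0 < e -> exists2 d, 0 < d &
    forall s', 0 <= s' -> s' <= 1 -> s' != s -> `|s' - s| < d ->
    nrm2M2 (subM2 (scaleM2 ((s' - s)^-1)%:C (subM2 (W s') (W s))) (dW s)) <= e.
  move=> _ _ e e0; pose ep := Num.min 1 (e / (nrm2M2 x + 1)).
  have ep0 : 0 < ep by rewrite lt_min ltr01 /=; apply: divr_gt0 => //; lra.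
  have [d d0 hd] := expR_quotient m s ep0; exists d => // s' _ _ ne sd.
  have := hd (s' - s); rewrite subr_eq0 ne sd [s + _]addrC subrK => /(_ isT isT).
  set q := _ - m * expR (m * s) => hq.
  have -> : subM2 (scaleM2 ((s' - s)^-1)%:C (subM2 (W s') (W s))) (dW s) = scaleM2 q%:C x.
    have zid (v : 'cV[C]_n) : ((s' - s)^-1)%:C *: ((expR (m * s'))%:C *: v + -1 *: ((expR (m * s))%:C *: v)) +
        -1 *: ((m * expR (m * s))%:C *: v) = q%:C *: v.
      rewrite !scaleN1r -scalerBl scalerA -scalerBl; congr (_ *: _).
      by rewrite /q rmorphB !rmorphM rmorphB.
    rewrite /subM2 /W /dW /addM2 /scaleM2 /=; congr pair; first exact: zid.
    by apply/funext => t; exact: zid.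
  rewrite nrm2_scale // /cabs2 /= expr0n addr0.
  have q2 : q ^+ 2 <= ep.
    rewrite -real_normK ?num_real //; have e1 : ep <= 1 by rewrite ge_min lexx.
    by have := normr_ge0 q; move: (`|q|) hq => z z1 z2; nra.
  have e2 : ep <= e / (nrm2M2 x + 1) by rewrite ge_min lexx orbT.
  apply: (@le_trans _ _ (e / (nrm2M2 x + 1) * nrm2M2 x)).
    by apply: ler_wpM2r => //; exact: le_trans q2 e2.
  by rewrite mulrAC ler_pdivrMr; [nra|lra].
have := orbit SA ler01 WM WD => o.
have W0 : W 0 = x.
  rewrite /W mulr0 expR0 /scaleM2; case: (x) => x1 x2 /=; rewrite scale1r; congr pair.
  by apply/funext => t; rewrite scale1r.
rewrite W0 in o; have := hM x hx.
have hW1 : inM2 (W 1) by exact: inM2_scale.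
rewrite (nrm2_eq (S_in SA ler01 hx) hW1 o) /W mulr1 nrm2_scale // /cabs2 /= expr0n addr0 => le1.
apply: nrm2_eq0 => //.
have em : 1 + m <= expR m by apply: expR_ge1Dx.
have := ler_norm M.
move: (nrm2M2 x) (expR m) (`|M|) nx le1 em mM M0 => p q N' p0 le1 em mM M0 MN.
rewrite leNgt; apply/negP => pp.
have : q ^+ 2 <= M by rewrite -(ler_pM2r pp).
nra.
Qed.
End ResolventRank.

(** * Times greater than n *)

Section KernelControl.
Context (R : realType).
Local Notation C := R[i].

Lemma cexp_real (m r : R) : cexp (m%:C * r%:C) = (expR (m * r))%:C.
Proof. by rewrite /cexp /= !mul0r !mulr0 addr0 subr0 cos0 sin0 mulr1 mulr0. Qed.

(** The control 1 on [[s, t]] contributes at least [expR (m * (s + de)) * de], already from its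
    later half. A control on [[0, s]] contributes at most [expR (m * s) * B], which is smaller for
    large [m]. *)
Lemma laplace_nonzero (L s t : R) (U : R -> 'M[C]_1) : 0 <= s -> s < t -> t <= L -> ctrl s U ->
  exists m0 : R, forall m, m0 <= m -> 0 < m ->
    cnv (Ex L m%:C 1) (fun r => cut (- t) (- s) (fun=> 1%:M) r - U r) 0 <> 0.
Proof.
move=> s0 st tL [kU U0].
have kc : K (cut (- t) (- s) (fun=> 1%:M : 'M[C]_1)).
  by apply: (@K_cutb _ _ _ _ _ _ (mn (1%:M : 'M[C]_1))) => //; exact: Mm_cst.
have riU := Mi_mn (K_Mi kU).
pose B := rI (fun r => mn (U r)); pose de := (t - s) / 2.
have B0 : 0 <= B by apply: rI_ge0 => r; exact: mn_ge0.
have de0 : 0 < de by rewrite /de; lra.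
(* For such [m], [(1 + m * de) * de] exceeds [B]. *)
exists ((B + 1) / de / de) => m m1 m0 /eqP.
have kE := @K_Ex R L m%:C 1.
rewrite (convDr _ kE kc (KN kU)) (convNr _ kE kU) subr_eq0 => /eqP e.
have le1 : mn (cnv (Ex L m%:C 1) U 0) <= expR (m * s) * B.
  rewrite convE; apply: le_trans (mn_mI (conv_Mi 0 kE kU)) _.
  rewrite /B -rIZ //; apply: le_rI; [exact: Mi_mn (conv_Mi 0 kE kU)|exact: riZ|].
  move=> r; have [hr|hr] := boolP (- s <= r <= 0); last by rewrite U0 // mulmx0 mn0 mulr0.
  apply: le_trans (mnM _ _) _; apply: ler_wpM2r; first exact: mn_ge0.
  rewrite /Ex /cut sub0r; case: ifP => _; last by rewrite mn0 expR_ge0.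
  rewrite cexp_real mn_scalar mulr1n n1_real ger0_norm ?expR_ge0 // ler_expR.
  by apply: ler_wpM2l; [exact: ltW|move/andP: hr => [x y]; lra].
have le2 : expR (m * (s + de)) * de <= mn (cnv (Ex L m%:C 1) (cut (- t) (- s) (fun=> 1%:M)) 0).
  rewrite mn11; apply: le_trans (normRe_le _); apply: le_trans (ler_norm _).
  have ci := conv_Mi 0 kE kc 0 0.
  rewrite convE mIE /=.
  have -> : expR (m * (s + de)) * de = rI (fun r => expR (m * (s + de)) * ind (- t) (- (s + de)) r).
    rewrite rIZ; last exact: ri_indic.
    rewrite rI_indic; first by congr (_ * _); rewrite /de; lra.
    by rewrite /de; lra.
  apply: le_rI; [by apply: riZ; exact: ri_indic|exact: ci.1|].
  move=> r; rewrite /cut; case: ifP => hr; last first.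
    rewrite mulmx0 mxE /ind; case: (boolP (- t <= r <= - (s + de))) => [/andP[x y]|_].
      by move/negP: hr; case; rewrite x /=; lra.
    by rewrite mulr0.
  move/andP: hr => [x y]; rewrite mulmx1 /Ex /cut sub0r.
  have -> : 0 <= - r <= L by apply/andP; split; lra.
  rewrite cexp_real mxE eqxx mulr1n /=.
  rewrite /ind; case: (boolP (- t <= r <= - (s + de))) => [/andP[z1 z2]|_]; last by rewrite mulr0 expR_ge0.
  by rewrite mulr1 ler_expR; apply: ler_wpM2l; [exact: ltW|lra].
have := le_trans le2 _; move=> /(_ (expR (m * s) * B)); rewrite e => /(_ le1).
rewrite mulrDr expRD -mulrA ler_pM2l ?expR_gt0 // => le3.
have em : 1 + m * de <= expR (m * de) by exact: expR_ge1Dx.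
move: m1; rewrite !ler_pdivrMr // => m1.
move: (expR (m * de)) le3 em => q le3 em; nra.
Qed.
End KernelControl.

(** * Finite codimension of the reachable space *)

Section Generators.
Context (R : realType) (n : nat) (D : sys R n).
Local Notation C := R[i].
Local Notation N := (sN D).
Hypothesis nN : (n <= N)%N.
Variable Q : 'M[C]_n.
Hypothesis hQ : (\matrix_(i < n, k < n) bj (sA D) (sb D) k i 0) *m Q = 1%:M.
Local Notation Z := (Z D).

Lemma stp_delta m i (v : 'cV[C]_n) t :
  stp m i v t = \sum_(k < n) v k 0 *: stp m i (delta_mx k 0) t.
Proof.
rewrite stpE; case: ifP => ht; last by rewrite big1 // => k _; rewrite stpE ht scaler0.
rewrite {1}[v]matrix_sum_delta; apply: eq_bigr => k _.
by rewrite big_ord1 stpE ht.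
Qed.

Lemma prim_sum (I : finType) (a : I -> C) (g : I -> R -> 'cV[C]_n) t : (forall i, K (g i)) ->
  prim (fun r => \sum_i a i *: g i r) t = \sum_i a i *: prim (g i) t.
Proof.
move=> kg; have kc i := K_Mi (K_cut (-1) t (kg i)).
transitivity (mI (fun r => \sum_i a i *: cut (-1) t (g i) r)).
  apply: mI_ext => r; rewrite /cut; case: ifP => // _.
  by rewrite big1 // => i _; rewrite scaler0.
rewrite mI_sum; last by move=> i; exact: MiZ.
by apply: eq_bigr => i _; rewrite mIZ.
Qed.

(** Constants, and primitives of elementary step functions: the finitely many directions that
    controls at time [n] may miss. *)
Definition gen m (j : 'I_n + 'I_m * 'I_n) : R -> 'cV[C]_n :=
  match j with inl k => fun=> delta_mx k 0 | inr ik => prim (stp m ik.1 (delta_mx ik.2 0)) end.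
Definition dgen m (j : 'I_n + 'I_m * 'I_n) : R -> 'cV[C]_n :=
  match j with inl k => fun=> 0 | inr ik => stp m ik.1 (delta_mx ik.2 0) end.

Lemma gen_primitive m j : primitive_on (gen (m := m) j) (dgen j).
Proof.
case: j => [k|ik] /=; last by apply: prim_primitive; exact: K_stp.
split; first by apply: K_cut; exact: K0.
move=> t _; rewrite subrr -[LHS](@mI0 R n 1); apply: mI_ext => r; by rewrite /cut; case: ifP.
Qed.

(** The control of [fredholm] for the derivative of [f] errs by a step function. After integration
    the error is a constant plus primitives of step functions. *)
Lemma reach_cofinite : exists m, forall f g, primitive_on f g ->
  exists (a : 'I_n + 'I_m * 'I_n -> C) U, ctrl n%:R U /\
    forall t, -1 <= t -> t <= 0 -> f t = cnv Z U t + \sum_j a j *: gen j t.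
Proof.
have [m [hc [m0 khc sol _]]] := fredholm (leqW nN) hQ; exists m => f g [kg pf].
have [U [cU hU]] := sol g kg; have kU := cU.1.
have nNR : (n%:R : R) <= N%:R by rewrite ler_nat.
have [_ pU] := zeta_primitive nNR (ctrl'_ctrl cU).
pose v := f (-1) - cnv Z U (-1).
pose co (ik : 'I_m * 'I_n) := cnv hc U (- (ik.1%:R / m%:R)) ik.2 0.
exists (fun j => match j with inl k => v k 0 | inr ik => - co ik end), U.
split; first exact: ctrl'_ctrl.
move=> t t1 t0; have ht : -1 <= t <= 0 by rewrite t1 t0.
have kr := K_rho D kU; have kF := @K_fin_rank _ _ m hc U.
have eg : mI (cut (-1) t g) = mI (cut (-1) t (rho D U)) - mI (cut (-1) t (fin_rank m hc U)).
  have k1 := K_Mi (K_cut (-1) t kr); have k2 := K_Mi (K_cut (-1) t kF).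
  rewrite -(mIB k1 k2).
  have kg' : K (cut (-1) t g).
    apply: K_ext (K_cut (-1) t kg) => r; rewrite /cut; case: ifP => // /andP[x y].
    by rewrite x (le_trans y t0).
  have ae0 : {ae @lebesgue_measure R, forall r, cut (-1) t g r =
      cut (-1) t (rho D U) r - cut (-1) t (fin_rank m hc U) r}.
    apply: (aeS (@ae_neq R (-1))) => r r1; rewrite /cut; case: ifP => [/andP[x y]|_]; last by rewrite subr0.
    have r1' : -1 < r by rewrite lt_def x andbT; apply/eqP.
    by rewrite (hU r r1' (le_trans y t0)) addrK.
  exact: (mI_ae (K_Mi kg') (Mi_Mm (MiB k1 k2)) ae0).2.
have eF : mI (cut (-1) t (fin_rank m hc U)) = \sum_ik co ik *: gen (inr ik) t.
  have kst (ik : 'I_m * 'I_n) : K (stp m ik.1 (delta_mx ik.2 0 : 'cV[C]_n)) by exact: K_stp.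
  rewrite -(prim_sum co t kst) /prim; congr mI; congr (cut _ _ _); apply/funext => r.
  rewrite -(pair_bigA _ (fun (i : 'I_m) (k : 'I_n) => co (i, k) *: stp m i (delta_mx k 0) r)) /=.
  by apply: eq_bigr => i _; rewrite stp_delta.
have ev : v = \sum_(k < n) v k 0 *: gen (m := m) (inl k) t.
  rewrite {1}[v]matrix_sum_delta; apply: eq_bigr => k _; by rewrite big_ord1.
rewrite big_sumType /= -ev.
have -> : \sum_i - co i *: prim (stp m i.1 (delta_mx i.2 0)) t = - mI (cut (-1) t (fin_rank m hc U)).
  by rewrite eF -sumrN; apply: eq_bigr => ik _; rewrite scaleNr.
have := pf t ht; rewrite eg -(pU t ht) /v => e.
rewrite -[LHS](subrK (f (-1))) e.
move: (cnv Z U t) (cnv Z U (-1)) (mI _) (f (-1)) => p q r s.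
by rewrite -!addrA; congr (p + _); rewrite [RHS]addrC -addrA.
Qed.
End Generators.

(** * The single jump of a state of Z *)

Section Jumps.
Context (R : realType) (n : nat) (D : sys R n).
Local Notation C := R[i].
Local Notation N := (sN D).
Local Notation emb := (emb D).
Local Notation bj := (bj (sA D) (sb D)).
Local Notation H p := (Hv (sL D) p).

Lemma Z_jump (j : nat) (s t : R) : (j <= N)%N -> 0 <= s -> s < 1 -> -1 <= t -> t <= 0 ->
  Z D (j%:R + s + t) = (\sum_(i < N.+1 | (i < j)%N) bj i + cnv (H n) (sh D) (j%:R + s + t)) +
    (if - s <= t then bj j else 0).
Proof.
move=> jN s0 s1 t1 t0; rewrite ZE ZJE [RHS]addrAC; congr (_ + _).
have jL : (j%:R : R) <= N%:R by rewrite ler_nat.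
have i0 (i : nat) : (0 : R) <= i%:R by [].
have jN' : (j < N.+1)%N by [].
rewrite (bigD1 (Ordinal jN')) //= [LHS]addrC; congr (_ + _); last first.
  have -> : j%:R + s + t - j%:R = s + t by rewrite addrAC [j%:R + s]addrC addrK.
  case: ifP => st; last first.
    by rewrite Hv0 ?mul0mx //; move/negbT: st; rewrite -ltNge; lra.
  by rewrite Hv1 ?mul1mx //; apply/andP; split; [lra|rewrite /sL -natr1; have := i0 N; lra].
rewrite [RHS]big_mkcond [LHS]big_mkcond /=; apply: eq_bigr => i _.
have [ij|ij|ij] := ltngtP i j.
- have -> : i != Ordinal jN' by rewrite -val_eqE /= neq_ltn ij.
  rewrite Hv1 ?mul1mx //; have : (i%:R : R) + 1 <= j%:R by rewrite natr1 ler_nat.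
  by have := i0 i; move=> x y; apply/andP; split; [lra|rewrite /sL -natr1; lra].
- have -> : i != Ordinal jN' by rewrite -val_eqE /= neq_ltn ij orbT.
  rewrite Hv0 ?mul0mx //; have : (j%:R : R) + 1 <= i%:R by rewrite natr1 ler_nat.
  by move=> x; lra.
- by have -> : (i != Ordinal jN') = false by apply/negbTE; rewrite negbK -val_eqE /= ij.
Qed.

(** A window of length 1 ending at [j + s] sees one jump, that at time [j]. Earlier jumps only add a
    constant, and what remains is absolutely continuous. *)
Lemma dX_jump (j : nat) (s : R) : (j <= N)%N -> 0 <= s -> s < 1 ->
  exists f g, primitive_on f g /\
    eqM2 (dX D (j%:R + s)) (addM2 (emb f) (bj j, fun t => if - s <= t then bj j else 0)).
Proof.
move=> jN s0 s1; have jL : (j%:R : R) <= N%:R by rewrite ler_nat.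
have j0 : (0 : R) <= j%:R by [].
have kh := shK D; have l10 : (-1 : R) <= 0 by rewrite lerN10.
have [c ec] : exists c, c = \sum_(i < N.+1 | (i < j)%N) bj i by eexists.
exists (fun t => c + cnv (H n) (sh D) (j%:R + s + t)), (fun t => sh D (j%:R + s + t)); split.
  have kg : K (fun t => sh D (j%:R + s + t)) by apply: K_ext (K_shift (j%:R + s) kh) => t; rewrite addrC.
  split; first exact: K_cut.
  move=> t /andP[t1 t0]; rewrite opprD addrACA subrr add0r.
  have st : j%:R + s - 1 <= j%:R + s + t by rewrite lerD2l.
  have tL : j%:R + s + t - sL D <= 0 by rewrite /sL -natr1; lra.
  rewrite (Hv_diff kh (@sh_neg _ _ D) st tL).
  rewrite -(mI_shift (j%:R + s) (K_Mi (K_cut (j%:R + s - 1) (j%:R + s + t) kh))).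
  apply: mI_ext => r; rewrite /cut [r + _]addrC !lerD2l //.
have z0 := Z_jump jN s0 s1 l10 (lexx 0); have z1 := Z_jump jN s0 s1 (lexx (-1)) l10.
have hs0 : - s <= 0 by rewrite oppr_le0.
(* As [s < 1], the jump comes strictly after the left end -1, so the delayed term misses it and the
   first component receives all of [bj j]. *)
have hs1 : (- s <= -1) = false by apply/negbTE; rewrite -ltNge ltrN2.
rewrite -ec hs0 in z0; rewrite -ec hs1 addr0 in z1.
split; first by rewrite /= z0 z1 addrAC.
apply: aeW => t; rewrite /Iint /= in_itv /= => /andP[t1 t0].
by rewrite (Z_jump jN s0 s1 t1 t0) -ec.
Qed.
End Jumps.

(** * Reachable spaces and the graph of m - A *)

Section LongTime.
Context (R : realType) (n : nat).
Local Notation C := R[i].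
Variables (Am1 : 'M[R]_n) (b : 'cV[R]_n) (A2 A3 : R -> 'M[C]_n) (D : sys R n).
Hypothesis hA : sA D = toCmx Am1.
Hypothesis hb : sb D = toCmx b.
Hypothesis h2 : s2 D = cut 0 1 (fun r => A2 (- r)).
Hypothesis h3 : s3 D = cut 0 1 (fun r => A3 (- r)).
Local Notation Ar := (Arel Am1 A2 A3).
Local Notation N := (sN D).
Local Notation emb := (emb D).
Local Notation Mt := (M2 R n).
Local Notation Z := (Z D).
Local Notation DA := (inDA Am1 A2 A3).

Lemma subM2_sub (x y : Mt) : subM2 x y = x - y.
Proof. by rewrite -scaleN1r. Qed.
Lemma eqM2_lin a (x x' y y' : Mt) : eqM2 x x' -> eqM2 y y' -> eqM2 (a *: x + y) (a *: x' + y').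
Proof. by move=> e1 e2; exact: eqM2_add (eqM2_scale a e1) e2. Qed.
Lemma eqM2_B (x x' y y' : Mt) : eqM2 x x' -> eqM2 y y' -> eqM2 (x - y) (x' - y').
Proof. by move=> e1 e2; rewrite -!subM2_sub; exact: eqM2_sub. Qed.

Lemma ssp_inM2 : subspace (@inM2 R n : Mt -> Prop).
Proof.
split; first by apply: (@K_inM2 R n 0); exact: K0.
by move=> a x y hx hy; apply: inM2_add => //; exact: inM2_scale.
Qed.

Definition Rs (t : R) (x : Mt) : Prop := inM2 x /\ exists2 U, ctrl t U & eqM2 x (Wst D U).

Lemma Wst_lin a U V : K U -> K V -> Wst D (fun r => a *: U r + V r) = a *: Wst D U + Wst D V.
Proof.
move=> kU kV; rewrite /Wst -[RHS]emb_lin; congr (emb _); apply/funext => t.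
by rewrite (cnv_lin_r _ _ (K_Z D) kU kV).
Qed.
Lemma ctrl_lin (t : R) a U V : ctrl t U -> ctrl t V -> ctrl t (fun r => a *: U r + V r).
Proof.
move=> [kU U0] [kV V0]; split; first by apply: KD => //; exact: KZ.
by move=> r hr; rewrite U0 // V0 // scaler0 addr0.
Qed.
Lemma Wst0 : Wst D (fun=> 0) = 0.
Proof.
have e t : cnv Z (fun=> 0 : 'M[C]_1) t = 0.
  by rewrite convE -(@mI0 R n 1); apply: mI_ext => r; rewrite mulmx0.
have -> : Wst D (fun=> 0) = (cnv Z (fun=> 0 : 'M[C]_1) 0 - sA D *m cnv Z (fun=> 0 : 'M[C]_1) (-1), cnv Z (fun=> 0 : 'M[C]_1)) by [].
rewrite !e mulmx0 subr0; congr pair; apply/funext => t; exact: e.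
Qed.
Lemma ssp_Rs t : subspace (Rs t).
Proof.
split.
  split; first exact: ssp_inM2.1.
  exists (fun=> 0); first by split; [exact: K0|].
  by rewrite Wst0; exact: eqM2_refl.
move=> a x y [hx [U cU eU]] [hy [V cV eV]]; split; first exact: ssp_inM2.2.
exists (fun r => a *: U r + V r); first exact: ctrl_lin.
by rewrite Wst_lin; [exact: eqM2_lin|exact: cU.1|exact: cV.1].
Qed.
Lemma Rs_mono s t x : s <= t -> Rs s x -> Rs t x.
Proof.
move=> st [hx [U [kU U0] eU]]; split=> //; exists U => //; split=> // r hr; apply: U0.
by apply: contra hr => /andP[p q]; rewrite q andbT; apply: le_trans p; rewrite lerN2.
Qed.
Lemma Rs_eq t x y : inM2 y -> eqM2 x y -> Rs t x -> Rs t y.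
Proof.
move=> hy e [hx [U cU eU]]; split=> //; exists U => //.
exact: eqM2_trans (eqM2_sym e) eU.
Qed.
Lemma Rs_Wst t U : ctrl t U -> Rs t (Wst D U).
Proof. by move=> cU; split; [exact: (Wst_in D cU.1)|exists U => //; exact: eqM2_refl]. Qed.
Lemma Rs_DA t x : t <= N%:R -> Rs t x -> DA x.
Proof.
move=> tN [hx [U cU eU]]; split=> //.
exists (cnv (s2 D) (rho D U) 0 + cnv (s3 D) (cnv Z U) 0, rho D U).
exact: (Arel_eq (Arel_Wst hA h2 h3 tN cU) (eqM2_sym eU) (eqM2_refl _)).
Qed.
Lemma ssp_DA : subspace DA.
Proof.
split; first by apply: (@Rs_DA 0) => //; exact: (ssp_Rs 0).1.
move=> a x y [hx [v av]] [hy [w aw]]; split; first exact: ssp_inM2.2.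
exists (a *: v + w); exact: (Arel_lin hA h2 h3 a av aw).
Qed.

(** The graph of [m - A]. A relation is used because elements of the state space are
    representatives. *)
Definition Pr (m : C) (x y : Mt) : Prop := inM2 y /\ Ar x (m *: x - y).

Lemma lin_sub (L : lmodType C) (a m : C) (x x' y y' : L) :
  a *: (m *: x - y) + (m *: x' - y') = m *: (a *: x + x') - (a *: y + y').
Proof. by rewrite scalerBr scalerDr opprD addrACA !scalerA mulrC. Qed.
Lemma Pr_lin m a x y x' y' : Pr m x y -> Pr m x' y' -> Pr m (a *: x + x') (a *: y + y').
Proof.
move=> [h a1] [h' a2']; split; first exact: ssp_inM2.2.
by rewrite -lin_sub; exact: (Arel_lin hA h2 h3 a a1 a2').
Qed.
Lemma Pr_eq m x y x' y' : inM2 y' -> eqM2 x x' -> eqM2 y y' -> Pr m x y -> Pr m x' y'.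
Proof.
move=> hy' e1 e2 [hy a1]; split=> //; apply: (Arel_eq a1 e1).
by apply: eqM2_B => //; exact: eqM2_scale.
Qed.
Lemma Pr_ex m x : DA x -> exists y, Pr m x y.
Proof.
move=> [hx [v av]]; have [f [g [pf ef ev]]] := Arel_inv hA h2 h3 av.
have hv : inM2 (cnv (s2 D) g 0 + cnv (s3 D) f 0, g) by apply/inM2_K; exact: pf.1.
exists (m *: x - (cnv (s2 D) g 0 + cnv (s3 D) f 0, g)); split.
  by apply: sspB ssp_inM2 _ hv; exact: sspZ ssp_inM2 hx.
by rewrite subKr; exact: (Arel_eq av (eqM2_refl _) ev).
Qed.
Lemma Pr_0 m : Pr m 0 0.
Proof.
have [y py] := Pr_ex m ssp_DA.1; have := Pr_lin (-1) py py.
by rewrite !scaleN1r !addNr.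
Qed.
Lemma Pr_B m x y x' y' : Pr m x y -> Pr m x' y' -> Pr m (x - x') (y - y').
Proof. by move=> p q; have := Pr_lin (-1) q p; rewrite !scaleN1r ![- _ + _]addrC. Qed.
Lemma Pr_Z m a x y : Pr m x y -> Pr m (a *: x) (a *: y).
Proof. by move=> p; have := Pr_lin a p (Pr_0 m); rewrite !addr0. Qed.
Lemma Pr_sum m (I : finType) (a : I -> C) (x y : I -> Mt) : (forall i, Pr m (x i) (y i)) ->
  Pr m (\sum_i a i *: x i) (\sum_i a i *: y i).
Proof.
move=> h; elim/big_ind2 : _ => [|x1 y1 x2' y2 p1 p2|i _]; [exact: Pr_0| |exact: Pr_Z].
by have := Pr_lin 1 p1 p2; rewrite !scale1r.
Qed.

End LongTime.

(** * From stalling to reachability of D(A) *)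

Section Core.
Context (R : realType) (n : nat).
Local Notation C := R[i].
Variables (Am1 : 'M[R]_n) (b : 'cV[R]_n) (A2 A3 : R -> 'M[C]_n) (D : sys R n).
Hypothesis hA : sA D = toCmx Am1.
Hypothesis hb : sb D = toCmx b.
Hypothesis h2 : s2 D = cut 0 1 (fun r => A2 (- r)).
Hypothesis h3 : s3 D = cut 0 1 (fun r => A3 (- r)).
Local Notation Ar := (Arel Am1 A2 A3).
Local Notation N := (sN D).
Local Notation emb := (emb D).
Local Notation Mt := (M2 R n).
Local Notation Z := (Z D).
Local Notation DA := (inDA Am1 A2 A3).
Local Notation bj := (bj (sA D) (sb D)).
Local Notation Rs := (Rs D).
Local Notation ssp2 := (ssp_inM2 R n).
Hypothesis nN : (n <= N)%N.
Variable Q : 'M[C]_n.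
Hypothesis hQ : (\matrix_(i < n, k < n) bj k i 0) *m Q = 1%:M.
Hypothesis hrank : forall l : C, \rank (row_mx (Delta Am1 A2 A3 l) (toCmx b)) = n.
Variables (t1 t2 : R) (m : C) (U0 : R -> 'M[C]_1).
Hypothesis nt1 : n%:R <= t1.
Hypothesis t12 : t1 <= t2.
Hypothesis t2N : t2 <= N%:R.
Hypothesis stall : forall x, Rs t2 x -> Rs t1 x.
Hypothesis minj : forall x, inM2 x -> Ar x (scaleM2 m x) -> eqM2 x (0, fun=> 0).
Hypothesis cU0 : ctrl t2 U0.
Hypothesis W0 : eqM2 (Wst D U0) 0.
Hypothesis uhat : cnv (Ex (sL D) m 1) U0 0 <> 0.
Local Notation Pr := (Pr Am1 A2 A3 m).

Let t1N : t1 <= N%:R. Proof. exact: le_trans t12 t2N. Qed.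
Let n00 : (0 : R) <= n%:R. Proof. by []. Qed.
Let t20 : 0 <= t2. Proof. exact: le_trans n00 (le_trans nt1 t12). Qed.
Let t10 : 0 <= t1. Proof. exact: le_trans n00 nt1. Qed.

(** The image of the stalled space under [m - A]. The quotient of D(A) by the stalled space
    corresponds to that of the whole state space by [Um], and the eigenvalue argument is carried out
    in the latter. *)
Definition Um (y : Mt) : Prop := exists2 v, Rs t1 v & Pr v y.

Lemma ssp_Um : subspace Um.
Proof.
split; first by exists 0; [exact: (ssp_Rs D t1).1|exact: (Pr_0 hA h2 h3 m)].
move=> a x y [v hv pv] [w hw pw]; exists (a *: v + w); first exact: (ssp_Rs D t1).2.
exact: (Pr_lin hA h2 h3 a pv pw).
Qed.
Lemma Um_eq y y' : inM2 y' -> eqM2 y y' -> Um y -> Um y'.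
Proof. by move=> hy' e [v hv pv]; exists v => //; exact: Pr_eq (eqM2_refl _) e pv. Qed.

Lemma Um_control U : ctrl t2 U -> Um (Wst D U - (sb D *m cnv (Ex (sL D) m 1) U 0, fun=> 0)).
Proof.
move=> cU; have [P [cP aP]] := resolvent_control hA h2 h3 m t20 t2N cU.
exists (Wst D P); first by apply: stall; exact: Rs_Wst.
split; last by move: aP; rewrite !subM2_sub.
apply: sspB ssp2 (Wst_in D cU.1) _.
by apply: (@K_inM2 R n); exact: K0.
Qed.
Lemma in_const (v : 'cV[C]_n) : inM2 ((v, fun=> 0) : Mt). Proof. by apply: K_inM2; exact: K0. Qed.
Lemma const_scale (a : C) (v : 'cV[C]_n) : a *: ((v, fun=> 0) : Mt) = (a *: v, fun=> 0).
Proof. by congr pair; apply/funext => t; exact: scaler0. Qed.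

(** [U0] reaches the zero state, so [Um_control] leaves a multiple of [(b, 0)] alone, and the factor
    is nonzero by [uhat]. *)
Lemma Um_B (s : C) : Um (s *: sb D, fun=> 0).
Proof.
have u0 : cnv (Ex (sL D) m 1) U0 0 0 0 != 0.
  apply/eqP => e; apply: uhat; apply/matrixP => i j.
  by rewrite (ord1 i) (ord1 j) e mxE.
have := Um_control cU0; set u := cnv _ _ _ in u0 *.
have -> : sb D *m u = u 0 0 *: sb D by rewrite [in LHS](mx11_scalar u) mul_mx_scalar.
move=> h; have h' : Um (0 - (u 0 0 *: sb D, fun=> 0)).
  apply: Um_eq h; first by apply: sspB ssp2 ssp2.1 (in_const _).
  by apply: eqM2_B W0 (eqM2_refl _).
have := sspZ (- (s / u 0 0)) ssp_Um h'.
by rewrite sub0r scaleNr scalerN opprK const_scale scalerA divfK.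
Qed.

(** This is the stability of the stalled space under the inverse of [m - A]: [resolvent_control]
    gives it up to a multiple of [(b, 0)], and [Um_B] removes that. *)
Lemma Rs_Um x : Rs t1 x -> Um x.
Proof.
move=> [hx [U cU eU]].
have cU2 : ctrl t2 U.
  case: cU => kU U0'; split=> // r hr; apply: U0'; apply: contra hr => /andP[p q].
  by rewrite q andbT; apply: le_trans p; rewrite lerN2.
have h := Um_control cU2; move: h; set u := cnv _ _ _.
have -> : sb D *m u = u 0 0 *: sb D by rewrite [in LHS](mx11_scalar u) mul_mx_scalar.
move=> h; have := sspD ssp_Um h (Um_B (u 0 0)); rewrite subrK => h'.
exact: Um_eq hx (eqM2_sym eU) h'.
Qed.

(** The rank condition solves the equation up to a multiple of [(b, 0)], which [Um_B] shows to be in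
    the range as well. *)
Lemma Pr_surj y : inM2 y -> exists2 x, DA x & Pr x y.
Proof.
move=> hy; have [x [s [hx ax]]] := resolvent_rank hA hb h2 h3 (hrank m) hy.
have [v hv pv] := Um_B s.
have px : Pr x (y - (s *: sb D, fun=> 0)).
  by split; [apply: sspB ssp2 hy (in_const _)|move: ax; rewrite !subM2_sub].
exists (x + v).
  apply: sspD (ssp_DA hA h2 h3) _ (Rs_DA hA h2 h3 t1N hv).
  by split=> //; eexists; exact: ax.
by have := Pr_lin hA h2 h3 1 px pv; rewrite !scale1r subrK.
Qed.

Lemma eqM2_sub0 (x y : Mt) : eqM2 (x - y) 0 -> eqM2 x y.
Proof.
move=> e; have := eqM2_lin 1 e (eqM2_refl y); by rewrite !scale1r subrK add0r.
Qed.
Lemma Pr_inj x v y : inM2 x -> inM2 v -> Pr x y -> Pr v y -> eqM2 x v.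
Proof.
move=> hx hv px pv; have [_ a] := Pr_B hA h2 h3 px pv.
apply: eqM2_sub0; apply: minj; first exact: sspB ssp2 hx hv.
by move: a; rewrite subrr subr0.
Qed.
Lemma Um_inj x y : inM2 x -> Pr x y -> Um y -> Rs t1 x.
Proof.
move=> hx px [v hv pv]; have hv1 := hv.1; apply: (Rs_eq hx _ hv); apply: eqM2_sym.
exact: Pr_inj hx hv1 px pv.
Qed.

Lemma X_Wst s : 0 <= s -> s <= N%:R ->
  ctrl s (cut (- s) 0 (fun=> 1%:M)) /\ eqM2 (X D s) (Wst D (cut (- s) 0 (fun=> 1%:M))).
Proof.
move=> s0 sN; split.
  split; last by move=> r hr; rewrite /cut (negbTE hr).
  by apply: (@K_cutb _ _ _ _ _ _ (mn (1%:M : 'M[C]_1))) => //; exact: Mm_cst.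
apply: eqM2_emb => t tm t0; have kZ := K_Z D; have kH := K_H D 1.
have -> : cnv Z (cut (- s) 0 (fun=> 1%:M)) t = cnv Z (fun r => Hv (sL D) 1 (r - - s)) t.
  apply: (conv_local_r (@Z_neg _ _ D)); rewrite subr0 => r rt; rewrite opprK /Hv /cut.
  have -> : (- s <= r <= 0) = (- s <= r) by rewrite (le_trans rt t0) andbT.
  have -> : (0 <= r + s <= sL D) = (- s <= r); last by [].
  have -> : r + s <= sL D by rewrite /sL -natr1; lra.
  by rewrite andbT -lerBlDr sub0r.
rewrite (conv_shiftr _ _ kZ kH) opprK -(conv_HvC _ _ kZ) zzE addrC //.
Qed.

(** [X s] is reached by the control 1 on [[0, s]], and [dX s = m X s - (m - A) X s + (b, 0)] by
    [Arel_X]; all three terms lie in [Um]. *)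
Lemma Um_dX s : 0 <= s -> s <= t1 -> Um (dX D s).
Proof.
move=> s0 st; have sN := le_trans st t1N; have [cs es] := X_Wst s0 sN.
have rX : Rs t1 (X D s).
  apply: (Rs_mono st); split; first exact: X_in.
  by exists (cut (- s) 0 (fun=> 1%:M)).
have pX : Pr (X D s) (m *: X D s - (dX D s - Bv D)).
  split; last by rewrite subKr -subM2_sub; exact: (Arel_X hA h2 h3 s0 sN).
  apply: sspB ssp2 (sspZ _ ssp2 (X_in D s)) _.
  by apply: sspB ssp2 (dX_in D s) (Bv_in D).
have u1 : Um (m *: X D s - (dX D s - Bv D)) by exists (X D s).
have u2 := sspB ssp_Um (sspZ m ssp_Um (Rs_Um rX)) u1; rewrite subKr in u2.
have := sspD ssp_Um u2 (Um_B 1); rewrite scale1r.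
by rewrite -[(sb D, _)]/(Bv D) subrK.
Qed.

(** The sum of D(A) and [Um]. That it is everything means that the inverse of [m - A] is onto modulo
    [Um], which excludes the eigenvalue 0 on the quotient. *)
Definition UD (y : Mt) : Prop := exists2 x, DA x & Um (y - x).

Lemma ssp_UD : subspace UD.
Proof.
have sD := ssp_DA hA h2 h3; have sU := ssp_Um.
split; first by exists 0; [exact: sD.1|rewrite subr0; exact: sU.1].
move=> a y y' [x dx ux] [x' dx' ux']; exists (a *: x + x'); first exact: sD.2.
have := sU.2 a _ _ ux ux'; have -> // : a *: (y - x) + (y' - x') = a *: y + y' - (a *: x + x').
by rewrite scalerBr opprD addrACA.
Qed.
Lemma Um_UD y : Um y -> UD y.
Proof. by move=> u; exists 0; [exact: (ssp_DA hA h2 h3).1|rewrite subr0]. Qed.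
Lemma DA_UD y : DA y -> UD y.
Proof. by move=> d; exists y => //; rewrite subrr; exact: ssp_Um.1. Qed.
Lemma UD_eq y y' : inM2 y' -> eqM2 y y' -> UD y -> UD y'.
Proof.
move=> hy' e [x dx ux]; exists x => //; apply: Um_eq ux.
  by apply: sspB ssp2 hy' dx.1.
exact: eqM2_B e (eqM2_refl _).
Qed.
Lemma emb_DA f g : primitive_on f g -> DA (emb f).
Proof.
move=> pf; apply/(inDA_emb hA h2 h3 (primitive_bounded D pf)).
by exists f, g; split=> //; exact: eqM2_refl.
Qed.

Let jmp (s : R) (v : 'cV[C]_n) t : 'cV[C]_n := if - s <= t then v else 0.
Lemma in_jmp c s v : inM2 ((c, jmp s v) : Mt).
Proof.
apply/inM2_K; rewrite /=; have k : K (cut (- s) 0 (fun=> v)).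
  by apply: (@K_cutb _ _ _ _ _ _ (mn v)) => //; exact: Mm_cst.
apply: K_ext (K_cut (-1) 0 k) => t; rewrite /cut /jmp; case: ifP => // /andP[_ ->].
by rewrite andbT.
Qed.
(** The times [j + s] with [j < n] and [s < 1] stay below [n <= t1], so the states [dX (j + s)] lie
    in [Um]; by [dX_jump] they are pure jumps modulo D(A). *)
Lemma UD_jump (j : 'I_n) s : 0 <= s -> s < 1 -> UD (bj j, jmp s (bj j)).
Proof.
move=> s0 s1; have jN : (j <= N)%N by exact: leq_trans (ltnW (ltn_ord j)) nN.
have [f [g [pf e]]] := dX_jump jN s0 s1.
have js0 : 0 <= j%:R + s by apply: addr_ge0.
have js1 : j%:R + s <= t1.
  have : (j%:R : R) + 1 <= n%:R by rewrite natr1 ler_nat.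
  have := nt1; lra.
have u : UD (emb f + (bj j, jmp s (bj j))).
  apply: (UD_eq _ e (Um_UD (Um_dX js0 js1))).
  by apply: sspD ssp2 (primitive_bounded D pf) (in_jmp _ _ _).
by have := sspB ssp_UD u (DA_UD (emb_DA pf)); rewrite addrC addKr.
Qed.

Lemma bj_span (v : 'cV[C]_n) : exists a : 'I_n -> C, v = \sum_j a j *: bj j.
Proof.
exists (fun j => (rq Q j *m v) 0 0).
rewrite -[LHS]mul1mx -(bj_rq hQ) mulmx_suml; apply: eq_bigr => j _.
rewrite -mulmxA [in LHS](mx11_scalar (rq Q j *m v)) mul_mx_scalar //.
Qed.
Lemma UD_bj (j : 'I_n) : UD (bj j, fun=> 0).
Proof.
apply: (UD_eq (in_const _) _ (UD_jump j (lexx 0) ltr01)); split=> //.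
apply: (aeS (@ae_neq R 0)) => t t0 It; rewrite /= /jmp oppr0; case: ifP => // t00.
move: It; rewrite /Iint /= in_itv /= => /andP[_ t0']; case: t0; apply/eqP.
by rewrite eq_le t0' t00.
Qed.
Lemma UD_const v : UD (v, fun=> 0).
Proof.
have [a ->] := bj_span v.
have sC : subspace (fun v => UD (v, fun=> 0)).
  split; first exact: ssp_UD.1.
  move=> c x y hx hy; have := ssp_UD.2 c _ _ hx hy.
  have -> // : c *: ((x, fun=> 0) : Mt) + (y, fun=> 0) = (c *: x + y, fun=> 0).
  by rewrite const_scale; congr pair; apply/funext => t; exact: addr0.
by apply: (ssp_sum _ sC) => j; exact: UD_bj.
Qed.
Lemma jmp_lin s c v w : jmp s (c *: v + w) = (fun t => c *: jmp s v t + jmp s w t).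
Proof. by apply/funext => t; rewrite /jmp; case: ifP => _; rewrite ?scaler0 ?addr0. Qed.
Lemma UD_jmp s v : 0 <= s -> s <= 1 -> UD (0, jmp s v).
Proof.
move=> s0; rewrite le_eqVlt => /orP[/eqP ->|s1].
  (* A jump at -1 is a constant on the interval, hence comes from D(A). *)
  pose z : R -> 'cV[C]_n := fun=> 0.
  have pv : primitive_on (fun=> v) z.
    split; first by apply: K_cut; exact: K0.
    by move=> t _; rewrite subrr -[LHS](@mI0 R n 1); apply: mI_ext => r; rewrite /cut; case: ifP.
  have u := sspB ssp_UD (DA_UD (emb_DA pv)) (UD_const (v - sA D *m v)).
  apply: UD_eq (in_jmp _ _ _) _ u; split; first by rewrite /= subrr.
  apply: aeW => t; rewrite /Iint /= in_itv /= /jmp => /andP[-> _].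
  exact: subr0.
have [a ->] := bj_span v.
have sC : subspace (fun v => UD (0, jmp s v)).
  split.
    have -> : jmp s 0 = (fun=> 0) by apply/funext => t; rewrite /jmp; case: ifP.
    exact: UD_const.
  move=> c x y hx hy; have := ssp_UD.2 c _ _ hx hy.
  rewrite jmp_lin; have -> // : c *: ((0, jmp s x) : Mt) + (0, jmp s y) = (0, fun t => c *: jmp s x t + jmp s y t).
  by congr pair; rewrite -[LHS]/(c *: (0 : 'cV[C]_n) + 0) scaler0 addr0.
apply: (ssp_sum _ sC) => j.
have := sspB ssp_UD (UD_jump j s0 s1) (UD_bj j).
have -> // : ((bj j, jmp s (bj j)) : Mt) - (bj j, fun=> 0) = (0, jmp s (bj j)).
by congr pair; [exact: subrr|apply/funext => t; exact: subr0].
Qed.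
(** A step on a block is the difference of the jumps at its two ends, up to these ends. *)
Lemma UD_stp p (i : 'I_p) v : UD (0, stp p i v).
Proof.
have p0 : (0 : R) < p%:R by rewrite ltr0n; exact: leq_trans (ltn_ord i).
have s1 : (0 : R) <= i%:R / p%:R by rewrite divr_ge0 // ltW.
have s2 : (0 : R) <= i.+1%:R / p%:R by rewrite divr_ge0 // ltW.
have s3 : (i%:R / p%:R : R) <= 1 by rewrite ler_pdivrMr // mul1r ler_nat ltnW.
have s4 : (i.+1%:R / p%:R : R) <= 1 by rewrite ler_pdivrMr // mul1r ler_nat.
have s5 := stp_le R p i.
have u := sspB ssp_UD (UD_jmp v s2 s4) (UD_jmp v s1 s3).
apply: UD_eq _ _ u; first by apply: K_inM2; exact: K_stp.
split; first exact: subrr.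
apply: (aeS (aeI (@ae_neq R (- (i.+1%:R / p%:R))) (@ae_neq R (- (i%:R / p%:R))))) => t [n1 n2] _.
rewrite /= stpE; rewrite -[LHS]/(jmp _ _ _ - jmp _ _ _) /jmp.
move: (- (i.+1%:R / p%:R)) (- (i%:R / p%:R)) s5 n1 n2 => x y xy /eqP n1 /eqP n2.
have -> : (x < t) = (x <= t) by rewrite lt_def n1.
have -> : (y <= t) = (y < t) by rewrite lt_def n2.
rewrite [t <= y]leNgt; case: (ltP y t) => yt; last by rewrite andbT subr0.
by rewrite andbF (le_trans xy (ltW yt)) subrr.
Qed.
Lemma UD_pair c g : UD (0, g) -> UD (c, g).
Proof.
move=> u; have := sspD ssp_UD (UD_const c) u; have -> // : ((c, fun=> 0) : Mt) + (0, g) = (c, g).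
by congr pair; [exact: addr0|apply/funext => t; exact: add0r].
Qed.

Lemma emb_sum (I : finType) (a : I -> C) (F : I -> R -> 'cV[C]_n) :
  emb (fun t => \sum_i a i *: F i t) = \sum_i a i *: emb (F i).
Proof.
elim: (index_enum I) => [|i s IH].
  rewrite big_nil; have -> : (fun t => \sum_(i <- [::]) a i *: F i t) = (fun=> 0 : 'cV[C]_n).
    by apply/funext => t; rewrite big_nil.
  by congr pair; rewrite -[LHS]/((0 : 'cV[C]_n) - sA D *m 0) mulmx0 subr0.
rewrite big_cons -IH -[RHS]emb_lin; congr (emb _); apply/funext => t.
by rewrite big_cons.
Qed.

Definition Eg p (j : 'I_n + 'I_p * 'I_n) : Mt := emb (gen j).
(** The image of [Eg j] under [m - A]. These states generate the state space modulo [Um], and belong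
    to [UD] since their second component is a step function modulo D(A). *)
Definition Qg p (j : 'I_n + 'I_p * 'I_n) : Mt :=
  m *: Eg j - (cnv (s2 D) (dgen j) 0 + cnv (s3 D) (gen j) 0, dgen j).

Lemma Eg_DA p (j : 'I_n + 'I_p * 'I_n) : DA (Eg j).
Proof. exact: emb_DA (gen_primitive R j). Qed.

Lemma span_reach : exists p, forall x, DA x ->
  exists a : 'I_n + 'I_p * 'I_n -> C, Rs n%:R (x - \sum_j a j *: Eg j).
Proof.
have [p hp] := reach_cofinite nN hQ; exists p => x dx.
have /(inDA_emb hA h2 h3 dx.1) [f [g [pf ef]]] := dx.
have [a [U [cU hU]]] := hp f g pf; exists a; split.
  apply: sspB ssp2 dx.1 _; apply: ssp_sum ssp2 _ => j; exact: (Eg_DA j).1.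
exists U => //.
have e : eqM2 (emb f) (1 *: Wst D U + \sum_j a j *: Eg j).
  rewrite /Eg -emb_sum -[X in eqM2 _ X]emb_lin; apply: eqM2_emb => t tm t0.
  by rewrite scale1r hU.
have := eqM2_B (eqM2_trans ef e) (eqM2_refl (\sum_j a j *: Eg j)).
by rewrite addrK scale1r.
Qed.

Lemma in_dgen p (j : 'I_n + 'I_p * 'I_n) c : inM2 ((c, dgen j) : Mt).
Proof. by apply: K_inM2; case: j => [k|ik] /=; [exact: K0|exact: K_stp]. Qed.
Lemma Pr_Eg p (j : 'I_n + 'I_p * 'I_n) : Pr (Eg j) (Qg j).
Proof.
split.
  by apply: sspB ssp2 _ (in_dgen _ _); apply: sspZ ssp2 _; exact: (Eg_DA j).1.
by rewrite /Qg subKr; exact: (Arel_emb hA h2 h3 (gen_primitive R j) (eqM2_refl _)).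
Qed.
Lemma UD_Qg p (j : 'I_n + 'I_p * 'I_n) : UD (Qg j).
Proof.
apply: sspB ssp_UD _ _; first by apply: sspZ ssp_UD _; apply: DA_UD; exact: Eg_DA.
by apply: UD_pair; case: j => [k|ik] /=; [exact: UD_const|exact: UD_stp].
Qed.

(** [pencil_trivial] shows that [Um] is the whole state space; [Um_inj] then returns to D(A). *)
Lemma inDA_reached x : DA x -> Rs t1 x.
Proof.
have [p hp] := span_reach.
have spanQ y : inM2 y -> exists a : 'I_n + 'I_p * 'I_n -> C, Um (y - \sum_j a j *: Qg j).
  move=> hy; have [z dz pz] := Pr_surj hy; have [a ra] := hp z dz; exists a.
  exists (z - \sum_j a j *: Eg j); first exact: Rs_mono nt1 ra.
  apply: (Pr_B hA h2 h3 pz); apply: (Pr_sum hA h2 h3); exact: Pr_Eg.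
have all_UD y : inM2 y -> UD y.
  move=> /spanQ[a ua]; have := sspD ssp_UD (Um_UD ua) (ssp_sum a ssp_UD (@UD_Qg p)).
  by rewrite subrK.
(* For nonzero [nu], [x - nu (m - A) x = - nu (l - A) x] with [l = m - nu^-1], so the rank condition
   at [l] applies. For [nu = 0] the claim is [all_UD]. *)
have pen nu y : inM2 y -> exists x p, [/\ DA x, Pr x p & Um (y - (x - nu *: p))].
  move=> hy; have [->|nu0] := eqVneq nu 0.
    have [z dz uz] := all_UD y hy; have [q pq] := Pr_ex hA h2 h3 m dz.
    by exists z, q; rewrite scale0r subr0.
  have hy' := sspZ (- nu^-1) ssp2 hy.
  have [z [s [hz az]]] := resolvent_rank hA hb h2 h3 (hrank (m - nu^-1)) hy'.
  exists z, (nu^-1 *: (z - y) - (s *: sb D, fun=> 0)); split.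
  - by split=> //; eexists; exact: az.
  - split.
      by apply: sspB ssp2 _ (in_const _); apply: sspZ ssp2 _; exact: sspB ssp2 hz hy.
    move: az; rewrite !subM2_sub; congr (Arel _ _ _ _ _).
    have zid (L : lmodType C) (u v w : L) :
        (m - nu^-1) *: u - (- nu^-1 *: v - w) = m *: u - (nu^-1 *: (u - v) - w).
      rewrite scalerBl scalerBr scaleNr; move: (m *: u) (_ *: u) (_ *: v) => p1 p2 p3.
      by rewrite -addrA -opprD addrA.
    exact: zid.
  have -> : y - (z - nu *: (nu^-1 *: (z - y) - (s *: sb D, fun=> 0))) =
      - nu *: ((s *: sb D, fun=> 0) : Mt).
    have zid (L : lmodType C) (u v w : L) :
        v - (u - nu *: (nu^-1 *: (u - v) - w)) = - nu *: w.
      rewrite scalerBr scalerA divff // scale1r scaleNr opprB; move: (nu *: w) => z1.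
      by rewrite [u - v]addrC addrAC addrK addrA subrr add0r.
    exact: zid.
  exact: sspZ ssp_Um (Um_B s).
have key y : inM2 y -> Um y.
  pose I : finType := ('I_n + 'I_p * 'I_n)%type.
  apply: (@pencil_trivial C Mt DA Um (@inM2 R n) Pr #|I| (fun i => Qg (enum_val i : I))).
  - exact: ssp_Um.
  - exact: ssp_DA hA h2 h3.
  - by move=> z [].
  - by move=> a x1 y1 x2 y2; exact: (Pr_lin hA h2 h3).
  - exact: (Pr_0 hA h2 h3).
  - by move=> x1 y1 _ [].
  - exact: Pr_surj.
  - by move=> x1 y1 dx px uy; apply: Rs_Um; exact: Um_inj dx.1 px uy.
  - exact: pen.
  - by move=> i; exact: (Pr_Eg _).1.
  - exact: ssp2.
  - move=> y1 /spanQ[a ua]; exists (fun i => a (enum_val i)).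
    move: ua; rewrite (reindex _ (onW_bij _ (@enum_val_bij I))) //.
move=> dx; have [y py] := Pr_ex hA h2 h3 m dx.
exact: Um_inj dx.1 py (key y py.1).
Qed.
End Core.

(** * Stalling and conclusion for long times *)

Section Controllability.
Context (R : realType) (n : nat).
Local Notation C := R[i].
Variables (Am1 : 'M[R]_n) (b : 'cV[R]_n) (A2 A3 : R -> 'M[C]_n) (D : sys R n).
Hypothesis hA : sA D = toCmx Am1.
Hypothesis hb : sb D = toCmx b.
Hypothesis h2 : s2 D = cut 0 1 (fun r => A2 (- r)).
Hypothesis h3 : s3 D = cut 0 1 (fun r => A3 (- r)).
Local Notation Ar := (Arel Am1 A2 A3).
Local Notation N := (sN D).
Local Notation emb := (emb D).
Variable S : R -> M2 R n -> M2 R n.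
Hypothesis SA : C0_semigroup_generated_by S Ar.
Local Notation Mt := (M2 R n).
Local Notation DA := (inDA Am1 A2 A3).
Local Notation bj := (bj (sA D) (sb D)).
Local Notation Rs := (Rs D).
Variable Q : 'M[C]_n.
Hypothesis hQ : (\matrix_(i < n, k < n) bj k i 0) *m Q = 1%:M.
Hypothesis hrank : forall l : C, \rank (row_mx (Delta Am1 A2 A3 l) (toCmx b)) = n.

(** The reachable space at time [n] has codimension at most [d] in D(A), so among [d + 1] successive
    enlargements between [n] and [T] one is not strict. *)
Lemma reach_stalls (T : R) : n%:R < T -> T <= N%:R ->
  exists t1 t2, [/\ n%:R <= t1, t1 < t2, t2 <= T & forall x, Rs t2 x -> Rs t1 x].
Proof.
move=> nT TN; have nN : (n <= N)%N by rewrite -(ler_nat R); exact: ltW (lt_le_trans nT TN).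
have [p hp] := span_reach hA h2 h3 nN hQ.
pose I : finType := ('I_n + 'I_p * 'I_n)%type; pose d := #|I|.
(* [chain_stalls] takes an infinite chain; the minimum freezes it at [T] after [d + 1] equal
   steps. *)
pose tau (i : nat) : R := n%:R + (T - n%:R) * ((minn i d.+1)%:R / d.+1%:R).
have d0 : (0 : R) < d.+1%:R by [].
have Tn : 0 < T - n%:R by rewrite subr_gt0.
have tau0 : tau 0%N = n%:R by rewrite /tau min0n mul0r mulr0 addr0.
have tau_le i j : (i <= j)%N -> tau i <= tau j.
  move=> ij; rewrite /tau lerD2l; apply: ler_wpM2l; first exact: ltW.
  apply: ler_wpM2r; first by rewrite invr_ge0.
  by rewrite ler_nat leq_min !geq_min leqnn orbT andbT ij.
have tauT i : tau i <= T.
  rewrite /tau -lerBrDl -[X in _ <= X]mulr1; apply: ler_wpM2l; first exact: ltW.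
  by rewrite ler_pdivrMr // mul1r ler_nat geq_minr.
have tau_lt i : (i <= d)%N -> tau i < tau i.+1.
  move=> id; rewrite /tau ltrD2l ltr_pM2l // ltr_pM2r ?invr_gt0 // ltr_nat.
  by rewrite (minn_idPl _) ?(minn_idPl _) // leqW.
have sp : spans_mod (L := Mt) (Rs (tau 0%N)) DA (fun i : 'I_#|I| => Eg D (enum_val i)).
  move=> x dx; have [a ra] := hp x dx; exists (fun i => a (enum_val i)); rewrite tau0.
  by move: ra; rewrite (reindex _ (onW_bij _ (@enum_val_bij I))).
have [i id hi] := chain_stalls (V := fun i => Rs (tau i))
  (fun i => ssp_Rs D (tau i)) (fun i x => Rs_mono (tau_le _ _ (leqnSn i)))
  (fun i x => Rs_DA hA h2 h3 (le_trans (tauT i) TN)) sp.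
exists (tau i), (tau i.+1); split=> //; [by rewrite -tau0; exact: tau_le|exact: tau_lt].
Qed.

Lemma controllable_long (T : R) : n%:R < T -> T < N%:R ->
  exactly_controllable_at S b Am1 A2 A3 T.
Proof.
move=> nT TN; have TN' := ltW TN.
have n00 : (0 : R) <= n%:R by [].
have T0 : 0 <= T by exact: le_trans n00 (ltW nT).
have nN : (n <= N)%N by rewrite -(ler_nat R); exact: ltW (lt_trans nT TN).
have reachRs x : reachable S b T x <-> Rs T x.
  split=> [/(reachableP hA hb h2 h3 SA _ T0 TN)[hx [U [cU eU]]]|[hx [U cU eU]]].
    by split=> //; exists U.
  by apply/(reachableP hA hb h2 h3 SA _ T0 TN); split=> //; exists U.
have [t1 [t2 [nt1 t12 t2T stall]]] := reach_stalls nT TN'.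
have t2N := le_trans t2T TN'; have t10 := le_trans n00 nt1.
(* By stalling, the state reached by the control 1 on [[t1, t2]] is also reached by a control [U']
   on [[0, t1]]; the difference [U0] steers 0 to 0. *)
pose U1 : R -> 'M[C]_1 := cut (- t2) (- t1) (fun=> 1%:M).
have cU1 : ctrl t2 U1.
  split; first by apply: (@K_cutb _ _ _ _ _ _ (mn (1%:M : 'M[C]_1))) => //; exact: Mm_cst.
  move=> r hr; rewrite /U1 /cut; case: ifP => // /andP[p q]; case/negP: hr; rewrite p /=.
  by apply: le_trans q _; rewrite oppr_le0.
have [_ [U' cU' eU']] := stall _ (Rs_Wst D cU1).
have cU'2 : ctrl t2 U'.
  case: cU' => kU U0'; split=> // r hr; apply: U0'; apply: contra hr => /andP[p q].
  by rewrite q andbT; apply: le_trans p; rewrite lerN2 ltW.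
have sLt : t2 <= sL D by apply: le_trans t2N _; rewrite /sL ler_nat.
have [m1 hm1] := laplace_nonzero t10 t12 sLt cU'.
have [m2 m20 hm2] := resolvent_inj hA h2 h3 SA.
pose m : R := Num.max m1 m2.
have m0 : 0 < m by rewrite lt_max m20 orbT.
have l1 : m1 <= m by rewrite le_max lexx.
have l2 : m2 <= m by rewrite le_max lexx orbT.
pose U0 r := U1 r - U' r.
have eU0 : U0 = (fun r => -1 *: U' r + U1 r) by apply/funext => r; rewrite scaleN1r addrC.
have cU0 : ctrl t2 U0 by rewrite eU0; exact: ctrl_lin.
have W0 : eqM2 (Wst D U0) 0.
  rewrite eU0 (Wst_lin D (-1) cU'2.1 cU1.1) scaleN1r addrC.
  have := eqM2_B eU' (eqM2_refl (Wst D U')); by rewrite subrr.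
move=> x hx; split=> [/reachRs rx|dx]; first exact: (Rs_DA hA h2 h3 TN' rx).
apply/reachRs; apply: (Rs_mono (le_trans (ltW t12) t2T)).
exact: (inDA_reached hA hb h2 h3 nN hQ hrank nt1 (ltW t12) t2N stall
  (fun x hx => hm2 m x l2 hx) cU0 W0 (hm1 m l1 m0)).
Qed.
End Controllability.

Theorem theorem5 (R : realType) (n : nat) (Am1 : 'M[R]_n) (b : 'cV[R]_n)
    (A2 A3 : R -> 'M[R[i]]_n) (S : R -> M2 R n -> M2 R n) :
  (0 < n)%N ->
  mL2 Iint A2 -> mL2 Iint A3 ->
  C0_semigroup_generated_by S (Arel Am1 A2 A3) ->
  (forall l : R[i], \rank (row_mx (Delta Am1 A2 A3 l) (toCmx b)) = n) ->
  \rank (ctrb Am1 b) = n ->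
  (forall T : R, n%:R < T -> exactly_controllable_at S b Am1 A2 A3 T) /\
  (forall T : R, 0 < T -> T <= n%:R -> ~ exactly_controllable_at S b Am1 A2 A3 T).
Proof.
move=> n0 hA2 hA3 SA hrank hctrb.
have K_reflect (F : R -> 'M[R[i]]_n) : mL2 Iint F -> K (cut 0 1 (fun r => F (- r))).
  move=> /mL2_K k; apply: K_ext (K_refl 0 k) => t; rewrite /cut sub0r.
  by rewrite lerN2 oppr_le0 andbC.
have cut0 (F : R -> 'M[R[i]]_n) t : ~~ (0 <= t <= 1) -> cut 0 1 F t = 0.
  by move=> ht; rewrite /cut (negbTE ht).
(* The horizon is chosen beyond both [n] and the time considered, so that the explicit response
   covers all controls that occur. *)
have exD (T : R) : exists D : sys R n, [/\ sA D = toCmx Am1, sb D = toCmx b,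
    s2 D = cut 0 1 (fun r => A2 (- r)), s3 D = cut 0 1 (fun r => A3 (- r)) &
    (n < sN D)%N /\ T < (sN D)%:R].
  have [D [e1 e2 e3 e4 e5]] := exists_sys (toCmx Am1) (toCmx b)
    (maxn n.+1 (Num.trunc T).+1) (K_reflect _ hA2) (K_reflect _ hA3)
    (cut0 _) (cut0 _).
  exists D; split=> //; rewrite e5 leq_max ltnSn; split=> //.
  apply: lt_le_trans (truncnS_gt T) _; by rewrite ler_nat leq_max leqnn orbT.
have toCM p q r (M : 'M[R]_(p, q)) (M' : 'M[R]_(q, r)) : toCmx (M *m M') = toCmx M *m toCmx M'.
  exact: (map_mxM (real_complex R)).
have uC : ctrb Am1 b \in unitmx by rewrite -row_full_unit /row_full hctrb.
have hQ (D : sys R n) : sA D = toCmx Am1 -> sb D = toCmx b ->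
    (\matrix_(i < n, k < n) bj (sA D) (sb D) k i 0) *m toCmx (invmx (ctrb Am1 b)) = 1%:M.
  move=> -> ->; have -> : \matrix_(i < n, k < n) bj (toCmx Am1) (toCmx b) k i 0 = toCmx (ctrb Am1 b).
    have e k : bj (toCmx Am1) (toCmx b) k = toCmx (iter k (mulmx Am1) b).
      elim: k => [|k IH] //; by rewrite bjS IH /= toCM.
    by apply/matrixP => i k; rewrite !mxE e !mxE.
  by rewrite -toCM mulmxV //; exact: (map_mx1 (real_complex R)).
split=> T.
  move=> nT; have [D [hA hb h2 h3 [nN TN]]] := exD T.
  exact: (controllable_long hA hb h2 h3 SA (hQ D hA hb) hrank nT TN).
move=> T0 Tn; have [D [hA hb h2 h3 [nN TN]]] := exD T.
exact: (not_controllable_short hA hb h2 h3 SA n0 (ltnW nN) (hQ D hA hb) nN T0 Tn).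
Qed.
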